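(* Let $g\in C^2(\Gamma)$ be a generating function satisfying conditions A1, A2 and A1*. Then condition A3s is invariant under duality, that is, $g$ satisfies A3s if and only if its dual generating function $g^*$ satisfies A3s$^*$. Moreover, condition A3s is equivalent to each of the following two conditions: A3s(1): for every $\mathcal U'\subset\subset\mathcal U$ there is a constant $\delta>0$ such that for all $x_0,u_0,p_0,p_1$ with $\{x_0\}\times\{u_0\}\times[p_0,p_1]\subset\mathcal U'$, the set $S_{1,\delta}$ is locally $g$-convex at $x_0$ with respect to $(y_0,z_0)$. A3s(2): for every $\mathcal U'\subset\subset\mathcal U$ there is a constant $\delta_0>0$ such that for all $x_0,u_0,p_0,p_1$ with $\{x_0\}\times\{u_0\}\times[p_0,p_1]\subset\mathcal U'$, there exists a neighbourhood $\mathcal N_0$ of $x_0$ such that $$g(x,y_\theta,z_\theta)\le\max\{g(x,y_0,z_0),\,g(x,y_1,z_1)\}-\delta_0\big[\theta(1-\theta)|p_1-p_0|\,|x-x_0|\big]^2$$ for all $x\in\mathcal N_0$ and all $\theta\in[0,1]$.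
   Context: Setting. $\Gamma\subset\mathbb R^n\times\mathbb R^n\times\mathbb R$ is a domain whose projections $I(x,y)=\{z\in\mathbb R: (x,y,z)\in\Gamma\}$ are open intervals. A generating function is $g=g(x,y,z)\in C^2(\Gamma)$ with $g_z<0$ in $\Gamma$. Subscripts denote partial derivatives; $[p_0,p_1]$ is the closed straight segment joining $p_0$ and $p_1$; $\mathcal U'\subset\subset\mathcal U$ means that the closure of $\mathcal U'$ is a compact subset of $\mathcal U$. Set $\mathcal U=\{(x,g(x,y,z),g_x(x,y,z)) : (x,y,z)\in\Gamma\}\subset\mathbb R^n\times\mathbb R\times\mathbb R^n$. A1: for each $(x,u,p)\in\mathcal U$ there is a unique point $(x,y,z)\in\Gamma$ with $g(x,y,z)=u$, $g_x(x,y,z)=p$. One writes $Y(x,u,p)=y$, $Z(x,u,p)=z$. A2: $\det E\ne0$ in $\Gamma$, where $E=g_{x,y}-(g_z)^{-1}g_{x,z}\otimes g_y$. A1*: with $Q:=-g_y/g_z$, for all $(y,z)$ the map $x\mapsto Q(x,y,z)$ is one-to-one on $\{x:(x,y,z)\in\Gamma\}$. A3s: let $A(x,u,p)=g_{xx}(x,Y(x,u,p),Z(x,u,p))$ on $\mathcal U$. The matrix function $A$ is locally uniformly co-dimension one convex in $p$: for every $\mathcal U'\subset\subset\mathcal U$ there is $\delta>0$ such that $$(A\xi,\xi)(x_0,u_0,p_\theta)\le(1-\theta)(A\xi,\xi)(x_0,u_0,p_0)+\theta(A\xi,\xi)(x_0,u_0,p_1)-\delta\,\theta(1-\theta)|p_1-p_0|^2|\xi|^2$$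 whenever $\{x_0\}\times\{u_0\}\times[p_0,p_1]\subset\mathcal U'$, $p_\theta=(1-\theta)p_0+\theta p_1$, $0\le\theta\le1$, $\xi\in\mathbb R^n$ and $\xi\cdot(p_1-p_0)=0$. Duality. The dual generating function $g^*$ is defined on $\Gamma^*=\{(x,y,g(x,y,z)):(x,y,z)\in\Gamma\}$ by $g(x,y,g^*(x,y,u))=u$. Thus $g^*_y=-g_y/g_z$ and $g^*_u=1/g_z<0$. For $g^*$ the roles of $x$ and $y$ (and of $u$ and $z$) are interchanged: set $\mathcal V=\{(y,z,Q(x,y,z)):(x,y,z)\in\Gamma\}$. By A1*, for $(y,z,q)\in\mathcal V$ there is a unique $x=X(y,z,q)$ with $(x,y,z)\in\Gamma$, $Q(x,y,z)=q$. Set $A^*(y,z,q)=g^*_{yy}(x,y,g(x,y,z))$ with $x=X(y,z,q)$. A3s$^*$ is the condition obtained from A3s by replacing $(\mathcal U,A,(x,u,p))$ by $(\mathcal V,A^*,(y,z,q))$: for every $\mathcal V'\subset\subset\mathcal V$ there is $\delta>0$ such that $(A^*\xi,\xi)(y_0,z_0,q_\theta)\le(1-\theta)(A^*\xi,\xi)(y_0,z_0,q_0)+\theta(A^*\xi,\xi)(y_0,z_0,q_1)-\delta\theta(1-\theta)|q_1-q_0|^2|\xi|^2$ whenever $\{y_0\}\times\{z_0\}\times[q_0,q_1]\subset\mathcal V'$, $q_\theta=(1-\theta)q_0+\theta q_1$, $0\le\theta\le1$, $\xi\cdot(q_1-q_0)=0$. Notation for A3s(1) and A3s(2). Given $\{x_0\}\times\{u_0\}\times[p_0,p_1]\subset\mathcal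 U$, for $\theta\in[0,1]$ put $p_\theta=(1-\theta)p_0+\theta p_1$, $y_\theta=Y(x_0,u_0,p_\theta)$, $z_\theta=Z(x_0,u_0,p_\theta)=g^*(x_0,y_\theta,u_0)$, $h_\theta(x)=g(x,y_\theta,z_\theta)-g(x,y_0,z_0)$, $h_{\theta,\delta}(x)=h_\theta(x)-\frac{\delta}{2}|p_\theta-p_0|^2|x-x_0|^2$, $\Omega_0=\{x:\{x\}\times\{u_0\}\times[p_0,p_1]\subset\mathcal U\}$, and $S_{\theta,\delta}=\{x\in\Omega_0: h_{\theta,\delta}(x)<0\}$. Here only $x$ at which the expressions are defined are considered (this includes a full neighbourhood of $x_0$), and neighbourhoods of $x_0$ are taken small enough that all expressions are defined. A set $\Omega\subset\mathbb R^n$ is $g$-convex with respect to $(y_0,z_0)$ if $\Omega\times\{y_0\}\times\{z_0\}\subset\Gamma$ and $Q(\cdot,y_0,z_0)(\Omega)$ is convex in $\mathbb R^n$. A set $S$ is locally $g$-convex at $x_0$ with respect to $(y_0,z_0)$ if there is a neighbourhood $\mathcal N_0$ of $x_0$ such that $S\cap\mathcal N_0$ is $g$-convex with respect to $(y_0,z_0)$. *)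

(* Defs.v *)
From HB Require Import structures.
From mathcomp Require Import all_boot all_order all_algebra.
From mathcomp Require Import all_classical all_reals all_analysis.

Set Implicit Arguments.
Unset Strict Implicit.
Unset Printing Implicit Defensive.

Import Order.TTheory GRing.Theory Num.Theory.
Import numFieldNormedType.Exports.

Local Open Scope classical_set_scope.
Local Open Scope ring_scope.

(* Vectors of R^n are row vectors.  The library norm on 'rV[R]_n is the
   sup norm; it only serves to define the topology and differentiability.
   All lengths |v| in the conditions below are Euclidean ([enorm]). *)

Section Calculus.
Context {R : realType} {n : nat}.
Local Notation E := 'rV[R]_n.

Definition dotp (u v : E) : R := (u *m v^T) 0 0.

Definition enorm (u : E) : R := Num.sqrt (dotp u u).

(* (A xi, xi) *)
Definition quadf (A : 'M[R]_n) (xi : E) : R := (xi *m A *m xi^T) 0 0.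

Definition grad (f : E -> R) (x : E) : E := \row_i 'D_(delta_mx 0 i) f x.

Definition hess (f : E -> R) (x : E) : 'M[R]_n :=
  \matrix_(i, j) 'D_(delta_mx 0 j) ('D_(delta_mx 0 i) f) x.

Definition segpt (p0 p1 : E) (t : R) : E := (1 - t) *: p0 + t *: p1.

(* {x} x {u} x [p0, p1] *)
Definition vsegment (x : E) (u : R) (p0 p1 : E) : set (E * R * E) :=
  [set (x, u, segpt p0 p1 t) | t in `[0, 1]].

End Calculus.

Section Regularity.
Context {R : realType} {V : normedModType R}.

Definition C1_on (D : set V) (f : V -> R) : Prop :=
  (forall x, D x -> differentiable f x) /\
  (forall v x, D x -> {for x, continuous ('D_v f)}).

Definition C2_on (D : set V) (f : V -> R) : Prop :=
  C1_on D f /\ forall v, C1_on D ('D_v f).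

(* D' is compactly contained in D: D' subset-subset D *)
Definition compactly_contained (D' D : set V) : Prop :=
  compact (closure D') /\ closure D' `<=` D.

End Regularity.

Section GeneratingFunction.
Context {R : realType} {n : nat}.
Local Notation E := 'rV[R]_n.
Variables (Gam : set (E * E * R)) (g : E * E * R -> R).

Definition g_x (x y : E) (z : R) : E := grad (fun x' => g (x', y, z)) x.
Definition g_y (x y : E) (z : R) : E := grad (fun y' => g (x, y', z)) y.
Definition g_z (x y : E) (z : R) : R := derive1 (fun z' => g (x, y, z')) z.
Definition g_xx (x y : E) (z : R) : 'M[R]_n := hess (fun x' => g (x', y, z)) x.
Definition g_xy (x y : E) (z : R) : 'M[R]_n :=
  \matrix_(i, j) 'D_(delta_mx 0 j) (fun y' => g_x x y' z 0 i) y.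
Definition g_xz (x y : E) (z : R) : E :=
  \row_i derive1 (fun z' => g_x x y z' 0 i) z.

Definition generating_function : Prop :=
  [/\ open Gam, connected Gam, Gam !=set0,
      forall x y, open [set z | Gam (x, y, z)] /\
                  is_interval [set z | Gam (x, y, z)] &
      C2_on Gam g /\ forall x y z, Gam (x, y, z) -> g_z x y z < 0].

Definition dom_U : set (E * R * E) :=
  [set w | exists x y z, Gam (x, y, z) /\ w = (x, g (x, y, z), g_x x y z)].

Definition condA1 : Prop :=
  forall x u p, dom_U (x, u, p) ->
    exists! yz : E * R, [/\ Gam (x, yz.1, yz.2), g (x, yz.1, yz.2) = u
                          & g_x x yz.1 yz.2 = p].

(* Only meaningful on dom_U, under condA1. *)
Definition YZ (x : E) (u : R) (p : E) : E * R :=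
  get [set yz : E * R | [/\ Gam (x, yz.1, yz.2), g (x, yz.1, yz.2) = u
                          & g_x x yz.1 yz.2 = p]].
Definition Yfun (x : E) (u : R) (p : E) : E := (YZ x u p).1.
Definition Zfun (x : E) (u : R) (p : E) : R := (YZ x u p).2.

(* For row vectors a, b the tensor product a (x) b is a^T *m b. *)
Definition Emx (x y : E) (z : R) : 'M[R]_n :=
  g_xy x y z - (g_z x y z)^-1 *: ((g_xz x y z)^T *m g_y x y z).

Definition condA2 : Prop :=
  forall x y z, Gam (x, y, z) -> \det (Emx x y z) != 0.

Definition Qfun (x y : E) (z : R) : E := - ((g_z x y z)^-1 *: g_y x y z).

Definition condA1star : Prop :=
  forall y z, set_inj [set x | Gam (x, y, z)] (fun x => Qfun x y z).

(* The common form of A3s and A3s^*: local uniform codimension one convexity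
   in the last variable of the matrix function A on U. *)
Definition unif_codim1_convex (U : set (E * R * E))
    (A : E -> R -> E -> 'M[R]_n) : Prop :=
  forall U' : set (E * R * E), compactly_contained U' U ->
  exists2 delta : R, 0 < delta &
  forall (x0 : E) (u0 : R) (p0 p1 : E), vsegment x0 u0 p0 p1 `<=` U' ->
  forall (t : R) (xi : E), 0 <= t <= 1 -> dotp xi (p1 - p0) = 0 ->
    quadf (A x0 u0 (segpt p0 p1 t)) xi <=
      (1 - t) * quadf (A x0 u0 p0) xi + t * quadf (A x0 u0 p1) xi
      - delta * t * (1 - t) * enorm (p1 - p0) ^+ 2 * enorm xi ^+ 2.

Definition Amx (x : E) (u : R) (p : E) : 'M[R]_n :=
  g_xx x (Yfun x u p) (Zfun x u p).

Definition condA3s : Prop := unif_codim1_convex dom_U Amx.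

(* The dual generating function: g(x, y, g^*(x, y, u)) = u.  Only meaningful
   on Gamma^* = {(x, y, g(x, y, z)) : (x, y, z) in Gamma}, where the solution
   is unique because g_z < 0 and the sections I(x, y) are intervals. *)
Definition gstar (x y : E) (u : R) : R :=
  get [set z : R | Gam (x, y, z) /\ g (x, y, z) = u].

Definition gstar_yy (x y : E) (u : R) : 'M[R]_n :=
  hess (fun y' => gstar x y' u) y.

Definition dom_V : set (E * R * E) :=
  [set w | exists x y z, Gam (x, y, z) /\ w = (y, z, Qfun x y z)].

(* Only meaningful on dom_V, under condA1star. *)
Definition Xfun (y : E) (z : R) (q : E) : E :=
  get [set x : E | Gam (x, y, z) /\ Qfun x y z = q].

Definition Astar (y : E) (z : R) (q : E) : 'M[R]_n :=
  gstar_yy (Xfun y z q) y (g (Xfun y z q, y, z)).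

Definition condA3s_star : Prop := unif_codim1_convex dom_V Astar.

Definition g_convex (Om : set E) (y0 : E) (z0 : R) : Prop :=
  (forall x, Om x -> Gam (x, y0, z0)) /\
  convex_set ((fun x => Qfun x y0 z0) @` Om).

Definition locally_g_convex (S : set E) (x0 y0 : E) (z0 : R) : Prop :=
  exists2 N0 : set E, nbhs x0 N0 & g_convex (S `&` N0) y0 z0.

Section Sections.
Variables (x0 : E) (u0 : R) (p0 p1 : E).

Definition y_at (t : R) : E := Yfun x0 u0 (segpt p0 p1 t).
Definition z_at (t : R) : R := Zfun x0 u0 (segpt p0 p1 t).

Definition h_fun (t : R) (x : E) : R :=
  g (x, y_at t, z_at t) - g (x, y_at 0, z_at 0).

Definition h_delta (t delta : R) (x : E) : R :=
  h_fun t x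
  - delta / 2 * enorm (segpt p0 p1 t - p0) ^+ 2 * enorm (x - x0) ^+ 2.

Definition Omega0 : set E := [set x | vsegment x u0 p0 p1 `<=` dom_U].

(* The two membership conditions in Gam say that h_delta is defined at x. *)
Definition S_set (t delta : R) : set E :=
  [set x | [/\ Omega0 x, Gam (x, y_at t, z_at t), Gam (x, y_at 0, z_at 0)
             & h_delta t delta x < 0]].

End Sections.

Definition condA3s1 : Prop :=
  forall U' : set (E * R * E), compactly_contained U' dom_U ->
  exists2 delta : R, 0 < delta &
  forall (x0 : E) (u0 : R) (p0 p1 : E), vsegment x0 u0 p0 p1 `<=` U' ->
    locally_g_convex (S_set x0 u0 p0 p1 1 delta) x0
      (y_at x0 u0 p0 p1 0) (z_at x0 u0 p0 p1 0).

(* The membership in Gam says that N0 is taken so small that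
   g(x, y_theta, z_theta) is defined for all x in N0 and theta in [0, 1]. *)
Definition condA3s2 : Prop :=
  forall U' : set (E * R * E), compactly_contained U' dom_U ->
  exists2 delta0 : R, 0 < delta0 &
  forall (x0 : E) (u0 : R) (p0 p1 : E), vsegment x0 u0 p0 p1 `<=` U' ->
  exists2 N0 : set E, nbhs x0 N0 &
  forall (x : E) (t : R), N0 x -> 0 <= t <= 1 ->
    Gam (x, y_at x0 u0 p0 p1 t, z_at x0 u0 p0 p1 t) /\
    g (x, y_at x0 u0 p0 p1 t, z_at x0 u0 p0 p1 t) <=
      Num.max (g (x, y_at x0 u0 p0 p1 0, z_at x0 u0 p0 p1 0))
              (g (x, y_at x0 u0 p0 p1 1, z_at x0 u0 p0 p1 1))
      - delta0 * (t * (1 - t) * enorm (p1 - p0) * enorm (x - x0)) ^+ 2.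

End GeneratingFunction.

(* Main.v *)
Require Import Defs.
From HB Require Import structures.
From mathcomp Require Import all_boot all_order all_algebra.
From mathcomp Require Import all_classical all_reals all_analysis.
From mathcomp Require Import ring lra.

(* Write m = (y, z), G(x, m) = g(x, y, z).  By A2 the map m |-> (G, G_x)(x, .) is a
   local diffeomorphism, so only C^2 regularity and inverse functions are used.

   The heart is a maximum principle: under A3s, along a g-segment m_t from m_0 to m_1
   based at x0,
     G(x, m_t) <= max(G(x, m_0), G(x, m_1)) - kappa (t (1 - t) |p1 - p0| |x - x0|)^2.
   One maximizes the excess over the base points lying on {G(., m_0) = G(., m_1)}.
   At an interior maximum, criticality in t makes the displacement x - x0 almost
   orthogonal to the segment of slopes; moving the base point towards x then brings
   in the second difference of A in that direction, positive by A3s, a contradiction.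
   The mixed second differences of A are not controlled by A3s directly; they are
   by a Zygmund type argument: along every line A is almost convex on the orthogonal
   directions, which bounds the off-diagonal entries.

   The maximum principle is A3s(2), and the second order Taylor expansion at x0 gives
   A3s back, midpoint convexity at all small scales being enough.  Letting t tend to 0
   it says: if G(x1, m_1) - G(x1, m_0) is below a small quadratic quantity, then
   D_m G(x1, m_0) is nonpositive on the initial velocity of the segment.  Applied at
   a boundary point of S this shows that S lies on one side of a Q-hyperplane, hence
   A3s(1); applied with the roles of points and directions exchanged, it is the second
   order inequality A3s^*.  Conversely, under A3s(1) the sublevel sets at the midpoint
   of a g-segment lie in opposite Q-half-spaces, whereas a failure of A3s would
   provide an open set of common points. *)

Set Implicit Arguments.
Unset Strict Implicit.
Unset Printing Implicit Defensive.

Import Order.TTheory GRing.Theory Num.Theory.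
Import numFieldNormedType.Exports.

Local Open Scope classical_set_scope.
Local Open Scope ring_scope.

(** * Differential calculus in finite coordinates *)

(** The delicate point is uniformity as the segment of slopes shrinks: the maximum principle is
    proved with one neighbourhood valid for all nearby base points and end slopes, p0 = p1 included,
    because its applications move the base point and perturb the target slope. At an interior
    maximum the gain from A3s has size t (1 - t) |D|^2 |x - x1|^2, where D is the difference of the
    end slopes at the base point x. The displacement x1 - x is orthogonal to D only up to a small
    multiple of D, and the trivial bound of the mixed term produced by this multiple is linear in
    |D|, hence too large when |D| is much smaller than |x - x1|. The mixed second differences must
    therefore be O(|D|^2), which continuity of A does not give. The excess carries the weight (t (1
    - t))^2 |x - x1|^2: it vanishes where the excess is trivially bounded, and its derivative in t
    is O(t (1 - t)), which matches the factor t (1 - t) of A3s. *)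

Section Calculus.
Context {R : realType}.

Definition finite_coords (V : normedModType R) : Prop :=
  exists (I : finType) (e : I -> V) (c : I -> V -> R),
    forall v, v = \sum_i c i v *: e i /\ forall i, `|c i v| <= `|v|.

(** Differentiability is replaced by linearity of the directional derivatives, which is what
    implicit differentiation of the dual function produces; in finite coordinates it is recovered by
    [C1linP]. *)
Definition C1lin (V : normedModType R) (D : set V) (f : V -> R) : Prop :=
  (forall x, D x -> (forall v, derivable f x v) /\
     (forall a u v, 'D_(a *: u + v) f x = a * 'D_u f x + 'D_v f x)) /\
  (forall v x, D x -> {for x, continuous ('D_v f)}).

Lemma C1_onW (V : normedModType R) (D : set V) (f : V -> R) :
  C1_on D f -> C1lin D f.
Proof.
move=> [df cf]; split => // x Dx; split=> [v|a u v].
  by apply: diff_derivable; exact: df.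
rewrite !deriveE; [|exact: df..].
by rewrite linearP.
Qed.

(** Smallness in each fixed direction becomes uniform in the direction by expanding it in the
    finitely many coordinate vectors. The parameter space and its filter are arbitrary, so that the
    parameter can be a point, a pair of points, or a point together with a second direction. *)
Lemma uniform_in_direction (V : normedModType R) (X : Type) (F : set_system X)
    (FF : Filter F) (L : V -> X -> R) (N : X -> R) :
  finite_coords V ->
  (\forall x \near F, 0 <= N x /\
     forall a u v, L (a *: u + v) x = a * L u x + L v x) ->
  (forall u (eps : R), 0 < eps -> \forall x \near F, `|L u x| <= eps * N x) ->
  forall eps : R, 0 < eps -> \forall x \near F, forall u, `|L u x| <= eps * `|u| * N x.
Proof.
move=> [I [e [c cE]]] Llin Lsmall eps eps0.
pose k : R := (#|I|.+1)%:R.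
have k0 : 0 < k by rewrite /k ltr0n.
have ek : 0 < eps / k by rewrite divr_gt0.
have : \forall x \near F, forall i, `|L (e i) x| <= eps / k * N x.
  by apply: filter_forall => i; exact: Lsmall.
apply: filter_app; near=> x => Hx u.
have [Nx Lx] : 0 <= N x /\ forall a u v, L (a *: u + v) x = a * L u x + L v x.
  by near: x.
have L0 : L 0 x = 0.
  by have := Lx (-1) 0 0; rewrite scaler0 addr0 mulN1r addNr.
have [uE cu] := cE u.
have -> : L u x = \sum_i c i u * L (e i) x.
  rewrite {1}uE; elim/big_ind2 : _ => // [v1 r1 v2 r2|i _].
    move=> <- <-; have := Lx 1 r1 r2; by rewrite scale1r mul1r.
  by have := Lx (c i u) (e i) 0; rewrite L0 !addr0.
apply: le_trans (ler_norm_sum _ _ _) _.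
have : \sum_i `|c i u * L (e i) x| <= \sum_(i in I) (eps / k * (`|u| * N x)).
  apply: ler_sum => i _; rewrite normrM.
  apply: le_trans (ler_pM _ _ (cu i) (Hx i)) _ => //.
  by rewrite mulrCA.
move=> /le_trans; apply; rewrite sumr_const -mulrA -mulr_natl.
set M := `|u| * N x.
have -> : #|I|%:R * (eps * (k^-1 * M)) = (#|I|%:R / k) * (eps * M) by ring.
rewrite -[leRHS]mulrA -/M; apply: ler_piMl.
  by apply: mulr_ge0; [exact: ltW|exact: mulr_ge0].
by rewrite ler_pdivrMr // mul1r /k ler_nat.
Unshelve. all: by end_near. Qed.

Lemma is_derive_line (V : normedModType R) (f : V -> R) (P v : V) (t : R) :
  derivable f (P + t *: v) v ->
  is_derive t 1 (fun s => f (P + s *: v)) ('D_v f (P + t *: v)).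
Proof.
move=> df.
have E : (fun h : R => h^-1 *: (((fun s => f (P + s *: v)) \o shift t) (h *: 1)
            - f (P + t *: v)))
   = (fun h => h^-1 *: ((f \o shift (P + t *: v)) (h *: v) - f (P + t *: v))).
  apply/funext => h /=; congr (_ *: (f _ - _)).
  by rewrite [h *: 1]mulr1 scalerDl addrCA.
by split; rewrite /derivable /derive E.
Qed.

Local Opaque derive.

Lemma mvt_line (f df : R -> R) :
  (forall t : R, 0 <= t <= 1 -> is_derive t 1 f (df t)) ->
  exists2 c : R, 0 < c < 1 & f 1 - f 0 = df c.
Proof.
move=> fd; have [|x /andP[x0 x1]||c] := @MVT R f df 0 1.
- exact: ltr01.
- by apply: fd; rewrite !ltW.
- apply: continuous_in_subspaceT => x; rewrite inE /= in_itv /= => x01.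
  apply: differentiable_continuous; apply/derivable1_diffP.
  by have := fd _ x01 => ?; exact: ex_derive.
- by rewrite in_itv /= subr0 mulr1 => c01 E; exists c.
Qed.

Lemma ball_segment (V : normedModType R) (P A B : V) (r t : R) :
  `|A - P| < r -> `|B - P| < r -> 0 <= t <= 1 -> `|A + t *: (B - A) - P| < r.
Proof.
move=> Ar Br /andP[t0 t1].
have -> : A + t *: (B - A) - P = (1 - t) *: (A - P) + t *: (B - P).
  rewrite scalerBl scale1r -addrA [RHS]addrAC -addrA.
  rewrite [in RHS]addrA.
  have -> : t *: (B - P) = t *: (B - A) + t *: (A - P).
    by rewrite -scalerDr addrA subrK.
  by rewrite addrA addrAC [in RHS]addrA addrK.
apply: le_lt_trans (ler_normD _ _) _; rewrite !normrZ.
rewrite (ger0_norm t0) ger0_norm ?subr_ge0//.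
move: Ar Br; set a := `|A - P|; set b := `|B - P| => ar br.
have [t00|t00] := eqVneq t 0; first by subst t; lra.
have tp : 0 < t by rewrite lt_def t00.
have : t * b < t * r by rewrite ltr_pM2l.
have : (1 - t) * a <= (1 - t) * r by rewrite ler_wpM2l// ?subr_ge0// ltW.
lra.
Qed.

Lemma derivative_near (V : normedModType R) (D : set V) (f : V -> R) (P : V) :
  finite_coords V -> open D -> C1lin D f -> D P -> forall eps : R, 0 < eps ->
  \forall x \near P, D x /\ forall u, `|'D_u f x - 'D_u f P| <= eps * `|u|.
Proof.
move=> hV oD [fl fc] DP eps eps0.
have nD : \forall x \near P, D x by apply: open_nbhs_nbhs.
have : \forall x \near P, forall u, `|'D_u f x - 'D_u f P| <= eps * `|u| * 1.
  apply: uniform_in_direction (eps0) => //.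
    near=> x; split => // a u v; have Dx : D x by near: x.
    rewrite (fl _ Dx).2 (fl _ DP).2; lra.
  move=> u e e0; have := fc u P DP; move=> /cvgrPdist_le /(_ _ e0).
  by apply: filter_app; near=> x; rewrite mulr1 distrC.
apply: filter_app; near=> x => H; split; first by near: x.
by move=> u; have := H u; rewrite mulr1.
Unshelve. all: by end_near. Qed.

(** The mean value theorem on the segment from A to B, which stays in the ball: the derivative at an
    intermediate point is close to the one at P, uniformly in the direction [B - A]. *)
Lemma strict_diff (V : normedModType R) (D : set V) (f : V -> R) (P : V) :
  finite_coords V -> open D -> C1lin D f -> D P -> forall eps : R, 0 < eps ->
  exists2 r : R, 0 < r & forall A B, `|A - P| < r -> `|B - P| < r ->
    D A /\ `|f B - f A - 'D_(B - A) f P| <= eps * `|B - A|.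
Proof.
move=> hV oD fC DP eps eps0.
have /nbhs_normP[r /= r0 Hr] := derivative_near hV oD fC DP eps0.
have {}Hr A : `|A - P| < r ->
    D A /\ forall u, `|'D_u f A - 'D_u f P| <= eps * `|u|.
  by move=> Ar; apply: Hr; rewrite /= distrC.
exists r => // A B Ar Br; split; first by case: (Hr _ Ar).
have [t t01|c /andP[c0 c1]] := @mvt_line (fun s => f (A + s *: (B - A)))
  (fun t => 'D_(B - A) f (A + t *: (B - A))).
  apply: is_derive_line; apply: (fC.1 _ _).1.
  by case: (Hr _ (ball_segment Ar Br t01)).
rewrite scale1r scale0r addr0 subrKC => ->.
apply: (Hr _ _).2; apply: ball_segment => //; rewrite !ltW//.
Qed.

Lemma strict_differentiable (V : normedModType R) (D : set V) (f : V -> R)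
    (P : V) : finite_coords V -> open D -> C1lin D f -> D P ->
  differentiable f P.
Proof.
move=> hV oD fC DP.
have lin : linear (fun v => 'D_v f P) by move=> a u v; exact: (fC.1 _ DP).2.
pose L : {linear V -> R} :=
  HB.pack (fun v => 'D_v f P) (GRing.isLinear.Build R V R *:%R _ lin).
have Lc : continuous L.
  apply/linear_bounded_continuous.
  have [I [e [c cE]]] := hV.
  apply/linear_boundedP; exists (\sum_i `|L (e i)|); split; first by rewrite realE sumr_ge0.
  move=> M ltM v; have [vE cv] := cE v.
  rewrite {1}vE linear_sum; apply: le_trans (ler_norm_sum _ _ _) _.
  apply: (@le_trans _ _ (\sum_i `|L (e i)| * `|v|)).
    by apply: ler_sum => i _; rewrite linearZ normrM mulrC ler_wpM2l.
  by rewrite -mulr_suml ler_wpM2r// ltW.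
have E : f \o shift P = cst (f P) + L +o_ 0 id.
  apply/eqaddoP => eps eps0.
  have [r r0 H] := strict_diff hV oD fC DP eps0.
  apply/nbhs_normP; exists r => // h /=; rewrite sub0r normrN => hr.
  have := (H P (h + P)); rewrite subrr normr0 addrK => /(_ r0 hr)[_].
  rewrite !fctE /= opprD addrA; exact.
apply/diff_locallyP; rewrite (diff_unique Lc E); split=> //.
Qed.

Lemma C1linP (V : normedModType R) (D : set V) (f : V -> R) :
  finite_coords V -> open D -> C1lin D f -> C1_on D f.
Proof.
by move=> hV oD fC; split; [move=> x; exact: strict_differentiable|exact: fC.2].
Qed.

Lemma derivDl (V : normedModType R) (D : set V) (f : V -> R) (P : V) :
  C1_on D f -> D P -> forall a u v,
  'D_(a *: u + v) f P = a * 'D_u f P + 'D_v f P.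
Proof. by move=> /C1_onW[H _] DP; case: (H _ DP). Qed.

Lemma derivZ (V : normedModType R) (D : set V) (f : V -> R) (P : V) :
  C1_on D f -> D P -> forall a u, 'D_(a *: u) f P = a * 'D_u f P.
Proof.
move=> fC DP a u; have := derivDl fC DP a u 0.
by rewrite [a *: u + 0]addr0 derive0 => ->; exact: addr0.
Qed.

Lemma derivD (V : normedModType R) (D : set V) (f : V -> R) (P : V) :
  C1_on D f -> D P -> forall u v, 'D_(u + v) f P = 'D_u f P + 'D_v f P.
Proof.
move=> fC DP u v; have := derivDl fC DP 1 u v.
by rewrite scale1r => ->; congr (_ + _); exact: mul1r.
Qed.

Lemma quotient_le (T M x a b e : R) : 0 < e -> 0 < T -> M <= e / 4 ->
  `|x - T * a| <= T * M -> `|x - T * b| <= T * M -> a <= b + e.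
Proof.
move=> e0 T0 Me; rewrite !ler_norml => /andP[? ?] /andP[? ?].
have TM : T * M <= T * (e / 4) by apply: ler_wpM2l => //; exact: ltW.
have Te : 0 < T * e by apply: mulr_gt0.
rewrite -(ler_pM2l T0); lra.
Qed.

Section Second_order.
Context {V : normedModType R} (hV : finite_coords V) (D : set V) (g : V -> R).
Hypotheses (oD : open D) (gC : C2_on D g).

Lemma deriv2Dl (P : V) : D P -> forall a u v w,
  'D_w ('D_(a *: u + v) g) P = a * 'D_w ('D_u g) P + 'D_w ('D_v g) P.
Proof.
move=> DP a u v w.
have -> : 'D_w ('D_(a *: u + v) g) P = 'D_w (a *: 'D_u g + 'D_v g) P.
  apply: near_eq_derive; have : \forall x \near P, D x by exact: open_nbhs_nbhs.
  by apply: filterS => x Dx; rewrite !fctE (derivDl gC.1 Dx).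
have dd u' : derivable ('D_u' g) P w.
  by apply: diff_derivable; apply (gC.2 u').1.
by rewrite deriveD ?deriveZ//; exact: derivableZ.
Qed.

Lemma deriv2Zl (P : V) : D P -> forall a u w,
  'D_w ('D_(a *: u) g) P = a * 'D_w ('D_u g) P.
Proof.
move=> DP a u w; have := deriv2Dl DP a u 0 w.
rewrite [a *: u + 0]addr0 => ->.
have -> : 'D_0 g = cst 0 by apply/funext => x; rewrite derive0.
by rewrite derive_cst; exact: addr0.
Qed.

Lemma strict_diff2 (P : V) : D P -> forall eps : R, 0 < eps ->
  exists2 r : R, 0 < r & forall A B u, `|A - P| < r -> `|B - P| < r ->
    `|'D_u g B - 'D_u g A - 'D_(B - A) ('D_u g) P| <= eps * `|u| * `|B - A|.
Proof.
move=> DP eps eps0.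
(* The filter of pairs of points both tending to P, so that [uniform_in_direction] gives one radius
   for all directions u. *)
pose F : set_system (V * V) := filter_from [set r : R | 0 < r]
  (fun r => [set AB | `|AB.1 - P| < r /\ `|AB.2 - P| < r]).
have FF : Filter F.
  apply: filter_from_filter; first by exists 1 => /=.
  move=> r s /= r0 s0; exists (Num.min r s); first by rewrite /= lt_min r0.
  by move=> x /=; rewrite !lt_min => -[/andP[? ?] /andP[? ?]].
have FD : \forall x \near F, D x.1 /\ D x.2.
  have /nbhs_normP[r r0 H] : \forall x \near P, D x by exact: open_nbhs_nbhs.
  exists r => // x /= [x1 x2]; split; apply: H; rewrite /= distrC//.
have : \forall x \near F, forall u,
    `|'D_u g x.2 - 'D_u g x.1 - 'D_(x.2 - x.1) ('D_u g) P| <=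
     eps * `|u| * `|x.2 - x.1|.
  apply: (uniform_in_direction FF (N := fun x : V * V => `|x.2 - x.1|)
    (L := fun u (x : V * V) =>
    'D_u g x.2 - 'D_u g x.1 - 'D_(x.2 - x.1) ('D_u g) P)) => //.
    apply: filterS FD => x [D1 D2]; split => // a u v.
    rewrite deriv2Dl // (derivDl gC.1 D1) (derivDl gC.1 D2).
    have E (p q c p' q' c' : R) : a * p + p' - (a * q + q') - (a * c + c') =
        a * (p - q - c) + (p' - q' - c') by ring.
    exact: E.
  move=> u e e0.
  have [r r0 H] := strict_diff hV oD (C1_onW (gC.2 u)) DP e0.
  by exists r => // x /= [x1 x2]; case: (H _ _ x1 x2).
move=> [r r0 H]; exists r => // A B u Ar Br.
by apply: (H (A, B)) => /=.
Qed.

(** The quadratic term is frozen at P while A and B both move. Two expansions with the same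
    displacement then share their quadratic term, which cancels in the difference. *)
Lemma taylor2 (P : V) : D P -> forall eps : R, 0 < eps ->
  exists2 r : R, 0 < r & forall A B, `|A - P| < r -> `|B - P| < r ->
    D A /\ `|g B - g A - 'D_(B - A) g A - 2^-1 * 'D_(B - A) ('D_(B - A) g) P|
       <= eps * `|B - A| ^+ 2.
Proof.
move=> DP eps eps0.
have [r1 r10 H1] := strict_diff hV oD (C1_onW gC.1) DP eps0.
have [r2 r20 H2] := strict_diff2 DP eps0.
exists (Num.min r1 r2); first by rewrite lt_min r10.
move=> A B; rewrite !lt_min => /andP[A1 A2] /andP[B1 B2].
split; first by case: (H1 _ _ A1 B1).
set v := B - A.
pose k := 'D_v ('D_v g) P.
pose f s := g (A + s *: v) - s * 'D_v g A - 2^-1 * s ^+ 2 * k.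
have [t t01|c /andP[c0 c1]] := @mvt_line f
  (fun s => 'D_v g (A + s *: v) - 'D_v g A - s * k).
  have DA : D (A + t *: v).
    have b1 := ball_segment A1 B1 t01; by case: (H1 _ _ b1 b1).
  have ? : is_derive t 1 (fun s => g (A + s *: v)) ('D_v g (A + t *: v)).
    apply: is_derive_line; exact: ((C1_onW gC.1).1 _ DA).1.
  rewrite /f; apply: is_derive_eq.
  have E (X Y : R) : X - (t * 0 + Y * 1) -
      ((2^-1 * t ^+ 2) * 0 + k * (2^-1 * (t * 1 + t * 1))) = X - Y - t * k.
    by field.
  exact: E.
rewrite /f scale1r scale0r addr0 /v subrKC -/v => E.
have -> : g B - g A - 'D_v g A - 2^-1 * k =
    g B - 1 * 'D_v g A - 2^-1 * 1 ^+ 2 * k - (g A - 0 * 'D_v g A - 2^-1 * 0 ^+ 2 * k).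
  by ring.
rewrite E.
have cb : `|A + c *: v - P| < r2 by apply: ball_segment; rewrite // !ltW.
have := H2 A (A + c *: v) v A2 cb.
have -> : A + c *: v - A = c *: v by rewrite addrC addKr.
have -> : 'D_(c *: v) ('D_v g) P = c * k.
  exact: derivZ (gC.2 v) DP c v.
move=> /le_trans; apply; rewrite normrZ (ger0_norm (ltW c0)) expr2 mulrA.
rewrite [leRHS]mulrA -[_ * c * _]mulrA [c * _]mulrC mulrA ler_piMr ?(ltW c1) //.
by rewrite !mulr_ge0 // ltW.
Qed.

Lemma schwarz (P : V) : D P -> forall u v,
  'D_u ('D_v g) P = 'D_v ('D_u g) P.
Proof.
move=> DP.
suff H u v : 'D_u ('D_v g) P <= 'D_v ('D_u g) P.
  by move=> u v; apply: le_anti; apply/andP; split; exact: H.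
apply/ler_addgt0Pr => e e0.
pose k := `|u| * `|v| + 1.
pose eps := e / (4 * k).
have k0 : 0 < k by rewrite ltr_wpDl// mulr_ge0.
have eps0 : 0 < eps by rewrite divr_gt0 // mulr_gt0.
have [r1 r10 H1] := strict_diff hV oD (C1_onW gC.1) DP eps0.
have [r2 r20 H2] := strict_diff2 DP eps0.
pose r := Num.min r1 r2.
have r0 : 0 < r by rewrite lt_min r10.
pose t := r / (2 * (`|u| + `|v| + 1)).
have t0 : 0 < t by rewrite divr_gt0// mulr_gt0// ltr_wpDl// addr_ge0.
have tE : t * (`|u| + `|v| + 1) = r / 2.
  rewrite /t; field; apply/lt0r_neq0; rewrite ltr_wpDl// addr_ge0//.
clearbody t.
have bnd a b : 0 <= a <= 1 -> 0 <= b <= 1 ->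
   `|P + (a * t) *: u + (b * t) *: v - P| < r.
  move=> /andP[a0 a1] /andP[b0 b1].
  have -> X Y : P + X + Y - P = X + Y by rewrite -[P + _ + _]addrA [P + _]addrC addrK.
  apply: le_lt_trans (ler_normD _ _) _.
  rewrite !normrZ !ger0_norm ?mulr_ge0// ?ltW//.
  have h1 : a * t * `|u| <= t * `|u|.
    by rewrite -mulrA ler_piMl // mulr_ge0 // ltW.
  have h2 : b * t * `|v| <= t * `|v|.
    by rewrite -mulrA ler_piMl // mulr_ge0 // ltW.
  lra.
(* The mixed second difference of g over the parallelogram spanned by tu and
   tv is t^2 D_u D_v g up to o(t^2), and it is symmetric in u and v. *)
pose Delta (u v : V) := g (P + t *: u + t *: v) - g (P + t *: v)
   - (g (P + t *: u) - g P).
have key u' v' : (forall a b, 0 <= a <= 1 -> 0 <= b <= 1 ->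
    `|P + (a * t) *: u' + (b * t) *: v' - P| < r) ->
   `|Delta u' v' - t ^+ 2 * 'D_u' ('D_v' g) P| <= t ^+ 2 * (eps * (`|u'| * `|v'|)).
  move=> B.
  have DD a b : 0 <= a <= 1 -> 0 <= b <= 1 -> D (P + (a * t) *: u' + b *: (t *: v')).
    move=> ha hb; have := B _ _ ha hb; rewrite lt_min => /andP[B1 _].
    by rewrite [b *: _]scalerA; case: (H1 _ _ B1 B1).
  have [s s01|c c01] := @mvt_line
    (fun s => g (P + t *: u' + s *: (t *: v')) - g (P + s *: (t *: v')))
    (fun s => 'D_(t *: v') g (P + t *: u' + s *: (t *: v')) -
              'D_(t *: v') g (P + s *: (t *: v'))).
    have D1 : D (P + t *: u' + s *: (t *: v')).
      by have := DD 1 s; rewrite mul1r; apply => //; rewrite lexx ler01.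
    have D2 : D (P + s *: (t *: v')).
      by have := DD 0 s; rewrite mul0r scale0r addr0; apply => //; rewrite lexx ler01.
    have ? : is_derive s 1 (fun s => g (P + t *: u' + s *: (t *: v')))
      ('D_(t *: v') g (P + t *: u' + s *: (t *: v'))).
      by apply: is_derive_line; exact: ((C1_onW gC.1).1 _ D1).1.
    have ? : is_derive s 1 (fun s => g (P + s *: (t *: v')))
      ('D_(t *: v') g (P + s *: (t *: v'))).
      by apply: is_derive_line; exact: ((C1_onW gC.1).1 _ D2).1.
    exact: is_derive_eq.
  rewrite !scale1r !scale0r !addr0 -/(Delta u' v') => ->.
  have c01' : 0 <= c <= 1 by case/andP: c01 => ? ?; rewrite !ltW.
  have B1 := B 1 c _ c01'; have B0 := B 0 c _ c01'.
  move: B1 B0; rewrite mul1r mul0r scale0r addr0 !lexx !ler01.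
  move=> /(_ isT) + /(_ isT); rewrite !lt_min => /andP[_ B1] /andP[_ B0].
  have := H2 _ _ (t *: v') B0 B1; rewrite !scalerA.
  have -> : P + t *: u' + (c * t) *: v' - (P + (c * t) *: v') = t *: u'.
    by rewrite (addrAC P (t *: u')) [_ + t *: u']addrC addrK.
  have -> : 'D_(t *: u') ('D_(t *: v') g) P = t ^+ 2 * 'D_u' ('D_v' g) P.
    by rewrite (deriv2Zl DP t v' (t *: u')) (derivZ (gC.2 v') DP t u') expr2; exact: mulrA.
  move=> /le_trans; apply; rewrite !normrZ (ger0_norm (ltW t0)).
  by rewrite le_eqVlt; apply/orP; left; apply/eqP; ring.
have K1 := key u v bnd.
have bnd' a b : 0 <= a <= 1 -> 0 <= b <= 1 ->
    `|P + (a * t) *: v + (b * t) *: u - P| < r.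
  by move=> ha hb; rewrite (addrAC P); exact: bnd.
have K2 := key v u bnd'.
have DE : Delta u v = Delta v u.
  have E (w x y z : R) : w - x - (y - z) = w - y - (x - z) by ring.
  by rewrite /Delta [P + t *: v + _]addrAC; exact: E.
rewrite DE in K1.
have t20 : 0 < t ^+ 2 by rewrite exprn_gt0.
have eK : eps * (`|u| * `|v|) <= e / 4.
  have -> : e / 4 = eps * k by rewrite /eps; field; rewrite gt_eqF.
  by apply: ler_wpM2l; [exact: ltW|rewrite /k lerDl].
rewrite [`|v| * _]mulrC in K2.
exact: quotient_le e0 t20 eK K1 K2.
Qed.

End Second_order.
End Calculus.

Lemma combB (R : realType) (a x y x' y' : R) :
  a * x + y - (a * x' + y') = a * (x - x') + (y - y').
Proof. by ring. Qed.

Section Directional.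
Context {R : realType} {V : normedModType R}.

(* Sealed copies of the directional derivatives: [derive] unfolds too eagerly
   during unification. *)
Definition d1 (f : V -> R) (P u : V) : R := 'D_u f P.
Definition d2 (f : V -> R) (P u v : V) : R := 'D_u ('D_v f) P.

Variables (D : set V) (g : V -> R).
Hypotheses (hV : finite_coords V) (oD : open D) (gC : C2_on D g).

Lemma d1Dl P : D P -> forall a u v, d1 g P (a *: u + v) = a * d1 g P u + d1 g P v.
Proof. exact: derivDl gC.1. Qed.

Lemma d1Z P : D P -> forall a u, d1 g P (a *: u) = a * d1 g P u.
Proof. exact: derivZ gC.1. Qed.

Lemma d1D P : D P -> forall u v, d1 g P (u + v) = d1 g P u + d1 g P v.
Proof. exact: derivD gC.1. Qed.

Lemma d1N P : D P -> forall u, d1 g P (- u) = - d1 g P u.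
Proof. by move=> DP u; rewrite -scaleN1r d1Z // mulN1r. Qed.

Lemma d10 P : d1 g P 0 = 0.
Proof. exact: derive0. Qed.

Lemma d2C P : D P -> forall u v, d2 g P u v = d2 g P v u.
Proof. exact: schwarz. Qed.

Lemma d2Dl P : D P -> forall a u v w,
  d2 g P (a *: u + v) w = a * d2 g P u w + d2 g P v w.
Proof. by move=> DP a u v w; exact: (derivDl (gC.2 w) DP). Qed.

Lemma d2Dr P : D P -> forall a u v w,
  d2 g P w (a *: u + v) = a * d2 g P w u + d2 g P w v.
Proof. by move=> DP a u v w; rewrite !(d2C DP w) d2Dl. Qed.

Lemma d2Zl P : D P -> forall a u w, d2 g P (a *: u) w = a * d2 g P u w.
Proof. by move=> DP a u w; exact: (derivZ (gC.2 w) DP). Qed.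

Lemma d2DDl P : D P -> forall u v w, d2 g P (u + v) w = d2 g P u w + d2 g P v w.
Proof. by move=> DP u v w; exact: (derivD (gC.2 w) DP). Qed.

Lemma d20l P w : d2 g P 0 w = 0.
Proof. exact: derive0. Qed.

Lemma d1_continuous P u : D P -> {for P, continuous (fun Q => d1 g Q u)}.
Proof. exact: gC.1.2. Qed.

Lemma g_continuous P : D P -> {for P, continuous g}.
Proof. by move=> DP; apply: differentiable_continuous; exact: gC.1.1. Qed.

Lemma near_ball (P : V) (Q : V -> Prop) : (\forall x \near P, Q x) <->
  exists2 r : R, 0 < r & forall x, `|x - P| < r -> Q x.
Proof.
split=> [/nbhs_normP[r /= r0 H]|[r r0 H]].
  by exists r => // x xr; apply: H; rewrite /= distrC.
apply/nbhs_normP; exists r => // x /=; rewrite distrC; exact: H.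
Qed.

Lemma D_near P : D P -> exists2 r : R, 0 < r & forall A, `|A - P| < r -> D A.
Proof. by move=> DP; apply/near_ball; exact: open_nbhs_nbhs. Qed.

Lemma strict1 P : D P -> forall e : R, 0 < e -> exists2 r : R, 0 < r &
  forall A B, `|A - P| < r -> `|B - P| < r ->
    D A /\ `|g B - g A - d1 g P (B - A)| <= e * `|B - A|.
Proof. exact: strict_diff hV oD (C1_onW gC.1). Qed.

Lemma strict2 P : D P -> forall e : R, 0 < e -> exists2 r : R, 0 < r &
  forall A B u, `|A - P| < r -> `|B - P| < r ->
    D A /\ `|d1 g B u - d1 g A u - d2 g P (B - A) u| <= e * `|u| * `|B - A|.
Proof.
move=> DP e e0; have [r r0 H] := strict_diff2 hV oD gC DP e0.
have [s s0 H'] := D_near DP.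
exists (Num.min r s); first by rewrite lt_min r0.
move=> A B u; rewrite !lt_min => /andP[A1 A2] /andP[B1 B2]; split.
  exact: H'.
exact: H.
Qed.

Lemma taylor P : D P -> forall e : R, 0 < e -> exists2 r : R, 0 < r &
  forall A B, `|A - P| < r -> `|B - P| < r -> D A /\
   `|g B - g A - d1 g A (B - A) - 2^-1 * d2 g P (B - A) (B - A)|
       <= e * `|B - A| ^+ 2.
Proof. exact: taylor2. Qed.

Lemma d1_near P : D P -> forall e : R, 0 < e -> exists2 r : R, 0 < r &
  forall A, `|A - P| < r -> D A /\
    forall u, `|d1 g A u - d1 g P u| <= e * `|u|.
Proof.
move=> DP e e0; apply/near_ball.
exact: derivative_near hV oD (C1_onW gC.1) DP _ e0.
Qed.

Lemma d2_near P : D P -> forall e : R, 0 < e -> exists2 r : R, 0 < r &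
  forall A, `|A - P| < r -> D A /\
    forall u v, `|d2 g A u v - d2 g P u v| <= e * `|u| * `|v|.
Proof.
move=> DP e e0; apply/near_ball.
have nD : \forall x \near P, D x by exact: open_nbhs_nbhs.
have H : \forall x \near P, forall v u, `|d2 g x u v - d2 g P u v| <= e * `|u| * `|v|.
  pose F : set_system (V * V) := filter_from [set r : R | 0 < r]
    (fun r => [set xu | `|xu.1 - P| < r]).
  have FF : Filter F.
    apply: filter_from_filter; first by exists 1 => /=.
    move=> r s /= r0 s0; exists (Num.min r s); first by rewrite /= lt_min r0.
    by move=> x /=; rewrite !lt_min => /andP[].
  have H2 : \forall xu \near F, forall v,
      `|d2 g xu.1 xu.2 v - d2 g P xu.2 v| <= e * `|v| * `|xu.2|.
    apply: (uniform_in_direction FF (N := fun xu : V * V => `|xu.2|)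
      (L := fun v (xu : V * V) => d2 g xu.1 xu.2 v - d2 g P xu.2 v)) => //.
      move/near_ball : nD => [r r0 Hr]; exists r => // xu /= xr; split=> // a u v.
      rewrite !d2Dr //; last exact: Hr.
      exact: combB.
    move=> u eps eps0.
    have /near_ball[r r0 Hr] := derivative_near hV oD (C1_onW (gC.2 u)) DP eps0.
    by exists r => // xu /= xr; apply: (Hr _ xr).2.
  case: H2 => r r0 Hr; apply/near_ball; exists r => // x xr v u.
  by have := Hr (x, u) xr v; rewrite /= mulrAC.
by apply: filterS2 nD H.
Qed.

End Directional.
#[global] Opaque d1 d2.

(** * Product coordinates: the point x and the pair m = (y, z) *)

Section Coordinates.
Context {R : realType} {n : nat}.
Local Notation E := 'rV[R]_n.
Local Notation W := (E * E * R)%type.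
Local Notation M := (E * R)%type.

Definition inx (v : E) : W := (v, 0, 0).
Definition inm (k : M) : W := (0, k.1, k.2).
Definition pt (x : E) (m : M) : W := (x, m.1, m.2).

Lemma inxD a u v : inx (a *: u + v) = a *: inx u + inx v.
Proof. by rewrite /inx; congr (_, _, _); rewrite /= ?scaler0 ?addr0 ?mulr0. Qed.

Lemma inmD a u v : inm (a *: u + v) = a *: inm u + inm v.
Proof. by rewrite /inm; congr (_, _, _); rewrite /= ?scaler0 ?addr0. Qed.

Lemma inxZ a u : inx (a *: u) = a *: inx u.
Proof. by rewrite /inx; congr (_, _, _); rewrite /= ?scaler0 ?mulr0. Qed.

Lemma inmZ a u : inm (a *: u) = a *: inm u.
Proof. by rewrite /inm; congr (_, _, _); rewrite /= ?scaler0. Qed.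

Lemma inmN u : inm (- u) = - inm u.
Proof. by rewrite -scaleN1r inmZ scaleN1r. Qed.

Lemma inx0 : inx 0 = 0. Proof. by []. Qed.
Lemma inm0 : inm 0 = 0. Proof. by []. Qed.

Lemma ptB x m x' m' : pt x' m' - pt x m = inx (x' - x) + inm (m' - m).
Proof. by rewrite /pt /inx /inm; congr (_, _, _); rewrite /= ?addr0 ?add0r. Qed.

Lemma ptBx x x' m : pt x' m - pt x m = inx (x' - x).
Proof. by rewrite ptB subrr inm0 addr0. Qed.

Lemma ptBm x m m' : pt x m' - pt x m = inm (m' - m).
Proof. by rewrite ptB subrr inx0 add0r. Qed.

Lemma norm_inx u : `|inx u| = `|u|.
Proof.
by rewrite !prod_normE /= !normr0 !max_l.
Qed.

Lemma norm_inm k : `|inm k| = `|k|.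
Proof. by rewrite !prod_normE /= normr0 [Num.max 0 _]max_r. Qed.

Lemma norm_pt x m x' m' : `|pt x' m' - pt x m| = Num.max `|x' - x| `|m' - m|.
Proof. by rewrite !prod_normE /= maxA. Qed.

Lemma norm_pt_lt x m x' m' (r : R) : `|x' - x| < r -> `|m' - m| < r ->
  `|pt x' m' - pt x m| < r.
Proof. by move=> h h'; rewrite norm_pt gt_max h. Qed.

Lemma pt_surj (P : W) : P = pt P.1.1 (P.1.2, P.2).
Proof. by case: P => -[]. Qed.

Lemma norm_coord (u : E) i : `|u 0 i| <= `|u|.
Proof.
rewrite [leRHS]/Num.Def.normr /= mx_normrE.
by apply/bigmax_geP; right => /=; exists (0, i).
Qed.

Lemma norm_le (u : E) (c : R) : 0 <= c -> (forall i, `|u 0 i| <= c) -> `|u| <= c.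
Proof.
move=> c0 H; rewrite [leLHS]/Num.Def.normr /= mx_normrE.
by apply/bigmax_leP; split => // -[j i] _ /=; rewrite ord1.
Qed.

Lemma norm_delta (i : 'I_n) : `|delta_mx 0 i : E| <= 1.
Proof.
apply: norm_le => // j; rewrite mxE eqxx /=.
by case: (j == i); rewrite ?normr1 ?normr0.
Qed.

Lemma row_delta (v : E) : v = \sum_i v 0 i *: delta_mx 0 i.
Proof. exact: row_sum_delta. Qed.

Lemma derive_x (f : W -> R) x y z (v : E) :
  'D_v (fun x' => f (x', y, z)) x = 'D_(inx v) f (x, y, z).
Proof.
rewrite /derive; set a := (X in lim (X @ _)); set b := (X in _ = lim (X @ _)).
suff -> : a = b by []; apply/funext => h; rewrite /a /b /=.
congr (_ *: (f _ - _)); rewrite /inx; congr (_, _, _) => /=.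
  by rewrite scaler0 add0r.
by rewrite scaler0 add0r.
Qed.

Lemma derive_y (f : W -> R) x y z (v : E) :
  'D_v (fun y' => f (x, y', z)) y = 'D_(inm (v, 0)) f (x, y, z).
Proof.
rewrite /derive; set a := (X in lim (X @ _)); set b := (X in _ = lim (X @ _)).
suff -> : a = b by []; apply/funext => h; rewrite /a /b /=.
congr (_ *: (f _ - _)); rewrite /inm; congr (_, _, _) => /=.
  by rewrite scaler0 add0r.
by rewrite scaler0 add0r.
Qed.

Lemma derive_z (f : W -> R) x y z :
  derive1 (fun z' => f (x, y, z')) z = 'D_(inm (0, 1)) f (x, y, z).
Proof.
rewrite /derive1 /derive; set a := (X in lim (X @ _)); set b := (X in _ = lim (X @ _)).
suff -> : a = b by []; apply/funext => h; rewrite /a /b /=.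
congr (_ *: (f _ - _)); rewrite /inm; congr (_, _, _) => /=.
- by rewrite scaler0 add0r.
- by rewrite scaler0 add0r.
- by congr (_ + _); exact/esym/mulr1.
Qed.

Lemma ptP x (m : M) : (x, m.1, m.2) = pt x m.
Proof. by []. Qed.

Lemma ptE x y z : (x, y, z) = pt x (y, z).
Proof. by []. Qed.

Lemma g_xE (f : W -> R) x m :
  g_x f x m.1 m.2 = \row_i d1 f (pt x m) (inx (delta_mx 0 i)).
Proof. by apply/rowP => i; rewrite /g_x /grad [LHS]mxE [RHS]mxE; exact: derive_x. Qed.

Lemma g_xxE (f : W -> R) x y z i j :
  g_xx f x y z i j = d2 f (x, y, z) (inx (delta_mx 0 j)) (inx (delta_mx 0 i)).
Proof.
rewrite mxE.
rewrite (_ : 'D_(delta_mx 0 i) (fun x' => f (x', y, z)) =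
   fun x' => ('D_(inx (delta_mx 0 i)) f) (x', y, z)).
  exact: derive_x.
by apply/funext => x'; exact: derive_x.
Qed.

Lemma W_coords : finite_coords W.
Proof.
exists ('I_n + 'I_n + unit)%type.
exists (fun i => match i with
  | inl (inl i) => inx (delta_mx 0 i)
  | inl (inr i) => inm (delta_mx 0 i, 0)
  | inr _ => inm (0, 1) end).
exists (fun i (v : W) => match i with
  | inl (inl i) => v.1.1 0 i
  | inl (inr i) => v.1.2 0 i
  | inr _ => v.2 end).
move=> v; split.
  rewrite !big_sumType /= (big_pred1 tt) //.
  have -> : \sum_i v.1.1 0 i *: inx (delta_mx 0 i) = inx v.1.1.
    rewrite {2}(row_sum_delta v.1.1) (big_morph inx (id1 := 0) (op1 := +%R)) //.
      by apply: eq_bigr => i _; rewrite inxZ.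
    by move=> x y; have := inxD 1 x y; rewrite !scale1r.
  have -> : \sum_i v.1.2 0 i *: inm (delta_mx 0 i, 0) = inm (v.1.2, 0).
    rewrite {2}(row_sum_delta v.1.2) (big_morph (fun y => inm (y, 0)) (id1 := 0) (op1 := +%R)) //.
      by apply: eq_bigr => i _; rewrite -inmZ /inm /=; congr (_, _, _); exact: mulr0.
    by move=> x y; rewrite /inm /=; congr (_, _, _); rewrite /= ?addr0.
  case: v => -[v1 v2] v3; rewrite /inx /inm /=; congr (_, _, _) => /=.
  - by rewrite scaler0 !addr0.
  - by rewrite scaler0 add0r addr0.
  - by rewrite !add0r; exact/esym/mulr1.
move=> [[i|i]|[]].
- apply: le_trans (norm_coord _ _) _; rewrite prod_normE le_max prod_normE le_max lexx //.
- apply: le_trans (norm_coord _ _) _; rewrite prod_normE le_max prod_normE le_max lexx orbT //.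
- by rewrite prod_normE le_max lexx orbT.
Qed.

End Coordinates.
#[global] Opaque inx inm pt.

(** * Euclidean length compared with the sup norm, and segments of slopes *)

Section Euclidean.
Context {R : realType} {n : nat}.
Local Notation E := 'rV[R]_n.

Lemma dotpE (u v : E) : dotp u v = \sum_i u 0 i * v 0 i.
Proof. by rewrite /dotp mxE; apply: eq_bigr => i _; rewrite mxE. Qed.

Lemma dotpC (u v : E) : dotp u v = dotp v u.
Proof. by rewrite !dotpE; apply: eq_bigr => i _; rewrite mulrC. Qed.

Lemma dotpDl (a : R) (u v w : E) : dotp (a *: u + v) w = a * dotp u w + dotp v w.
Proof. by rewrite /dotp mulmxDl -scalemxAl !mxE. Qed.

Lemma dotpZl (a : R) (u w : E) : dotp (a *: u) w = a * dotp u w.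
Proof. by rewrite /dotp -scalemxAl !mxE. Qed.

Lemma dotpDDl (u v w : E) : dotp (u + v) w = dotp u w + dotp v w.
Proof. by rewrite /dotp mulmxDl !mxE. Qed.

Lemma dotpNl (u w : E) : dotp (- u) w = - dotp u w.
Proof. by rewrite -scaleN1r dotpZl mulN1r. Qed.

Lemma dotpBl (u v w : E) : dotp (u - v) w = dotp u w - dotp v w.
Proof. by rewrite dotpDDl dotpNl. Qed.

Lemma dotp0l (w : E) : dotp 0 w = 0.
Proof. by rewrite /dotp mul0mx mxE. Qed.

Lemma dotpZr (a : R) (u w : E) : dotp w (a *: u) = a * dotp w u.
Proof. by rewrite !(dotpC w) dotpZl. Qed.

Lemma dotpDDr (u v w : E) : dotp w (u + v) = dotp w u + dotp w v.
Proof. by rewrite !(dotpC w) dotpDDl. Qed.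

Lemma dotpBr (u v w : E) : dotp w (u - v) = dotp w u - dotp w v.
Proof. by rewrite !(dotpC w) dotpBl. Qed.

Lemma dotp0r (w : E) : dotp w 0 = 0.
Proof. by rewrite dotpC dotp0l. Qed.

Lemma dotp_delta (u : E) i : dotp u (delta_mx 0 i) = u 0 i.
Proof.
rewrite dotpE (bigD1 i) //= big1 ?addr0 ?mxE ?eqxx ?mulr1 // => j /negPf ji.
by rewrite mxE ji /= mulr0.
Qed.

Lemma dotp_ge0 (u : E) : 0 <= dotp u u.
Proof. by rewrite dotpE sumr_ge0 // => i _; rewrite -expr2 sqr_ge0. Qed.

Lemma enorm_ge0 (u : E) : 0 <= enorm u.
Proof. exact: sqrtr_ge0. Qed.

Lemma enorm_sqr (u : E) : enorm u ^+ 2 = dotp u u.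
Proof. by rewrite /enorm sqr_sqrtr // dotp_ge0. Qed.

Lemma enormZ (a : R) (u : E) : enorm (a *: u) = `|a| * enorm u.
Proof.
by rewrite /enorm dotpZl dotpZr mulrA -expr2 sqrtrM ?sqr_ge0 // sqrtr_sqr.
Qed.

Lemma enormN (u : E) : enorm (- u) = enorm u.
Proof. by rewrite -scaleN1r enormZ normrN1 mul1r. Qed.

Lemma enormB (u v : E) : enorm (u - v) = enorm (v - u).
Proof. by rewrite -opprB enormN. Qed.

Lemma norm_le_enorm (u : E) : `|u| <= enorm u.
Proof.
apply: norm_le => [|i]; first exact: enorm_ge0.
rewrite /enorm -sqrtr_sqr; apply: ler_wsqrtr.
rewrite dotpE (bigD1 i) //= -expr2 lerDl sumr_ge0 // => j _.
by rewrite -expr2 sqr_ge0.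
Qed.

Lemma enorm_le_norm (u : E) : enorm u <= n.+1%:R * `|u|.
Proof.
rewrite -[leRHS]ger0_norm ?mulr_ge0 // -sqrtr_sqr; apply: ler_wsqrtr.
rewrite dotpE exprMn.
apply: (@le_trans _ _ (\sum_(i < n) `|u| ^+ 2)).
  apply: ler_sum => i _; rewrite -expr2 -[_ ^+ 2]ger0_norm ?sqr_ge0 // normrX.
  by rewrite lerXn2r ?nnegrE // norm_coord.
have -> : \sum_(i < n) `|u| ^+ 2 = n%:R * `|u| ^+ 2 :> R.
  by rewrite sumr_const card_ord mulr_natl.
apply: ler_wpM2r; first exact: sqr_ge0.
by rewrite -natrX ler_nat expnS expn1; apply: leq_trans (leq_pmulr _ _).
Qed.

Lemma enorm_gt0 (u : E) : u != 0 -> 0 < enorm u.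
Proof. by move=> u0; apply: lt_le_trans (norm_le_enorm u); rewrite normr_gt0. Qed.

Lemma enorm0 : enorm (0 : E) = 0.
Proof. by rewrite /enorm dotp0l sqrtr0. Qed.

Lemma cauchy_schwarz (u v : E) : `|dotp u v| <= enorm u * enorm v.
Proof.
have [->|v0] := eqVneq v 0; first by rewrite dotp0r enorm0 mulr0 normr0.
have vv0 : 0 < dotp v v by rewrite -enorm_sqr exprn_gt0 // enorm_gt0.
rewrite -[leRHS]ger0_norm ?mulr_ge0 ?enorm_ge0 // -ler_sqr ?nnegrE //.
rewrite !real_normK ?num_real // exprMn !enorm_sqr.
have := dotp_ge0 (dotp v v *: u - dotp u v *: v).
rewrite dotpBl !dotpBr !dotpZl !dotpZr (dotpC v u).
move: (dotp u v) (dotp u u) (dotp v v) vv0 => a b c c0 H.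
have {}H : 0 <= c * (b * c - a ^+ 2) by apply: le_trans H _; rewrite le_eqVlt; apply/orP; left; apply/eqP; ring.
by rewrite -subr_ge0 -(pmulr_rge0 _ c0).
Qed.

Lemma dotp_eq (u v : E) : (forall w, dotp u w = dotp v w) -> u = v.
Proof. by move=> H; apply/rowP => i; rewrite -!dotp_delta. Qed.

Lemma norm_dotp (u v : E) : `|dotp u v| <= n.+1%:R ^+ 2 * (`|u| * `|v|).
Proof.
apply: le_trans (cauchy_schwarz _ _) _.
have -> : n.+1%:R ^+ 2 * (`|u| * `|v|) = (n.+1%:R * `|u|) * (n.+1%:R * `|v|).
  by rewrite expr2; ring.
by apply: ler_pM; rewrite ?enorm_ge0 // enorm_le_norm.
Qed.

Lemma segpt0 (p0 p1 : E) : segpt p0 p1 0 = p0.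
Proof. by rewrite /segpt subr0 scale1r scale0r addr0. Qed.

Lemma segpt1 (p0 p1 : E) : segpt p0 p1 1 = p1.
Proof. by rewrite /segpt subrr scale1r scale0r add0r. Qed.

Lemma segptE (p0 p1 : E) t : segpt p0 p1 t = p0 + t *: (p1 - p0).
Proof. by apply/rowP => i; rewrite !mxE; ring. Qed.

Lemma segpt_sub (p0 p1 : E) s t r :
  segpt (segpt p0 p1 s) (segpt p0 p1 t) r = segpt p0 p1 ((1 - r) * s + r * t).
Proof. by apply/rowP => i; rewrite !mxE; ring. Qed.

Lemma segptB (p0 p1 : E) s t : segpt p0 p1 t - segpt p0 p1 s = (t - s) *: (p1 - p0).
Proof. by apply/rowP => i; rewrite !mxE; ring. Qed.

End Euclidean.
#[global] Opaque dotp enorm.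

Lemma bilinear_le (R : realType) (a b c d : R) : 0 <= a -> 0 <= b -> 0 <= c ->
  0 <= d -> a * b + c * d <= (b + c + 1) * (a + d).
Proof. by move=> a0 b0 c0 d0; nra. Qed.

(** * Nondegenerate generating systems and the linear algebra of A2 *)

Section System.
Context {R : realType} {n : nat}.
Local Notation E := 'rV[R]_n.
Local Notation W := (E * E * R)%type.
Local Notation M := (E * R)%type.

(* The hypotheses on (Gamma, g) in a form exchanged by duality: A1' and A1s
   are injectivity of (g, g_x) in (y, z) and of Q in x; s_A2 and s_A2s are the
   two sided nondegeneracy of E, tested on vectors (eta, zeta) with
   g_y eta + g_z zeta = 0. *)
Record generating_system (Gam : set W) (g : W -> R) : Prop := {
  s_open : open Gam;
  s_C2 : C2_on Gam g;
  s_gz : forall P, Gam P -> d1 g P (inm (0, 1)) < 0;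
  s_zinj : forall x y z z', Gam (x, y, z) -> Gam (x, y, z') ->
    g (x, y, z) = g (x, y, z') -> z = z';
  s_A1 : forall x m m', Gam (pt x m) -> Gam (pt x m') ->
    g (pt x m) = g (pt x m') ->
    (forall v, d1 g (pt x m) (inx v) = d1 g (pt x m') (inx v)) -> m = m';
  s_A1s : forall x x' m, Gam (pt x m) -> Gam (pt x' m) ->
    (forall k, d1 g (pt x m) (inm k) = 0 -> d1 g (pt x' m) (inm k) = 0) -> x = x';
  s_A2 : forall P k, Gam P -> d1 g P (inm k) = 0 ->
    (forall v, d2 g P (inm k) (inx v) = 0) -> k = 0;
  s_A2s : forall P v, Gam P ->
    (forall k, d1 g P (inm k) = 0 -> d2 g P (inm k) (inx v) = 0) -> v = 0 }.

Definition gx (g : W -> R) (x : E) (m : M) : E :=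
  \row_i d1 g (pt x m) (inx (delta_mx 0 i)).

Lemma gx_g_x (g : W -> R) x (m : M) : g_x g x m.1 m.2 = gx g x m.
Proof. by rewrite g_xE. Qed.

(** The derivative of [gx] at P along k in the variables (y, z). Together with [d1 g P (inm k)] it
    forms the linear map inverted in the inverse function argument. *)
Definition tx (g : W -> R) (P : W) (k : M) : E :=
  \row_i d2 g P (inm k) (inx (delta_mx 0 i)).

Variables (Gam : set W) (g : W -> R).
Hypothesis S : generating_system Gam g.

Let oG := s_open S.
Let gC := s_C2 S.
Let hW : finite_coords W := W_coords.

Lemma lin_row (f : E -> R) (v : E) :
  (forall (a : R) (u w : E), f (a *: u + w) = a * f u + f w) ->
  dotp (\row_i f (delta_mx 0 i)) v = f v.
Proof.
move=> fl; have f0 : f 0 = 0.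
  by have := fl (-1) 0 0; rewrite scaler0 addr0 mulN1r addNr.
rewrite dotpE {2}(row_delta v).
rewrite (big_morph f (id1 := 0) (op1 := +%R)) //.
  apply: eq_bigr => i _; rewrite mxE mulrC.
  by have := fl (v 0 i) (delta_mx 0 i) 0; rewrite addr0 f0 addr0.
by move=> u w; have := fl 1 u w; rewrite scale1r mul1r.
Qed.

Lemma d1mD P (a : R) (k l : M) : Gam P ->
  d1 g P (inm (a *: k + l)) = a * d1 g P (inm k) + d1 g P (inm l).
Proof. by move=> GP; rewrite inmD; exact: (d1Dl gC GP). Qed.

Lemma d1xD P (a : R) (u v : E) : Gam P ->
  d1 g P (inx (a *: u + v)) = a * d1 g P (inx u) + d1 g P (inx v).
Proof. by move=> GP; rewrite inxD; exact: (d1Dl gC GP). Qed.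

Lemma d2mD P (a : R) (k l : M) (w : W) : Gam P ->
  d2 g P (inm (a *: k + l)) w = a * d2 g P (inm k) w + d2 g P (inm l) w.
Proof. by move=> GP; rewrite inmD; exact: (d2Dl gC GP). Qed.

Lemma d2xD P (a : R) (u v : E) (w : W) : Gam P ->
  d2 g P w (inx (a *: u + v)) = a * d2 g P w (inx u) + d2 g P w (inx v).
Proof. by move=> GP; rewrite inxD; exact: (d2Dr hW oG gC GP). Qed.

Lemma gxE x m v : Gam (pt x m) -> dotp (gx g x m) v = d1 g (pt x m) (inx v).
Proof.
move=> GP; rewrite /gx (lin_row (f := fun v => d1 g (pt x m) (inx v))) //.
by move=> a u w; exact: d1xD.
Qed.

Lemma txE P k v : Gam P -> dotp (tx g P k) v = d2 g P (inm k) (inx v).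
Proof.
move=> GP; rewrite /tx (lin_row (f := fun v => d2 g P (inm k) (inx v))) //.
by move=> a u w; exact: d2xD.
Qed.

Local Opaque tx gx.

Lemma txD P (a : R) (k l : M) : Gam P -> tx g P (a *: k + l) = a *: tx g P k + tx g P l.
Proof. move=> GP.
apply: dotp_eq => w.
transitivity (d2 g P (inm (a *: k + l)) (inx w)); first exact: txE.
transitivity (a * d2 g P (inm k) (inx w) + d2 g P (inm l) (inx w)).
  exact: d2mD.
by rewrite dotpDl; congr (_ * _ + _); apply/esym; exact: txE.
Qed.

(** The map from k to the pair ([d1], [tx]) is linear between spaces of dimension n + 1 and
    injective by [s_A2], hence onto. The pair k is encoded as a row of length n + 1 in order to work
    with a square matrix. *)
Lemma tx_surj P : Gam P -> forall al pi, exists k : M,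
  d1 g P (inm k) = al /\ tx g P k = pi.
Proof.
move=> GP.
pose dec (r : 'rV[R]_(n + 1)) : M := (lsubmx r, rsubmx r 0 0).
have decD a r s : dec (a *: r + s) = a *: dec r + dec s.
  by rewrite /dec !linearP /= !mxE.
pose f (r : 'rV[R]_(n + 1)) : 'rV[R]_(n + 1) :=
  row_mx (tx g P (dec r)) (d1 g P (inm (dec r)))%:M.
have fl : linear f.
  move=> a r s; rewrite /f decD (txD _ _ _ GP) (d1mD _ _ _ GP).
  rewrite scale_row_mx add_row_mx; congr row_mx.
  by rewrite raddfD /= -scale_scalar_mx.
pose F : {linear 'rV[R]_(n + 1) -> 'rV[R]_(n + 1)} :=
  HB.pack f (GRing.isLinear.Build R _ _ *:%R f fl).
have Fu : lin1_mx F \in unitmx.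
  rewrite -row_free_unit; apply: inj_row_free => v.
  rewrite mul_rV_lin1 => /= /eqP; rewrite /f -row_mx0 => /eqP /eq_row_mx[t0 s0].
  have s0' : d1 g P (inm (dec v)) = 0.
    by move/matrixP : s0 => /(_ 0 0); rewrite !mxE eqxx mulr1n.
  have /(s_A2 S GP s0') : forall w, d2 g P (inm (dec v)) (inx w) = 0.
    by move=> w; rewrite -txE // t0 dotp0l.
  rewrite /dec => -[l0 r0]; rewrite -[v]hsubmxK l0.
  have -> : rsubmx v = 0 by apply/matrixP => i j; rewrite !ord1 r0 mxE.
  by rewrite row_mx0.
move=> al pi.
pose r := row_mx pi al%:M *m invmx (lin1_mx F).
have : f r = row_mx pi al%:M.
  by rewrite -[f r]/(F r) -mul_rV_lin1 mulmxKV.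
rewrite /f => /eq_row_mx[tr sr]; exists (dec r); split => //.
by move/matrixP : sr => /(_ 0 0); rewrite !mxE eqxx !mulr1n.
Qed.

Lemma tx_inj P (k l : M) : Gam P -> d1 g P (inm k) = d1 g P (inm l) ->
  tx g P k = tx g P l -> k = l.
Proof.
move=> GP e1 e2; apply/eqP; rewrite -subr_eq0; apply/eqP.
have kl : k - l = (-1) *: l + k by rewrite scaleN1r addrC.
apply: (s_A2 S GP); first by rewrite kl (d1mD _ _ _ GP) e1 mulN1r addNr.
by move=> v; rewrite -(txE _ _ GP) kl (txD _ _ _ GP) e2 scaleN1r addNr dotp0l.
Qed.

Lemma tx_basis P : Gam P -> exists (k0 : M) (kk : 'I_n -> M),
  [/\ d1 g P (inm k0) = 1, tx g P k0 = 0,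
     forall i, d1 g P (inm (kk i)) = 0 /\ tx g P (kk i) = delta_mx 0 i &
     forall k : M, k = d1 g P (inm k) *: k0 + \sum_i (tx g P k) 0 i *: kk i].
Proof.
move=> GP.
have [k0 [a0 t0]] := tx_surj GP 1 0.
have /choice[kk kkE] : forall i : 'I_n, exists k : M,
  d1 g P (inm k) = 0 /\ tx g P k = delta_mx 0 i.
  by move=> i; exact: tx_surj.
exists k0, kk; split=> // k.
have H (I : seq 'I_n) (c : 'I_n -> R) :
    d1 g P (inm (\sum_(i <- I) c i *: kk i)) = 0 /\
    tx g P (\sum_(i <- I) c i *: kk i) = \sum_(i <- I) c i *: delta_mx 0 i.
  elim: I => [|i I [IH1 IH2]].
    rewrite !big_nil; split; first exact: d10.
    by apply: dotp_eq => w; rewrite (txE _ _ GP) dotp0l; exact: d20l.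
  rewrite !big_cons (d1mD _ _ _ GP) (kkE i).1 mulr0 IH1 addr0; split=> //.
  by rewrite (txD _ _ _ GP) (kkE i).2 IH2.
have [H1 H2] := H (index_enum _) (tx g P k 0).
apply: (tx_inj GP).
  by rewrite (d1mD _ _ _ GP) a0 mulr1 H1 addr0.
by rewrite (txD _ _ _ GP) t0 scaler0 add0r H2 -row_delta.
Qed.

Lemma tx_bound P : Gam P -> exists2 C : R, 0 < C &
  forall k : M, `|k| <= C * (`|d1 g P (inm k)| + `|tx g P k|).
Proof.
move=> GP; have [k0 [kk [a0 t0 kkE kE]]] := tx_basis GP.
exists (`|k0| + \sum_i `|kk i| + 1).
  by rewrite ltr_wpDl // addr_ge0 // sumr_ge0.
move=> k; move: (kE k); set al := d1 g P _; set pi := tx g P k => {}kE.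
have h : `|k| <= `|al| * `|k0| + (\sum_i `|kk i|) * `|pi|.
  rewrite {1}kE; apply: le_trans (ler_normD _ _) _; rewrite normrZ lerD2l.
  apply: le_trans (ler_norm_sum _ _ _) _; rewrite mulr_suml.
  by apply: ler_sum => i _; rewrite normrZ mulrC ler_wpM2l // norm_coord.
have s0 : 0 <= \sum_i `|kk i| by exact: sumr_ge0.
apply: le_trans h _.
exact: bilinear_le.
Qed.

Lemma d1m_sum P (I : seq 'I_n) (c : 'I_n -> R) (kk : 'I_n -> M) : Gam P ->
  d1 g P (inm (\sum_(i <- I) c i *: kk i)) =
  \sum_(i <- I) c i * d1 g P (inm (kk i)).
Proof.
move=> GP; elim: I => [|i I IH]; first by rewrite !big_nil; exact: d10.
by rewrite !big_cons (d1mD _ _ _ GP) IH.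
Qed.

(* The linear form D_(y,z) g(x1, .) read through the isomorphism
   (d1, tx) of D_(y,z) (g, g_x) at (x0, m0). *)
Lemma dual_form x0 x1 m0 : Gam (pt x0 m0) -> Gam (pt x1 m0) ->
  exists (c0 : R) (w : E), forall k : M, d1 g (pt x1 m0) (inm k) =
    c0 * d1 g (pt x0 m0) (inm k) + dotp w (tx g (pt x0 m0) k).
Proof.
move=> G0 G1; have [k0 [kk [a0 t0 kkE kE]]] := tx_basis G0.
exists (d1 g (pt x1 m0) (inm k0)), (\row_i d1 g (pt x1 m0) (inm (kk i))) => k.
rewrite {1}(kE k) (d1mD _ _ _ G1) (d1m_sum _ _ _ G1) mulrC; congr (_ + _).
rewrite dotpE; apply: eq_bigr => i _; rewrite mulrC; congr (_ * _).
exact/esym/mxE.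
Qed.

End System.
#[global] Opaque tx gx.

(** * The inverse of (y, z) |-> (g, g_x) *)

Lemma min2 (R : realFieldType) (a b : R) : 0 < a -> 0 < b ->
  exists r : R, [/\ 0 < r, r <= a & r <= b].
Proof.
by move=> a0 b0; exists (Num.min a b); rewrite lt_min a0 b0 !ge_min !lexx !orbT.
Qed.

Lemma min3 (R : realFieldType) (a b c : R) : 0 < a -> 0 < b -> 0 < c ->
  exists r : R, [/\ 0 < r, r <= a, r <= b & r <= c].
Proof.
move=> a0 b0 c0; have [s [s0 sa sb]] := min2 a0 b0.
have [r [r0 rs rc]] := min2 s0 c0; exists r; split=> //; exact: le_trans rs _.
Qed.

Lemma min4 (R : realFieldType) (a b c d : R) : 0 < a -> 0 < b -> 0 < c ->
  0 < d -> exists r : R, [/\ 0 < r, r <= a, r <= b, r <= c & r <= d].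
Proof.
move=> a0 b0 c0 d0; have [s [s0 sa sb sc]] := min3 a0 b0 c0.
have [r [r0 rs rc]] := min2 s0 d0; exists r; split=> //; exact: le_trans rs _.
Qed.

Lemma sum6_le (R : realFieldType) (x y a b c d f : R) : x <= a + c ->
  y <= b + d -> a <= f -> b <= f -> c <= f -> d <= f -> x + y <= 4 * f.
Proof. lra. Qed.

Lemma sum4_le (R : realFieldType) (x y a b f : R) : x <= a -> y <= b ->
  a <= f / 2 -> b <= f / 2 -> x + y <= f.
Proof. lra. Qed.

Lemma sum4b_le (R : realFieldType) (x y a b c d f : R) : x <= a + b ->
  y <= c + d -> b + d <= 4 * f -> a + c <= 4 * f -> x + y <= 8 * f.
Proof. lra. Qed.

Lemma half_le_eq0 (R : realFieldType) (x : R) : x <= x / 2 -> x <= 0.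
Proof. lra. Qed.

Lemma newton_half (R : realFieldType) (C x y k F : R) : 0 < C ->
  x <= (4 * C)^-1 * k -> y <= (4 * C)^-1 * k -> k <= C * F -> x + y <= F / 2.
Proof.
move=> C0 h1 h2 h3.
have : (4 * C)^-1 * k <= (4 * C)^-1 * (C * F).
  by rewrite ler_pM2l // invr_gt0 mulr_gt0.
have -> : (4 * C)^-1 * (C * F) = F / 4 by field; rewrite gt_eqF.
lra.
Qed.

Lemma newton_step_le (R : realFieldType) (C C' f F s k d : R) : 0 < C -> 0 < f ->
  F <= 4 * f -> (2 * C' + C + 1) * f = s / 8 -> k <= C * F ->
  d <= C' * (8 * f) -> d + k <= s / 2.
Proof.
move=> C0 f0 h1 h2 h3 h4.
have : C * F <= C * (4 * f) by rewrite ler_pM2l.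
have : 0 < C * f by rewrite mulr_gt0.
nra.
Qed.

Lemma newton_lip (R : realFieldType) (C x y z w k : R) : 0 < C ->
  y <= x + (4 * C)^-1 * k -> w <= z + (4 * C)^-1 * k -> k <= C * (y + w) ->
  k <= 2 * C * (x + z).
Proof.
move=> C0 h1 h2 h3.
have h : C * ((4 * C)^-1 * k) = k / 4 by field; rewrite gt_eqF.
set c := (4 * C)^-1 * k in h h1 h2.
have : C * (y + w) <= C * (x + z + 2 * c) by rewrite ler_pM2l //; lra.
have -> : C * (x + z + 2 * c) = C * (x + z) + 2 * (C * c) by ring.
rewrite h; lra.
Qed.

Lemma continuous_eps (R : realType) (V U : normedModType R) (f : V -> U) (x : V) :
  (forall e : R, 0 < e -> exists2 r : R, 0 < r &
     forall y, `|y - x| < r -> `|f x - f y| <= e) -> {for x, continuous f}.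
Proof.
move=> H; apply/cvgrPdist_le => e e0; apply/near_ball.
by have [r r0 Hr] := H _ e0; exists r.
Qed.

(** * Compact balls and uniform choices over compact sets *)

Section Compactness.
Context {R : realType}.

Definition proper_space (V : normedModType R) : Prop :=
  forall (x : V) (r : R), 0 < r -> compact [set y : V | `|y - x| <= r].

Lemma closed_ball_closed' (V : normedModType R) (x : V) (r : R) :
  0 < r -> closed [set y : V | `|y - x| <= r].
Proof.
move=> r0; have := @closed_ball_closed _ V x r.
rewrite closed_ballE //; congr closed; apply/seteqP; split => y /=;
  by rewrite /closed_ball_ /= distrC.
Qed.

Lemma proper_rV n : proper_space 'rV[R]_n.
Proof.
move=> x r r0; apply: bounded_closed_compact; last exact: closed_ball_closed'.
exists (r + `|x|); split; first exact: num_real.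
move=> k kr y /= yx; apply: ltW; apply: le_lt_trans kr.
by rewrite -[y](subrK x); apply: le_trans (ler_normD _ _) _; rewrite lerD2r.
Qed.

Lemma proper_R : proper_space R.
Proof.
move=> x r r0.
have -> : [set y : R | `|y - x| <= r] = `[x - r, x + r]%classic.
  apply/seteqP; split => y /=; rewrite in_itv /= ler_distl //.
exact: segment_compact.
Qed.

Lemma proper_prod (U V : normedModType R) :
  proper_space U -> proper_space V -> proper_space (U * V)%type.
Proof.
move=> hU hV x r r0.
have -> : [set y : U * V | `|y - x| <= r] =
    [set y | `|y - x.1| <= r] `*` [set y | `|y - x.2| <= r].
  by apply/seteqP; split => -[y1 y2] /=; rewrite prod_normE /= ge_max => /andP.
by apply: compact_setX; [exact: hU|exact: hV].
Qed.

(* Tube lemma: what holds near every point of K, locally uniformly in a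
   parameter near x0, holds near x0 uniformly on K. *)
Lemma tube (X Y : normedModType R) (x0 : X) (K : set Y) (Q : X -> Y -> Prop) :
  compact K ->
  (forall y0, K y0 -> exists2 r : R, 0 < r & forall x y,
     `|x - x0| < r -> `|y - y0| < r -> Q x y) ->
  exists2 r : R, 0 < r & forall x y y0, `|x - x0| < r -> K y0 ->
    `|y - y0| < r -> Q x y.
Proof.
move=> /compact_near_coveringP cK H.
pose F : set_system (X * R) := filter_from [set r : R | 0 < r]
  (fun r => [set xs | `|xs.1 - x0| < r /\ xs.2 < r]).
have FF : Filter F.
  apply: filter_from_filter; first by exists 1 => /=.
  move=> r s /= r0 s0; exists (Num.min r s); first by rewrite /= lt_min r0.
  by move=> x /=; rewrite !lt_min => -[/andP[? ?] /andP[? ?]].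
have := cK _ F (fun xs y0 => forall y, `|y - y0| < xs.2 -> Q xs.1 y) FF.
have H' : forall y0, K y0 -> \forall y' \near y0 & xs \near F,
    forall y, `|y - y'| < xs.2 -> Q xs.1 y.
  move=> y0 Ky0; have [r r0 Hr] := H _ Ky0.
  exists ([set y' | `|y' - y0| < r / 2], [set xs | `|xs.1 - x0| < r / 2 /\ xs.2 < r / 2]).
    split => /=.
      by apply/nbhs_normP; exists (r / 2); rewrite /= ?divr_gt0 // => y /=; rewrite distrC.
    by exists (r / 2); rewrite /= ?divr_gt0.
  move=> [y' xs] /= [yy' [xx' sx]] y yy.
  apply: Hr; first by apply: lt_trans xx' _; lra.
  have -> : y - y0 = (y - y') + (y' - y0) by rewrite addrA subrK.
  by apply: le_lt_trans (ler_normD _ _) _; lra.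
move=> /(_ H') [r r0 Hr]; exists (r / 2); first by rewrite divr_gt0.
move=> x y y0 xx Ky yy; apply: (Hr (x, r / 2) _ y0 Ky y yy).
split => /=; first by apply: lt_trans xx _; move: r0 => /=; lra.
by move: r0 => /=; lra.
Qed.

End Compactness.

Section Inverse.
Context {R : realType} {n : nat}.
Local Notation E := 'rV[R]_n.
Local Notation W := (E * E * R)%type.
Local Notation M := (E * R)%type.

Lemma proper_M : proper_space M.
Proof. by apply: proper_prod; [exact: proper_rV|exact: proper_R]. Qed.

Variables (Gam : set W) (g : W -> R).
Hypothesis S : generating_system Gam g.
Let oG := s_open S.
Let gC := s_C2 S.
Let hW : finite_coords W := W_coords.

Lemma gxi x m i : gx g x m 0 i = d1 g (pt x m) (inx (delta_mx 0 i)).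
Proof. exact: mxE. Qed.

Lemma txi P k i : tx g P k 0 i = d2 g P (inm k) (inx (delta_mx 0 i)).
Proof. exact: mxE. Qed.

Lemma gxBi x m x' m' i : (gx g x' m' - gx g x m) 0 i =
  d1 g (pt x' m') (inx (delta_mx 0 i)) - d1 g (pt x m) (inx (delta_mx 0 i)).
Proof.
rewrite [LHS]mxE; congr (_ + _); first exact: gxi.
by rewrite [LHS]mxE; congr (- _); exact: gxi.
Qed.

Lemma g_near P : Gam P -> forall e : R, 0 < e -> exists2 r : R, 0 < r &
  forall A : W, `|A - P| < r -> Gam A /\ `|g A - g P| < e.
Proof.
move=> GP e e0; apply/near_ball.
have nD : \forall x \near P, Gam x by exact: open_nbhs_nbhs.
have := g_continuous gC GP => /cvgrPdist_lt /(_ _ e0) H.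
by apply: filterS2 nD H => x; rewrite distrC.
Qed.

Lemma gx_near x0 m0 : Gam (pt x0 m0) -> forall e : R, 0 < e ->
  exists2 r : R, 0 < r & forall (x : E) (m : M), `|x - x0| < r -> `|m - m0| < r ->
   `|gx g x m - gx g x0 m0| <= e.
Proof.
move=> GP e e0; have [r r0 H] := d1_near hW oG gC GP e0.
exists r => // x m xr mr; apply: norm_le => [|i]; first exact: ltW.
have [_ /(_ (inx (delta_mx 0 i)))] := H _ (norm_pt_lt xr mr).
rewrite gxBi => /le_trans; apply.
by rewrite norm_inx ler_piMr ?(ltW e0) // norm_delta.
Qed.

Lemma strictm x0 m0 : Gam (pt x0 m0) -> forall e : R, 0 < e ->
  exists2 r : R, 0 < r & forall (x : E) (m m' : M),
    `|x - x0| < r -> `|m - m0| < r -> `|m' - m0| < r ->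
  [/\ Gam (pt x m),
    `|g (pt x m') - g (pt x m) - d1 g (pt x0 m0) (inm (m' - m))| <= e * `|m' - m| &
    `|gx g x m' - gx g x m - tx g (pt x0 m0) (m' - m)| <= e * `|m' - m|].
Proof.
move=> GP e e0.
have [r1 r10 H1] := strict1 hW oG gC GP e0.
have [r2 r20 H2] := strict2 hW oG gC GP e0.
exists (Num.min r1 r2); first by rewrite lt_min r10.
move=> x m m'; rewrite !lt_min => /andP[x1 x2] /andP[m1 m2] /andP[m1' m2'].
have [GA HA] := H1 _ _ (norm_pt_lt x1 m1) (norm_pt_lt x1 m1').
rewrite ptBm norm_inm in HA; split=> //.
apply: norm_le => [|i]; first by rewrite mulr_ge0 // ltW.
have [_] := H2 _ _ (inx (delta_mx 0 i)) (norm_pt_lt x2 m2) (norm_pt_lt x2 m2').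
have -> : (gx g x m' - gx g x m - tx g (pt x0 m0) (m' - m)) 0 i =
    (gx g x m' - gx g x m) 0 i - tx g (pt x0 m0) (m' - m) 0 i.
  by rewrite [LHS]mxE; congr (_ + _); exact: mxE.
rewrite gxBi txi ptBm norm_inm norm_inx => /le_trans; apply.
by rewrite ler_wpM2r // ler_piMr ?(ltW e0) // norm_delta.
Qed.

(** The derivative of m -> (g, g_x)(x, m) is frozen at (x0, m0). An error of (4C)^-1 |m' - m| in
    each of the two components is absorbed by the lower bound of [tx_bound], at the cost of doubling
    the constant. *)
Lemma inverse_lipschitz x0 m0 : Gam (pt x0 m0) -> exists2 C : R, 0 < C &
  exists2 r : R, 0 < r & forall (x : E) (m m' : M),
    `|x - x0| < r -> `|m - m0| < r -> `|m' - m0| < r ->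
  `|m' - m| <= C * (`|g (pt x m') - g (pt x m)| + `|gx g x m' - gx g x m|).
Proof.
move=> GP; have [C C0 HC] := tx_bound S GP.
have e0 : 0 < (4 * C)^-1 by rewrite invr_gt0 mulr_gt0.
have [r r0 H] := strictm GP e0.
exists (2 * C); first by rewrite mulr_gt0.
exists r => // x m m' xr mr mr'.
have [_ H1 H2] := H x m m' xr mr mr'.
have := HC (m' - m).
set a := g (pt x m') - _ in H1 *; set b := d1 g _ _ in H1 *.
set p := gx g x m' - _ in H2 *; set t := tx _ _ _ in H2 *; set k := `|m' - m| in H1 H2 *.
have h1 : `|b| <= `|a| + (4 * C)^-1 * k.
  have -> : b = a - (a - b) by rewrite opprB addrC subrK.
  by apply: le_trans (ler_normB _ _) _; rewrite lerD2l.
have h2 : `|t| <= `|p| + (4 * C)^-1 * k.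
  have -> : t = p - (p - t) by rewrite opprB addrC subrK.
  by apply: le_trans (ler_normB _ _) _; rewrite lerD2l.
by move=> h; exact: newton_lip C0 h1 h2 h.
Qed.

(* Newton step at a minimum point of the residual over a small closed ball. *)
Lemma inverse_function x0 m0 : Gam (pt x0 m0) -> forall e : R, 0 < e ->
  exists2 r : R, 0 < r & forall (x : E) (u : R) (p : E),
    `|x - x0| < r -> `|u - g (pt x0 m0)| < r -> `|p - gx g x0 m0| < r ->
  exists m : M, [/\ `|m - m0| < e, Gam (pt x m), g (pt x m) = u & gx g x m = p].
Proof.
move=> GP e e0; have [C C0 HC] := tx_bound S GP.
have [C' C'0 [r1 r10 H1]] := inverse_lipschitz GP.
have d0 : 0 < (4 * C)^-1 by rewrite invr_gt0 mulr_gt0.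
have [r2 r20 H2] := strictm GP d0.
(* The minimum point will lie within 8 C' f of m0 and the Newton step has length at most 4 C f; K f
   = s/8 keeps the sum below s/2, inside the closed ball. *)
have [s [s0 s1 s2 s3]] := min3 r10 r20 e0.
pose K := 2 * C' + C + 1.
have K0 : 0 < K by rewrite /K; lra.
pose f := s / (8 * K).
have f0 : 0 < f by rewrite divr_gt0 // mulr_gt0.
have [r3 r30 H3] := g_near GP f0.
have [r4 r40 H4] := gx_near GP f0.
have [r [r0 rr3 rr4 rf rs]] := min4 r30 r40 f0 s0; exists r => // x u p xr ur pr.
have x3 := lt_le_trans xr rr3; have x4 := lt_le_trans xr rr4.
have xs := lt_le_trans xr rs; have uf := lt_le_trans ur rf.
have pf := lt_le_trans pr rf.
pose F (m : M) : R := `|g (pt x m) - u| + `|gx g x m - p|.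
have F0 : F m0 <= 4 * f.
  have n0 : `|m0 - m0| < r3 by rewrite subrr normr0.
  have n0' : `|m0 - m0| < r4 by rewrite subrr normr0.
  have [_ h3] := H3 _ (norm_pt_lt x3 n0).
  have h4 := H4 _ _ x4 n0'.
  have a1 := ler_distD (g (pt x0 m0)) (g (pt x m0)) u.
  have a2 := ler_distD (gx g x0 m0) (gx g x m0) p.
  rewrite distrC in uf; rewrite distrC in pf.
  exact: sum6_le a1 a2 (ltW h3) h4 (ltW uf) (ltW pf).
pose B := [set m : M | `|m - m0| <= s / 2].
have Bs m : B m -> `|m - m0| < s by rewrite /B /= => h; apply: le_lt_trans h _; lra.
have cB : compact B by apply: proper_M; rewrite divr_gt0.
have Fc : {within B, continuous F}.
  apply: continuous_in_subspaceT => m; rewrite inE => Bm.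
  have xr2 : `|x - x0| < r2 by apply: lt_le_trans xs s2.
  have mr2 := lt_le_trans (Bs _ Bm) s2.
  have [Gm _ _] := H2 x m m xr2 mr2 mr2.
  apply: (@continuous_eps R M R F m) => c c0.
  have c20 : 0 < c / 2 by rewrite divr_gt0.
  have [t1 t10 K1] := g_near Gm c20.
  have [t2 t20 K2] := gx_near Gm c20.
  have [t [t0 tt1 tt2]] := min2 t10 t20; exists t => // m' mt.
  have m1 := lt_le_trans mt tt1; have m2 := lt_le_trans mt tt2.
  have n1 : `|x - x| < t1 by rewrite subrr normr0.
  have n2 : `|x - x| < t2 by rewrite subrr normr0.
  have [_ k1] := K1 _ (norm_pt_lt n1 m1).
  have k2 := K2 _ _ n2 m2.
  rewrite /F opprD addrACA; apply: le_trans (ler_normD _ _) _.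
  have a1 := ler_dist_dist (g (pt x m) - u) (g (pt x m') - u).
  have a2 := ler_dist_dist (gx g x m - p) (gx g x m' - p).
  rewrite opprB addrA subrK in a1.
  rewrite opprB addrA subrK [X in _ <= X]distrC in a2.
  by rewrite distrC in k1; exact: sum4_le a1 a2 (ltW k1) k2.
have Bne : B !=set0 by exists m0; rewrite /B /= subrr normr0 divr_ge0 // ltW.
have [mh mhB mhmin] := compact_EVT_min Bne cB Fc.
rewrite inE in mhB.
have m0B : B m0 by rewrite /B /= subrr normr0 divr_ge0 // ltW.
have Fmh : F mh <= 4 * f by apply: le_trans F0; apply: mhmin; rewrite inE.
have xr1 : `|x - x0| < r1 by apply: lt_le_trans xs s1.
have xr2 : `|x - x0| < r2 by apply: lt_le_trans xs s2.
have fs : K * f = s / 8 by rewrite /f; field; rewrite gt_eqF.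
have n01 : `|m0 - m0| < r1 by rewrite subrr normr0.
have Fge m : 0 <= F m by rewrite addr_ge0.
have mhd : `|mh - m0| <= C' * (8 * f).
  apply: le_trans (H1 x m0 mh xr1 n01 (lt_le_trans (Bs _ mhB) s1)) _.
  apply: ler_wpM2l; first exact: ltW.
  have a1 := ler_distD u (g (pt x mh)) (g (pt x m0)).
  have a2 := ler_distD p (gx g x mh) (gx g x m0).
  rewrite (distrC u) in a1; rewrite (distrC p) in a2.
  exact: sum4b_le a1 a2 F0 Fmh.
have [k [k1 k2]] := tx_surj S GP (u - g (pt x mh)) (p - gx g x mh).
have kF : `|k| <= C * F mh.
  have := HC k; rewrite k1 k2 /F.
  by rewrite [`|u - _|]distrC [`|p - _|]distrC.
pose m' := mh + k.
have m'k : m' - mh = k by rewrite /m' addrC addKr.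
have m'B : B m'.
  rewrite /B /=; apply: (@le_trans _ _ (`|mh - m0| + `|k|)).
    by rewrite /m' addrAC; exact: ler_normD.
  exact: newton_step_le C0 f0 Fmh fs kF mhd.
have [Gmh S1 S2] := H2 x mh m' xr2 (lt_le_trans (Bs _ mhB) s2)
  (lt_le_trans (Bs _ m'B) s2).
rewrite m'k k1 in S1; rewrite m'k k2 in S2.
have Fm' : F m' <= F mh / 2.
  have e1 : g (pt x m') - g (pt x mh) - (u - g (pt x mh)) = g (pt x m') - u.
    by rewrite opprB addrA subrK.
  have e2 : gx g x m' - gx g x mh - (p - gx g x mh) = gx g x m' - p.
    by rewrite opprB addrA subrK.
  rewrite e1 in S1; rewrite e2 in S2.
  exact: newton_half C0 S1 S2 kF.
have Fz : F mh = 0.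
  apply: le_anti; rewrite Fge andbT.
  have := mhmin m'; rewrite inE => /(_ m'B) h.
  exact: half_le_eq0 (le_trans h Fm').
exists mh; split=> //.
- exact: lt_le_trans (Bs _ mhB) s3.
- apply/eqP; rewrite -subr_eq0 -normr_le0 -Fz /F.
  by rewrite lerDl.
- apply/eqP; rewrite -subr_eq0 -normr_le0 -Fz /F.
  by rewrite lerDr.
Qed.

End Inverse.

Lemma dist_le (R : realFieldType) (a b c d : R) : `|a - b| <= c -> `|a| <= d ->
  `|b| <= d + c.
Proof.
move=> h1 h2; have -> : b = a - (a - b) by ring.
by apply: le_trans (ler_normB _ _) _; rewrite lerD.
Qed.

Lemma dist_le' (R : numDomainType) (V : normedZmodType R) (a b : V) (c : R) :
  `|a - b| <= c -> `|b| <= `|a| + c.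
Proof.
move=> h1; have -> : b = a - (a - b) by rewrite opprB addrC subrK.
by apply: le_trans (ler_normB _ _) _; rewrite lerD2l.
Qed.

Lemma newton_dm (R : realFieldType) (C A P X D a p : R) : 0 < C -> 0 <= X ->
  a <= A + (4 * C)^-1 * (X + D) -> p <= P + (4 * C)^-1 * (X + D) ->
  D <= C * (a + p) -> 0 <= A -> 0 <= P -> D <= (2 * C + 1) * (X + A + P).
Proof.
move=> C0 X0 h1 h2 h3 A0 P0; have := newton_lip C0 h1 h2 _.
have h : C * ((4 * C)^-1 * (X + D)) = (X + D) / 4 by field; rewrite gt_eqF.
set c := (4 * C)^-1 * (X + D) in h h1 h2.
have : C * (a + p) <= C * (A + P + 2 * c) by rewrite ler_pM2l //; lra.
have -> : C * (A + P + 2 * c) = C * (A + P) + 2 * (C * c) by ring.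
rewrite h => h4 _; have CX : 0 <= C * X by rewrite mulr_ge0 // ltW.
lra.
Qed.

Lemma first_order_real (R : realFieldType) (C e N K c0 X D A P B al G dP dT : R) :
  0 < C -> 0 < e -> 0 <= N -> 0 < K ->
  K = C + (`|c0| + N) * (1 + C) + 1 -> 0 <= X -> 0 <= A -> 0 <= P ->
  D <= C * (X + A + P) -> `|al - B| <= e / K * (X + D) ->
  `|G - (c0 * B + dT)| <= e / K * D -> `|dP - dT| <= N * (e / K * (X + D)) ->
  `|G - (c0 * al + dP)| <= e * (X + A + P).
Proof.
move=> C0 e0 N0 K0 KE X0 A0 P0 h1 h2 h3 h4.
have -> : G - (c0 * al + dP) = (G - (c0 * B + dT)) - c0 * (al - B) - (dP - dT) by ring.
apply: le_trans (ler_normB _ _) _.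
have h5 := ler_normB (G - (c0 * B + dT)) (c0 * (al - B)).
have h6 : `|c0 * (al - B)| <= `|c0| * (e / K * (X + D)).
  by rewrite normrM ler_wpM2l.
set T := X + A + P in h1 *.
have T0 : 0 <= T by rewrite /T !addr_ge0.
have XT : X <= T by rewrite /T; lra.
set f := e / K in h2 h3 h4 h6.
have f0 : 0 < f by rewrite divr_gt0.
have fK : f * K = e by rewrite /f divfK // gt_eqF.
have h7 : f * (X + D) <= f * ((1 + C) * T) by rewrite ler_pM2l //; lra.
have h8 : f * D <= f * (C * T) by rewrite ler_pM2l.
have h9 : `|c0| * (f * (X + D)) <= `|c0| * (f * ((1 + C) * T)) by rewrite ler_wpM2l.
have h10 : N * (f * (X + D)) <= N * (f * ((1 + C) * T)) by rewrite ler_wpM2l.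
have h11 : e * T = f * (C * T) + `|c0| * (f * ((1 + C) * T)) + N * (f * ((1 + C) * T)) + f * T.
  by rewrite -fK KE; ring.
have fT : 0 <= f * T by rewrite mulr_ge0 // ltW.
lra.
Qed.

(** * The maps Y, Z and first order expansions in the data (x, g, g_x) *)

Section YZ_map.
Context {R : realType} {n : nat}.
Local Notation E := 'rV[R]_n.
Local Notation W := (E * E * R)%type.
Local Notation M := (E * R)%type.
Variables (Gam : set W) (g : W -> R).
Hypothesis S : generating_system Gam g.
Let oG := s_open S.
Let gC := s_C2 S.
Let hW : finite_coords W := W_coords.

Lemma gx_inj x (m m' : M) : Gam (pt x m) -> Gam (pt x m') ->
  g (pt x m) = g (pt x m') -> gx g x m = gx g x m' -> m = m'.
Proof.
move=> G G' e1 e2; apply: (s_A1 S G G' e1) => v.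
by rewrite -(gxE S _ G) -(gxE S _ G') e2.
Qed.

Lemma dom_UP x u p : dom_U Gam g (x, u, p) <->
  exists m : M, [/\ Gam (pt x m), g (pt x m) = u & gx g x m = p].
Proof.
split=> [[x' [y [z [G [-> -> ->]]]]]|[m [G gu gp]]].
  by exists (y, z); split=> //; rewrite -gx_g_x.
by exists x, m.1, m.2; rewrite ptP gx_g_x gu gp.
Qed.

Lemma YZP x u p : dom_U Gam g (x, u, p) ->
  [/\ Gam (pt x (YZ Gam g x u p)), g (pt x (YZ Gam g x u p)) = u &
      gx g x (YZ Gam g x u p) = p].
Proof.
move=> /dom_UP[m [G gu gp]].
have : [set yz : M | [/\ Gam (x, yz.1, yz.2), g (x, yz.1, yz.2) = u
                          & g_x g x yz.1 yz.2 = p]] (YZ Gam g x u p).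
  by apply: getPex; exists m; split; rewrite ?ptP // gx_g_x.
by rewrite /= ptP gx_g_x.
Qed.

Lemma YZ_pt x (m : M) : Gam (pt x m) -> YZ Gam g x (g (pt x m)) (gx g x m) = m.
Proof.
move=> G; have : dom_U Gam g (x, g (pt x m), gx g x m).
  by apply/dom_UP; exists m.
by move=> /YZP[G' gu gp]; exact: gx_inj gp.
Qed.

(** [inverse_function] provides some preimage close to m0, and the global uniqueness A1 identifies
    it with the one selected by [YZ]. *)
Lemma YZ_near x0 m0 : Gam (pt x0 m0) -> forall e : R, 0 < e ->
  exists2 r : R, 0 < r & forall (x : E) (u : R) (p : E),
    `|x - x0| < r -> `|u - g (pt x0 m0)| < r -> `|p - gx g x0 m0| < r ->
  dom_U Gam g (x, u, p) /\ `|YZ Gam g x u p - m0| < e.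
Proof.
move=> G0 e e0; have [r r0 H] := inverse_function S G0 e0.
exists r; first exact: r0.
move=> x u p xr ur pr; have [m [me G gu gp]] := H _ _ _ xr ur pr.
split; first by apply/dom_UP; exists m.
by rewrite -gu -gp YZ_pt.
Qed.

Lemma dom_U_open : open (dom_U Gam g).
Proof.
rewrite openE => -[[x u] p] /dom_UP[m [G <- <-]]; apply/(@near_ball R (E * R * E)%type).
have [r r0 H] := YZ_near G ltr01.
exists r; first exact: r0.
move=> -[[x' u'] p'].
rewrite !prod_normE /= !gt_max => /andP[/andP[xr ur] pr].
by have [] := H x' u' p' xr ur pr.
Qed.

Lemma tx_bound_near P0 : Gam P0 -> exists2 C : R, 0 < C &
  exists2 r : R, 0 < r & forall P : W, `|P - P0| < r -> Gam P /\
    forall k : M, `|k| <= C * (`|d1 g P (inm k)| + `|tx g P k|).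
Proof.
move=> G0; have [C C0 HC] := tx_bound S G0.
have e0 : 0 < (4 * C)^-1 by rewrite invr_gt0 mulr_gt0.
have [r1 r10 H1] := d1_near hW oG gC G0 e0.
have [r2 r20 H2] := d2_near hW oG gC G0 e0.
have [r [r0 rr1 rr2]] := min2 r10 r20.
exists (2 * C); first by rewrite mulr_gt0.
exists r; first exact: r0.
move=> P Pr.
have [G K1] := H1 _ (lt_le_trans Pr rr1).
have [_ K2] := H2 _ (lt_le_trans Pr rr2); split; first exact: G.
move=> k.
have h1 : `|d1 g P0 (inm k)| <= `|d1 g P (inm k)| + (4 * C)^-1 * `|k|.
  rewrite -lerBlDl; apply: le_trans (ler_norm _) _.
  apply: le_trans (ler_dist_dist _ _) _; rewrite distrC.
  by apply: le_trans (K1 _) _; rewrite norm_inm.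
have h2 : `|tx g P0 k| <= `|tx g P k| + (4 * C)^-1 * `|k|.
  apply: norm_le => [|i]; first by rewrite addr_ge0 // mulr_ge0 // ltW.
  rewrite txi; have := K2 (inm k) (inx (delta_mx 0 i)).
  rewrite norm_inm norm_inx => h.
  have h' : (4 * C)^-1 * `|k| * `|delta_mx 0 i : E| <= (4 * C)^-1 * `|k|.
    by rewrite ler_piMr ?norm_delta // mulr_ge0 // ltW.
  have nc := norm_coord (tx g P k) i; rewrite txi in nc.
  exact: dist_le (le_trans h h') nc.
exact: newton_lip C0 h1 h2 (HC k).
Qed.

(** The Hessian of g in x applied to v, as the row vector of a linear form. *)
Definition hx (P : W) (v : E) : E := \row_i d2 g P (inx v) (inx (delta_mx 0 i)).

Lemma hxi P v i : hx P v 0 i = d2 g P (inx v) (inx (delta_mx 0 i)).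
Proof. exact: mxE. Qed.

Lemma hxE P v w : Gam P -> dotp (hx P v) w = d2 g P (inx v) (inx w).
Proof.
move=> GP; rewrite /hx (lin_row (f := fun w => d2 g P (inx v) (inx w))) //.
by move=> a u w'; exact: (d2xD S).
Qed.

Local Opaque hx.

(** [al] and [pi] are what remains of the increments of g and g_x once the first order effect of
    moving x is removed. To first order they are the images of m - m0 under the isomorphism ([d1],
    [tx]), so they control m - m0 and are approximated by these images. *)
Lemma dm_estimate x0 m0 : Gam (pt x0 m0) -> exists2 C : R, 0 < C &
  forall e : R, 0 < e -> exists2 r : R, 0 < r & forall (x : E) (m : M) (al : R) (pi : E),
    `|x - x0| < r -> `|m - m0| < r ->
    al = g (pt x m) - g (pt x0 m0) - dotp (gx g x0 m0) (x - x0) ->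
    pi = gx g x m - gx g x0 m0 - hx (pt x0 m0) (x - x0) ->
  [/\ `|m - m0| <= C * (`|x - x0| + `|al| + `|pi|),
   `|al - d1 g (pt x0 m0) (inm (m - m0))| <= e * (`|x - x0| + `|m - m0|) &
   `|pi - tx g (pt x0 m0) (m - m0)| <= e * (`|x - x0| + `|m - m0|)].
Proof.
move=> G0; have [C C0 HC] := tx_bound S G0.
exists (2 * C + 1); first by rewrite addr_gt0 // mulr_gt0.
move=> e e0.
have d0 : 0 < (4 * C)^-1 by rewrite invr_gt0 mulr_gt0.
have [e1 [e10 e1e e1C]] := min2 e0 d0.
have [r1 r10 H1] := strict1 hW oG gC G0 e10.
have [r2 r20 H2] := strict2 hW oG gC G0 e10.
have [r [r0 rr1 rr2]] := min2 r10 r20.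
exists r; first exact: r0.
move=> x m al pi xr mr alE piE.
have z : `|pt x0 m0 - pt x0 m0| < r by rewrite subrr normr0.
have [_ K1] := H1 _ _ (lt_le_trans z rr1) (lt_le_trans (norm_pt_lt xr mr) rr1).
have K2 u := (H2 _ _ u (lt_le_trans z rr2) (lt_le_trans (norm_pt_lt xr mr) rr2)).2.
have nP : `|pt x m - pt x0 m0| <= `|x - x0| + `|m - m0|.
  by rewrite norm_pt ge_max lerDl lerDr !normr_ge0.
have A1 : `|al - d1 g (pt x0 m0) (inm (m - m0))| <= e1 * (`|x - x0| + `|m - m0|).
  have -> : al - d1 g (pt x0 m0) (inm (m - m0)) =
      g (pt x m) - g (pt x0 m0) - d1 g (pt x0 m0) (pt x m - pt x0 m0).
    rewrite ptB (d1D gC G0) alE (gxE S _ G0).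
    by rewrite opprD addrA.
  apply: le_trans K1 _; apply: ler_wpM2l => //; exact: ltW.
have A2 : `|pi - tx g (pt x0 m0) (m - m0)| <= e1 * (`|x - x0| + `|m - m0|).
  apply: norm_le => [|i]; first by rewrite mulr_ge0 ?addr_ge0 // ltW.
  have -> : (pi - tx g (pt x0 m0) (m - m0)) 0 i =
     d1 g (pt x m) (inx (delta_mx 0 i)) - d1 g (pt x0 m0) (inx (delta_mx 0 i))
     - d2 g (pt x0 m0) (pt x m - pt x0 m0) (inx (delta_mx 0 i)).
    rewrite ptB (d2DDl gC G0) piE.
    rewrite -gxBi -hxi -txi opprD addrA.
    by rewrite [LHS]mxE; congr (_ + _); [rewrite [LHS]mxE; congr (_ + _)|]; rewrite mxE.
  apply: le_trans (K2 _) _; rewrite norm_inx.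
  apply: ler_pM => //; first by rewrite mulr_ge0 // ltW.
  by rewrite ler_piMr ?norm_delta // ltW.
have ee : e1 * (`|x - x0| + `|m - m0|) <= e * (`|x - x0| + `|m - m0|).
  by apply: ler_wpM2r => //; rewrite addr_ge0.
have eC : e1 * (`|x - x0| + `|m - m0|) <= (4 * C)^-1 * (`|x - x0| + `|m - m0|).
  by apply: ler_wpM2r => //; rewrite addr_ge0.
split; [|exact: le_trans A1 ee|exact: le_trans A2 ee].
have h1 := dist_le' (le_trans A1 eC); have h2 := dist_le' (le_trans A2 eC).
exact: newton_dm C0 (normr_ge0 _) h1 h2 (HC _) (normr_ge0 _) (normr_ge0 _).
Qed.

(* First order expansion of m |-> g(x1, m) in terms of the increments of
   (x, g, g_x) at (x0, m0). *)
Lemma first_order x0 x1 m0 c0 w : Gam (pt x0 m0) -> Gam (pt x1 m0) ->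
  (forall k : M, d1 g (pt x1 m0) (inm k) =
    c0 * d1 g (pt x0 m0) (inm k) + dotp w (tx g (pt x0 m0) k)) ->
  forall e : R, 0 < e -> exists2 r : R, 0 < r & forall (x : E) (m : M) (al : R) (pi : E),
    `|x - x0| < r -> `|m - m0| < r ->
    al = g (pt x m) - g (pt x0 m0) - dotp (gx g x0 m0) (x - x0) ->
    pi = gx g x m - gx g x0 m0 - hx (pt x0 m0) (x - x0) ->
  `|g (pt x1 m) - g (pt x1 m0) - (c0 * al + dotp w pi)| <=
    e * (`|x - x0| + `|al| + `|pi|).
Proof.
move=> G0 G1 wE e e0; have [C C0 HC] := dm_estimate G0.
pose N : R := n.+1%:R ^+ 2 * `|w|.
have N0 : 0 <= N by rewrite mulr_ge0 // exprn_ge0.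
pose K := C + (`|c0| + N) * (1 + C) + 1.
have K0 : 0 < K.
  rewrite /K ltr_wpDl // addr_ge0 // ?(ltW C0) // mulr_ge0 // ?addr_ge0 //.
  exact: ltW.
have eK : 0 < e / K by rewrite divr_gt0.
have [r1 r10 H1] := HC _ eK.
have [r2 r20 H2] := strict1 hW oG gC G1 eK.
have [r [r0 rr1 rr2]] := min2 r10 r20.
exists r; first exact: r0.
move=> x m al pi xr mr alE piE.
have [D1 D2 D3] := H1 x m al pi (lt_le_trans xr rr1) (lt_le_trans mr rr1) alE piE.
have z : `|pt x1 m0 - pt x1 m0| < r2 by rewrite subrr normr0.
have z' : `|x1 - x1| < r2 by rewrite subrr normr0.
have [_] := H2 _ _ z (norm_pt_lt z' (lt_le_trans mr rr2)).
rewrite ptBm norm_inm wE => D4.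
have D5 : `|dotp w pi - dotp w (tx g (pt x0 m0) (m - m0))| <=
    N * (e / K * (`|x - x0| + `|m - m0|)).
  rewrite -dotpBr; apply: le_trans (norm_dotp _ _) _; rewrite mulrA -/N.
  exact: ler_wpM2l.
exact: (first_order_real C0 e0 N0 K0 erefl (normr_ge0 _) (normr_ge0 _) (normr_ge0 _) D1 D2 D4 D5).
Qed.

End YZ_map.
#[global] Opaque hx.

(** * First variations of the excess function *)

Section Reals.
Context {R : realFieldType}.

Lemma small_slope (T : R) : (forall e : R, 0 < e -> exists2 r : R, 0 < r &
  forall s : R, `|s| < r -> s * T <= e * `|s|) -> T = 0.
Proof.
move=> H; apply/eqP; rewrite -normr_le0; apply/ler_addgt0Pr => e e0; rewrite add0r.
have [r r0 Hr] := H _ e0.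
have r20 : 0 < r / 2 by lra.
have [T0|T0] := leP 0 T.
  have := Hr (r / 2); rewrite !ger0_norm ?(ltW r20) // => /(_ _).
  by rewrite [e * _]mulrC ler_pM2l //; apply; lra.
have := Hr (- (r / 2)); rewrite normrN gtr0_norm // ltr0_norm // mulNr -mulrN.
by rewrite [e * _]mulrC ler_pM2l //; apply; lra.
Qed.

Lemma small_slope_le (T : R) : (forall e : R, 0 < e -> exists2 s : R, 0 < s &
  s * T <= e * s) -> T <= 0.
Proof.
move=> H; apply/ler_addgt0Pr => e e0; rewrite add0r.
by have [s s0] := H _ e0; rewrite mulrC ler_pM2r.
Qed.

(** First order expansion in s of the weight of the excess function. Only a lower bound is kept,
    because at a maximum point the perturbed excess is bounded from above. *)
Lemma weight_expansion (t s : R) : 0 <= t <= 1 -> `|s| <= 1 ->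
  (t * (1 - t)) ^+ 2 + 2 * (t * (1 - t)) * (1 - 2 * t) * s - 10 * s ^+ 2 <=
  ((t + s) * (1 - (t + s))) ^+ 2.
Proof.
move=> /andP[t0 t1]; rewrite ler_norml => /andP[s0 s1].
have q0 : 0 <= t * (1 - t) by rewrite mulr_ge0 // subr_ge0.
have -> : (t + s) * (1 - (t + s)) = t * (1 - t) + (1 - 2 * t) * s - s ^+ 2 by ring.
have e1 : (t * (1 - t) + (1 - 2 * t) * s - s ^+ 2) ^+ 2 =
  (t * (1 - t)) ^+ 2 + 2 * (t * (1 - t)) * (1 - 2 * t) * s - 10 * s ^+ 2 +
  s ^+ 2 * ((1 - 2 * t - s) ^+ 2 + 10 - 2 * (t * (1 - t))) by ring.
rewrite e1 lerDl mulr_ge0 ?sqr_ge0 //.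
have := sqr_ge0 (1 - 2 * t - s).
nra.
Qed.

(* The numerical contradiction at an interior maximum point; q = t (1 - t). *)
Lemma max_point_contradiction (del kap lam C q f D d X c wMX XMX XMD Xd : R) :
  0 < del -> kap = del / 8 -> 0 < lam -> lam <= D -> 0 < q -> q <= 4^-1 ->
  0 < d -> C * d <= 1 -> kap * lam * d <= 4^-1 -> 0 <= C ->
  `|f| <= 2 * q -> c = - (kap * lam ^+ 2 * d ^+ 2 * f) ->
  0 <= X -> 3 / 4 * d <= X -> X <= 5 / 4 * d -> Xd <= 5 / 4 * d ^+ 2 ->
  wMX = XMX + c / D ^+ 2 * XMD ->
  del * q * D ^+ 2 * X ^+ 2 <= XMX -> `|XMD| <= C * D ^+ 2 * X ->
  wMX <= 2 * kap * lam ^+ 2 * q ^+ 2 * Xd -> False.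
Proof.
move=> del0 kapE lam0 lamD q0 q4 d0 Cd kld C0 fq cE X0 X1 X2 Xd1 wE h1 h2 h3.
have D0 : 0 < D by apply: lt_le_trans lamD.
have kap0 : 0 < kap by rewrite kapE; lra.
have L0 : 0 < lam ^+ 2 by rewrite exprn_gt0.
have LD : lam ^+ 2 <= D ^+ 2 by rewrite lerXn2r // nnegrE ltW.
have DD0 : 0 < D ^+ 2 by rewrite exprn_gt0.
have d20 : 0 < d ^+ 2 by rewrite exprn_gt0.
have cb : `|c| <= kap * lam ^+ 2 * d ^+ 2 * (2 * q).
  rewrite cE normrN normrM ger0_norm; last by rewrite !mulr_ge0 // ltW.
  by rewrite ler_wpM2l // !mulr_ge0 // ltW.
have cross : `|c / D ^+ 2 * XMD| <= kap * lam ^+ 2 * d ^+ 2 * (2 * q) * (5 / 4).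
  rewrite !normrM [`|_^-1|]ger0_norm ?invr_ge0 ?(ltW DD0) //.
  apply: (@le_trans _ _ (`|c| / D ^+ 2 * (C * D ^+ 2 * X))).
    by rewrite ler_wpM2l // mulr_ge0 // invr_ge0 ltW.
  have -> : `|c| / D ^+ 2 * (C * D ^+ 2 * X) = `|c| * (C * X).
    by field; rewrite gt_eqF.
  apply: ler_pM => //; first by rewrite mulr_ge0.
  apply: le_trans (ler_wpM2l C0 X2) _; rewrite mulrCA; lra.
have main : del * q * D ^+ 2 * (9 / 16 * d ^+ 2) <= XMX.
  apply: le_trans h1; rewrite ler_wpM2l //; first by rewrite !mulr_ge0 // ltW.
  have := ler_pM (_ : 0 <= 3 / 4 * d) (_ : 0 <= 3 / 4 * d) X1 X1.
  by rewrite -!expr2 => H; apply: le_trans (H _ _); [rewrite exprMn|..]; lra.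
have up : 2 * kap * lam ^+ 2 * q ^+ 2 * Xd <=
    2 * kap * lam ^+ 2 * q ^+ 2 * (5 / 4 * d ^+ 2).
  by rewrite ler_wpM2l // !mulr_ge0 ?sqr_ge0 // ltW.
pose Y := q * d ^+ 2 * del.
have Y0 : 0 < Y by rewrite !mulr_gt0.
have YD : Y * lam ^+ 2 <= Y * D ^+ 2 by rewrite ler_pM2l.
have YL0 : 0 < Y * lam ^+ 2 by rewrite mulr_gt0.
have YLq : Y * lam ^+ 2 * q <= Y * lam ^+ 2 * 4^-1 by rewrite ler_pM2l.
move: cross; rewrite ler_norml => /andP[cross _].
have e1 : kap * lam ^+ 2 * d ^+ 2 * (2 * q) * (5 / 4) = 5 / 16 * (Y * lam ^+ 2).
  by rewrite kapE /Y; field.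
have e2 : 2 * kap * lam ^+ 2 * q ^+ 2 * (5 / 4 * d ^+ 2) =
   5 / 16 * (Y * lam ^+ 2 * q) by rewrite kapE /Y; field.
have e3 : del * q * D ^+ 2 * (9 / 16 * d ^+ 2) = 9 / 16 * (Y * D ^+ 2).
  by rewrite /Y; field.
rewrite e1 in cross; rewrite e2 in up; rewrite e3 in main.
lra.
Qed.

End Reals.

Section Variations.
Context {R : realType} {n : nat}.
Local Notation E := 'rV[R]_n.
Local Notation W := (E * E * R)%type.
Local Notation M := (E * R)%type.
Variables (Gam : set W) (g : W -> R).
Hypothesis S : generating_system Gam g.
Let oG := s_open S.
Let gC := s_C2 S.
Let hW : finite_coords W := W_coords.

Lemma strictx x0 m0 : Gam (pt x0 m0) -> forall e : R, 0 < e ->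
  exists2 r : R, 0 < r & forall x : E, `|x - x0| < r ->
  [/\ Gam (pt x m0),
   `|g (pt x m0) - g (pt x0 m0) - dotp (gx g x0 m0) (x - x0)| <= e * `|x - x0| &
   `|gx g x m0 - gx g x0 m0 - hx g (pt x0 m0) (x - x0)| <= e * `|x - x0|].
Proof.
move=> G0 e e0.
have [r1 r10 H1] := strict1 hW oG gC G0 e0.
have [r2 r20 H2] := strict2 hW oG gC G0 e0.
have [r [r0 rr1 rr2]] := min2 r10 r20.
exists r; first exact: r0.
move=> x xr.
have z s : 0 < s -> `|m0 - m0| < s by rewrite subrr normr0.
have z' s : 0 < s -> `|pt x0 m0 - pt x0 m0| < s by rewrite subrr normr0.
have P1 := norm_pt_lt (lt_le_trans xr rr1) (z _ r10).
have P2 := norm_pt_lt (lt_le_trans xr rr2) (z _ r20).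
have [_] := H1 _ _ (z' _ r10) P1; rewrite ptBx norm_inx -(gxE S _ G0) => K1.
split; first by case: (H1 _ _ P1 P1).
  exact: K1.
apply: norm_le => [|i]; first by rewrite mulr_ge0 // ltW.
have [_] := H2 _ _ (inx (delta_mx 0 i)) (z' _ r20) P2.
rewrite ptBx !norm_inx -gxBi -hxi => K2.
have -> : (gx g x m0 - gx g x0 m0 - hx g (pt x0 m0) (x - x0)) 0 i =
   (gx g x m0 - gx g x0 m0) 0 i - hx g (pt x0 m0) (x - x0) 0 i.
  by rewrite [LHS]mxE; congr (_ + _); rewrite mxE.
apply: le_trans K2 _; apply: ler_wpM2r => //.
by apply: ler_piMr; [exact: ltW|exact: norm_delta].
Qed.

Lemma hxD P (a : R) (u v : E) : Gam P ->
  hx g P (a *: u + v) = a *: hx g P u + hx g P v.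
Proof.
move=> GP; apply: dotp_eq => w; rewrite dotpDl.
transitivity (d2 g P (inx (a *: u + v)) (inx w)); first exact: (hxE S).
rewrite inxD; transitivity (a * d2 g P (inx u) (inx w) + d2 g P (inx v) (inx w)).
  exact: (d2Dl gC GP).
by congr (_ * _ + _); apply/esym; exact: (hxE S).
Qed.

Lemma hx_bound P : Gam P -> exists2 C : R, 0 < C & forall v, `|hx g P v| <= C * `|v|.
Proof.
move=> GP; exists (\sum_i `|hx g P (delta_mx 0 i)| + 1).
  by rewrite ltr_wpDl // sumr_ge0.
move=> v.
have hD (u w : E) : hx g P (u + w) = hx g P u + hx g P w.
  by have := hxD 1 u w GP; rewrite !scale1r.
have h0 : hx g P 0 = 0.
  by have := hxD (-1) 0 0 GP; rewrite scaler0 addr0 scaleN1r addNr.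
rewrite {1}(row_delta v) (big_morph (hx g P) (id1 := 0) (op1 := +%R)) //.
apply: le_trans (ler_norm_sum _ _ _) _; rewrite mulrDl mulr_suml.
apply: (@le_trans _ _ (\sum_i `|hx g P (delta_mx 0 i)| * `|v|)).
  apply: ler_sum => i _.
  have := hxD (v 0 i) (delta_mx 0 i) 0 GP; rewrite h0 !addr0 => ->.
  by rewrite normrZ mulrC ler_wpM2l // norm_coord.
by rewrite lerDl mulr_ge0.
Qed.

(* A curve tangent to xi inside the level set of g(., b) - g(., a). *)
Lemma level_curve (a b : M) (x xi : E) : Gam (pt x a) -> Gam (pt x b) ->
  g (pt x a) = g (pt x b) -> gx g x b - gx g x a != 0 ->
  dotp xi (gx g x b - gx g x a) = 0 -> forall e : R, 0 < e ->
  exists2 s0 : R, 0 < s0 & forall s : R, 0 < s -> s < s0 ->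
  exists2 tau : R, `|tau| <= e * s &
    let x' := x + s *: xi + tau *: (gx g x b - gx g x a) in
    g (pt x' a) = g (pt x' b).
Proof.
move=> Ga Gb ab; set D := gx g x b - gx g x a => D0 xiD e e0.
have DD0 : 0 < dotp D D by rewrite -enorm_sqr exprn_gt0 // enorm_gt0.
pose L := `|xi| + e * `|D| + 1.
have L0 : 0 < L by rewrite /L ltr_wpDl // addr_ge0 // mulr_ge0 // ltW.
(* With this f the remainder 2 f s L is half of e s |D|^2, so h is nonpositive at -e s and
   nonnegative at e s. *)
pose f := e * dotp D D / (4 * L).
have f0 : 0 < f by rewrite divr_gt0 ?mulr_gt0.
have [r1 r10 H1] := strictx Ga f0.
have [r2 r20 H2] := strictx Gb f0.
have [r [r0 rr1 rr2]] := min2 r10 r20.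
exists (r / L); first by rewrite divr_gt0.
move=> s s0 sr.
have sL : s * L < r by move: sr; rewrite ltr_pdivlMr.
pose X t := x + s *: xi + t *: D.
have XE t : X t - x = s *: xi + t *: D by rewrite /X -(addrA x) [x + _]addrC addrK.
have Xn t : `|t| <= e * s -> `|X t - x| <= s * (`|xi| + e * `|D|).
  move=> te; rewrite XE; apply: le_trans (ler_normD _ _) _.
  rewrite !normrZ gtr0_norm // mulrDr lerD2l mulrA [s * e]mulrC.
  by rewrite ler_wpM2r.
have Xr t : `|t| <= e * s -> `|X t - x| < r.
  move=> te; apply: le_lt_trans (Xn _ te) _; apply: le_lt_trans sL.
  by rewrite ler_wpM2l ?(ltW s0) // /L lerDl.
pose h t := g (pt (X t) b) - g (pt (X t) a).
have hE t : `|t| <= e * s -> `|h t - t * dotp D D| <= 2 * f * (s * L).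
  move=> te; have Xt := Xr _ te.
  have [_ A1 _] := H1 _ (lt_le_trans Xt rr1).
  have [_ B1 _] := H2 _ (lt_le_trans Xt rr2).
  have dX : dotp D (X t - x) = t * dotp D D.
    by rewrite XE dotpDDr !dotpZr (dotpC D xi) xiD mulr0 add0r.
  have -> : h t - t * dotp D D =
     (g (pt (X t) b) - g (pt x b) - dotp (gx g x b) (X t - x)) -
     (g (pt (X t) a) - g (pt x a) - dotp (gx g x a) (X t - x)).
    rewrite -dX /D dotpBl ab /h; ring.
  apply: le_trans (ler_normB _ _) _.
  have XL : `|X t - x| <= s * L.
    apply: le_trans (Xn _ te) _; rewrite ler_wpM2l ?(ltW s0) // /L lerDl //.
  have fX : f * `|X t - x| <= f * (s * L) by rewrite ler_pM2l.
  lra.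
have hc : {within `[- (e * s), e * s], continuous h}.
  apply: continuous_in_subspaceT => t; rewrite inE /= in_itv /= -ler_norml => te.
  have Xt := Xr _ te.
  have [Gta _ _] := H1 _ (lt_le_trans Xt rr1).
  have [Gtb _ _] := H2 _ (lt_le_trans Xt rr2).
  have cont (m : M) : Gam (pt (X t) m) -> {for t, continuous (fun t => g (pt (X t) m))}.
    move=> Gm; apply: continuous_eps => c c0.
    have [q q0 Hq] := g_near S Gm c0.
    have DL : 0 < `|D| + 1 by rewrite ltr_wpDl.
    exists (q / (`|D| + 1)); first by rewrite divr_gt0.
    move=> t' t't; rewrite distrC; apply: ltW; apply: (Hq _ _).2.
    rewrite ptBx norm_inx.
    have -> : X t' - X t = (t' - t) *: D.
      by rewrite /X opprD addrACA subrr add0r -scalerBl.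
    rewrite normrZ; move: t't; rewrite ltr_pdivlMr //; apply: le_lt_trans.
    by rewrite ler_wpM2l // lerDl.
  by apply: continuousB; exact: cont.
have es0 : 0 < e * s by rewrite mulr_gt0.
have fE : 2 * f * (s * L) = e * s * dotp D D / 2.
  by rewrite /f; field; rewrite gt_eqF.
have esD : 0 < e * s * dotp D D by rewrite mulr_gt0.
have hm : h (- (e * s)) <= 0.
  have := hE (- (e * s)); rewrite normrN gtr0_norm // lexx fE => /(_ isT).
  rewrite ler_norml mulNr => /andP[_]; lra.
have hp : 0 <= h (e * s).
  have := hE (e * s); rewrite gtr0_norm // lexx fE => /(_ isT).
  rewrite ler_norml => /andP[+ _]; lra.
have [||c] := @IVT R h (- (e * s)) (e * s) 0 _ hc.
- by apply: le_trans (ltW es0); rewrite oppr_le0 ltW.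
- by rewrite ge_min hm /= le_max hp orbT.
rewrite in_itv /= -ler_norml => ce hc0.
by exists c => //; apply/eqP; rewrite eq_sym -subr_eq0; apply/eqP.
Qed.

End Variations.

Lemma eighth_lt (R : realFieldType) (r : R) : 0 < r -> r / 8 < r.
Proof. lra. Qed.

Lemma sum3_lt (R : realFieldType) (u v w r : R) : u <= r / 8 -> v <= r / 8 ->
  w <= r / 4 -> 0 < r -> 2 * u + 2 * v + w < r.
Proof. lra. Qed.

Lemma dx_real (R : realFieldType) (a s X Y t e1 : R) : 0 < s -> 0 <= Y -> e1 <= 1 ->
  a <= s * X + t * Y -> t <= e1 * s -> a <= s * (X + Y + 1).
Proof.
move=> s0 Y0 e11 h1 h2.
have h3 : t * Y <= e1 * s * Y by apply: ler_wpM2r.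
have h4 : e1 * (s * Y) <= 1 * (s * Y).
  by apply: ler_wpM2r => //; apply: mulr_ge0 => //; exact: ltW.
lra.
Qed.

Lemma al_real (R : realFieldType) (al A B t DD e1 s L dx : R) : 0 <= DD ->
  0 <= e1 -> 0 <= t -> t <= 1 -> 0 <= B ->
  al <= A + t * (B * DD) -> A <= e1 * dx -> dx <= s * L -> B <= e1 * s ->
  al <= e1 * s * (L + DD).
Proof.
move=> D0 e10 t0 t1 B0 h1 h2 h3 h4.
have h5 : e1 * dx <= e1 * (s * L) by apply: ler_wpM2l.
have h6 : B * DD <= e1 * s * DD by apply: ler_wpM2r.
have h7 : t * (B * DD) <= 1 * (B * DD).
  by apply: ler_wpM2r => //; exact: mulr_ge0.
lra.
Qed.

Lemma pi_real (R : realFieldType) (p A B T MD e1 s L dx t : R) : 0 <= MD ->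
  0 <= e1 -> 0 <= t -> t <= 1 -> p <= (1 - t) * A + t * B + T * MD ->
  A <= e1 * dx -> B <= e1 * dx -> dx <= s * L -> T <= e1 * s ->
  p <= e1 * s * (L + MD).
Proof.
move=> D0 e10 t0 t1 h1 h2 h2' h3 h4.
have h5 : e1 * dx <= e1 * (s * L) by apply: ler_wpM2l.
have h6 : T * MD <= e1 * s * MD by apply: ler_wpM2r.
have h7 : (1 - t) * A <= (1 - t) * (e1 * (s * L)).
  by apply: ler_wpM2l; [rewrite subr_ge0|lra].
have h8 : t * B <= t * (e1 * (s * L)) by apply: ler_wpM2l => //; lra.
lra.
Qed.

Lemma scale_real (R : realFieldType) (e1 s X : R) : e1 <= 1 -> 0 <= s -> 0 <= X ->
  e1 * s * X <= s * X.
Proof.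
move=> e11 s0 X0; rewrite -mulrA; apply: ler_piMl => //; exact: mulr_ge0.
Qed.

Lemma opp_assoc (R : ringType) (A x y z : R) : A - (x + y * z) = A - x - y * z.
Proof. by rewrite opprD addrA. Qed.

Lemma theta_real (R : realFieldType) (e K s d : R) : 0 < K -> 0 <= e -> 0 <= s ->
  d <= K -> e / K * (0 + 0 + s * d) <= e * s.
Proof.
move=> K0 e0 s0 dK; have -> : e / K * (0 + 0 + s * d) = e * s * (d / K) by ring.
apply: ler_piMr; first exact: mulr_ge0.
by rewrite ler_pdivrMr // mul1r.
Qed.

Lemma x_var_const (R : realFieldType) (c0 L DD N MD Mxi nD K : R) : 0 < L ->
  0 <= DD -> 0 <= MD -> 0 <= Mxi -> 0 <= N -> 0 <= nD ->
  K = `|c0| * (L + DD) + N * (L + MD) + (L + (L + DD) + (Mxi + L + MD)) + nD + 1 ->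
  nD <= K /\ 0 < K.
Proof.
move=> L0 DD0 MD0 Mxi0 N0 nD0 ->.
have h1 : 0 <= `|c0| * (L + DD) by rewrite mulr_ge0 // addr_ge0 // ltW.
have h2 : 0 <= N * (L + MD) by rewrite mulr_ge0 // addr_ge0 // ltW.
by split; lra.
Qed.

Lemma pin_real (R : realFieldType) (p q s A B C : R) : p <= q + s * A ->
  q <= s * (B + C) -> p <= s * (A + B + C).
Proof. lra. Qed.

(* [have [y e] := named x] hides a term x that unification would unfold. *)
Lemma named (T : Type) (x : T) : exists y, y = x.
Proof. by exists x. Qed.

Lemma x_var_real (R : realFieldType) (e1 s c0 L DD N MD Mxi K al e G Y dwp wM
    dxn aln pin : R) : 0 <= e1 -> 0 <= s ->
  0 <= Y -> K = `|c0| * (L + DD) + N * (L + MD) + (L + (L + DD) + (Mxi + L + MD)) + Y + 1 ->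
  `|G - (c0 * al + dwp)| <= e1 * (dxn + aln + pin) ->
  `|dwp - s * wM| <= N * (e1 * s * (L + MD)) ->
  `|c0 * al| <= `|c0| * (e1 * s * (L + DD)) ->
  dxn <= s * L -> aln <= s * (L + DD) -> pin <= s * (Mxi + L + MD) ->
  e1 * s * K <= e * s -> s * wM - e * s <= G.
Proof.
move=> e10 s0 Y0 KE; rewrite !ler_norml => /andP[h1 _] /andP[h2 _] /andP[h3 _] h4 h5 h6 h7.
have h8 : e1 * (dxn + aln + pin) <= e1 * (s * (L + (L + DD) + (Mxi + L + MD))).
  by apply: ler_wpM2l => //; lra.
have h9 : 0 <= e1 * s * Y by rewrite !mulr_ge0.
have h10 : 0 <= e1 * s by rewrite mulr_ge0.
have h11 : e1 * s * K = `|c0| * (e1 * s * (L + DD)) + N * (e1 * s * (L + MD)) +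
  e1 * (s * (L + (L + DD) + (Mxi + L + MD))) + e1 * s * Y + e1 * s.
  by rewrite KE; ring.
lra.
Qed.

(** * The family of g-segments joining two fixed ends, as the base point varies *)

Section Max_principle_core.
Context {R : realType} {n : nat}.
Local Notation E := 'rV[R]_n.
Local Notation W := (E * E * R)%type.
Local Notation M := (E * R)%type.

Lemma enormD (u v : E) : enorm (u + v) <= enorm u + enorm v.
Proof.
rewrite -(@ler_pXn2r R 2) ?nnegrE ?addr_ge0 ?enorm_ge0 //.
rewrite sqrrD !enorm_sqr dotpDDl !dotpDDr (dotpC v u).
have := le_trans (ler_norm _) (cauchy_schwarz u v).
lra.
Qed.

Lemma enorm_dist (u v : E) : `|enorm u - enorm v| <= n.+1%:R * `|u - v|.
Proof.
have H (x y : E) : enorm x - enorm y <= n.+1%:R * `|x - y|.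
  rewrite lerBlDr; apply: (@le_trans _ _ (enorm (x - y) + enorm y)).
    by rewrite -{1}(subrK y x) enormD.
  by rewrite lerD2r enorm_le_norm.
by rewrite ler_norml H andbT -lerN2 opprK opprB distrC H.
Qed.

Lemma sub_dotp_eq (A B A' B' : R) (p p' d : E) : A' = A -> B' = B -> p' = p ->
  A - B - dotp p d = A' - B' - dotp p' d.
Proof. by move=> -> -> ->. Qed.

Lemma sub_eq (p q p' q' : E) : p' = p -> q' = q -> p - q = p' - q'.
Proof. by move=> -> ->. Qed.

Lemma sub_sub_eq (p q p' q' h : E) : p' = p -> q' = q -> p - q - h = p' - q' - h.
Proof. by move=> -> ->. Qed.

Lemma norm_comb (u v : E) (t : R) : 0 <= t -> t <= 1 ->
  `|(1 - t) *: u + t *: v| <= (1 - t) * `|u| + t * `|v|.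
Proof.
move=> t0 t1; apply: le_trans (ler_normD _ _) _; rewrite !normrZ.
by rewrite !ger0_norm // subr_ge0.
Qed.

Lemma norm_comb3 (u v w : E) (t s : R) : 0 <= t -> t <= 1 ->
  `|(1 - t) *: u + t *: v + s *: w| <= (1 - t) * `|u| + t * `|v| + `|s| * `|w|.
Proof.
move=> t0 t1; apply: le_trans (ler_normD _ _) _; rewrite normrZ.
by apply: lerD => //; exact: norm_comb.
Qed.

Lemma segpt_dist (p q p' q' : E) (t t' : R) : 0 <= t' <= 1 -> `|t - t'| <= 1 ->
  `|segpt p q t - segpt p' q' t'| <=
  2 * `|p - p'| + 2 * `|q - q'| + `|t - t'| * `|q' - p'|.
Proof.
move=> /andP[t0 t1] tt.
have -> : segpt p q t - segpt p' q' t' =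
    (1 - t) *: (p - p') + t *: (q - q') + (t - t') *: (q' - p').
  by apply/rowP => i; rewrite !mxE; ring.
apply: le_trans (ler_normD _ _) _; rewrite normrZ lerD2r.
apply: le_trans (ler_normD _ _) _; rewrite !normrZ.
move: tt; rewrite ler_norml => /andP[ta tb].
apply: lerD; apply: ler_wpM2r => //; rewrite ler_norml; apply/andP; split; lra.
Qed.

Variables (Gam : set W) (g : W -> R).
Hypothesis S : generating_system Gam g.
Let oG := s_open S.
Let gC := s_C2 S.
Let hW : finite_coords W := W_coords.

Lemma hx0 P : Gam P -> hx g P 0 = 0.
Proof.
by move=> GP; have := hxD S (-1) 0 0 GP; rewrite scaler0 addr0 scaleN1r addNr.
Qed.

Section Family.
Variables (a b : M) (x1 : E).

Definition Dp x := gx g x b - gx g x a.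
Definition pth x t := segpt (gx g x a) (gx g x b) t.
(** The member of parameter t of the g-segment based at x that starts at a, on the level of a. It
    ends at b only when g(x, a) = g(x, b), which is why base points are restricted to this level
    set. *)
Definition mth x t : M := YZ Gam g x (g (pt x a)) (pth x t).
(** On the level set g(x, a) = g(x, b) this is the second difference (1 - t) A(p0) + t A(p1) -
    A(p_t) applied to xi. A3s bounds its quadratic form from below for xi orthogonal to [Dp]. *)
Definition Mx x t (xi : E) : E :=
  (1 - t) *: hx g (pt x a) xi + t *: hx g (pt x b) xi - hx g (pt x (mth x t)) xi.
Definition admissible x t := [/\ Gam (pt x a), Gam (pt x b),
  dom_U Gam g (x, g (pt x a), pth x t) & Gam (pt x1 (mth x t))].

Lemma mthP x t : admissible x t -> [/\ Gam (pt x (mth x t)),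
  g (pt x (mth x t)) = g (pt x a) & gx g x (mth x t) = pth x t].
Proof. by move=> [_ _ /YZP]. Qed.

Lemma mthU x t : dom_U Gam g (x, g (pt x a), pth x t) ->
  [/\ Gam (pt x (mth x t)), g (pt x (mth x t)) = g (pt x a) &
      gx g x (mth x t) = pth x t].
Proof. exact: YZP. Qed.

Lemma mth0 x : Gam (pt x a) -> mth x 0 = a.
Proof. by move=> Ga; rewrite /mth /pth segpt0 (YZ_pt S Ga). Qed.

Lemma mth1 x : Gam (pt x b) -> g (pt x a) = g (pt x b) -> mth x 1 = b.
Proof. by move=> Gb ab; rewrite /mth /pth segpt1 ab (YZ_pt S Gb). Qed.

Lemma mth_near x t : admissible x t -> 0 <= t <= 1 -> forall e : R, 0 < e ->
  exists2 r : R, 0 < r & forall (x' : E) (t' : R), `|x' - x| < r -> `|t' - t| < r ->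
    dom_U Gam g (x', g (pt x' a), pth x' t') /\ `|mth x' t' - mth x t| < e.
Proof.
move=> H t01 e e0; have [Gm gu gp] := mthP H; have [Ga Gb _ _] := H.
have [r r0 Hr] := YZ_near S Gm e0.
pose K := `|gx g x b - gx g x a| + 1.
have K0 : 0 < K by rewrite /K ltr_wpDl.
have f0 : 0 < r / 8 by rewrite divr_gt0.
have [r1 r10 H1] := g_near S Ga f0.
have [r2 r20 H2] := gx_near S Ga f0.
have [r3 r30 H3] := gx_near S Gb f0.
have k0 : 0 < r / (4 * K) by rewrite divr_gt0 ?mulr_gt0.
have [s [s0 ss1 ss2 ss3 ss4]] := min4 r10 r20 r30 k0.
have [q [q0 qs qr q1]] := min3 s0 r0 ltr01.
exists q; first exact: q0.
move=> x' t' x'x t't.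
have x's := lt_le_trans x'x qs; have t's := lt_le_trans t't qs.
have zz (m : M) s' : 0 < s' -> `|m - m| < s' by rewrite subrr normr0.
have h1 := (H1 _ (norm_pt_lt (lt_le_trans x's ss1) (zz a _ r10))).2.
have h2 := H2 _ _ (lt_le_trans x's ss2) (zz a _ r20).
have h3 := H3 _ _ (lt_le_trans x's ss3) (zz b _ r30).
have h4 : `|t' - t| * `|gx g x b - gx g x a| <= r / 4.
  apply: (@le_trans _ _ (r / (4 * K) * K)).
    apply: ler_pM => //; first by apply: ltW; exact: lt_le_trans t's ss4.
    by rewrite /K lerDl.
  by rewrite le_eqVlt; apply/orP; left; apply/eqP; field; rewrite gt_eqF.
apply: Hr.
- exact: lt_le_trans x'x qr.
- by rewrite gu; apply: lt_trans h1 _; exact: eighth_lt.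
- rewrite gp; apply: le_lt_trans (segpt_dist _ _ _ _ t01 _) _.
    by apply: ltW; exact: lt_le_trans t't q1.
  exact: sum3_lt h2 h3 h4 r0.
Qed.

Local Opaque mth.

(** For fixed x the family keeps g(x, .) constant and moves g_x with constant velocity [Dp]. In
    [first_order] this means al = 0 and pi = s Dp. *)
Lemma theta_variation x t c0 w : admissible x t -> 0 <= t <= 1 ->
  (forall k : M, d1 g (pt x1 (mth x t)) (inm k) =
    c0 * d1 g (pt x (mth x t)) (inm k) + dotp w (tx g (pt x (mth x t)) k)) ->
  forall e : R, 0 < e -> exists2 r : R, 0 < r & forall s : R, `|s| < r ->
   `|g (pt x1 (mth x (t + s))) - g (pt x1 (mth x t)) - s * dotp w (Dp x)| <= e * `|s|.
Proof.
move=> H t01 wE e e0; have [Gm gu gp] := mthP H; have [Ga Gb _ G1] := H.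
pose K := `|Dp x| + 1.
have K0 : 0 < K by rewrite /K ltr_wpDl.
have eK0 : 0 < e / K by rewrite divr_gt0.
have [r1 r10 H1] := first_order S Gm G1 wE eK0.
have [r2 r20 H2] := mth_near H t01 r10.
exists r2; first exact: r20.
move=> s sr.
have zx s' : 0 < s' -> `|x - x| < s' by rewrite subrr normr0.
have ts : `|t + s - t| < r2 by rewrite addrC addKr.
have [U' m'm] := H2 x (t + s) (zx _ r20) ts.
have [Gm' gu' gp'] := mthU U'.
have alE : 0 = g (pt x (mth x (t + s))) - g (pt x (mth x t)) -
    dotp (gx g x (mth x t)) (x - x).
  by rewrite subrr dotp0r gu gu' !subrr.
have piE : s *: Dp x = gx g x (mth x (t + s)) - gx g x (mth x t) -
    hx g (pt x (mth x t)) (x - x).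
  have h0 : hx g (pt x (mth x t)) (x - x) = 0 by rewrite subrr; exact: hx0.
  rewrite h0 subr0; transitivity (pth x (t + s) - pth x t).
    have tE : t + s - t = s by rewrite addrC addKr.
    by rewrite /pth segptB tE.
  exact: sub_eq gp' gp.
have := H1 x (mth x (t + s)) 0 (s *: Dp x) (zx _ r10) m'm alE piE.
rewrite mulr0 add0r dotpZr => /le_trans; apply.
rewrite subrr normrZ; have -> : `|0 : E| = 0 by exact: normr0.
have -> : `|0 : R| = 0 by exact: normr0.
apply: theta_real => //; first exact: ltW.
by rewrite /K lerDl.
Qed.

Lemma MxZ x t (s r : R) (u v : E) : admissible x t ->
  Mx x t (s *: u + r *: v) = s *: Mx x t u + r *: Mx x t v.
Proof.
move=> H; have [Gm _ _] := mthP H; have [Ga Gb _ _] := H.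
have hZ P (c : R) (z : E) : Gam P -> hx g P (c *: z) = c *: hx g P z.
  by move=> GP; have := hxD S c z 0 GP; rewrite hx0 // !addr0.
rewrite /Mx !(hxD S) // !hZ //.
move: (hx g (pt x a) u) (hx g (pt x a) v) (hx g (pt x b) u) (hx g (pt x b) v).
move: (hx g (pt x (mth x t)) u) (hx g (pt x (mth x t)) v) => A B C' D F G.
by apply/rowP => i; rewrite !mxE; ring.
Qed.

(** Moving x inside the level set of g(., b) - g(., a) keeps both ends. The slope [pth] then moves
    with the interpolated Hessians of the ends, while moving x at fixed m would move g_x with the
    Hessian at [mth]; the discrepancy is [Mx]. So pi is s Mx xi up to o(s), and al is o(s). *)
Lemma x_variation x t c0 w xi : admissible x t -> 0 <= t <= 1 ->
  g (pt x a) = g (pt x b) -> Dp x != 0 -> dotp xi (Dp x) = 0 ->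
  (forall k : M, d1 g (pt x1 (mth x t)) (inm k) =
    c0 * d1 g (pt x (mth x t)) (inm k) + dotp w (tx g (pt x (mth x t)) k)) ->
  forall e : R, 0 < e -> exists2 s0 : R, 0 < s0 & forall s : R, 0 < s -> s < s0 ->
  exists x' : E, [/\ g (pt x' a) = g (pt x' b), `|x' - x - s *: xi| <= e * s &
    s * dotp w (Mx x t xi) - e * s <=
    g (pt x1 (mth x' t)) - g (pt x1 (mth x t))].
Proof.
move=> H /andP[t0 t1] ab D0 xiD wE e e0; have [Gm gu gp] := mthP H.
have t01 : 0 <= t <= 1 by rewrite t0.
have [Ga Gb _ G1] := H.
have [D DE] := named (Dp x); rewrite -DE in D0 xiD.
have [nD nDE] := named `|D|; have nD0 : 0 <= nD by rewrite nDE.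
have [L LE] := named (`|xi| + nD + 1).
have [DD DDE] := named (dotp D D); have DD0 : 0 <= DD by rewrite DDE dotp_ge0.
have [MD MDE] := named `|Mx x t D|; have MD0 : 0 <= MD by rewrite MDE.
have [Mxi MxiE] := named `|Mx x t xi|; have Mxi0 : 0 <= Mxi by rewrite MxiE.
have [N NE] := named (n.+1%:R ^+ 2 * `|w|).
have N0 : 0 <= N by rewrite NE mulr_ge0 // exprn_ge0.
have L0 : 0 < L by rewrite LE ltr_wpDl // addr_ge0.
have LD0 : 0 <= L + DD by apply: addr_ge0 => //; exact: ltW.
have LM0 : 0 <= L + MD by apply: addr_ge0 => //; exact: ltW.
have [K KE] := named (`|c0| * (L + DD) + N * (L + MD) +
  (L + (L + DD) + (Mxi + L + MD)) + nD + 1).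
have [K1 K0] := x_var_const L0 DD0 MD0 Mxi0 N0 nD0 KE.
have eK : 0 < e / K by exact: divr_gt0.
have [e1 [e10 e11 e1K]] := min2 ltr01 eK.
have [r1 r10 H1] := first_order S Gm G1 wE e10.
have [r2 r20 H2] := mth_near H t01 r10.
have [r3 r30 H3] := strictx S Ga e10.
have [r4 r40 H4] := strictx S Gb e10.
have D0' : gx g x b - gx g x a != 0 by rewrite -/(Dp x) -DE.
have xiD' : dotp xi (gx g x b - gx g x a) = 0 by rewrite -/(Dp x) -DE.
have [s1 s10 H5] := level_curve S Ga Gb ab D0' xiD' e10.
have [r [r0 rr1 rr2 rr3 rr4]] := min4 r10 r20 r30 r40.
have rL0 : 0 < r / L by exact: divr_gt0.
have [s2 [s20 ss1 ss2]] := min2 s10 rL0.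
exists s2; first exact: s20.
move=> s s0 ss.
have [tau taue /= ab'] := H5 s s0 (lt_le_trans ss ss1).
rewrite -/(Dp x) -DE in ab'.
have [x' x'E] := named (x + s *: xi + tau *: D); rewrite -x'E in ab'.
have dxE : x' - x = s *: xi + tau *: D.
  by rewrite x'E -(addrA x) [x + _]addrC addrK.
have dxn : `|x' - x| <= s * L.
  rewrite LE; apply: (dx_real s0 nD0 e11 _ taue).
  rewrite dxE nDE; apply: le_trans (ler_normD _ _) _.
  by rewrite !normrZ (gtr0_norm s0).
have xr : `|x' - x| < r.
  apply: le_lt_trans dxn _; have := lt_le_trans ss ss2.
  by rewrite (ltr_pdivlMr _ _ L0).
have tt s' : 0 < s' -> `|t - t| < s' by rewrite subrr normr0.
have [U' m'm] := H2 x' t (lt_le_trans xr rr2) (tt _ r20).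
have [Gm' gu' gp'] := mthU U'.
have [Ga' A1 A2] := H3 _ (lt_le_trans xr rr3).
have [Gb' B1 B2] := H4 _ (lt_le_trans xr rr4).
have [al alE] := named (g (pt x' a) - g (pt x a) - dotp (pth x t) (x' - x)).
have [pi piE] := named (pth x' t - pth x t - hx g (pt x (mth x t)) (x' - x)).
have K2 := H1 x' (mth x' t) al pi (lt_le_trans xr rr1) m'm.
have alE' : al = g (pt x' (mth x' t)) - g (pt x (mth x t)) -
    dotp (gx g x (mth x t)) (x' - x).
  by apply: etrans alE _; exact: sub_dotp_eq gu' gu gp.
have piE' : pi = gx g x' (mth x' t) - gx g x (mth x t) -
    hx g (pt x (mth x t)) (x' - x).
  by apply: etrans piE _; exact: sub_sub_eq gp' gp.
have {}K2 := K2 alE' piE'.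
have dD : dotp D (x' - x) = tau * DD.
  by rewrite dxE dotpDDr !dotpZr (dotpC D xi) xiD mulr0 add0r DDE.
(* [pth] differs from the slope of a by t D, and D applied to the displacement gives only tau |D|^2,
   where |tau| is at most e1 s. *)
have alb : `|al| <= e1 * s * (L + DD).
  apply: (al_real DD0 (ltW e10) t0 t1 (normr_ge0 tau) _ A1 dxn taue).
  have -> : al = (g (pt x' a) - g (pt x a) - dotp (gx g x a) (x' - x)) - t * (tau * DD).
    rewrite alE /pth segptE dotpDDl dotpZl -/(Dp x) -DE dD.
    exact: opp_assoc.
  apply: le_trans (ler_normB _ _) _; rewrite lerD2l.
  by rewrite !normrM (ger0_norm DD0) (ger0_norm t0).
have pib : `|pi - s *: Mx x t xi| <= e1 * s * (L + MD).
  apply: (pi_real MD0 (ltW e10) t0 t1 _ A2 B2 dxn taue).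
  have -> : pi - s *: Mx x t xi =
     (1 - t) *: (gx g x' a - gx g x a - hx g (pt x a) (x' - x)) +
     t *: (gx g x' b - gx g x b - hx g (pt x b) (x' - x)) + tau *: Mx x t D.
    have Mdx : Mx x t (x' - x) = s *: Mx x t xi + tau *: Mx x t D.
      by rewrite dxE; exact: MxZ.
    have -> : tau *: Mx x t D = Mx x t (x' - x) - s *: Mx x t xi.
      by rewrite Mdx addrC addKr.
    move: (s *: Mx x t xi) => h5.
    rewrite piE /pth /Mx.
    move: (gx g x' a) (gx g x a) (gx g x' b) (gx g x b) => p1 p2 p3 p4.
    move: (hx g (pt x a) (x' - x)) (hx g (pt x b) (x' - x)) => h1 h2.
    move: (hx g (pt x (mth x t)) (x' - x)) => h3.
    by apply/rowP => i; rewrite !mxE; ring.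
  by rewrite MDE; exact: norm_comb3.
have pin : `|pi| <= s * (Mxi + L + MD).
  have h1 : `|pi| <= `|pi - s *: Mx x t xi| + s * Mxi.
    have -> : s * Mxi = `|s *: Mx x t xi| by rewrite normrZ (gtr0_norm s0) MxiE.
    by rewrite -{1}(subrK (s *: Mx x t xi) pi) ler_normD.
  have h2 := le_trans pib (scale_real e11 (ltW s0) LM0).
  exact: pin_real h1 h2.
have aln := le_trans alb (scale_real e11 (ltW s0) LD0).
have dpi : `|dotp w pi - s * dotp w (Mx x t xi)| <= N * (e1 * s * (L + MD)).
  rewrite -dotpZr -dotpBr; apply: le_trans (norm_dotp _ _) _; rewrite mulrA -NE.
  exact: ler_wpM2l.
have c0al : `|c0 * al| <= `|c0| * (e1 * s * (L + DD)).
  by rewrite normrM; apply: ler_wpM2l.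
have KEs : e1 * s * K <= e * s.
  rewrite mulrAC; apply: ler_wpM2r; first exact: ltW.
  by rewrite -ler_pdivlMr.
exists x'; split=> //.
- have -> : x' - x - s *: xi = tau *: D by rewrite dxE addrC addKr.
  rewrite normrZ -nDE; apply: le_trans KEs.
  apply: (@le_trans _ _ (e1 * s * nD)); first exact: ler_wpM2r.
  by apply: ler_wpM2l => //; apply: mulr_ge0; exact: ltW.
- exact: (x_var_real (ltW e10) (ltW s0) nD0 KE K2 dpi c0al dxn aln pin KEs).
Qed.

End Family.
End Max_principle_core.

Section Reals.
Context {R : realFieldType}.

Lemma quarter (t : R) : t * (1 - t) <= 4^-1.
Proof. by have := sqr_ge0 (t - 2^-1); nra. Qed.

Lemma slope_le (q t : R) : 0 <= q -> 0 <= t -> t <= 1 ->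
  `|2 * q * (1 - 2 * t)| <= 2 * q.
Proof.
move=> q0 t0 t1; rewrite normrM ger0_norm ?mulr_ge0 //.
by apply: ler_piMr; [exact: mulr_ge0|rewrite ler_norml; apply/andP; split; lra].
Qed.

Lemma range_le (s t : R) : `|s| < t -> `|s| < 1 - t -> 0 <= t + s <= 1.
Proof.
by rewrite !ltr_norml => /andP[h1 h2] /andP[h3 h4]; apply/andP; split; lra.
Qed.

Lemma half_lt (s s1 : R) : 0 < s -> s <= s1 / 2 -> s < s1.
Proof. lra. Qed.

Lemma quarter_half (s : R) : s <= 2^-1 / 2 -> s <= 2^-1.
Proof. lra. Qed.

Lemma le_sub_add (e a b c : R) : - e <= a - b -> a <= c -> b <= c + e.
Proof. lra. Qed.

Lemma theta_slope (e r c f wD s g0 g1 P0 P1 : R) : 0 <= c ->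
  10 * c * r <= e / 2 -> `|s| < r ->
  P0 + f * s - 10 * s ^+ 2 <= P1 ->
  `|g1 - g0 - s * wD| <= e / 2 * `|s| -> g1 + c * P1 <= g0 + c * P0 ->
  s * (wD + c * f) <= e * `|s|.
Proof.
move=> c0 cr sr h1; rewrite ler_norml => /andP[h2 _] h3.
have h4 : c * (P0 + f * s - 10 * s ^+ 2) <= c * P1 by apply: ler_wpM2l.
have h5 : 10 * c * s ^+ 2 <= e / 2 * `|s|.
  rewrite -real_normK ?num_real // expr2 mulrA; apply: ler_wpM2r => //.
  apply: le_trans cr; apply: ler_wpM2l; first exact: mulr_ge0.
  exact: ltW.
lra.
Qed.

Lemma x_slope (e e1 s wM A Xd Z g0 g1 d d' : R) : 0 < s -> 0 <= A ->
  d - d' <= 2 * s * Xd + Z * e1 * s ->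
  s * wM - e1 * s <= g1 - g0 -> g1 + A * d' <= g0 + A * d ->
  e1 * (1 + A * Z) <= e ->
  s * (wM - 2 * A * Xd) <= e * s.
Proof.
move=> s0 A0 h1 h2 h3 h4.
have h5 : A * (d - d') <= A * (2 * s * Xd + Z * e1 * s) by apply: ler_wpM2l.
have h6 : s * (e1 * (1 + A * Z)) <= s * e by rewrite ler_pM2l.
lra.
Qed.

Lemma step_real (d s X u a b : R) : 0 < d -> 0 < s -> s <= 2^-1 ->
  u <= 8^-1 * d -> `|a| <= d * (u * s) -> 3 / 4 * d ^+ 2 <= X ->
  0 <= b -> b <= s * (5 / 4 * d) + u * s ->
  0 <= 2 * s * X - 2 * a - b ^+ 2.
Proof.
move=> d0 s0 s1 u0; rewrite ler_norml => /andP[_ h1] h2 b0 h3.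
have h4 : b <= s * (11 / 8 * d).
  have : u * s <= 8^-1 * d * s by rewrite ler_pM2r.
  lra.
have h5 : b ^+ 2 <= (s * (11 / 8 * d)) ^+ 2.
  by rewrite ler_sqr ?nnegrE // !mulr_ge0 // ltW.
have h6 : s * (3 / 4 * d ^+ 2) <= s * X by rewrite ler_pM2l.
have h7 : d * (u * s) <= d * (8^-1 * d * s) by rewrite ler_pM2l // ler_pM2r.
have e7 : d * (8^-1 * d * s) = 8^-1 * (s * d ^+ 2) by ring.
have e8 : (s * (11 / 8 * d)) ^+ 2 = 121 / 64 * s * (s * d ^+ 2) by field.
have h9 : s * (s * d ^+ 2) <= 2^-1 * (s * d ^+ 2).
  by rewrite ler_wpM2r // mulr_ge0 ?sqr_ge0 // ltW.
have h10 : 0 <= s * d ^+ 2 by rewrite mulr_ge0 ?sqr_ge0 // ltW.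
rewrite e8 in h5; rewrite e7 in h7; lra.
Qed.

Lemma sqr2_le (d x : R) : 0 <= d -> `|x - d ^+ 2| <= 4^-1 * d * d ->
  3 / 4 * d ^+ 2 <= x /\ x <= 5 / 4 * d ^+ 2.
Proof. by move=> d0; rewrite ler_norml => /andP[h1 h2]; split; lra. Qed.

Lemma weight_le (kap lam d q f D : R) : 0 < kap -> 0 < lam -> lam <= D -> 0 < d ->
  kap * lam * d <= 4^-1 -> 0 <= q -> q <= 4^-1 -> `|f| <= 2 * q ->
  `|- (kap * lam ^+ 2 * d ^+ 2 * f)| <= 8^-1 * d * D.
Proof.
move=> k0 l0 lD d0 h1 q0 q1 h2.
have A0 : 0 <= kap * lam ^+ 2 * d ^+ 2 by rewrite !mulr_ge0 ?sqr_ge0 // ltW.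
rewrite normrN normrM ger0_norm //.
have ld0 : 0 < lam * d by rewrite mulr_gt0.
have h3 : kap * lam ^+ 2 * d ^+ 2 <= 4^-1 * (lam * d).
  have -> : kap * lam ^+ 2 * d ^+ 2 = kap * lam * d * (lam * d) by ring.
  by rewrite ler_pM2r.
have h4 : `|f| <= 2^-1 by lra.
have h5 : kap * lam ^+ 2 * d ^+ 2 * `|f| <= 4^-1 * (lam * d) * 2^-1.
  by apply: ler_pM.
have h6 : lam * d <= D * d by rewrite ler_pM2r.
lra.
Qed.

End Reals.

Section Geometry.
Context {R : realType} {n : nat}.
Local Notation E := 'rV[R]_n.

(** xi is the projection of w onto the orthogonal complement of D. Both w - v and the removed
    component have length at most d/8, so xi stays within d/4 of v; hence the factors 3/4 and
    5/4. *)
Lemma xi_geometry (w v D : E) (d : R) : enorm v = d -> 0 < d -> D != 0 ->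
  enorm (w - v) <= 8^-1 * d -> `|dotp w D| <= 8^-1 * d * enorm D ->
  let xi := w - (dotp w D / enorm D ^+ 2) *: D in
  [/\ dotp xi D = 0, 3 / 4 * d <= enorm xi, enorm xi <= 5 / 4 * d &
      3 / 4 * d ^+ 2 <= dotp xi v /\ dotp xi v <= 5 / 4 * d ^+ 2].
Proof.
move=> vd d0 D0 wv wD xi.
have eD : 0 < enorm D by exact: enorm_gt0.
have xiv : enorm (xi - v) <= 4^-1 * d.
  have -> : xi - v = (w - v) + (- (dotp w D / enorm D ^+ 2)) *: D.
    by rewrite /xi scaleNr addrAC.
  apply: le_trans (enormD _ _) _; rewrite enormZ.
  have h : `|- (dotp w D / enorm D ^+ 2)| * enorm D <= 8^-1 * d.
    rewrite normrN normrM normfV [`|enorm D ^+ 2|]ger0_norm ?sqr_ge0 //.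
    have -> : `|dotp w D| / enorm D ^+ 2 * enorm D = `|dotp w D| / enorm D.
      by field; rewrite gt_eqF.
    by rewrite ler_pdivrMr.
  by apply: le_trans (lerD wv h) _; lra.
have h1 : enorm xi <= enorm (xi - v) + d.
  by rewrite -{1}(subrK v xi) -vd enormD.
have h2 : d <= enorm (xi - v) + enorm xi.
  by rewrite -{1}vd -{1}(subKr xi v) addrC -(enormN (xi - v)); exact: enormD.
split; [|lra..|].
  by rewrite dotpBl dotpZl -enorm_sqr mulfVK ?subrr // expf_eq0 /= gt_eqF.
apply: sqr2_le; first exact: ltW.
rewrite -vd enorm_sqr -dotpBl.
apply: le_trans (cauchy_schwarz _ _) _; rewrite vd.
by apply: ler_wpM2r => //; exact: ltW.
Qed.

(** v points from the base point to the target x1. The first conclusion keeps the moved base point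
    in the ball where all data are defined; the second bounds the weight lost by the move. *)
Lemma step_geometry (v xi eta : E) (d s u : R) : enorm v = d -> 0 < d ->
  enorm xi <= 5 / 4 * d -> 3 / 4 * d ^+ 2 <= dotp xi v -> 0 < s ->
  s <= 2^-1 -> u <= 8^-1 * d -> enorm eta <= u * s ->
  let d' := enorm (s *: xi + eta - v) in
  d' <= d /\ d ^+ 2 - d' ^+ 2 <= 2 * s * dotp xi v + 2 * d * u * s.
Proof.
move=> vd d0 X1 X2 s0 s1 u1 etan d'.
have cs : `|- dotp eta v| <= d * (u * s).
  rewrite normrN; apply: le_trans (cauchy_schwarz _ _) _; rewrite vd mulrC.
  by apply: ler_wpM2l => //; exact: ltW.
have bE : enorm (s *: xi + eta) <= s * (5 / 4 * d) + u * s.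
  apply: le_trans (enormD _ _) _; rewrite enormZ gtr0_norm //.
  by apply: lerD => //; rewrite ler_pM2l.
have dd : d ^+ 2 - d' ^+ 2 = 2 * s * dotp xi v - 2 * (- dotp eta v) -
    enorm (s *: xi + eta) ^+ 2.
  rewrite /d' -{1}vd !enorm_sqr.
  have [z zE] := named (s *: xi + eta).
  have -> : 2 * s * dotp xi v = 2 * (dotp z v - dotp eta v).
    by rewrite zE dotpDl addrK mulrA.
  by rewrite -zE !dotpBl !dotpBr (dotpC v z); ring.
split.
  have := step_real d0 s0 s1 u1 cs X2 (enorm_ge0 _) bE; rewrite -dd subr_ge0.
  by rewrite ler_sqr ?nnegrE ?enorm_ge0 // ltW.
have h0 : 0 <= enorm (s *: xi + eta) ^+ 2 by exact: sqr_ge0.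
move: cs; rewrite ler_norml => /andP[cs _]; lra.
Qed.

Lemma dotp_split (w D z : E) (c : R) : 
  dotp w z = dotp z (w - c *: D) + c * dotp z D.
Proof. by rewrite dotpBr dotpZr subrK dotpC. Qed.

End Geometry.

Lemma closure_near (R : realType) (V : normedModType R) (A : set V) (p : V) :
  closure A p -> forall r : R, 0 < r -> exists2 q, A q & `|q - p| < r.
Proof.
move=> Ap r r0; have := Ap (ball p r) (nbhsx_ballx _ _ r0).
move=> [q [Aq]]; rewrite -ball_normE /= distrC => h; by exists q.
Qed.

(** * Maximization of the excess over base points and parameters *)

Section Core.
Context {R : realType} {n : nat}.
Local Notation E := 'rV[R]_n.
Local Notation W := (E * E * R)%type.
Local Notation M := (E * R)%type.
Variables (Gam : set W) (g : W -> R).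
Hypothesis S : generating_system Gam g.
Variables (a b : M) (x1 : E) (rho : R).
Hypothesis rho0 : 0 < rho.
Hypothesis HGa : forall x : E, enorm (x - x1) <= rho -> Gam (pt x a).
Hypothesis HGb : forall x : E, enorm (x - x1) <= rho -> Gam (pt x b).

Definition sigma_set : set (E * R)%type :=
  [set X | [/\ enorm (X.1 - x1) <= rho, g (pt X.1 a) = g (pt X.1 b) & 0 <= X.2 <= 1]].

Lemma sigma_compact : compact sigma_set.
Proof.
have K : compact [set X : (E * R)%type | `|X - (x1, 0)| <= rho + 1].
  apply: proper_M; exact: addr_gt0.
apply: (subclosed_compact _ K); last first.
  move=> -[x t] [/= h1 _ /andP[t0 t1]].
  rewrite /= prod_normE /= ge_max subr0 (ger0_norm t0); apply/andP; split.
    apply: le_trans (norm_le_enorm _) _; apply: le_trans h1 _; by rewrite lerDl.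
  by apply: le_trans t1 _; rewrite lerDr ltW.
move=> -[x t] cl.
have near (r : R) : 0 < r -> exists X : E * R, [/\ sigma_set X, `|X.1 - x| < r & `|X.2 - t| < r].
  move=> r0; have [X sX] := closure_near cl r0.
  by rewrite prod_normE /= gt_max => /andP[h1 h2]; exists X.
have h1 : enorm (x - x1) <= rho.
  apply/ler_addgt0Pr => e e0.
  have r0 : 0 < e / n.+1%:R :> R by exact: divr_gt0.
  have [X [[h1 _ _] h2 _]] := near _ r0.
  have -> : x - x1 = (X.1 - x1) + (x - X.1) by rewrite [RHS]addrC addrA subrK.
  apply: le_trans (enormD _ _) _; apply: lerD; first exact: h1.
  apply: le_trans (enorm_le_norm _) _; rewrite distrC mulrC -ler_pdivlMr //.
  exact: ltW.
split; rewrite /=; first exact: h1.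
  apply/eqP; rewrite -subr_eq0 -normr_le0; apply/ler_addgt0Pr => e e0; rewrite add0r.
  have f0 : 0 < e / 2 by exact: divr_gt0.
  have [r1 r10 H1] := g_near S (HGa h1) f0.
  have [r2 r20 H2] := g_near S (HGb h1) f0.
  have [r [r0 rr1 rr2]] := min2 r10 r20.
  have [X [[_ h2 _] h3 _]] := near _ r0.
  have zz (m : M) s : 0 < s -> `|m - m| < s by rewrite subrr normr0.
  have [_ k1] := H1 _ (norm_pt_lt (lt_le_trans h3 rr1) (zz a _ r10)).
  have [_ k2] := H2 _ (norm_pt_lt (lt_le_trans h3 rr2) (zz b _ r20)).
  rewrite h2 in k1.
  move: k1 k2 => {h2 H1 H2}.
  move: (g (pt x a)) (g (pt x b)) (g (pt X.1 b)) => A B C k1 k2.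
  have -> : A - B = (C - B) - (C - A) by ring.
  apply: le_trans (ler_normB _ _) _; rewrite (splitr e); apply: lerD; exact: ltW.
apply/andP; split; apply/ler_addgt0Pr => e e0.
  have [X [[_ _ /andP[k1 _]] _]] := near _ e0; rewrite ltr_norml => /andP[_ k2].
  by apply: le_trans k1 _; rewrite addrC -lerBlDr ltW.
have [X [[_ _ /andP[_ k1]] _]] := near _ e0; rewrite ltr_norml => /andP[k2 _].
by apply: (le_sub_add _ k1); exact: ltW.
Qed.

Variables (kap del lam C : R).
Hypothesis del0 : 0 < del.
Hypothesis kapE : kap = del / 8.
Hypothesis lam0 : 0 < lam.
Hypothesis C0 : 0 <= C.
Hypothesis Crho : C * rho <= 1.
Hypothesis klr : kap * lam * rho <= 4^-1.
Hypothesis Hadm : forall (x : E) (t : R), enorm (x - x1) <= rho ->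
  g (pt x a) = g (pt x b) -> 0 <= t <= 1 -> admissible Gam g a b x1 x t.
Hypothesis Hw : forall (x : E) (t : R), enorm (x - x1) <= rho ->
  g (pt x a) = g (pt x b) -> 0 <= t <= 1 ->
  forall (c0 : R) (w : E),
  (forall k : M, d1 g (pt x1 (mth Gam g a b x t)) (inm k) =
    c0 * d1 g (pt x (mth Gam g a b x t)) (inm k) +
    dotp w (tx g (pt x (mth Gam g a b x t)) k)) ->
  enorm (w - (x1 - x)) <= 8^-1 * enorm (x1 - x).
Hypothesis Hlam : forall x : E, enorm (x - x1) <= rho ->
  g (pt x a) = g (pt x b) -> lam <= enorm (Dp g a b x).
Hypothesis HM : forall (x : E) (t : R) (xi : E), enorm (x - x1) <= rho ->
  g (pt x a) = g (pt x b) -> 0 <= t <= 1 -> dotp xi (Dp g a b x) = 0 ->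
  del * (t * (1 - t)) * enorm (Dp g a b x) ^+ 2 * enorm xi ^+ 2 <=
    dotp (Mx Gam g a b x t xi) xi /\
  `|dotp (Mx Gam g a b x t xi) (Dp g a b x)| <=
    C * enorm (Dp g a b x) ^+ 2 * enorm xi.

Local Notation c := (kap * lam ^+ 2).
Let F (X : (E * R)%type) : R := g (pt x1 (mth Gam g a b X.1 X.2)) +
  c * (X.2 * (1 - X.2)) ^+ 2 * enorm (X.1 - x1) ^+ 2.

Lemma sigma_continuous : {within sigma_set, continuous F}.
Proof.
apply: continuous_in_subspaceT => -[x t]; rewrite inE => -[/= h1 h2 h3].
have adm := Hadm h1 h2 h3.
have c5 : {for (x, t), continuous (fun X : E * R => g (pt x1 (mth Gam g a b X.1 X.2)))}.
  apply: continuous_eps => e e0.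
  have [_ _ _ G1] := adm.
  have [r1 r10 H1] := g_near S G1 e0.
  have [r2 r20 H2] := mth_near S adm h3 r10.
  exists r2; first exact: r20.
  move=> [x' t']; rewrite prod_normE /= gt_max => /andP[h4 h5].
  have [_ k] := H2 _ _ h4 h5.
  have zz s : 0 < s -> `|x1 - x1| < s by rewrite subrr normr0.
  have [_ k'] := H1 _ (norm_pt_lt (zz _ r10) k).
  by rewrite distrC; exact: ltW.
have cs : {for (x, t), continuous (fun X : E * R => X.2)} by exact: cvg_snd.
have ce : {for (x, t), continuous (fun X : E * R => enorm (X.1 - x1))}.
  apply: continuous_eps => e e0.
  exists (e / n.+1%:R); first exact: divr_gt0.
  move=> [x' t']; rewrite prod_normE /= gt_max => /andP[h4 _].
  apply: le_trans (enorm_dist _ _) _.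
  have -> : x - x1 - (x' - x1) = x - x' by rewrite opprB addrA subrK.
  by rewrite mulrC -ler_pdivlMr // distrC; exact: ltW.
have c1 : {for (x, t), continuous (fun X : E * R => 1 - X.2)}.
  by apply: continuousB => //; exact: cvg_cst.
have c2 : {for (x, t), continuous (fun X : E * R => X.2 * (1 - X.2))}.
  exact: continuousM.
have c3 : {for (x, t), continuous (fun X : E * R => (X.2 * (1 - X.2)) ^+ 2)}.
  exact: continuousM.
have c4 : {for (x, t), continuous (fun X : E * R => enorm (X.1 - x1) ^+ 2)}.
  exact: continuousM.
have c6 : {for (x, t), continuous (fun X : E * R => c * (X.2 * (1 - X.2)) ^+ 2)}.
  by apply: continuousM => //; exact: cvg_cst.
have c7 := continuousM c6 c4.
exact: (continuousD c5 c7).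
Qed.

(** On the faces t = 0, t = 1 and x = x1 the weight vanishes and the excess is g(x1, a) or g(x1, b).
    Anywhere else a maximum gives an equation in t and an inequality in x, which
    [max_point_contradiction] refutes. [lam] bounds |Dp| from below on the whole set and enters the
    weight squared, so that the weight scales in |Dp| like the A3s term. *)
Lemma max_principle_core (x0 : E) (t0 : R) : enorm (x0 - x1) <= rho ->
  g (pt x0 a) = g (pt x0 b) -> 0 <= t0 <= 1 ->
  g (pt x1 (mth Gam g a b x0 t0)) +
    c * (t0 * (1 - t0)) ^+ 2 * enorm (x0 - x1) ^+ 2 <=
  Num.max (g (pt x1 a)) (g (pt x1 b)).
Proof.
move=> x0r x0ab t01.
have [|[x t]] := compact_EVT_max _ sigma_compact sigma_continuous.
  by exists (x0, t0).
rewrite inE => -[/= xr xab t01'] Fmax.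
have kap0 : 0 < kap by rewrite kapE divr_gt0.
have c0 : 0 < c by rewrite mulr_gt0 // exprn_gt0.
apply: (@le_trans _ _ (F (x, t))).
  by apply: (Fmax (x0, t0)); rewrite inE.
have adm := Hadm xr xab t01'.
have [Ga Gb U G1] := adm.
have [-> | tn0] := eqVneq t 0.
  rewrite /F /= mul0r expr0n mulr0 mul0r addr0 (mth0 S b Ga).
  by rewrite le_max lexx.
have [-> | tn1] := eqVneq t 1.
  rewrite /F /= subrr mulr0 expr0n mulr0 mul0r addr0 (mth1 S Gb xab).
  by rewrite le_max lexx orbT.
have [xx1 | xn] := eqVneq x x1.
  have [_ gu _] := mthP adm; rewrite xx1 in gu.
  by rewrite /F /= xx1 subrr enorm0 expr0n mulr0 addr0 gu le_max lexx.
exfalso.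
have [t0' t1'] := andP t01'.
have tp : 0 < t by rewrite lt_neqAle eq_sym tn0.
have tp1 : 0 < 1 - t by rewrite subr_gt0 lt_neqAle tn1.
have [v vE] := named (x1 - x).
have [d dE] := named (enorm v).
have d0 : 0 < d by rewrite dE; apply: enorm_gt0; rewrite vE subr_eq0 eq_sym.
have dx : enorm (x - x1) = d by rewrite enormB -vE.
have dr : d <= rho by rewrite -dx.
have [q qE] := named (t * (1 - t)).
have q0 : 0 < q by rewrite qE mulr_gt0.
have q1 : q <= 4^-1 by rewrite qE; exact: quarter.
have [D DE] := named (Dp g a b x).
have lD : lam <= enorm D by rewrite DE; exact: Hlam.
have eD0 : 0 < enorm D := lt_le_trans lam0 lD.
have D0 : D != 0 by apply: contraTneq eD0 => ->; rewrite enorm0 ltxx.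
have [f fE] := named (2 * q * (1 - 2 * t)).
have fq : `|f| <= 2 * q by rewrite fE; apply: slope_le => //; exact: ltW.
have Gm : Gam (pt x (mth Gam g a b x t)) by case: (mthP adm).
have [c1 [w wE]] := dual_form S Gm G1.
have wv : enorm (w - v) <= 8^-1 * d by rewrite dE vE; exact: Hw xr xab t01' c1 w wE.
have [m mE] := named (g (pt x1 (mth Gam g a b x t))).
have Fm x' t' : sigma_set (x', t') -> g (pt x1 (mth Gam g a b x' t')) +
    c * (t' * (1 - t')) ^+ 2 * enorm (x' - x1) ^+ 2 <= m + c * q ^+ 2 * d ^+ 2.
  by move=> s'; rewrite mE qE -dx; apply: (Fmax (x', t')); rewrite inE.
(* t is interior, so both signs of s are allowed and the t-derivative of the excess vanishes: w is
   orthogonal to D up to the derivative of the weight. *)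
have Tw : dotp w D = - (c * d ^+ 2 * f).
  apply/eqP; rewrite -subr_eq0 opprK; apply/eqP; apply: small_slope => e e0.
  have e20 : 0 < e / 2 by exact: divr_gt0.
  have [r1 r10 H1] := theta_variation S adm t01' wE e20.
  have k0 : 0 < e / 2 / (10 * (c * d ^+ 2)).
    by apply: divr_gt0 => //; rewrite !mulr_gt0 // exprn_gt0.
  have [r [r0 rr1 rr2 rr3]] := min3 r10 k0 tp.
  have [r' [r'0 rr rr4]] := min2 r0 tp1.
  exists r'; first exact: r'0.
  move=> s sr.
  have sr1 := lt_le_trans sr rr.
  have := H1 s (lt_le_trans sr1 rr1); rewrite -mE -DE => h1.
  have st : 0 <= t + s <= 1.
    exact: range_le (lt_le_trans sr1 rr3) (lt_le_trans sr rr4).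
  have s1 : `|s| <= 1 by apply: ltW; apply: lt_le_trans (lt_le_trans sr1 rr3) _.
  have h2 := weight_expansion t01' s1; rewrite -qE -fE in h2.
  have h3 : g (pt x1 (mth Gam g a b x (t + s))) +
     c * d ^+ 2 * ((t + s) * (1 - (t + s))) ^+ 2 <= m + c * d ^+ 2 * q ^+ 2.
    rewrite (mulrAC c) [c * _ * q ^+ 2]mulrAC -{1}dx; apply: Fm.
    by split.
  have cd0 : 0 <= c * d ^+ 2 by apply: mulr_ge0; [exact: ltW|exact: sqr_ge0].
  have cr : 10 * (c * d ^+ 2) * r' <= e / 2.
    have k1 : 0 < 10 * (c * d ^+ 2) by rewrite !mulr_gt0 // exprn_gt0.
    by rewrite mulrC -ler_pdivlMr //; exact: le_trans rr rr2.
  exact: (theta_slope cd0 cr sr h2 h1 h3).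
have klr' : kap * lam * d <= 4^-1.
  apply: le_trans klr; apply: ler_wpM2l => //; apply: mulr_ge0; exact: ltW.
have wD : `|dotp w D| <= 8^-1 * d * enorm D.
  by rewrite Tw; exact: weight_le lD d0 klr' (ltW q0) q1 fq.
have [xi xiE] := named (w - (dotp w D / enorm D ^+ 2) *: D).
have := xi_geometry (esym dE) d0 D0 wv wD; rewrite /= -xiE.
move=> [xiD X1 X2 [Y1 Y2]].
have [MM MME] := named (Mx Gam g a b x t xi).
have := HM xr xab t01' (_ : dotp xi (Dp g a b x) = 0); rewrite -DE -qE -MME.
move=> /(_ xiD)[K1 K2].
(* The base point is moved in the direction xi, with s > 0 only: at a maximum the gain in g cannot
   exceed the loss of weight. *)
have wMX : dotp w MM <= 2 * kap * lam ^+ 2 * q ^+ 2 * dotp xi v.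
  have A0 : 0 <= c * q ^+ 2 by apply: mulr_ge0; [exact: ltW|exact: sqr_ge0].
  have -> : 2 * kap * lam ^+ 2 * q ^+ 2 = 2 * (c * q ^+ 2) by ring.
  rewrite -subr_le0; apply: small_slope_le => e e0.
  have [Z ZE] := named (2 * d * n.+1%:R : R).
  have Z0 : 0 <= Z by rewrite ZE; apply: mulr_ge0 => //; apply: mulr_ge0 => //; exact: ltW.
  have Z1 : 0 < 1 + c * q ^+ 2 * Z by apply: ltr_wpDr => //; exact: mulr_ge0.
  have f1 : 0 < e / (1 + c * q ^+ 2 * Z) by exact: divr_gt0.
  have f2 : 0 < 8^-1 * d / n.+1%:R by apply: divr_gt0 => //; exact: mulr_gt0.
  have [e1 [e10 e11 e12]] := min2 f1 f2.
  have D0' : Dp g a b x != 0 by rewrite -DE.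
  have xiD' : dotp xi (Dp g a b x) = 0 by rewrite -DE.
  have [s1 s10 H1] := x_variation S adm t01' xab D0' xiD' wE e10.
  have h20 : 0 < 2^-1 / 2 :> R by exact: divr_gt0.
  have s20 : 0 < s1 / 2 by exact: divr_gt0.
  have [s [s0 ss1 ss2]] := min2 s20 h20.
  exists s; first exact: s0.
  have ss1' : s < s1 by exact: half_lt s0 ss1.
  have ss2' : s <= 2^-1 by exact: quarter_half ss2.
  have [x' [xab' xx' h1]] := H1 s s0 ss1'.
  have {}h1 : s * dotp w MM - e1 * s <= g (pt x1 (mth Gam g a b x' t)) - m.
    by rewrite MME mE; exact: h1.
  have [eta etaE] := named (x' - x - s *: xi).
  have etan : enorm eta <= n.+1%:R * e1 * s.
    rewrite etaE -mulrA; apply: le_trans (enorm_le_norm _) _.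
    exact: ler_wpM2l.
  have u1 : n.+1%:R * e1 <= 8^-1 * d by rewrite mulrC -ler_pdivlMr.
  have [] := step_geometry (esym dE) d0 X2 Y1 s0 ss2' u1 etan.
  have -> : s *: xi + eta - v = x' - x1.
    rewrite etaE vE addrC (addrC (s *: xi)) subrK opprB.
    by rewrite addrC addrA subrK.
  move=> d'd dd'.
  have Fx : g (pt x1 (mth Gam g a b x' t)) + c * q ^+ 2 * enorm (x' - x1) ^+ 2 <=
      m + c * q ^+ 2 * d ^+ 2.
    rewrite {1}qE; apply: Fm; split=> //=; exact: le_trans d'd dr.
  apply: (x_slope s0 A0 _ h1 Fx); last first.
    have : e1 * (1 + c * q ^+ 2 * Z) <= e by rewrite -ler_pdivlMr.
    apply.
  by apply: le_trans dd' _; rewrite ZE !mulrA.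
have Cd : C * d <= 1 by apply: le_trans Crho; exact: ler_wpM2l.
(* w is xi plus a multiple of D. The xi part is bounded below by A3s; the D part is the mixed term,
   where the quadratic bound in |D| is needed. *)
have wMXE : dotp w MM = dotp MM xi + dotp w D / enorm D ^+ 2 * dotp MM D.
  by rewrite xiE; exact: dotp_split.
exact: (max_point_contradiction del0 kapE lam0 lD q0 q1 d0 Cd klr' C0 fq Tw
  (enorm_ge0 xi) X1 X2 Y2 wMXE K1 K2 wMX).
Qed.

End Core.

(** * Midpoint convexity and mixed second differences *)

Section Convexity.
Context {R : realType}.

Lemma sub2_le (s : R) : 0 <= s -> s <= 1 -> `|s - 2| <= 2.
Proof. by move=> *; rewrite ler_norml; apply/andP; split; lra. Qed.

Lemma tau_ge1 (s : R) : s <= 1 -> 1 <= 2 - s.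
Proof. lra. Qed.

Lemma tau_le2 (s : R) : 0 <= s -> 2 - s <= 2.
Proof. lra. Qed.

Lemma scale_second_diff (c s x y z : R) : 0 <= c ->
  `|(1 - s) * (c * x) + s * (c * y) - c * z| = c * `|(1 - s) * x + s * y - z|.
Proof.
move=> c0; transitivity `|c * ((1 - s) * x + s * y - z)|; first by congr (`|_|); ring.
by rewrite normrM (ger0_norm c0).
Qed.

Lemma div64_le (r : R) : 0 < r -> r / 64 <= r.
Proof. lra. Qed.

Lemma convex_le (a b c t : R) : 0 <= t -> t <= 1 -> a <= c -> b <= c ->
  (1 - t) * a + t * b <= c.
Proof. by move=> *; nra. Qed.

Lemma sum64_le (a b r : R) : a <= r / 64 -> b <= r / 64 -> a + b <= r / 32.
Proof. lra. Qed.

Lemma abs_range (t T : R) : - T <= t -> t <= 1 + T -> `|t| <= 1 + T.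
Proof. by move=> *; rewrite ler_norml; apply/andP; split; lra. Qed.

Lemma radius_le (r l T : R) : l <= r / 32 -> T * l = r / 8 -> 0 <= r ->
  r / 64 + (4 * l + (1 + T) * (4 * l)) <= r.
Proof. by move=> *; lra. Qed.

Lemma second_diff_le (a b c s D L : R) :
  `|b - a - s * (D / 4)| <= 2 * L -> `|c - a - 1 * (D / 4)| <= 2 * L ->
  0 <= s -> s <= 1 -> `|(1 - s) * a + s * c - b| <= 4 * L.
Proof.
set u := b - a - _ => h1; set v := c - a - _ => h2 s0 s1.
have -> : (1 - s) * a + s * c - b = s * v - u by rewrite /u /v; ring.
apply: le_trans (ler_normB _ _) _; rewrite normrM (ger0_norm s0).
have : s * `|v| <= 1 * `|v| by apply: ler_wpM2r.
lra.
Qed.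

(** A parabola is added to f and the chord is subtracted. At an interior maximum of the sum the
    hypothesis loses k r^2 while the parabola gives back only half of it, so the maximum is attained
    at an end, where the sum vanishes. Hence one good r at each t is enough. *)
Lemma midpoint_convex (f : R -> R) (k : R) : 0 < k ->
  {within `[0, 1], continuous f} ->
  (forall t r0 : R, 0 < t -> t < 1 -> 0 < r0 -> exists r : R,
    [/\ 0 < r, r < r0, 0 <= t - r, t + r <= 1 &
      f t <= (f (t + r) + f (t - r)) / 2 - k * r ^+ 2]) ->
  forall t : R, 0 <= t <= 1 ->
  f t <= (1 - t) * f 0 + t * f 1 - k / 2 * (t * (1 - t)).
Proof.
move=> k0 fc H t t01.
pose q (s : R) := k / 2 * (s * (1 - s)) - (1 - s) * f 0 - s * f 1.
have qc : continuous q.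
  move=> s; apply: cvgB; last by apply: cvgM; [exact: cvg_id|exact: cvg_cst].
  have c1 : (fun x : R => 1 - x) @ s --> 1 - s.
    by apply: cvgB; [exact: cvg_cst|exact: cvg_id].
  apply: cvgB; last by apply: cvgM; [exact: c1|exact: cvg_cst].
  apply: cvgM; first exact: cvg_cst.
  by apply: cvgM; [exact: cvg_id|exact: c1].
pose h := f \+ q.
have hc : {within `[0, 1], continuous h}.
  by move=> s; apply: cvgD; [exact: fc|exact: (continuous_subspaceT qc)].
have [c c01 cmax] := EVT_max (ler01 : (0 : R) <= 1) hc.
have h0 : h 0 = 0 by rewrite /h /q /=; ring.
have h1 : h 1 = 0 by rewrite /h /q /=; ring.
have hle : h c <= 0.
  move: c01; rewrite in_itv /= => /andP[c0 c1].
  have [->|cn0] := eqVneq c 0; first by rewrite h0.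
  have [->|cn1] := eqVneq c 1; first by rewrite h1.
  have cp : 0 < c by rewrite lt_neqAle eq_sym cn0.
  have cp1 : c < 1 by rewrite lt_neqAle cn1.
  have [r [r0 _ r1 r2 Hr]] := H c 1 cp cp1 ltr01.
  have m1 : h (c + r) <= h c.
    by apply: cmax; rewrite in_itv /= r2 andbT addr_ge0 // ltW.
  have m2 : h (c - r) <= h c.
    by apply: cmax; rewrite in_itv /= r1 /= lerBlDr (le_trans c1) // lerDl ltW.
  have kr : 0 < k * r ^+ 2 by rewrite mulr_gt0 // exprn_gt0.
  move: m1 m2; rewrite /h /q /=; lra.
have := le_trans (cmax t _) hle; rewrite in_itv /= => /(_ t01).
rewrite /h /q /=; lra.
Qed.

(** A bounded convex function on a long interval is nearly constant on a short inner piece: its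
    increment on [0, 1] lies between slopes over the outer pieces of length T, and these are at most
    2K / T in absolute value. *)
Lemma convex_increment (F : R -> R) (K T : R) : 0 < T -> 
  (forall s t r : R, - T <= s -> s <= 1 + T -> - T <= t -> t <= 1 + T ->
     0 <= r <= 1 -> F ((1 - r) * s + r * t) <= (1 - r) * F s + r * F t) ->
  (forall t : R, - T <= t -> t <= 1 + T -> `|F t| <= K) ->
  `|F 1 - F 0| <= 2 * K / T.
Proof.
move=> T0 cF bF.
have T1 : 0 < 1 + T by rewrite addr_gt0.
have r01 : 0 <= T / (1 + T) <= 1.
  apply/andP; split; first by apply: divr_ge0; exact: ltW.
  by rewrite ler_pdivrMr // mul1r lerDr.
have e1 : 1 - T / (1 + T) = (1 + T)^-1 by field; rewrite gt_eqF.
have p1 := cF (1 + T) 0 (T / (1 + T)).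
have p2 := cF (- T) 1 (T / (1 + T)).
rewrite e1 in p1 p2.
have q1 : F 1 <= (1 + T)^-1 * F (1 + T) + T / (1 + T) * F 0.
  have -> : F 1 = F ((1 + T)^-1 * (1 + T) + T / (1 + T) * 0).
    by congr F; field; rewrite gt_eqF.
  by apply: p1 => //; lra.
have q2 : F 0 <= (1 + T)^-1 * F (- T) + T / (1 + T) * F 1.
  have -> : F 0 = F ((1 + T)^-1 * (- T) + T / (1 + T) * 1).
    by congr F; field; rewrite gt_eqF.
  by apply: p2 => //; lra.
have z1 : (1 + T) * F 1 <= F (1 + T) + T * F 0.
  have := ler_wpM2l (ltW T1) q1.
  suff -> : (1 + T) * ((1 + T)^-1 * F (1 + T) + T / (1 + T) * F 0) =
    F (1 + T) + T * F 0 by [].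
  by field; rewrite gt_eqF.
have z2 : (1 + T) * F 0 <= F (- T) + T * F 1.
  have := ler_wpM2l (ltW T1) q2.
  suff -> : (1 + T) * ((1 + T)^-1 * F (- T) + T / (1 + T) * F 1) =
    F (- T) + T * F 1 by [].
  by field; rewrite gt_eqF.
have b1 := bF (1 + T); have b2 := bF (- T); have b3 := bF 0; have b4 := bF 1.
rewrite ler_pdivlMr // -[X in _ * X <= _](gtr0_norm T0) -normrM ler_norml.
have {}b1 : `|F (1 + T)| <= K by apply: b1; lra.
have {}b2 : `|F (- T)| <= K by apply: b2; lra.
have {}b3 : `|F 0| <= K by apply: b3; lra.
have {}b4 : `|F 1| <= K by apply: b4; lra.
move: b1 b2 b3 b4; rewrite !ler_norml => /andP[? ?] /andP[? ?] /andP[? ?] /andP[? ?].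
apply/andP; split; lra.
Qed.

(* If a symmetric form (a, b; b, d) has, along each line of the plane, an almost
   constant value on the vectors orthogonal to that line, then b is almost
   affine: exactly constant values are those of rotated Killing tensors. *)
Lemma killing_form (L aO bO dO aA bA dA aB bB dB aX bX dX tau : R) :
  1 <= tau -> tau <= 2 ->
  `|(aA - aO) - 4 * (bA - bO) + 4 * (dA - dO)| <= L ->
  `|(aB - aO) + 4 * (bB - bO) + 4 * (dB - dO)| <= L ->
  `|(aX - aA) - 2 * tau * (bX - bA) + tau ^+ 2 * (dX - dA)| <= L ->
  `|(aX - aB) + 2 * tau * (bX - bB) + tau ^+ 2 * (dX - dB)| <= L ->
  `|aB - aA| <= L ->
  `|bX - bO - (2 - tau) * ((dA - dB) / 4)| <= 2 * L.
Proof.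
move=> t1 t2.
set r1 := _ + _ + _ => h1; set r2 := _ + _ + _ => h2; set r3 := _ + _ + _ => h3.
set r4 := _ + _ + _ => h4; set r5 := aB - aA => h5.
have e : 4 * tau * (bX - bO - (2 - tau) * ((dA - dB) / 4)) =
   (r4 - r3) + tau / 2 * (r2 - r1) + (1 - tau / 2) * r5.
  by rewrite /r1 /r2 /r3 /r4 /r5; field.
have k (c A B x : R) : A <= c -> c <= B -> 0 <= A -> `|x| <= L -> `|c * x| <= B * L.
  move=> Ac cB A0 xL; rewrite normrM; apply: ler_pM => //.
  by rewrite ger0_norm // (le_trans A0).
have k1 := k (tau / 2) (1 / 2) 1 r1; have k2 := k (tau / 2) (1 / 2) 1 r2.
have k5 := k (1 - tau / 2) 0 1 r5.
have {}k1 : `|tau / 2 * r1| <= 1 * L by apply: k1 => //; lra.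
have {}k2 : `|tau / 2 * r2| <= 1 * L by apply: k2 => //; lra.
have {}k5 : `|(1 - tau / 2) * r5| <= 1 * L by apply: k5 => //; lra.
have t0 : 0 < 4 * tau by lra.
have L0 : 0 <= L by exact: le_trans h5.
rewrite -(ler_pM2l t0) -{1}(gtr0_norm t0) -normrM e.
move: h3 h4 k1 k2 k5 (mulr_ge0 (ltW t0) L0).
rewrite !ler_norml => /andP[? ?] /andP[? ?] /andP[? ?] /andP[? ?] /andP[? ?] ?.
have : 4 * L <= 4 * tau * L by apply: ler_wpM2r => //; lra.
move=> ?; apply/andP; split; lra.
Qed.

End Convexity.

(** * Mixed second differences of a codimension one convex family of forms *)

Section Zygmund.
Context {R : realType} {n : nat}.
Local Notation E := 'rV[R]_n.
Variables (Phi : E -> E -> E -> R) (r B : R) (ps : E).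
Hypothesis r0 : 0 < r.
Hypothesis PhiC : forall p u v, enorm (p - ps) <= r -> Phi p u v = Phi p v u.
Hypothesis PhiD : forall p a u v w, enorm (p - ps) <= r ->
  Phi p (a *: u + v) w = a * Phi p u w + Phi p v w.
Hypothesis PhiB : forall p u, enorm (p - ps) <= r -> `|Phi p u u| <= B * enorm u ^+ 2.
Hypothesis Phi_convex : forall p0 p1 xi t, enorm (p0 - ps) <= r ->
  enorm (p1 - ps) <= r -> dotp xi (p1 - p0) = 0 -> 0 <= t <= 1 ->
  Phi (segpt p0 p1 t) xi xi <= (1 - t) * Phi p0 xi xi + t * Phi p1 xi xi.

Lemma Phi2 p (i j : R) (e f : E) : enorm (p - ps) <= r ->
  Phi p (- j *: e + i *: f) (- j *: e + i *: f) =
  j ^+ 2 * Phi p e e - 2 * (i * j) * Phi p e f + i ^+ 2 * Phi p f f.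
Proof.
move=> pr.
have D0 w : Phi p 0 w = 0.
  by have := PhiD (-1) 0 0 w pr; rewrite scaler0 addr0 mulN1r addNr.
have Dl u v w : Phi p (u + v) w = Phi p u w + Phi p v w.
  by have := PhiD 1 u v w pr; rewrite scale1r mul1r.
have Zl c u w : Phi p (c *: u) w = c * Phi p u w.
  by have := PhiD c u 0 w pr; rewrite !addr0 D0 addr0.
rewrite Dl !(PhiC _ (- j *: e + i *: f)) // !Dl !Zl.
rewrite !(PhiC _ (_ *: _)) // !Zl (PhiC f e) //; ring.
Qed.

(** Take the plane of e = p1 - p0 and of f, the multiple of xi with the length l of e. Along each
    line of this plane the value on the orthogonal direction is convex and bounded over length of
    order r, so over length l it varies by at most L = O(B l^3 / r). Five lines joining four points
    then force Phi(e, f) to be affine along e up to O(L), by [killing_form]. The radius r/64 keeps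
    these lines, prolonged by T, inside the ball. *)
Lemma zygmund (p0 p1 xi : E) (s : R) : enorm (p0 - ps) <= r / 64 ->
  enorm (p1 - ps) <= r / 64 -> dotp xi (p1 - p0) = 0 -> 0 <= s <= 1 ->
  `|(1 - s) * Phi p0 xi (p1 - p0) + s * Phi p1 xi (p1 - p0) -
    Phi (segpt p0 p1 s) xi (p1 - p0)| <=
  1024 * B / r * enorm (p1 - p0) ^+ 2 * enorm xi.
Proof.
move=> p0r p1r xie /andP[s0 s1].
have pr p : enorm (p - ps) <= r / 64 -> enorm (p - ps) <= r.
  move=> h; apply: le_trans h _; exact: div64_le.
have psr : enorm (ps - ps) <= r by rewrite subrr enorm0 ltW.
have [e eE] := named (p1 - p0); rewrite -eE in xie *.
have [l lE] := named (enorm e).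
have Z0 p u : enorm (p - ps) <= r -> Phi p 0 u = 0.
  by move=> h; have := PhiD (-1) 0 0 u h; rewrite scaler0 addr0 mulN1r addNr.
have Zl p c u w : enorm (p - ps) <= r -> Phi p (c *: u) w = c * Phi p u w.
  by move=> h; have := PhiD c u 0 w h; rewrite !addr0 Z0 // addr0.
have segr t : 0 <= t <= 1 -> enorm (segpt p0 p1 t - ps) <= r.
  move=> /andP[t0 t1]; apply: pr.
  have -> : segpt p0 p1 t - ps = (1 - t) *: (p0 - ps) + t *: (p1 - ps).
    by apply/rowP => i; rewrite !mxE; ring.
  apply: le_trans (enormD _ _) _; rewrite !enormZ (ger0_norm t0) ger0_norm ?subr_ge0 //.
  by apply: convex_le.
have [x0|xn0] := eqVneq xi 0.
  rewrite x0 !Z0; [|by apply: segr; rewrite s0|exact: pr..].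
  by rewrite !mulr0 subr0 addr0 normr0 enorm0 mulr0.
have [en0|en0] := eqVneq e 0.
  rewrite en0 !(PhiC _ 0); [|by apply: segr; rewrite s0|exact: pr..].
  rewrite !Z0; [|by apply: segr; rewrite s0|exact: pr..].
  by rewrite !mulr0 subr0 addr0 normr0 enorm0 expr0n mulr0 mul0r.
have l0 : 0 < l by rewrite lE; exact: enorm_gt0.
have nx0 : 0 < enorm xi by exact: enorm_gt0.
have lr : l <= r / 32.
  have -> : l = enorm ((p1 - ps) - (p0 - ps)).
    by rewrite lE eE opprB addrA subrK.
  by apply: le_trans (enormD _ _) _; rewrite enormN; exact: sum64_le.
have [f fE] := named ((l / enorm xi) *: xi).
have ef : dotp e f = 0 by rewrite fE dotpZr dotpC xie mulr0.
have fl : enorm f = l.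
  rewrite fE enormZ ger0_norm; last by apply: divr_ge0; exact: ltW.
  by rewrite divfK // gt_eqF.
have xif : xi = (enorm xi / l) *: f.
  rewrite fE scalerA; have -> : enorm xi / l * (l / enorm xi) = 1.
    by field; rewrite !gt_eqF.
  by rewrite scale1r.
(* T is the prolongation measured in units of l, so that T l is a fixed fraction of the radius. *)
have [T TE] := named (r / (8 * l)).
have T0 : 0 < T by rewrite TE divr_gt0 // mulr_gt0.
have Tl : T * l = r / 8 by rewrite TE; field; rewrite gt_eqF.
pose P (i j : R) := p0 + (i *: e + j *: f).
have nij (i j : R) : `|i| <= 2 -> `|j| <= 2 -> enorm (i *: e + j *: f) <= 4 * l.
  move=> i2 j1; apply: le_trans (enormD _ _) _; rewrite !enormZ fl -lE.
  rewrite -mulrDl; apply: ler_wpM2r; first exact: ltW.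
  by apply: le_trans (lerD i2 j1) _; lra.
pose L := 256 * (B * l ^+ 3 / r).
have B0 : 0 <= B.
  have := le_trans (normr_ge0 _) (PhiB e psr).
  by rewrite pmulr_lge0 // exprn_gt0 // -lE.
have line (i0 j0 i j : R) : `|i0| <= 2 -> `|j0| <= 2 -> `|i| <= 2 -> `|j| <= 2 ->
   `|j ^+ 2 * (Phi (P (i0 + i) (j0 + j)) e e - Phi (P i0 j0) e e)
     - 2 * (i * j) * (Phi (P (i0 + i) (j0 + j)) e f - Phi (P i0 j0) e f)
     + i ^+ 2 * (Phi (P (i0 + i) (j0 + j)) f f - Phi (P i0 j0) f f)| <= L.
  move=> i02 j01 i2 j1.
  pose v := i *: e + j *: f; pose w := - j *: e + i *: f.
  have vw : dotp w v = 0.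
    rewrite /v /w dotpDDl !dotpDDr !dotpZl !dotpZr (dotpC f e) ef -!enorm_sqr -lE fl.
    by ring.
  have PtE t : P (i0 + t * i) (j0 + t * j) = P i0 j0 + t *: v.
    by rewrite /P /v; apply/rowP => k; rewrite !mxE; ring.
  have Ptr t : - T <= t -> t <= 1 + T -> enorm (P (i0 + t * i) (j0 + t * j) - ps) <= r.
    move=> t1 t2; rewrite PtE /P.
    have -> : p0 + (i0 *: e + j0 *: f) + t *: v - ps =
      (p0 - ps) + ((i0 *: e + j0 *: f) + t *: v).
      move: (i0 *: e + j0 *: f) (t *: v) => z1 z2.
      by apply/rowP => k; rewrite !mxE; ring.
    apply: le_trans (enormD _ _) _.
    apply: le_trans (lerD p0r (enormD _ _)) _; rewrite enormZ.
    have h1 := nij _ _ i02 j01; have h2 := nij _ _ i2 j1.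
    have h3 : `|t| * enorm v <= (1 + T) * (4 * l).
      apply: ler_pM => //; first exact: enorm_ge0.
      by apply: abs_range.
    apply: le_trans (lerD (lexx _) (lerD h1 h3)) _.
    exact: radius_le lr Tl (ltW r0).
  pose F t := Phi (P (i0 + t * i) (j0 + t * j)) w w.
  have wl : enorm w <= 4 * l.
    apply: le_trans (enormD _ _) _; rewrite !enormZ fl -lE normrN -mulrDl.
    apply: ler_wpM2r; first exact: ltW.
    by rewrite addrC; apply: le_trans (lerD i2 j1) _; lra.
  have := @convex_increment R F (B * (4 * l) ^+ 2) T T0.
  have -> : 2 * (B * (4 * l) ^+ 2) / T = L.
    by rewrite TE /L; field; rewrite !gt_eqF.
  have -> : F 1 - F 0 = j ^+ 2 * (Phi (P (i0 + i) (j0 + j)) e e - Phi (P i0 j0) e e)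
     - 2 * (i * j) * (Phi (P (i0 + i) (j0 + j)) e f - Phi (P i0 j0) e f)
     + i ^+ 2 * (Phi (P (i0 + i) (j0 + j)) f f - Phi (P i0 j0) f f).
    have k0 : enorm (P i0 j0 - ps) <= r.
      by have := Ptr 0; rewrite !mul0r !addr0; apply; [rewrite oppr_le0|]; rewrite ?addr_ge0 // ltW.
    have k1 : enorm (P (i0 + i) (j0 + j) - ps) <= r.
      by have := Ptr 1; rewrite !mul1r; apply; rewrite ?lerDl ?(le_trans _ ler01) ?oppr_le0 // ltW.
    by rewrite /F !mul1r !mul0r !addr0 !Phi2 //; ring.
  apply.
    move=> t t' c t1 t2 t1' t2' c01; rewrite /F.
    have -> : P (i0 + ((1 - c) * t + c * t') * i) (j0 + ((1 - c) * t + c * t') * j) =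
      segpt (P (i0 + t * i) (j0 + t * j)) (P (i0 + t' * i) (j0 + t' * j)) c.
      by rewrite !PtE /segpt; apply/rowP => k; rewrite !mxE; ring.
    apply: Phi_convex; [exact: Ptr|exact: Ptr| |exact: c01].
    rewrite !PtE.
    have -> : P i0 j0 + t' *: v - (P i0 j0 + t *: v) = (t' - t) *: v.
      by apply/rowP => k; rewrite !mxE; ring.
    by rewrite dotpZr vw mulr0.
  move=> t t1 t2; rewrite /F; apply: le_trans (PhiB _ (Ptr _ t1 t2)) _.
  apply: ler_wpM2l => //.
  have h0 : 0 <= 4 * l by rewrite mulr_ge0 // ltW.
  by rewrite ler_sqr ?nnegrE // enorm_ge0.
have n1 : `|1 : R| <= 2 by rewrite normr1; lra.
have n1' : `|-1 : R| <= 2 by rewrite normrN1; lra.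
have n2 : `|2 : R| <= 2 by rewrite ger0_norm.
have n2' : `|-2 : R| <= 2 by rewrite normrN ger0_norm.
have n0 : `|0 : R| <= 2 by rewrite normr0.
have lOA := line 0 0 2 1 n0 n0 n2 n1.
have lOB := line 0 0 2 (-1) n0 n0 n2 n1'.
have lAB : `|Phi (P 2 (-1)) e e - Phi (P 2 1) e e| <= L.
  have e1 : 1 + -2 = -1 :> R by ring.
  have := line 2 1 0 (-2) n2 n1 n0 n2'; rewrite addr0 e1.
  move: (Phi _ _ _ - _) (Phi _ _ _ - _) (Phi _ _ _ - _) => A3 A2 A1 h.
  apply: le_trans h; have -> : (-2) ^+ 2 * A1 - 2 * (0 * -2) * A2 + 0 ^+ 2 * A3 = 4 * A1.
    by ring.
  by rewrite normrM ger0_norm //; apply: ler_peMl => //; lra.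
(* The point (sig, 0) is joined to (2, 1) and to (2, -1). The slope found for the affine function
   does not depend on sig, so it can be eliminated between sig = s and sig = 1. *)
have bX (sig : R) : 0 <= sig -> sig <= 1 ->
   `|Phi (P sig 0) e f - Phi (P 0 0) e f -
     sig * ((Phi (P 2 1) f f - Phi (P 2 (-1)) f f) / 4)| <= 2 * L.
  move=> g0 g1.
  have gn := sub2_le g0 g1.
  have lA := line 2 1 (sig - 2) (-1) n2 n1 gn n1'.
  have lB := line 2 (-1) (sig - 2) 1 n2 n1' gn n1.
  rewrite !add0r in lOA lOB.
  have e2 : 2 + (sig - 2) = sig by ring.
  rewrite e2 subrr in lA; rewrite e2 addNr in lB.
  have := @killing_form R L (Phi (P 0 0) e e) (Phi (P 0 0) e f) (Phi (P 0 0) f f)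
   (Phi (P 2 1) e e) (Phi (P 2 1) e f) (Phi (P 2 1) f f)
   (Phi (P 2 (-1)) e e) (Phi (P 2 (-1)) e f) (Phi (P 2 (-1)) f f)
   (Phi (P sig 0) e e) (Phi (P sig 0) e f) (Phi (P sig 0) f f) (2 - sig).
  have -> : 2 - (2 - sig) = sig by ring.
  apply; [exact: tau_ge1|exact: tau_le2|..|exact: lAB].
  - by move: lOA; congr (`|_| <= _); ring.
  - by move: lOB; congr (`|_| <= _); ring.
  - by move: lA; congr (`|_| <= _); ring.
  - by move: lB; congr (`|_| <= _); ring.
have bS := bX s s0 s1.
have bI := bX 1 ler01 (lexx _).
have PO : P 0 0 = p0 by rewrite /P !scale0r !addr0.
have PI : P 1 0 = p1 by rewrite /P scale0r scale1r addr0 eE addrC subrK.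
have PS : P s 0 = segpt p0 p1 s by rewrite /P scale0r addr0 segptE -eE.
rewrite PO PS in bS; rewrite PO PI in bI.
have fin : `|(1 - s) * Phi p0 e f + s * Phi p1 e f - Phi (segpt p0 p1 s) e f| <= 4 * L.
  exact: second_diff_le bS bI s0 s1.
have sr : enorm (segpt p0 p1 s - ps) <= r by apply: segr; rewrite s0.
have [c cE] := named (enorm xi / l).
have XE p : enorm (p - ps) <= r -> Phi p xi e = c * Phi p e f.
  by move=> h; rewrite {1}xif -cE Zl // PhiC.
rewrite (XE _ (pr _ p0r)) (XE _ (pr _ p1r)) (XE _ sr) -lE.
have -> : 1024 * B / r * l ^+ 2 * enorm xi = c * (4 * L).
  by rewrite cE /L; field; rewrite !gt_eqF.
have c0 : 0 <= c by rewrite cE; apply: divr_ge0; exact: ltW.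
apply: le_trans (ler_wpM2l c0 fin).
by rewrite (scale_second_diff _ _ _ _ c0).
Qed.

End Zygmund.

(** The maximum principle visits base points and slopes near the given ones, so A3s has to be
    applied on a slightly larger set. That set is the image of a product of two compact sets under
    addition, hence compact. *)
Lemma compact_thicken (R : realType) (V : normedModType R) (U' U : set V) :
  proper_space V -> open U -> compactly_contained U' U ->
  exists2 r : R, 0 < r & exists2 U'' : set V, compactly_contained U'' U &
    forall P Q, closure U' P -> `|Q - P| <= r -> U'' Q.
Proof.
move=> pV oU [cU sU].
have [|r r0 Hr] := @tube R R V 0 (closure U') (fun _ y => U y) cU.
  move=> y0 /sU Uy; have /(@near_ball R V)[r r0 Hr] : \forall y \near y0, U y.
    exact: open_nbhs_nbhs.
  by exists r => // _ y _; exact: Hr.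
have r20 : 0 < r / 2 by exact: divr_gt0.
have r2r : r / 2 < r by rewrite ltr_pdivrMr // ltr_pMr // ltr1n.
exists (r / 2) => //.
pose K := (fun z : V * V => z.1 + z.2) @` (closure U' `*` [set y | `|y - 0| <= r / 2]).
have cK : compact K.
  apply: continuous_compact; last by apply: compact_setX => //; exact: pV.
  by apply: continuous_subspaceT => z; exact: add_continuous.
exists K; last first.
  move=> P Q UP QP; exists (P, Q - P); last by rewrite /= addrC subrK.
  by split => //=; rewrite subr0.
have clK : closure K = K.
  by apply/esym/closure_id; apply: compact_closed => //; exact: norm_hausdorff.
split; rewrite clK // => Q [[P y] /= [UP]]; rewrite subr0 => yr <-.
apply: (Hr 0 (P + y) P); rewrite ?subrr ?normr0 //.
by rewrite addrC addKr; exact: le_lt_trans yr r2r.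
Qed.

Lemma w_close_real (R : realFieldType) (C e A B D k p X : R) : 0 < C -> 0 < e ->
  k <= C * p -> `|B - A| <= e / (2 * C) * k * X ->
  `|D - A| <= e / (2 * C) * X * k -> 0 <= X -> `|B - D| <= e * X * p.
Proof.
move=> C0 e0 kb h1 h2 X0.
have h : e / (2 * C) * k * X <= e * X * p / 2.
  have f0 : 0 <= e / (2 * C) by rewrite divr_ge0 ?mulr_ge0 // ltW.
  have : e / (2 * C) * k * X <= e / (2 * C) * (C * p) * X.
    by apply: ler_wpM2r => //; apply: ler_wpM2l.
  suff -> : e / (2 * C) * (C * p) * X = e * X * p / 2 by [].
  by field; rewrite gt_eqF.
have -> : B - D = (B - A) - (D - A) by ring.
apply: le_trans (ler_normB _ _) _; lra.
Qed.

Lemma ratio_real (R : realFieldType) (C e l p a b : R) : 0 < C -> 0 < e ->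
  l <= C * p -> a <= e / (2 * C) * l -> b <= e / (2 * C) * l -> a + b <= e * p.
Proof.
move=> C0 e0 lb h1 h2.
have f0 : 0 <= e / (2 * C) by rewrite divr_ge0 ?mulr_ge0 // ltW.
have h : e / (2 * C) * l <= e / (2 * C) * (C * p) by apply: ler_wpM2l.
have e1 : e / (2 * C) * (C * p) = e * p / 2 by field; rewrite gt_eqF.
rewrite e1 in h; lra.
Qed.

Lemma dotp_comb (R : realType) n (u v w z : 'rV[R]_n) (t : R) :
  dotp ((1 - t) *: u + t *: v - w) z =
  (1 - t) * dotp u z + t * dotp v z - dotp w z.
Proof. by rewrite dotpBl dotpDDl !dotpZl. Qed.

(** * The bilinear form of A, and comparison of data at nearby base points *)

Section Families.
Context {R : realType} {n : nat}.
Local Notation E := 'rV[R]_n.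
Local Notation W := (E * E * R)%type.
Local Notation M := (E * R)%type.
Variables (Gam : set W) (g : W -> R).
Hypothesis S : generating_system Gam g.
Let oG := s_open S.
Let gC := s_C2 S.
Let hW : finite_coords W := W_coords.

Lemma proper_U : proper_space (E * R * E)%type.
Proof. by apply: proper_prod; [exact: proper_M|exact: proper_rV]. Qed.

Lemma quadf_gxx x (m : M) xi : Gam (pt x m) ->
  quadf (g_xx g x m.1 m.2) xi = dotp (hx g (pt x m) xi) xi.
Proof.
move=> GP; rewrite /quadf -/(dotp _ _); congr dotp; apply/rowP => j.
rewrite hxi; transitivity (d2 g (pt x m) (inx (delta_mx 0 j)) (inx xi)); last first.
  exact: (d2C hW oG gC GP).
rewrite -(hxE S _ _ GP) dotpE mxE; apply: eq_bigr => i _.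
by rewrite hxi g_xxE mulrC.
Qed.

(** A3s concerns only the diagonal of this bilinear form of A; the maximum principle also needs its
    mixed values. *)
Definition Aform (x : E) (u : R) (p xi eta : E) : R :=
  dotp (hx g (pt x (YZ Gam g x u p)) xi) eta.

Lemma quadf_Aform x u p xi : dom_U Gam g (x, u, p) ->
  quadf (Amx Gam g x u p) xi = Aform x u p xi xi.
Proof. by move=> /YZP[GP _ _]; exact: quadf_gxx. Qed.

Lemma Aform_pt x (m : M) xi eta : Gam (pt x m) ->
  Aform x (g (pt x m)) (gx g x m) xi eta = dotp (hx g (pt x m) xi) eta.
Proof. by move=> GP; rewrite /Aform (YZ_pt S GP). Qed.

Lemma Mx_dotp a b x t xi eta : dotp (Mx Gam g a b x t xi) eta =
  (1 - t) * dotp (hx g (pt x a) xi) eta + t * dotp (hx g (pt x b) xi) eta -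
  Aform x (g (pt x a)) (pth g a b x t) xi eta.
Proof. exact: dotp_comb. Qed.

Lemma AformC x u p xi eta : dom_U Gam g (x, u, p) ->
  Aform x u p xi eta = Aform x u p eta xi.
Proof.
move=> /YZP[]; rewrite /Aform; move: (YZ Gam g x u p) => m GP _ _.
transitivity (d2 g (pt x m) (inx xi) (inx eta)); first exact: (hxE S).
transitivity (d2 g (pt x m) (inx eta) (inx xi)); last exact/esym/(hxE S).
exact: (d2C hW oG gC GP).
Qed.

Lemma AformD x u p (c : R) xi xi' eta : dom_U Gam g (x, u, p) ->
  Aform x u p (c *: xi + xi') eta = c * Aform x u p xi eta + Aform x u p xi' eta.
Proof.
move=> /YZP[GP _ _]; rewrite /Aform; have -> := hxD S c xi xi' GP.
exact: dotpDl.
Qed.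

Lemma hx_bound_near P0 : Gam P0 -> exists2 C : R, 0 < C & exists2 r : R, 0 < r &
  forall P : W, `|P - P0| < r -> Gam P /\ forall v, `|hx g P v| <= C * `|v|.
Proof.
move=> GP; have [C C0 HC] := hx_bound S GP.
have [r r0 Hr] := d2_near hW oG gC GP ltr01.
exists (C + 1); first exact: addr_gt0.
exists r; first exact: r0.
move=> P Pr; have [G H] := Hr P Pr; split; first exact: G.
move=> v; have C10 : 0 <= (C + 1) * `|v| by rewrite mulr_ge0 // addr_ge0 // ltW.
apply: norm_le; first exact: C10.
move=> i; have h1 := H (inx v) (inx (delta_mx 0 i)); rewrite -!hxi !norm_inx in h1.
have h2 : `|hx g P0 v 0 i| <= C * `|v| by apply: le_trans (norm_coord _ _) (HC v).
have h3 : `|hx g P v 0 i - hx g P0 v 0 i| <= 1 * `|v|.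
  apply: le_trans h1 _; rewrite mul1r; apply: ler_piMr => //; exact: norm_delta.
rewrite mulrDl addrC; rewrite -{1}(subrK (hx g P0 v 0 i) (hx g P v 0 i)).
by apply: le_trans (ler_normD _ _) _; apply: lerD.
Qed.

(* The covector w of [dual_form] is close to the displacement x1 - x0. *)
Lemma w_close xs ms : Gam (pt xs ms) -> forall e : R, 0 < e ->
  exists2 r : R, 0 < r & forall (x0 x1 : E) (m : M), `|x0 - xs| < r ->
    `|x1 - xs| < r -> `|m - ms| < r -> forall (c0 : R) (w : E),
    (forall k : M, d1 g (pt x1 m) (inm k) =
      c0 * d1 g (pt x0 m) (inm k) + dotp w (tx g (pt x0 m) k)) ->
    forall pi : E, `|dotp w pi - dotp (x1 - x0) pi| <= e * `|x1 - x0| * `|pi|.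
Proof.
move=> GP e e0.
have [C C0 [r1 r10 H1]] := tx_bound_near S GP.
have f0 : 0 < e / (2 * C) by apply: divr_gt0 => //; exact: mulr_gt0.
have [r2 r20 H2] := strict2 hW oG gC GP f0.
have [r3 r30 H3] := d2_near hW oG gC GP f0.
have [r [r0 rr1 rr2 rr3]] := min3 r10 r20 r30.
exists r; first exact: r0.
move=> x0 x1 m x0r x1r mr c0 w wE pi.
have Q1 := norm_pt_lt (lt_le_trans x0r rr1) (lt_le_trans mr rr1).
have Q2 := norm_pt_lt (lt_le_trans x0r rr2) (lt_le_trans mr rr2).
have Q2' := norm_pt_lt (lt_le_trans x1r rr2) (lt_le_trans mr rr2).
have Q3 := norm_pt_lt (lt_le_trans x0r rr3) (lt_le_trans mr rr3).
have [G0 HC] := H1 _ Q1.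
have [k [k1 k2]] := tx_surj S G0 0 pi.
have kb : `|k| <= C * `|pi| by have := HC k; rewrite k1 k2 normr0 add0r.
have wk := wE k; rewrite k1 mulr0 add0r k2 in wk.
have [_ h1] := H2 _ _ (inm k) Q2 Q2'; rewrite ptBx k1 subr0 wk in h1.
have [_ h3] := H3 _ Q3; have {}h3 := h3 (inx (x1 - x0)) (inm k).
have e3 : d2 g (pt x0 m) (inx (x1 - x0)) (inm k) = dotp (x1 - x0) pi.
  rewrite dotpC -k2 (txE S _ _ G0); exact: (d2C hW oG gC G0).
rewrite e3 in h3; rewrite !norm_inx !norm_inm in h1 h3.
move: h1 h3; move: (d2 g _ _ _) (dotp w pi) (dotp (x1 - x0) pi) => A B D h1 h3.
exact: w_close_real C0 e0 kb h1 h3 (normr_ge0 _).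
Qed.

(** Both differences of slopes are [tx] applied to b - a, up to a small multiple of |b - a|. On a
    common level |b - a| is itself controlled by the difference of slopes, so the error is relative
    and the estimate survives when a and b coalesce. *)
Lemma same_level_ratio x0 m0 : Gam (pt x0 m0) -> forall e : R, 0 < e ->
  exists2 r : R, 0 < r & forall (x x' : E) (a b : M), `|x - x0| < r ->
    `|x' - x0| < r -> `|a - m0| < r -> `|b - m0| < r ->
    g (pt x a) = g (pt x b) -> g (pt x' a) = g (pt x' b) ->
    `|(gx g x b - gx g x a) - (gx g x' b - gx g x' a)| <=
      e * `|gx g x' b - gx g x' a|.
Proof.
move=> GP e e0.
have [C C0 [r1 r10 H1]] := inverse_lipschitz S GP.
have f0 : 0 < e / (2 * C) by apply: divr_gt0 => //; exact: mulr_gt0.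
have [r2 r20 H2] := strictm S GP f0.
have [r [r0 rr1 rr2]] := min2 r10 r20.
exists r; first exact: r0.
move=> x x' a b xr x'r ar br ab ab'.
have h1 := H1 x' a b (lt_le_trans x'r rr1) (lt_le_trans ar rr1) (lt_le_trans br rr1).
rewrite ab' subrr normr0 add0r in h1.
have [_ _ h2] := H2 x a b (lt_le_trans xr rr2) (lt_le_trans ar rr2) (lt_le_trans br rr2).
have [_ _ h3] := H2 x' a b (lt_le_trans x'r rr2) (lt_le_trans ar rr2) (lt_le_trans br rr2).
move: h1 h2 h3.
move: (gx g x b - gx g x a) (gx g x' b - gx g x' a) (tx g (pt x0 m0) (b - a)) => A B D.
move: `|b - a| => l h1 h2 h3.
have -> : A - B = (A - D) - (B - D).
  by move=> *; apply/rowP => i; rewrite !mxE; ring.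
apply: le_trans (ler_normB _ _) _.
exact: ratio_real C0 e0 h1 h2 h3.
Qed.

End Families.

(** * The maximum principle *)

Lemma half_ltr (R : realFieldType) (r : R) : 0 < r -> r / 2 < r.
Proof. lra. Qed.

Lemma zygmund_const (R : realFieldType) (N B r : R) : 0 < N -> 0 < B -> 0 < r ->
  0 <= 1024 * (N * B) / r.
Proof.
move=> N0 B0 r0; apply: divr_ge0; last exact: ltW.
by apply: mulr_ge0; [exact: ler0n|exact: mulr_ge0 (ltW N0) (ltW B0)].
Qed.

Lemma cross_const (R : realFieldType) (N B r : R) : 0 < N -> 0 < B -> 0 < r ->
  0 <= N * (2 * B) / r.
Proof. by move=> N0 B0 r0; rewrite divr_ge0 ?mulr_ge0 // ltW. Qed.

Lemma move_le (R : realFieldType) (del t A B C D F : R) :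
  A <= (1 - t) * B + t * C - del * t * (1 - t) * D * F ->
  del * (t * (1 - t)) * D * F <= (1 - t) * B + t * C - A.
Proof. lra. Qed.

Lemma half_norm_le (R : realFieldType) (V : normedZmodType R) (D D' : V) :
  `|D - D'| <= `|D'| / 2 -> `|D'| / 2 <= `|D|.
Proof.
move=> h; have : `|D'| <= `|D| + `|D'| / 2.
  by rewrite -{1}(subKr D D'); apply: le_trans (ler_normB _ _) _; rewrite lerD2l.
lra.
Qed.

Lemma cross_real (R : realFieldType) (N B c D D' m x : R) : 0 < N -> 0 < B -> 0 < c ->
  c <= D -> D' <= D -> m <= 2 * B * x -> 0 <= x -> 0 <= D' ->
  N * (m * D') <= N * (2 * B) / c * D ^+ 2 * x.
Proof.
move=> N0 B0 c0 cD DD mx x0 D0.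
have -> : N * (2 * B) / c * D ^+ 2 * x = N * (2 * B * x * (D * D / c)) by ring.
rewrite ler_pM2l //; have Bx : 0 <= 2 * B * x by rewrite !mulr_ge0 // ltW.
apply: le_trans (ler_wpM2r D0 mx) _; apply: ler_wpM2l => //.
apply: le_trans DD _; rewrite ler_pdivlMr //; apply: ler_wpM2l => //.
by apply: le_trans cD; exact: ltW.
Qed.

Lemma ratio_far (R : realFieldType) (N D B X : R) : 0 <= D -> 1 <= N ->
  X <= 2 * (D / (4 * N)) -> D <= B + D / (4 * N) -> N * X <= B.
Proof.
move=> D0 N1 h1 h2; have N0 : 0 < N by lra.
have h3 : N * X <= N * (2 * (D / (4 * N))) by rewrite ler_pM2l.
have e3 : N * (2 * (D / (4 * N))) = D / 2 by field; rewrite gt_eqF.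
have h4 : D / (4 * N) <= D / 4.
  rewrite invfM mulrA ler_piMr // ?divr_ge0 //; by rewrite invf_le1.
lra.
Qed.

Lemma sum2_lt (R : realFieldType) (u v r : R) : u <= r / 8 -> v <= r / 8 ->
  0 < r -> 2 * u + 2 * v + 0 < r.
Proof. lra. Qed.

Lemma quad_lt (R : realType) (U V : normedModType R) (x x1 x' x1' : U)
    (a b a' b' : V) (r : R) : `|(x, x1, (a, b)) - (x', x1', (a', b'))| < r <->
  [/\ `|x - x'| < r, `|x1 - x1'| < r, `|a - a'| < r & `|b - b'| < r].
Proof.
rewrite !prod_normE /= !gt_max; split; first by move=> /andP[/andP[? ?] /andP[? ?]].
by move=> [-> -> -> ->].
Qed.

Lemma tube_segment (R : realType) (X : normedModType R) (x0 : X) (Q : X -> R -> Prop) :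
  (forall t0 : R, 0 <= t0 <= 1 -> exists2 r : R, 0 < r & forall (x : X) (t : R),
     `|x - x0| < r -> `|t - t0| < r -> Q x t) ->
  exists2 r : R, 0 < r & forall (x : X) (t : R), `|x - x0| < r -> 0 <= t <= 1 -> Q x t.
Proof.
move=> H; have [|r r0 Hr] := @tube R X R x0 `[0, 1]%classic Q (@segment_compact R 0 1).
  by move=> t0; rewrite /= in_itv /=; exact: H.
exists r => // x t xr t01; apply: (Hr x t t xr); first by rewrite /= in_itv.
by rewrite subrr normr0.
Qed.

Lemma drop_le (R : realFieldType) (del c A B D F : R) : 0 <= del -> 0 <= c <= 1 ->
  A <= B - del * c * (1 - c) * D ^+ 2 * F ^+ 2 -> A <= B.
Proof.
move=> d0 /andP[c0 c1]; move/le_trans; apply; rewrite lerBlDr lerDl.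
have c1' : 0 <= 1 - c by rewrite subr_ge0.
by do 4![apply: mulr_ge0; rewrite ?sqr_ge0 //].
Qed.

Lemma mp_final (R : realFieldType) (G X del q L d : R) :
  G + del / 8 * (L / 2) ^+ 2 * q ^+ 2 * d ^+ 2 <= X ->
  G <= X - del / 32 * (q * L * d) ^+ 2.
Proof.
have -> : del / 8 * (L / 2) ^+ 2 * q ^+ 2 * d ^+ 2 = del / 32 * (q * L * d) ^+ 2.
  by field.
by rewrite lerBrDr.
Qed.

Lemma rho_choice (R : realFieldType) (C K r : R) : 0 <= C -> 0 <= K -> 0 < r ->
  exists rho : R, [/\ 0 < rho, rho <= r, C * rho <= 1 & K * rho <= 4^-1].
Proof.
move=> C0 K0 r0.
have h1 : 0 < (C + 1)^-1 by rewrite invr_gt0 ltr_wpDl.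
have h2 : 0 < (4 * (K + 1))^-1 by rewrite invr_gt0 mulr_gt0 // ltr_wpDl.
have [rho [p0 p1 p2 p3]] := min3 r0 h1 h2.
exists rho; split=> //.
  have : (C + 1) * rho <= 1 by rewrite -ler_pdivlMl ?mulr1 // ltr_wpDl.
  lra.
have : 4 * (K + 1) * rho <= 1.
  by rewrite -ler_pdivlMl ?mulr1 // mulr_gt0 // ltr_wpDl.
lra.
Qed.

Lemma lam_real (R : realFieldType) (k L Lb rho : R) : 0 <= k -> 0 <= rho ->
  L <= Lb -> k * Lb * rho <= 4^-1 -> 0 <= L -> k * (L / 2) * rho <= 4^-1.
Proof.
move=> k0 r0 h1 h2 L0; apply: le_trans h2; apply: ler_wpM2r => //.
apply: ler_wpM2l => //; lra.
Qed.

Lemma half_sum_lt (R : realFieldType) (a b r : R) : a <= r / 2 -> b < r / 2 -> a + b < r.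
Proof. lra. Qed.

Lemma dist_near (R : realFieldType) (V : normedZmodType R) (x y z : V) (r s : R) :
  `|x - z| < r -> `|y - z| < s -> `|x - y| < r + s.
Proof.
move=> h1 h2; have -> : x - y = (x - z) - (y - z) by rewrite opprB addrA subrK.
by apply: le_lt_trans (ler_normB _ _) _; exact: ltrD.
Qed.

Lemma dbl_div (R : realFieldType) (N rho : R) : 0 < N -> N * (2 * (rho / (2 * N))) = rho.
Proof. by move=> N0; field; rewrite gt_eqF. Qed.

Lemma half_le_dbl (R : realFieldType) (a b : R) : a <= 2 * b -> a / 2 <= b.
Proof. lra. Qed.

(** * Uniform local estimates near a fixed segment of slopes *)

Section Base.
Context {R : realType} {n : nat}.
Local Notation E := 'rV[R]_n.
Local Notation W := (E * E * R)%type.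
Local Notation M := (E * R)%type.
Variables (Gam : set W) (g : W -> R).
Hypothesis S : generating_system Gam g.
Let oG := s_open S.
Let gC := s_C2 S.
Let hW : finite_coords W := W_coords.
Variables (xs : E) (us : R) (P0 P1 : E).
Hypothesis seg : forall t : R, 0 <= t <= 1 -> dom_U Gam g (xs, us, segpt P0 P1 t).

Let as_ := YZ Gam g xs us P0.
Let bs := YZ Gam g xs us P1.
Let ms (t : R) : M := YZ Gam g xs us (segpt P0 P1 t).

Lemma base_a : [/\ Gam (pt xs as_), g (pt xs as_) = us & gx g xs as_ = P0].
Proof. by have := seg (t := 0); rewrite segpt0 lexx ler01 => /(_ isT)/YZP. Qed.

Lemma base_b : [/\ Gam (pt xs bs), g (pt xs bs) = us & gx g xs bs = P1].
Proof. by have := seg (t := 1); rewrite segpt1 lexx ler01 => /(_ isT)/YZP. Qed.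

Lemma base_m t : 0 <= t <= 1 ->
  [/\ Gam (pt xs (ms t)), g (pt xs (ms t)) = us & gx g xs (ms t) = segpt P0 P1 t].
Proof. by move=> /seg/YZP. Qed.

(** The tube lemma on [0, 1] gives one radius for all t. In its local hypothesis, [key] compares
    both the perturbed and the unperturbed member at t with the unperturbed member at t0. *)
Lemma base_near (e : R) : 0 < e -> exists2 r : R, 0 < r &
  forall (x x1 : E) (a b : M) (t : R), `|x - xs| < r -> `|x1 - xs| < r ->
    `|a - as_| < r -> `|b - bs| < r -> 0 <= t <= 1 ->
  [/\ Gam (pt x a), Gam (pt x b), dom_U Gam g (x, g (pt x a), pth g a b x t) &
      Gam (pt x1 (mth Gam g a b x t))] /\
  [/\ `|mth Gam g a b x t - ms t| < e,
      `|g (pt x a) - us| < e & `|pth g a b x t - segpt P0 P1 t| < e].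
Proof.
move=> e0.
have [Ga gua gpa] := base_a; have [Gb gub gpb] := base_b.
pose Q (X : (E * E * (M * M))%type) (t : R) := 0 <= t <= 1 ->
  [/\ Gam (pt X.1.1 X.2.1), Gam (pt X.1.1 X.2.2),
      dom_U Gam g (X.1.1, g (pt X.1.1 X.2.1), pth g X.2.1 X.2.2 X.1.1 t) &
      Gam (pt X.1.2 (mth Gam g X.2.1 X.2.2 X.1.1 t))] /\
  [/\ `|mth Gam g X.2.1 X.2.2 X.1.1 t - ms t| < e,
      `|g (pt X.1.1 X.2.1) - us| < e & `|pth g X.2.1 X.2.2 X.1.1 t - segpt P0 P1 t| < e].
have [|r r0 Hr] := @tube_segment R _ (xs, xs, (as_, bs)) Q; last first.
  exists r; first exact: r0.
  move=> x x1 a b t xr x1r ar br t01.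
  have X1 : `|(x, x1, (a, b)) - (xs, xs, (as_, bs))| < r.
    by apply/quad_lt; split.
  exact: (Hr _ t X1 t01 t01).
move=> t0 t001.
have [G0 gu0 gp0] := base_m t001.
have [q [q0 qe]] : exists q : R, 0 < q /\ q <= e / 2.
  by exists (e / 2); split=> //; exact: divr_gt0.
have [r1 r10 H1] := g_near S G0 e0.
have [e1 [e10 e1q e1r]] := min2 q0 r10.
have [r2 r20 H2] := YZ_near S G0 e10.
rewrite gu0 gp0 in H2.
have [f1 [f10 f1e f1r]] := min2 e0 r20.
have [f [f0 fE]] : exists f : R, 0 < f /\ f = f1 / 8.
  by exists (f1 / 8); split=> //; exact: divr_gt0.
have [r3 r30 H3] := g_near S Ga f0; rewrite gua in H3.
have [r4 r40 H4] := gx_near S Ga f0; rewrite gpa in H4.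
have [r5 r50 H5] := g_near S Gb f0.
have [r6 r60 H6] := gx_near S Gb f0; rewrite gpb in H6.
have [K [K0 KE]] : exists K : R, 0 < K /\ `|P1 - P0| <= K.
  by exists (`|P1 - P0| + 1); split; [rewrite ltr_wpDl|rewrite lerDl].
have f2 : 0 < f1 / (4 * K) by apply: divr_gt0 => //; exact: mulr_gt0.
have [s1 [s10 s1a s1b s1c s1d]] := min4 r30 r40 r50 r60.
have [s2 [s20 s2a s2b s2c s2d]] := min4 s10 r10 r20 f2.
have [s [s0 ss1 ss2]] := min2 s20 ltr01.
exists s; first exact: s0.
have key (x : E) (a b : M) (t : R) : `|x - xs| < s -> `|a - as_| < s -> `|b - bs| < s ->
   0 <= t <= 1 -> `|t - t0| < s -> [/\ Gam (pt x a), Gam (pt x b),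
     dom_U Gam g (x, g (pt x a), pth g a b x t),
     `|mth Gam g a b x t - ms t0| < e1 &
     `|g (pt x a) - us| < e /\ `|pth g a b x t - segpt P0 P1 t| < e].
  move=> xr ar br tt1 tr.
  have xs1 := lt_le_trans (lt_le_trans xr ss1) s2a.
  have as1 := lt_le_trans (lt_le_trans ar ss1) s2a.
  have bs1 := lt_le_trans (lt_le_trans br ss1) s2a.
  have [Gxa h1] := H3 _ (norm_pt_lt (lt_le_trans xs1 s1a) (lt_le_trans as1 s1a)).
  have h2 := H4 _ _ (lt_le_trans xs1 s1b) (lt_le_trans as1 s1b).
  have [Gxb _] := H5 _ (norm_pt_lt (lt_le_trans xs1 s1c) (lt_le_trans bs1 s1c)).
  have h3 := H6 _ _ (lt_le_trans xs1 s1d) (lt_le_trans bs1 s1d).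
  have h1' : `|g (pt x a) - us| < f1.
    by apply: lt_trans h1 _; rewrite fE; exact: eighth_lt.
  have h4 : `|t - t0| * `|P1 - P0| <= f1 / 4.
    apply: (@le_trans _ _ (f1 / (4 * K) * K)).
      apply: ler_pM => //; apply: ltW; apply: lt_le_trans s2d.
      exact: lt_le_trans tr ss1.
    by rewrite le_eqVlt; apply/orP; left; apply/eqP; field; rewrite gt_eqF.
  rewrite fE in h2 h3.
  have h5 : `|pth g a b x t - segpt P0 P1 t0| < f1.
    apply: le_lt_trans (segpt_dist _ _ _ _ t001 _) _.
      by apply: ltW; exact: lt_le_trans tr ss2.
    exact: sum3_lt h2 h3 h4 f10.
  have x2 := lt_le_trans (lt_le_trans xr ss1) s2c.
  have [h6 h7] := H2 _ _ _ x2 (lt_le_trans h1' f1r) (lt_le_trans h5 f1r).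
  split; [exact: Gxa|exact: Gxb|exact: h6|exact: h7|].
  split; first exact: lt_le_trans h1' f1e.
  apply: (@lt_le_trans _ _ f1 _ _ _ f1e).
  have tt0 : `|t - t| = 0 by rewrite subrr normr0.
  apply: le_lt_trans (segpt_dist _ _ _ _ tt1 _) _; rewrite tt0 // mul0r.
  exact: sum2_lt h2 h3 f10.
move=> [[x x1] [a b]] t /quad_lt[xr x1r ar br] tr t01.
have zz (V : normedModType R) (v : V) : `|v - v| < s by rewrite subrr normr0.
have [k1 k2 k3 k4 [k5 k6]] := key x a b t xr ar br t01 tr.
have [_ _ _ k7 _] := key xs as_ bs t (zz _ _) (zz _ _) (zz _ _) t01 tr.
have x1r1 := lt_le_trans (lt_le_trans x1r ss1) s2b.
split.
  split; [exact: k1|exact: k2|exact: k3|].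
  by have [] := H1 _ (norm_pt_lt x1r1 (lt_le_trans k4 e1r)).
have E1 : mth Gam g as_ bs xs t = ms t by rewrite /mth /pth gua gpa gpb.
rewrite E1 in k7.
split; [|exact: k5|exact: k6].
have -> : mth Gam g a b x t - ms t = (mth Gam g a b x t - ms t0) + (ms t0 - ms t).
  by rewrite addrA subrK.
apply: le_lt_trans (ler_normD _ _) _; rewrite (distrC (ms t0)) (splitr e).
by apply: ltrD; [apply: lt_le_trans k4 _|apply: lt_le_trans k7 _]; exact: le_trans e1q qe.
Qed.

Lemma ms_continuous : {within `[0, 1], continuous ms}.
Proof.
apply: continuous_in_subspaceT => t; rewrite inE /= in_itv /= => t01.
have [Ga gua gpa] := base_a; have [Gb gub gpb] := base_b.
have E1 s : mth Gam g as_ bs xs s = ms s by rewrite /mth /pth gua gpa gpb.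
have adm : admissible Gam g as_ bs xs xs t.
  split; [exact: Ga|exact: Gb| |by rewrite E1; case: (base_m t01)].
  by rewrite gua /pth gpa gpb; exact: seg.
apply: continuous_eps => e e0.
have [r r0 Hr] := mth_near S adm t01 e0.
exists r; first exact: r0.
move=> t' tt; have zz : `|xs - xs| < r by rewrite subrr normr0.
have [_] := Hr xs t' zz tt; rewrite !E1 distrC; exact: ltW.
Qed.

Lemma ms_uniform (X : normedModType R) (X0 : X) (Q : X -> M -> Prop) :
  (forall t : R, 0 <= t <= 1 -> exists2 r : R, 0 < r & forall (x : X) (m : M),
     `|x - X0| < r -> `|m - ms t| < r -> Q x m) ->
  exists2 r : R, 0 < r & forall (x : X) (m : M) (t : R), `|x - X0| < r ->
    0 <= t <= 1 -> `|m - ms t| < r -> Q x m.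
Proof.
move=> H.
have cK : compact (ms @` `[0, 1]%classic).
  by apply: continuous_compact; [exact: ms_continuous|exact: segment_compact].
have [|r r0 Hr] := @tube R X M X0 _ Q cK.
  by move=> _ [t /= t01 <-]; apply: H; move: t01; rewrite in_itv.
exists r; first exact: r0.
move=> x m t xr t01 mr; apply: (Hr x m (ms t)); [exact: xr| |exact: mr].
by exists t; rewrite /= ?in_itv.
Qed.

Lemma Dp_near (e : R) : 0 < e -> exists2 r : R, 0 < r & forall (x : E) (a b : M),
  `|x - xs| < r -> `|a - as_| < r -> `|b - bs| < r ->
  `|Dp g a b x - (P1 - P0)| <= e.
Proof.
move=> e0; have e20 : 0 < e / 2 by exact: divr_gt0.
have [Ga gua gpa] := base_a; have [Gb gub gpb] := base_b.
have [r1 r10 H1] := gx_near S Ga e20; rewrite gpa in H1.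
have [r2 r20 H2] := gx_near S Gb e20; rewrite gpb in H2.
have [r [r0 rr1 rr2]] := min2 r10 r20.
exists r; first exact: r0.
move=> x a b xr ar br.
have h1 := H1 _ _ (lt_le_trans xr rr1) (lt_le_trans ar rr1).
have h2 := H2 _ _ (lt_le_trans xr rr2) (lt_le_trans br rr2).
move: h1 h2; rewrite /Dp; move: (gx g x a) (gx g x b) => A B h1 h2.
have -> : B - A - (P1 - P0) = (B - P1) - (A - P0).
  by apply/rowP => i; rewrite !mxE; ring.
by apply: le_trans (ler_normB _ _) _; rewrite (splitr e); apply: lerD.
Qed.

Lemma w_close_uniform (e : R) : 0 < e -> exists2 r : R, 0 < r &
  forall (x0 x1 : E) (m : M) (t : R), `|x0 - xs| < r -> `|x1 - xs| < r ->
    0 <= t <= 1 -> `|m - ms t| < r -> forall (c0 : R) (w : E),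
    (forall k : M, d1 g (pt x1 m) (inm k) =
      c0 * d1 g (pt x0 m) (inm k) + dotp w (tx g (pt x0 m) k)) ->
    enorm (w - (x1 - x0)) <= e * enorm (x1 - x0).
Proof.
move=> e0.
pose Q (X : (E * E)%type) (m : M) := forall (c0 : R) (w : E),
    (forall k : M, d1 g (pt X.2 m) (inm k) =
      c0 * d1 g (pt X.1 m) (inm k) + dotp w (tx g (pt X.1 m) k)) ->
    forall pi : E, `|dotp w pi - dotp (X.2 - X.1) pi| <= e * `|X.2 - X.1| * `|pi|.
have [t t01|r r0 Hr] := @ms_uniform (E * E)%type (xs, xs) Q.
  have [G0 _ _] := base_m t01; have [r r0 Hr] := w_close S G0 e0.
  exists r; first exact: r0.
  move=> [x0 x1] m; rewrite prod_normE /= gt_max => /andP[h1 h2] h3 c0 w H.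
  exact: Hr h1 h2 h3 c0 w H.
exists r; first exact: r0.
move=> x0 x1 m t h1 h2 t01 h3 c0 w H.
have h : `|(x0, x1) - (xs, xs)| < r by rewrite prod_normE /= gt_max h1.
have [z zE] := named (w - (x1 - x0)).
(* Testing with pi = w - (x1 - x0) itself turns the bound on pairings into a bound on the Euclidean
   length. *)
have := Hr (x0, x1) m t h t01 h3 c0 w H z; rewrite /= -dotpBl -zE.
have [->|z0] := eqVneq z 0; first by rewrite enorm0 => _; rewrite mulr_ge0 ?enorm_ge0 // ltW.
rewrite -enorm_sqr ger0_norm ?sqr_ge0 // => k.
have ez : 0 < enorm z by exact: enorm_gt0.
rewrite -(ler_pM2r ez) -expr2; apply: le_trans k _.
apply: ler_pM; [by rewrite mulr_ge0 // ltW|exact: normr_ge0| |exact: norm_le_enorm].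
apply: ler_wpM2l; [exact: ltW|exact: norm_le_enorm].
Qed.

(** If P0 = P1 the ends may be arbitrarily close and only the relative estimate of
    [same_level_ratio] helps; otherwise [Dp] stays close to the nonzero vector P1 - P0. *)
Lemma Dp_ratio : exists2 r : R, 0 < r & forall (x x' : E) (a b : M),
  `|x - xs| < r -> `|x' - xs| < r -> `|a - as_| < r -> `|b - bs| < r ->
  g (pt x a) = g (pt x b) -> g (pt x' a) = g (pt x' b) ->
  enorm (Dp g a b x) <= 2 * enorm (Dp g a b x').
Proof.
have N0 : 0 < n.+1%:R :> R by [].
have fin (A B : E) : n.+1%:R * `|A - B| <= `|B| -> enorm A <= 2 * enorm B.
  move=> h; rewrite -{1}(subrK B A); apply: le_trans (enormD _ _) _.
  rewrite mulr2n mulrDl mul1r lerD2r.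
  by apply: le_trans (enorm_le_norm _) _; apply: le_trans h (norm_le_enorm _).
have [P01|P01] := eqVneq P0 P1.
  have [Ga _ _] := base_a.
  have f0 : 0 < n.+1%:R^-1 :> R by rewrite invr_gt0.
  have [r r0 Hr] := same_level_ratio S Ga f0.
  exists r; first exact: r0.
  move=> x x' a b h1 h2 h3 h4 ab ab'; apply: fin.
  have h4' : `|b - as_| < r by rewrite /as_ P01.
  have := Hr x x' a b h1 h2 h3 h4' ab ab'.
  by rewrite -/(Dp g a b x) -/(Dp g a b x') ler_pdivlMl.
have D0 : 0 < `|P1 - P0| by rewrite normr_gt0 subr_eq0 eq_sym.
have f0 : 0 < `|P1 - P0| / (4 * n.+1%:R) by apply: divr_gt0 => //; exact: mulr_gt0.
have [r r0 Hr] := Dp_near f0.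
exists r; first exact: r0.
move=> x x' a b h1 h2 h3 h4 _ _; apply: fin.
have k1 := Hr x a b h1 h3 h4; have k2 := Hr x' a b h2 h3 h4.
move: k1 k2 D0; move: (Dp g a b x) (Dp g a b x') (P1 - P0) => A B D k1 k2 D0.
have h5 : `|A - B| <= 2 * (`|D| / (4 * n.+1%:R)).
  have -> : A - B = (A - D) - (B - D) by rewrite opprB addrA subrK.
  by apply: le_trans (ler_normB _ _) _; rewrite mulr2n mulrDl mul1r; apply: lerD.
have h6 : `|D| <= `|B| + `|D| / (4 * n.+1%:R).
  rewrite -{1}(subKr B D); apply: le_trans (ler_normB _ _) _.
  by rewrite lerD2l.
apply: ratio_far h5 h6; first exact: normr_ge0.
by rewrite ler1n.
Qed.

Lemma hx_uniform : exists2 B : R, 0 < B & exists2 r : R, 0 < r &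
  forall (x : E) (m : M) (t : R), `|x - xs| < r -> 0 <= t <= 1 -> `|m - ms t| < r ->
  forall v : E, `|hx g (pt x m) v| <= B * `|v|.
Proof.
(* The real component is the inverse of the bound: near 0 it allows a bound as large as needed, so
   [ms_uniform] produces the radius and a bound valid for all t at once. *)
pose Q (X : (E * R)%type) (m : M) := 0 < X.2 -> forall v : E,
  `|hx g (pt X.1 m) v| <= X.2^-1 * `|v|.
have [t t01|r r0 Hr] := @ms_uniform (E * R)%type (xs, 0) Q.
  have [G0 _ _] := base_m t01; have [B B0 [r r0 Hr]] := hx_bound_near S G0.
  have Bi : 0 < B^-1 by rewrite invr_gt0.
  have [s [s0 s1 s2]] := min2 r0 Bi.
  exists s; first exact: s0.
  move=> [x q] m; rewrite prod_normE /= gt_max => /andP[h1 h2] h3 q0 v.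
  have [_ H] := Hr _ (norm_pt_lt (lt_le_trans h1 s1) (lt_le_trans h3 s1)).
  apply: le_trans (H v) _; apply: ler_wpM2r; first exact: normr_ge0.
  rewrite -[B]invrK lef_pV2 ?posrE //; apply: ltW.
  by apply: lt_le_trans s2; move: h2; rewrite /= subr0 gtr0_norm.
have r20 : 0 < r / 2 by exact: divr_gt0.
exists (r / 2)^-1; first by rewrite invr_gt0.
exists r; first exact: r0.
move=> x m t h1 t01 h3 v; apply: (Hr (x, r / 2) m t _ t01 h3 r20).
by rewrite prod_normE /= gt_max h1 subr0 gtr0_norm //=; exact: half_ltr.
Qed.

Variables (U'' : set (E * R * E)) (del rho0 : R).
Hypothesis del0 : 0 < del.
Hypothesis rho00 : 0 < rho0.
Hypothesis HU : U'' `<=` dom_U Gam g.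
Hypothesis Hnear : forall (t : R) (x : E) (u : R) (p : E), 0 <= t <= 1 ->
  `|x - xs| < rho0 -> `|u - us| < rho0 -> `|p - segpt P0 P1 t| < rho0 -> U'' (x, u, p).
Hypothesis Hdel : forall (x : E) (u : R) (p0 p1 : E), vsegment x u p0 p1 `<=` U'' ->
  forall (t : R) (xi : E), 0 <= t <= 1 -> dotp xi (p1 - p0) = 0 ->
    Aform Gam g x u (segpt p0 p1 t) xi xi <=
      (1 - t) * Aform Gam g x u p0 xi xi + t * Aform Gam g x u p1 xi xi
      - del * t * (1 - t) * enorm (p1 - p0) ^+ 2 * enorm xi ^+ 2.

Lemma Mx_convex (x : E) (a b : M) : Gam (pt x a) -> Gam (pt x b) ->
  g (pt x a) = g (pt x b) ->
  (forall t : R, 0 <= t <= 1 -> U'' (x, g (pt x a), pth g a b x t)) ->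
  forall (t : R) (xi : E), 0 <= t <= 1 -> dotp xi (Dp g a b x) = 0 ->
  del * (t * (1 - t)) * enorm (Dp g a b x) ^+ 2 * enorm xi ^+ 2 <=
    dotp (Mx Gam g a b x t xi) xi.
Proof.
move=> Ga Gb ab HUt t xi t01 xiD.
have sU : vsegment x (g (pt x a)) (gx g x a) (gx g x b) `<=` U''.
  move=> _ [s /= s01 <-]; apply: HUt; move: s01; by rewrite in_itv.
have := Hdel sU t01 xiD.
rewrite (Aform_pt S _ _ Ga) {2}ab (Aform_pt S _ _ Gb).
rewrite Mx_dotp.
exact: move_le.
Qed.

(** If P0 and P1 differ, |Dp| is bounded below and the trivial bound, linear in |Dp|, is also
    quadratic up to a constant. If they agree, all slopes lie in a small ball around P0 on which A
    is bounded and codimension one convex, and [zygmund] applies at fixed (x, u). *)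
Lemma cross_bound : exists2 C : R, 0 <= C & exists2 r : R, 0 < r &
  forall (x : E) (a b : M) (t : R) (xi : E), `|x - xs| < r -> `|a - as_| < r ->
    `|b - bs| < r -> 0 <= t <= 1 -> g (pt x a) = g (pt x b) ->
    dotp xi (Dp g a b x) = 0 ->
  `|dotp (Mx Gam g a b x t xi) (Dp g a b x)| <=
     C * enorm (Dp g a b x) ^+ 2 * enorm xi.
Proof.
have [B B0 [r1 r10 H1]] := hx_uniform.
have [r2 r20 H2] := base_near r10.
have [N NE] := named (n.+1%:R ^+ 2 : R).
have N0 : 0 < N by rewrite NE exprn_gt0.
have t00 : 0 <= (0 : R) <= 1 by rewrite lexx ler01.
have t11 : 0 <= (1 : R) <= 1 by rewrite lexx ler01.
have a0 : ms 0 = as_ by rewrite /ms segpt0.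
have b1 : ms 1 = bs by rewrite /ms segpt1.
have [P01|P01] := eqVneq P0 P1; last first.
  have D0 : 0 < `|P1 - P0| by rewrite normr_gt0 subr_eq0 eq_sym.
  have D20 : 0 < `|P1 - P0| / 2 by exact: divr_gt0.
  have [r3 r30 H3] := Dp_near D20.
  have [r [r0 rr1 rr2 rr3]] := min3 r10 r20 r30.
  exists (N * (2 * B) / (`|P1 - P0| / 2)).
    exact: cross_const.
  exists r; first exact: r0.
  move=> x a b t xi xr ar br t01 ab xiD.
  have ar1 : `|a - ms 0| < r1 by rewrite a0; exact: lt_le_trans ar rr1.
  have br1 : `|b - ms 1| < r1 by rewrite b1; exact: lt_le_trans br rr1.
  have xr2 := lt_le_trans xr rr2.
  have [_ [mr _ _]] := H2 x x a b t xr2 xr2 (lt_le_trans ar rr2) (lt_le_trans br rr2) t01.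
  have xr1 := lt_le_trans xr rr1.
  have ka := H1 x a 0 xr1 t00 ar1 xi; have kb := H1 x b 1 xr1 t11 br1 xi.
  have km := H1 x _ t xr1 t01 mr xi.
  have Mb : `|Mx Gam g a b x t xi| <= 2 * B * `|xi|.
    have [t0 t1] := andP t01; rewrite /Mx.
    move: ka kb km; move: (hx _ _ _) (hx _ _ _) (hx _ _ _) => A1 A2 A3 ka kb km.
    apply: le_trans (ler_normB _ _) _; rewrite -mulrA mulr2n mulrDl mul1r.
    apply: lerD km; apply: le_trans (norm_comb _ _ t0 t1) _.
    exact: convex_le t0 t1 ka kb.
  have Dl := H3 x a b (lt_le_trans xr rr3) (lt_le_trans ar rr3) (lt_le_trans br rr3).
  apply: le_trans (norm_dotp _ _) _; rewrite -NE.
  have Dge : `|P1 - P0| / 2 <= enorm (Dp g a b x).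
    apply: le_trans (norm_le_enorm _).
    move: Dl; move: (Dp g a b x) (P1 - P0) => D D' Dl; exact: half_norm_le.
  have h1 : `|Mx Gam g a b x t xi| <= 2 * B * enorm xi.
    apply: le_trans Mb _; apply: ler_wpM2l; [by rewrite mulr_ge0 // ltW|].
    exact: norm_le_enorm.
  exact: cross_real N0 B0 D20 Dge (norm_le_enorm _) h1 (enorm_ge0 _) (normr_ge0 _).
have [Ga gua gpa] := base_a; have [Gb gub gpb] := base_b.
have asb : bs = as_ by rewrite /bs -P01.
have [r3 r30 H3] := YZ_near S Ga r10; rewrite gua gpa in H3.
have [q [q0 q1 q2 q3]] := min3 r30 rho00 r10.
have [rz [rz0 rzE]] : exists rz : R, 0 < rz /\ rz = q / 2.
  by exists (q / 2); split=> //; exact: divr_gt0.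
have rzq : rz < q by rewrite rzE; exact: half_ltr.
have f0 : 0 < rz / 64 / n.+1%:R by apply: divr_gt0 => //; exact: divr_gt0.
have [r4 r40 H4] := gx_near S Ga f0; rewrite gpa in H4.
have [r5 r50 H5] := g_near S Ga q0; rewrite gua in H5.
have [r6 r60 H6] := base_near rho00.
have [s [s0 ss1 ss2 ss3 ss4]] := min4 r40 r50 q0 r60.
exists (1024 * (N * B) / rz).
  exact: zygmund_const.
exists s; first exact: s0.
move=> x a b t xi xr ar br t01 ab xiD.
have bs' : `|b - as_| < s by rewrite -asb.
have xq := lt_le_trans xr ss3.
have [Gxa h5] := H5 _ (norm_pt_lt (lt_le_trans xr ss2) (lt_le_trans ar ss2)).
have [Gxb _] := H5 _ (norm_pt_lt (lt_le_trans xr ss2) (lt_le_trans bs' ss2)).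
have en (p : E) : `|p - P0| <= rz / 64 / n.+1%:R -> enorm (p - P0) <= rz / 64.
  by move=> h; apply: le_trans (enorm_le_norm _) _; rewrite mulrC -ler_pdivlMr.
have ea := en _ (H4 x a (lt_le_trans xr ss1) (lt_le_trans ar ss1)).
have eb := en _ (H4 x b (lt_le_trans xr ss1) (lt_le_trans bs' ss1)).
have [u uE] := named (g (pt x a)); rewrite -uE in h5.
pose Phi (p v v' : E) := Aform Gam g x u p v v'.
have near (p : E) : enorm (p - P0) <= rz -> `|p - P0| < q.
  by move=> h; apply: le_lt_trans rzq; apply: le_trans (norm_le_enorm _) h.
have nU (p : E) : enorm (p - P0) <= rz -> U'' (x, u, p) /\ (
    forall v : E, `|hx g (pt x (YZ Gam g x u p)) v| <= B * `|v|).
  move=> /near pq.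
  have Up : U'' (x, u, p).
    apply: (@Hnear 0 x u p t00); [exact: lt_le_trans xq q2|exact: lt_le_trans h5 q2|].
    by rewrite segpt0; exact: lt_le_trans pq q2.
  split; [exact: Up|move=> v].
  have [_ mr] := H3 x u p (lt_le_trans xq q1) (lt_le_trans h5 q1) (lt_le_trans pq q1).
  by apply: (H1 _ _ 0 (lt_le_trans xq q3) t00); rewrite a0.
have PC (p v v' : E) : enorm (p - P0) <= rz -> Phi p v v' = Phi p v' v.
  move=> /nU[/HU Up _]; exact: (@AformC _ _ _ _ S).
have PD (p : E) (c : R) (v v' w : E) : enorm (p - P0) <= rz ->
    Phi p (c *: v + v') w = c * Phi p v w + Phi p v' w.
  move=> /nU[/HU Up _]; exact: (@AformD _ _ _ _ S).
have PB (p v : E) : enorm (p - P0) <= rz -> `|Phi p v v| <= N * B * enorm v ^+ 2.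
  move=> /nU[_ hB]; apply: le_trans (norm_dotp _ _) _; rewrite -NE -mulrA.
  apply: ler_wpM2l; first exact: ltW.
  rewrite expr2 mulrA; apply: ler_pM; [exact: normr_ge0|exact: normr_ge0| |exact: norm_le_enorm].
  apply: le_trans (hB v) _; apply: ler_wpM2l; [exact: ltW|exact: norm_le_enorm].
have Pcv (p0 p1 v : E) (c : R) : enorm (p0 - P0) <= rz -> enorm (p1 - P0) <= rz ->
    dotp v (p1 - p0) = 0 -> 0 <= c <= 1 ->
    Phi (segpt p0 p1 c) v v <= (1 - c) * Phi p0 v v + c * Phi p1 v v.
  move=> p0r p1r vp c01.
  have sr (d : R) : 0 <= d <= 1 -> enorm (segpt p0 p1 d - P0) <= rz.
    move=> /andP[d0 d1].
    have -> : segpt p0 p1 d - P0 = (1 - d) *: (p0 - P0) + d *: (p1 - P0).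
      by apply/rowP => i; rewrite !mxE; ring.
    apply: le_trans (enormD _ _) _; rewrite !enormZ (ger0_norm d0) ger0_norm ?subr_ge0 //.
    exact: convex_le.
  have sU : vsegment x u p0 p1 `<=` U''.
    move=> _ [d /= d01 <-]; have dd : 0 <= d <= 1 by move: d01; rewrite in_itv.
    by have [] := nU _ (sr d dd).
  have := Hdel sU c01 vp.
  exact: drop_le (ltW del0) c01.
have := @zygmund R n Phi rz (N * B) P0 rz0 PC PD PB Pcv (gx g x a) (gx g x b) xi t
  ea eb xiD t01.
rewrite -/(Dp g a b x).
have Pa : Phi (gx g x a) xi (Dp g a b x) = dotp (hx g (pt x a) xi) (Dp g a b x).
  by rewrite /Phi uE; exact: (Aform_pt S).
have Pb : Phi (gx g x b) xi (Dp g a b x) = dotp (hx g (pt x b) xi) (Dp g a b x).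
  by rewrite /Phi uE ab; exact: (Aform_pt S).
have MxE : dotp (Mx Gam g a b x t xi) (Dp g a b x) =
    (1 - t) * dotp (hx g (pt x a) xi) (Dp g a b x) +
    t * dotp (hx g (pt x b) xi) (Dp g a b x) - Phi (pth g a b x t) xi (Dp g a b x).
  by rewrite /Phi uE; exact: Mx_dotp.
by rewrite MxE Pa Pb.
Qed.

(** The ends a and b belong to the perturbed segment based at x0, and [max_principle_core] is
    applied with [lam] equal to half of |p1 - p0|, since [Dp_ratio] loses a factor 2 when the base
    point moves. This is how del/8 becomes del/32. *)
Lemma max_principle_near : exists2 r : R, 0 < r &
  forall (x0 : E) (u0 : R) (p0 p1 x1 : E) (t : R), `|x0 - xs| < r -> `|u0 - us| < r ->
    `|p0 - P0| < r -> `|p1 - P1| < r -> `|x1 - xs| < r -> 0 <= t <= 1 ->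
  let m s := YZ Gam g x0 u0 (segpt p0 p1 s) in
  [/\ dom_U Gam g (x0, u0, segpt p0 p1 t), Gam (pt x1 (m t)) &
    g (pt x1 (m t)) <= Num.max (g (pt x1 (m 0))) (g (pt x1 (m 1))) -
      del / 32 * (t * (1 - t) * enorm (p1 - p0) * enorm (x1 - x0)) ^+ 2].
Proof.
have e80 : 0 < 8^-1 :> R by rewrite invr_gt0.
have [r2 r20 H2] := w_close_uniform e80.
have [e [e0 er2 erho]] := min2 r20 rho00.
have [r1 r10 H1] := base_near e0.
have [r3 r30 H3] := Dp_ratio.
have [C C0 [r4 r40 H4]] := cross_bound.
have [r1' [r1'0 r1'1 r1'2]] := min2 r10 rho00.
have [rr [rr0 rr1' rr2 rr3 rr4]] := min4 r1'0 r20 r30 r40.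
have rr1 := le_trans rr1' r1'1; have rrho := le_trans rr1' r1'2.
have [Lb LbE] := named (n.+1%:R * (`|P1 - P0| + 2)).
have Lb0 : 0 <= Lb by rewrite LbE mulr_ge0 // addr_ge0.
have [kap kapE] := named (del / 8).
have kap0 : 0 <= kap by rewrite kapE; apply: divr_ge0 => //; exact: ltW.
have rr20 : 0 < rr / 2 by exact: divr_gt0.
(* rho must not depend on the perturbed segment, so the upper bound [Lb] of |p1 - p0| stands in for
   [lam] in the last condition. *)
have [rho [rho_0 rhor Crho Krho]] := rho_choice C0 (mulr_ge0 kap0 Lb0) rr20.
have [Ga gua gpa] := base_a; have [Gb gub gpb] := base_b.
have [ra ra0 Ha] := YZ_near S Ga rr0; rewrite gua gpa in Ha.
have [rb rb0 Hb] := YZ_near S Gb rr0; rewrite gub gpb in Hb.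
have q0 : 0 < rho / (2 * n.+1%:R) by apply: divr_gt0 => //; exact: mulr_gt0.
have [s1 [s10 s1a s1b s1c]] := min3 ra0 rb0 q0.
have [r [r0 rs1 rr2' r_1]] := min3 s10 rr20 ltr01.
exists r; first exact: r0.
move=> x0 u0 p0 p1 x1 t x0r u0r p0r p1r x1r t01 m.
have x0a := lt_le_trans (lt_le_trans x0r rs1) s1a.
have u0a := lt_le_trans (lt_le_trans u0r rs1) s1a.
have p0a := lt_le_trans (lt_le_trans p0r rs1) s1a.
have x0b := lt_le_trans (lt_le_trans x0r rs1) s1b.
have u0b := lt_le_trans (lt_le_trans u0r rs1) s1b.
have p1b := lt_le_trans (lt_le_trans p1r rs1) s1b.
have [Ua ar] := Ha _ _ _ x0a u0a p0a; have [Gxa gxa pxa] := YZP Ua.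
have [Ub br] := Hb _ _ _ x0b u0b p1b; have [Gxb gxb pxb] := YZP Ub.
have [a aE] := named (YZ Gam g x0 u0 p0); rewrite -aE in ar Gxa gxa pxa.
have [b bE] := named (YZ Gam g x0 u0 p1); rewrite -bE in br Gxb gxb pxb.
have mE s : mth Gam g a b x0 s = m s by rewrite /mth /pth gxa pxa pxb.
have m0 : m 0 = a by rewrite /m segpt0 aE.
have m1 : m 1 = b by rewrite /m segpt1 bE.
have x1rr2 := lt_le_trans x1r rr2'.
have rrh : rr / 2 < rr by exact: half_ltr.
have x1rr := lt_trans x1rr2 rrh.
have x0rr := lt_trans (lt_le_trans x0r rr2') rrh.
have aa := lt_le_trans ar rr1; have bb := lt_le_trans br rr1.
have [[_ _ Ut Gt] _] := H1 x0 x1 a b t (lt_le_trans x0rr rr1) (lt_le_trans x1rr rr1)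
  aa bb t01.
rewrite mE in Gt; rewrite gxa /pth pxa pxb in Ut.
split; [exact: Ut|exact: Gt|].
have DpE : Dp g a b x0 = p1 - p0 by rewrite /Dp pxa pxb.
have [p01|p01] := eqVneq p0 p1.
  have -> : m t = m 0.
    by rewrite /m p01; congr (YZ _ _ _ _ _); apply/rowP => i; rewrite !mxE; ring.
  by rewrite p01 subrr enorm0 mulr0 mul0r expr0n mulr0 subr0 le_max lexx.
have L0 : 0 < enorm (p1 - p0) by apply: enorm_gt0; rewrite subr_eq0 eq_sym.
have L20 : 0 < enorm (p1 - p0) / 2 by exact: divr_gt0.
have Lle : enorm (p1 - p0) <= Lb.
  rewrite LbE; apply: le_trans (enorm_le_norm _) _; apply: ler_wpM2l => //.
  have -> : p1 - p0 = (P1 - P0) + ((p1 - P1) - (p0 - P0)).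
    by apply/rowP => i; rewrite !mxE; ring.
  apply: le_trans (ler_normD _ _) _; rewrite lerD2l.
  apply: le_trans (ler_normB _ _) _; rewrite mulr2n; apply: lerD.
    by apply: ltW; exact: lt_le_trans p1r r_1.
  by apply: ltW; exact: lt_le_trans p0r r_1.
have klr : kap * (enorm (p1 - p0) / 2) * rho <= 4^-1.
  exact: lam_real kap0 (ltW rho_0) Lle Krho (ltW L0).
have bx (x : E) : enorm (x - x1) <= rho -> `|x - xs| < rr.
  move=> h; have -> : x - xs = (x - x1) + (x1 - xs) by rewrite addrA subrK.
  apply: le_lt_trans (ler_normD _ _) _; apply: half_sum_lt x1rr2.
  by apply: le_trans (norm_le_enorm _) _; exact: le_trans h rhor.
have zt : 0 <= (0 : R) <= 1 by rewrite lexx ler01.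
have B1 (x : E) (s : R) : enorm (x - x1) <= rho -> 0 <= s <= 1 -> _ :=
  fun h h' => H1 x x1 a b s (lt_le_trans (bx x h) rr1) (lt_le_trans x1rr rr1) aa bb h'.
have HGa (x : E) : enorm (x - x1) <= rho -> Gam (pt x a).
  by move=> h; have [[]] := B1 x 0 h zt.
have HGb (x : E) : enorm (x - x1) <= rho -> Gam (pt x b).
  by move=> h; have [[]] := B1 x 0 h zt.
have Hadm (x : E) (s : R) : enorm (x - x1) <= rho -> g (pt x a) = g (pt x b) ->
    0 <= s <= 1 -> admissible Gam g a b x1 x s.
  by move=> h _ h'; have [[k1 k2 k3 k4] _] := B1 x s h h'.
have Hw (x : E) (s : R) : enorm (x - x1) <= rho -> g (pt x a) = g (pt x b) ->
    0 <= s <= 1 -> forall (c0 : R) (w : E),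
    (forall k : M, d1 g (pt x1 (mth Gam g a b x s)) (inm k) =
      c0 * d1 g (pt x (mth Gam g a b x s)) (inm k) +
      dotp w (tx g (pt x (mth Gam g a b x s)) k)) ->
    enorm (w - (x1 - x)) <= 8^-1 * enorm (x1 - x).
  move=> h _ h' c0 w wE; have [_ [k _ _]] := B1 x s h h'.
  exact: H2 (lt_le_trans (bx x h) rr2) (lt_le_trans x1rr rr2) h' (lt_le_trans k er2) c0 w wE.
have Hlam (x : E) : enorm (x - x1) <= rho -> g (pt x a) = g (pt x b) ->
    enorm (p1 - p0) / 2 <= enorm (Dp g a b x).
  move=> h ab; apply: half_le_dbl; rewrite -DpE.
  apply: H3 ab; [exact: lt_le_trans x0rr rr3|exact: lt_le_trans (bx x h) rr3| | |].
  - exact: lt_le_trans ar rr3.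
  - exact: lt_le_trans br rr3.
  - by rewrite gxa gxb.
have HM (x : E) (s : R) (xi : E) : enorm (x - x1) <= rho -> g (pt x a) = g (pt x b) ->
    0 <= s <= 1 -> dotp xi (Dp g a b x) = 0 ->
    del * (s * (1 - s)) * enorm (Dp g a b x) ^+ 2 * enorm xi ^+ 2 <=
      dotp (Mx Gam g a b x s xi) xi /\
    `|dotp (Mx Gam g a b x s xi) (Dp g a b x)| <=
      C * enorm (Dp g a b x) ^+ 2 * enorm xi.
  move=> h ab h' xiD; split.
    apply: Mx_convex h' xiD; [exact: HGa|exact: HGb|exact: ab|].
    move=> c c01; have [_ [_ k1 k2]] := B1 x c h c01.
    apply: Hnear c01 _ _ _; last exact: lt_le_trans k2 erho.
      exact: lt_le_trans (bx x h) rrho.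
    exact: lt_le_trans k1 erho.
  exact: H4 (lt_le_trans (bx x h) rr4) (lt_le_trans ar rr4) (lt_le_trans br rr4) h' ab xiD.
have x01 : enorm (x0 - x1) <= rho.
  apply: le_trans (enorm_le_norm _) _.
  have := dist_near x0r x1r => k.
  have k2 : `|x0 - x1| <= 2 * (rho / (2 * n.+1%:R)).
    apply: ltW; apply: lt_le_trans k _; rewrite mulr2n mulrDl mul1r.
    by apply: lerD; exact: le_trans rs1 s1c.
  apply: le_trans (ler_wpM2l _ k2) _ => //.
  by rewrite dbl_div.
have := max_principle_core S rho_0 HGa HGb del0 kapE L20 C0 Crho klr Hadm Hw Hlam HM
  x01 (_ : g (pt x0 a) = g (pt x0 b)) t01.
rewrite mE -m0 -m1 (enormB x0 x1) kapE => H; apply: mp_final; apply: H.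
by rewrite m0 m1 gxa gxb.
Qed.

End Base.

Lemma zero_in01 (R : realFieldType) : 0 <= (0 : R) <= 1.
Proof. by rewrite lexx ler01. Qed.

Lemma one_in01 (R : realFieldType) : 0 <= (1 : R) <= 1.
Proof. by rewrite ler01 lexx. Qed.

Lemma half_in01 (R : realFieldType) : 0 <= (2^-1 : R) <= 1.
Proof. by apply/andP; split; lra. Qed.

Section Codimension_one.
Context {R : realType} {n : nat}.
Local Notation E := 'rV[R]_n.

Lemma vsegment_mem (x : E) (u : R) (p0 p1 : E) (t : R) (U : set (E * R * E)) :
  vsegment x u p0 p1 `<=` U -> 0 <= t <= 1 -> U (x, u, segpt p0 p1 t).
Proof. by move=> sU t01; apply: sU; exists t => //; rewrite /= in_itv. Qed.

Lemma vsegment_sub (x : E) (u : R) (p0 p1 : E) (s t : R) (U : set (E * R * E)) :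
  vsegment x u p0 p1 `<=` U -> 0 <= s <= 1 -> 0 <= t <= 1 ->
  vsegment x u (segpt p0 p1 s) (segpt p0 p1 t) `<=` U.
Proof.
move=> sU /andP[s0 s1] /andP[t0 t1] _ [r /= r01 <-]; rewrite segpt_sub.
apply: vsegment_mem => //; move: r01; rewrite in_itv /= => /andP[r0 r1].
by apply/andP; split; [rewrite addr_ge0 ?mulr_ge0 // subr_ge0|exact: convex_le].
Qed.

Definition codim1_convex_on (U : set (E * R * E)) (F : E -> R -> E -> E -> R)
    (del : R) : Prop :=
  forall (x : E) (u : R) (p0 p1 : E), vsegment x u p0 p1 `<=` U ->
  forall (t : R) (xi : E), 0 <= t <= 1 -> dotp xi (p1 - p0) = 0 ->
    F x u (segpt p0 p1 t) xi <= (1 - t) * F x u p0 xi + t * F x u p1 xi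
      - del * t * (1 - t) * enorm (p1 - p0) ^+ 2 * enorm xi ^+ 2.

Definition codim1_convex (U : set (E * R * E)) (F : E -> R -> E -> E -> R) : Prop :=
  forall U' : set (E * R * E), compactly_contained U' U ->
  exists2 del : R, 0 < del & codim1_convex_on U' F del.

Lemma codim1_convexP (U : set (E * R * E)) (A : E -> R -> E -> 'M[R]_n)
    (F : E -> R -> E -> E -> R) :
  (forall x u p xi, U (x, u, p) -> quadf (A x u p) xi = F x u p xi) ->
  unif_codim1_convex U A <-> codim1_convex U F.
Proof.
move=> AF.
have key (U' : set (E * R * E)) (x : E) (u : R) (p0 p1 : E) (t : R) (xi : E) :
    compactly_contained U' U -> vsegment x u p0 p1 `<=` U' -> 0 <= t <= 1 ->
  [/\ quadf (A x u (segpt p0 p1 t)) xi = F x u (segpt p0 p1 t) xi,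
      quadf (A x u p0) xi = F x u p0 xi & quadf (A x u p1) xi = F x u p1 xi].
  move=> [_ cU] sU t01.
  have h s : 0 <= s <= 1 -> U (x, u, segpt p0 p1 s).
    by move=> s01; apply: cU; apply: subset_closure; exact: vsegment_mem sU s01.
  have h0 := h 0; have h1 := h 1; rewrite segpt0 in h0; rewrite segpt1 in h1.
  by split; apply: AF; [exact: h|apply: h0|apply: h1]; rewrite lexx ler01.
split=> H U' cU; have [del del0 Hd] := H U' cU; exists del => //.
  move=> x u p0 p1 sU t xi t01 xip.
  have [<- <- <-] := key U' x u p0 p1 t xi cU sU t01; exact: Hd.
move=> x u p0 p1 sU t xi t01 xip.
have [-> -> ->] := key U' x u p0 p1 t xi cU sU t01; exact: Hd.
Qed.

End Codimension_one.

(** * The local maximum principle and its infinitesimal form *)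

Section Star.
Context {R : realType} {n : nat}.
Local Notation E := 'rV[R]_n.
Local Notation W := (E * E * R)%type.
Local Notation M := (E * R)%type.
Variables (Gam : set W) (g : W -> R).
Hypothesis S : generating_system Gam g.
Let oG := s_open S.
Let gC := s_C2 S.
Let hW : finite_coords W := W_coords.

(** The constant is fixed before the base data and only the radius depends on them. This is the
    order of quantifiers of A3s(2), and [star_at] inherits it. *)
Definition max_principle_at (kap : R) (xs : E) (us : R) (P0 P1 : E) : Prop :=
  exists2 r : R, 0 < r &
  forall (x0 : E) (u0 : R) (p0 p1 x1 : E) (t : R), `|x0 - xs| < r -> `|u0 - us| < r ->
    `|p0 - P0| < r -> `|p1 - P1| < r -> `|x1 - xs| < r -> 0 <= t <= 1 ->
  let m s := YZ Gam g x0 u0 (segpt p0 p1 s) in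
  [/\ dom_U Gam g (x0, u0, segpt p0 p1 t), Gam (pt x1 (m t)) &
    g (pt x1 (m t)) <= Num.max (g (pt x1 (m 0))) (g (pt x1 (m 1))) -
      kap * (t * (1 - t) * enorm (p1 - p0) * enorm (x1 - x0)) ^+ 2].

Definition Aform_A3s : Prop :=
  codim1_convex (dom_U Gam g) (fun x u p xi => Aform Gam g x u p xi xi).

Lemma A3sP : condA3s Gam g <-> Aform_A3s.
Proof. by apply: codim1_convexP => x u p xi; exact: (quadf_Aform S). Qed.

Lemma max_principle (U' : set (E * R * E)) : Aform_A3s ->
  compactly_contained U' (dom_U Gam g) -> exists2 kap : R, 0 < kap &
  forall xs us P0 P1, vsegment xs us P0 P1 `<=` U' -> max_principle_at kap xs us P0 P1.
Proof.
move=> A cU; have [rho rho0 [U'' cU'' HU]] := compact_thicken proper_U (dom_U_open S) cU.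
have [del del0 Hd] := A U'' cU''.
exists (del / 32); first exact: divr_gt0.
move=> xs us P0 P1 sU.
have sub : U' `<=` dom_U Gam g by move=> w /subset_closure; exact: cU.2.
have sub'' : U'' `<=` dom_U Gam g by move=> w /subset_closure; exact: cU''.2.
apply: (max_principle_near S _ del0 rho0 sub'' _ Hd).
  by move=> t t01; apply: sub; exact: vsegment_mem sU t01.
move=> t x u p t01 h1 h2 h3; apply: (HU (xs, us, segpt P0 P1 t)).
  by apply: subset_closure; exact: vsegment_mem sU t01.
by apply: ltW; rewrite !prod_normE /= !gt_max h1 h2.
Qed.

(* The form of the maximum principle obtained by letting theta tend to 0. *)
Definition star_at (c : R) (xs : E) (us : R) (P0 P1 : E) : Prop :=
  exists2 r : R, 0 < r &
  forall (x0 : E) (u0 : R) (p0 p1 x1 : E), `|x0 - xs| < r -> `|u0 - us| < r ->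
    `|p0 - P0| < r -> `|p1 - P1| < r -> `|x1 - xs| < r ->
  let m0 := YZ Gam g x0 u0 p0 in let m1 := YZ Gam g x0 u0 p1 in
  g (pt x1 m1) - g (pt x1 m0) < c * (enorm (p1 - p0) * enorm (x1 - x0)) ^+ 2 ->
  forall k : M, d1 g (pt x0 m0) (inm k) = 0 -> tx g (pt x0 m0) k = p1 - p0 ->
  d1 g (pt x1 m0) (inm k) <= 0.

Lemma max_lt_real (G G0 G1 q d c : R) : G <= Num.max G0 G1 - 16 * c * (q * d) ^+ 2 ->
  G1 - G0 < c * d ^+ 2 -> q = 4^-1 -> 0 <= c -> G <= G0.
Proof.
move=> h1 h2 qE c0; rewrite qE in h1.
have d0 : 0 <= c * d ^+ 2 by rewrite mulr_ge0 // sqr_ge0.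
have e1 : 16 * c * (4^-1 * d) ^+ 2 = c * d ^+ 2 by field.
rewrite e1 in h1.
by move: h1; rewrite /Num.max; case: ifP => _ h1; lra.
Qed.

(** At t = 1/2 the strict term of the maximum principle outweighs the allowed excess of m1 over m0,
    so the midpoint does not exceed m0; the factor 16 is the inverse square of t (1 - t). The
    maximum principle on the first half then keeps every member up to the midpoint below m0, and the
    derivative at t = 0 is nonpositive. *)
Lemma max_principle_star (kap : R) (xs : E) (us : R) (P0 P1 : E) : 0 < kap ->
  max_principle_at kap xs us P0 P1 ->
  max_principle_at kap xs us P0 (segpt P0 P1 2^-1) ->
  star_at (kap / 16) xs us P0 P1.
Proof.
move=> kap0 [r1 r10 H1] [r2 r20 H2].
have r22 : 0 < r2 / 2 by exact: divr_gt0.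
have [r [r0 rr1 rr2]] := min2 r10 r22.
have r2r : r2 / 2 < r2 by exact: half_ltr.
exists r; first exact: r0.
move=> x0 u0 p0 p1 x1 x0r u0r p0r p1r x1r m0 m1 gl k k1 k2.
have h01 := half_in01 R.
have z01 := zero_in01 R.
have [_ _ mid] := H1 x0 u0 p0 p1 x1 2^-1 (lt_le_trans x0r rr1) (lt_le_trans u0r rr1)
  (lt_le_trans p0r rr1) (lt_le_trans p1r rr1) (lt_le_trans x1r rr1) h01.
rewrite /= segpt0 segpt1 -/m0 -/m1 in mid.
have qE : 2^-1 * (1 - 2^-1) = 4^-1 :> R by field.
have gmid : g (pt x1 (YZ Gam g x0 u0 (segpt p0 p1 2^-1))) <= g (pt x1 m0).
  apply: (@max_lt_real _ _ (g (pt x1 m1)) _ (enorm (p1 - p0) * enorm (x1 - x0)) (kap / 16) _ gl qE).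
    have -> : 16 * (kap / 16) = kap by field.
    by move: mid; rewrite -!mulrA.
  by apply: ltW; exact: divr_gt0.
have x02 := lt_trans (lt_le_trans x0r rr2) r2r.
have u02 := lt_trans (lt_le_trans u0r rr2) r2r.
have p02 := lt_trans (lt_le_trans p0r rr2) r2r.
have x12 := lt_trans (lt_le_trans x1r rr2) r2r.
have pm2 : `|segpt p0 p1 2^-1 - segpt P0 P1 2^-1| < r2.
  have -> : segpt p0 p1 2^-1 - segpt P0 P1 2^-1 = (1 - 2^-1) *: (p0 - P0) + 2^-1 *: (p1 - P1).
    by apply/rowP => i; rewrite !mxE; ring.
  have [h0 h1] := andP h01; apply: le_lt_trans (norm_comb _ _ h0 h1) _.
  apply: le_lt_trans r2r; apply: convex_le => //; apply: ltW.
    exact: lt_le_trans p0r rr2.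
  exact: lt_le_trans p1r rr2.
have quasi (s : R) : 0 <= s -> s <= 2^-1 -> g (pt x1 (YZ Gam g x0 u0 (segpt p0 p1 s))) <= g (pt x1 m0).
  move=> s0 s1; have s01 : 0 <= 2 * s <= 1.
    by apply/andP; split; lra.
  have [_ _] := H2 x0 u0 p0 (segpt p0 p1 2^-1) x1 (2 * s) x02 u02 p02 pm2 x12 s01.
  have -> : segpt p0 (segpt p0 p1 2^-1) (2 * s) = segpt p0 p1 s.
    by rewrite -{1}(segpt0 p0 p1) segpt_sub; congr (segpt _ _ _); field.
  rewrite /= segpt0 segpt1 => h; apply: le_trans h _.
  rewrite lerBlDr -[leLHS]addr0; apply: lerD; first by rewrite ge_max lexx.
  by apply: mulr_ge0; [exact: ltW|exact: sqr_ge0].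
have [U0 G1 _] := H2 x0 u0 p0 (segpt p0 p1 2^-1) x1 0 x02 u02 p02 pm2 x12 z01.
rewrite /= segpt0 -/m0 in U0 G1.
have [G0 g0 gp0] := YZP U0; rewrite -/m0 in G0 g0 gp0.
have o01 := one_in01 R.
have [U1 _ _] := H1 x0 u0 p0 p1 x1 1 (lt_le_trans x0r rr1) (lt_le_trans u0r rr1)
  (lt_le_trans p0r rr1) (lt_le_trans p1r rr1) (lt_le_trans x1r rr1) o01.
rewrite segpt1 in U1; have [Gb gb gpb] := YZP U1; rewrite -/m1 in Gb gb gpb.
have mE s : mth Gam g m0 m1 x0 s = YZ Gam g x0 u0 (segpt p0 p1 s).
  by rewrite /mth /pth g0 gp0 gpb.
have adm : admissible Gam g m0 m1 x1 x0 0.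
  split; [exact: G0|exact: Gb| |by rewrite mE segpt0].
  by rewrite g0 /pth gp0 segpt0.
have [c0 [w wE]] := dual_form S G0 G1.
have wE' : forall k : M, d1 g (pt x1 (mth Gam g m0 m1 x0 0)) (inm k) =
    c0 * d1 g (pt x0 (mth Gam g m0 m1 x0 0)) (inm k) +
    dotp w (tx g (pt x0 (mth Gam g m0 m1 x0 0)) k) by rewrite mE segpt0.
rewrite wE k1 mulr0 add0r k2.
have DE : Dp g m0 m1 x0 = p1 - p0 by rewrite /Dp gp0 gpb.
apply: small_slope_le => e e0.
have [q q0 Hq] := theta_variation S adm z01 wE' e0.
have h20 : 0 < 2^-1 :> R by rewrite invr_gt0.
have q20 : 0 < q / 2 by exact: divr_gt0.
have [s [s0 sq s2]] := min2 q20 h20.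
exists s; first exact: s0.
have sq' : `|s| < q by rewrite gtr0_norm //; exact: le_lt_trans sq (half_ltr q0).
have := Hq s sq'; rewrite add0r !mE segpt0 -/m0 DE (gtr0_norm s0) ler_norml => /andP[h _].
have := quasi s (ltW s0) s2; lra.
Qed.

End Star.

(** * Equivalence with A3s(2) *)

Lemma dxn_real (R : realFieldType) (s a b X : R) : 0 <= s -> s <= 1 -> 0 <= b ->
  X = a + b + 1 -> s * a + s ^+ 2 * b <= s * X.
Proof.
move=> s0 s1 b0 ->.
have : s * (s * b) <= s * (1 * b) by rewrite ler_wpM2l // ler_wpM2r.
lra.
Qed.

Lemma eps_sqr_le (R : realFieldType) (e a : R) : 0 <= e -> e / (a ^+ 2 + 1) * a * a <= e.
Proof.
move=> e0; have a0 : 0 < a ^+ 2 + 1 by rewrite ltr_wpDl // sqr_ge0.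
rewrite -mulrA -expr2 mulrAC ler_pdivrMr //; apply: ler_wpM2l => //.
by rewrite lerDl.
Qed.

Lemma curve_rest (R : realFieldType) (s a b p q h Z Z0 : R) : 0 < s -> s <= 1 ->
  `|Z0 + s * p + s ^+ 2 * q + 2^-1 * (s ^+ 2 * h + s * (s ^+ 2 * (2 * a + s * b))) -
    (Z0 + s * p + s ^+ 2 * (q + 2^-1 * h))| <= s * (s ^+ 2 * (`|a| + `|b|)).
Proof.
move=> s0 s1.
have -> : Z0 + s * p + s ^+ 2 * q + 2^-1 * (s ^+ 2 * h + s * (s ^+ 2 * (2 * a + s * b))) -
    (Z0 + s * p + s ^+ 2 * (q + 2^-1 * h)) = s * (s ^+ 2 * (a + s / 2 * b)) by field.
rewrite normrM (gtr0_norm s0) normrM (ger0_norm (sqr_ge0 s)).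
apply: ler_wpM2l; first exact: ltW.
apply: ler_wpM2l; first exact: sqr_ge0.
apply: le_trans (ler_normD _ _) _; rewrite lerD2l normrM.
by apply: ler_piMl => //; rewrite ger0_norm; lra.
Qed.

Lemma curve_real (R : realFieldType) (e e1 K X A s q T d : R) : 0 < e -> 0 <= s ->
  0 <= X -> 0 <= K -> e1 * X ^+ 2 <= e / 2 -> s * K <= e / 2 -> d <= s * X -> 0 <= d ->
  `|A - T| <= e1 * d ^+ 2 -> 0 < e1 -> `|T - q| <= s * (s ^+ 2 * K) ->
  `|A - q| <= e * s ^+ 2.
Proof.
move=> e0 s0 X0 K0 h1 h2 h3 d0 h4 e10 h5.
have -> : A - q = (A - T) + (T - q) by rewrite addrA subrK.
apply: le_trans (ler_normD _ _) _.
have k1 : d ^+ 2 <= (s * X) ^+ 2 by rewrite ler_sqr ?nnegrE // mulr_ge0.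
have k2 : e1 * d ^+ 2 <= e1 * (s * X) ^+ 2 by rewrite ler_pM2l.
have e2 : e1 * (s * X) ^+ 2 = s ^+ 2 * (e1 * X ^+ 2) by ring.
have k3 : s ^+ 2 * (e1 * X ^+ 2) <= s ^+ 2 * (e / 2) by rewrite ler_wpM2l ?sqr_ge0.
have k4 : s ^+ 2 * (s * K) <= s ^+ 2 * (e / 2) by rewrite ler_wpM2l ?sqr_ge0.
have e3 : s * (s ^+ 2 * K) = s ^+ 2 * (s * K) by ring.
rewrite e2 in k2; rewrite e3 in h5; lra.
Qed.

Lemma test_real (R : realFieldType) (K u s pxi pv c h0 hp hm e gv g0 gp gm d x : R) :
  0 < s -> 0 <= K -> c = (hm - hp) / 4 -> s ^+ 2 * x <= d ->
  `|g0 - u - s * pxi - s ^+ 2 * (pv + 2^-1 * h0)| <= e * s ^+ 2 ->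
  `|gp - u - s * pxi - s ^+ 2 * (pv + c + 2^-1 * hp)| <= e * s ^+ 2 ->
  `|gm - u - s * pxi - s ^+ 2 * (pv - c + 2^-1 * hm)| <= e * s ^+ 2 ->
  g0 <= Num.max gm gp - K * d ->
  s ^+ 2 * (2^-1 * h0 - (hp + hm) / 4 + K * x) <= 2 * e * s ^+ 2.
Proof.
move=> s0 K0 cE xd; rewrite !ler_norml => /andP[h1 _] /andP[_ h2] /andP[_ h3] h4.
have h5 : K * (s ^+ 2 * x) <= K * d by rewrite ler_wpM2l.
have h6 : Num.max gm gp <= u + s * pxi + s ^+ 2 * (pv + (hp + hm) / 4) + e * s ^+ 2.
  have e1 : pv + c + 2^-1 * hp = pv + (hp + hm) / 4 by rewrite cE; field.
  have e2 : pv - c + 2^-1 * hm = pv + (hp + hm) / 4 by rewrite cE; field.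
  rewrite e1 in h2; rewrite e2 in h3.
  rewrite ge_max; apply/andP; split; lra.
lra.
Qed.

Lemma half_final (R : realFieldType) (a b c K x : R) :
  2^-1 * a - (b + c) / 4 + K * x <= 0 -> a <= (b + c) / 2 - 2 * K * x.
Proof. lra. Qed.

Lemma norm_curve (R : realFieldType) (V : normedModType R) (xi v : V) (s : R) : 0 < s ->
  `|s *: xi + s ^+ 2 *: v| <= s * `|xi| + s ^+ 2 * `|v|.
Proof.
move=> s0; apply: le_trans (ler_normD _ _) _; rewrite (normrZ s xi) (normrZ (s ^+ 2) v).
by rewrite (gtr0_norm s0) (ger0_norm (sqr_ge0 s)).
Qed.

Lemma quad_expand (R : realType) n (A B xi v : 'rV[R]_n) (s : R) :
  dotp B xi = dotp A v ->
  dotp (s *: A + s ^+ 2 *: B) (s *: xi + s ^+ 2 *: v) =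
  s ^+ 2 * dotp A xi + s * (s ^+ 2 * (2 * dotp A v + s * dotp B v)).
Proof. by move=> sym; rewrite !dotpDDl !dotpDDr !dotpZl !dotpZr sym; ring. Qed.

(** * Taylor expansion along parabolas and the second order test *)

Section Second_order.
Context {R : realType} {n : nat}.
Local Notation E := 'rV[R]_n.
Local Notation W := (E * E * R)%type.
Local Notation M := (E * R)%type.
Variables (Gam : set W) (g : W -> R).
Hypothesis S : generating_system Gam g.
Let oG := s_open S.
Let gC := s_C2 S.
Let hW : finite_coords W := W_coords.

(** The term s^2 v is felt through the gradient only; its effect on the Hessian term is of order
    s^3. *)
Lemma taylor_curve (x0 : E) (m : M) (xi v : E) : Gam (pt x0 m) -> forall e : R, 0 < e ->
  exists2 s0 : R, 0 < s0 & forall s : R, 0 < s -> s < s0 ->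
  Gam (pt (x0 + (s *: xi + s ^+ 2 *: v)) m) /\
  `|g (pt (x0 + (s *: xi + s ^+ 2 *: v)) m) - g (pt x0 m) - s * dotp (gx g x0 m) xi -
    s ^+ 2 * (dotp (gx g x0 m) v + 2^-1 * dotp (hx g (pt x0 m) xi) xi)| <= e * s ^+ 2.
Proof.
move=> GP e e0.
have [P PE] := named (pt x0 m); rewrite -PE in GP *.
have [X XE] := named (`|xi| + `|v| + 1).
have X0 : 0 < X by rewrite XE ltr_wpDl // addr_ge0.
have [K KE] := named (`|dotp (hx g P xi) v| + `|dotp (hx g P v) v|).
have K0 : 0 <= K by rewrite KE addr_ge0.
have f0 : 0 < e / 2 / X ^+ 2 by apply: divr_gt0; [exact: divr_gt0|exact: exprn_gt0].
have [r r0 Hr] := taylor hW oG gC GP f0.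
have k1 : 0 < r / X by exact: divr_gt0.
have k2 : 0 < e / 2 / (K + 1) by apply: divr_gt0; [exact: divr_gt0|rewrite ltr_wpDl].
have [s0 [s00 sr s1 sK]] := min3 k1 ltr01 k2.
exists s0; first exact: s00.
move=> s sp ss0.
have s1' : s <= 1 by apply: ltW; exact: lt_le_trans ss0 s1.
have [dx dxE] := named (s *: xi + s ^+ 2 *: v); rewrite -dxE.
have dxn : `|dx| <= s * X.
  rewrite dxE; apply: le_trans (norm_curve _ _ sp) _.
  exact: dxn_real (ltW sp) s1' (normr_ge0 _) XE.
have dxr : `|dx| < r.
  apply: le_lt_trans dxn _; rewrite -ltr_pdivlMr //; exact: lt_le_trans ss0 sr.
have zz : `|P - P| < r by rewrite subrr normr0.
have BA : pt (x0 + dx) m - P = inx dx.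
  have e0' : x0 + dx - x0 = dx by rewrite addrC addKr.
  by rewrite PE ptBx e0'.
have QP : `|pt (x0 + dx) m - P| < r by rewrite BA norm_inx.
have [GQ _] := Hr _ _ QP QP; split; first exact: GQ.
have [_ T] := Hr _ _ zz QP; rewrite BA norm_inx in T.
have e1 : d1 g P (inx dx) = s * dotp (gx g x0 m) xi + s ^+ 2 * dotp (gx g x0 m) v.
  rewrite PE -(gxE S _ (_ : Gam (pt x0 m))) -?PE //.
  by rewrite dxE dotpDDr !dotpZr.
have hv (c : R) (z : E) : hx g P (c *: z) = c *: hx g P z.
  have h0 : hx g P 0 = 0 by exact: (hx0 S).
  by have := hxD S c z 0 GP; rewrite !addr0 h0 addr0.
have e2 : d2 g P (inx dx) (inx dx) = s ^+ 2 * dotp (hx g P xi) xi +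
   s * (s ^+ 2 * (2 * dotp (hx g P xi) v + s * dotp (hx g P v) v)).
  have sym : dotp (hx g P v) xi = dotp (hx g P xi) v.
    transitivity (d2 g P (inx v) (inx xi)); first exact: (hxE S).
    transitivity (d2 g P (inx xi) (inx v)); last exact/esym/(hxE S).
    exact: (d2C hW oG gC GP).
  transitivity (dotp (hx g P dx) dx); first exact/esym/(hxE S).
  have hdx : hx g P dx = s *: hx g P xi + s ^+ 2 *: hx g P v.
    rewrite dxE -(hv (s ^+ 2) v); exact: (hxD S).
  by rewrite hdx dxE; exact: quad_expand.
rewrite e1 e2 in T.
rewrite [x0 + dx]addrC in T *.
move: T; move: (g (pt (dx + x0) m)) (g P) => A B T.
have -> : A - B - s * dotp (gx g x0 m) xi -
   s ^+ 2 * (dotp (gx g x0 m) v + 2^-1 * dotp (hx g P xi) xi) =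
   A - (B + s * dotp (gx g x0 m) xi +
   s ^+ 2 * (dotp (gx g x0 m) v + 2^-1 * dotp (hx g P xi) xi)) by ring.
apply: (curve_real e0 (ltW sp) (ltW X0) K0 _ _ dxn (normr_ge0 _) _ f0).
- by rewrite divfK // expf_eq0 /= gt_eqF.
- apply: (@le_trans _ _ (s * (K + 1))).
    by rewrite ler_wpM2l ?(ltW sp) // lerDl.
  by rewrite -ler_pdivlMr ?ltr_wpDl //; apply: ltW; exact: lt_le_trans ss0 sK.
- by move: T; rewrite -!addrA -!opprD !addrA; apply.
rewrite KE; exact: curve_rest.
Qed.

(** The two competitors have slopes differing from that of m0 by D and -D. Along x0 + s xi + s^2 v
    with xi orthogonal to D all three functions agree to first order. The component of v along D is
    free, and it is used to make the competitors agree to second order as well, so that their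
    maximum becomes their mean. *)
Lemma second_order_test (x0 : E) (u0 : R) (m0 mp mm : M) (D xi : E) (K r0 : R) :
  Gam (pt x0 m0) -> Gam (pt x0 mp) -> Gam (pt x0 mm) ->
  g (pt x0 m0) = u0 -> g (pt x0 mp) = u0 -> g (pt x0 mm) = u0 ->
  gx g x0 mp = gx g x0 m0 + D -> gx g x0 mm = gx g x0 m0 - D -> D != 0 ->
  dotp xi D = 0 -> 0 <= K -> 0 < r0 ->
  (forall x : E, `|x - x0| < r0 -> g (pt x m0) <=
     Num.max (g (pt x mm)) (g (pt x mp)) - K * enorm (x - x0) ^+ 2) ->
  dotp (hx g (pt x0 m0) xi) xi <= (dotp (hx g (pt x0 mp) xi) xi +
    dotp (hx g (pt x0 mm) xi) xi) / 2 - 2 * K * enorm xi ^+ 2.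
Proof.
move=> G0 Gp Gm g0 gp gm pp pm Dn0 xiD K0 r00 H.
have [h0 h0E] := named (dotp (hx g (pt x0 m0) xi) xi).
have [hp hpE] := named (dotp (hx g (pt x0 mp) xi) xi).
have [hm hmE] := named (dotp (hx g (pt x0 mm) xi) xi).
have DD : dotp D D != 0 by rewrite -enorm_sqr expf_eq0 /= gt_eqF // enorm_gt0.
(* Solves hp/2 + D.v = hm/2 - D.v for v along D. *)
have [c cE] := named ((hm - hp) / 4 / dotp D D).
have [v vE] := named (c *: D).
have Dv : dotp D v = (hm - hp) / 4 by rewrite vE dotpZr cE divfK.
have Dxi : dotp D xi = 0 by rewrite dotpC.
suff F : 2^-1 * h0 - (hp + hm) / 4 + K * enorm xi ^+ 2 <= 0.
  by rewrite h0E hpE hmE in F; exact: half_final.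
apply: small_slope_le => e e0.
have e20 : 0 < e / 2 by exact: divr_gt0.
have [s1 s10 H1] := taylor_curve xi v G0 e20.
have [s2 s20 H2] := taylor_curve xi v Gp e20.
have [s3 s30 H3] := taylor_curve xi v Gm e20.
have [X XE] := named (`|xi| + `|v| + 1).
have X0 : 0 < X by rewrite XE ltr_wpDl // addr_ge0.
have k1 : 0 < r0 / X by exact: divr_gt0.
have [s4 [s40 s41 s42 s43 s44]] := min4 s10 s20 s30 k1.
have [s5 [s50 s54 s51]] := min2 s40 ltr01.
have sq : 0 < s5 / 2 by exact: divr_gt0.
exists ((s5 / 2) ^+ 2); first exact: exprn_gt0.
have ss : s5 / 2 < s4 by apply: lt_le_trans (half_ltr s50) s54.
have s1' : s5 / 2 <= 1 by apply: ltW; exact: lt_le_trans (half_ltr s50) s51.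
move: sq ss s1'; move: (s5 / 2) => s sp ss s1'.
have [_ T1] := H1 s sp (lt_le_trans ss s41).
have [_ T2] := H2 s sp (lt_le_trans ss s42).
have [_ T3] := H3 s sp (lt_le_trans ss s43).
have [dx dxE] := named (s *: xi + s ^+ 2 *: v); rewrite -dxE in T1 T2 T3.
have dxn : `|dx| <= s * X.
  rewrite dxE; apply: le_trans (norm_curve _ _ sp) _.
  exact: dxn_real (ltW sp) s1' (normr_ge0 _) XE.
have dxr : `|x0 + dx - x0| < r0.
  rewrite addrC addKr; apply: le_lt_trans dxn _.
  by rewrite -ltr_pdivlMr //; exact: lt_le_trans ss s44.
have := H _ dxr; rewrite [x0 + dx - x0]addrC addKr => Hx.
rewrite -h0E g0 in T1; rewrite -hpE gp pp !dotpDDl Dv Dxi addr0 in T2.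
rewrite -hmE gm pm !dotpBl Dv Dxi subr0 in T3.
have e2 : e * s ^+ 2 = 2 * (e / 2) * s ^+ 2 by field.
have xid : s ^+ 2 * enorm xi ^+ 2 <= enorm dx ^+ 2.
  have xiv : dotp xi v = 0 by rewrite vE dotpZr xiD mulr0.
  have vxi : dotp v xi = 0 by rewrite dotpC.
  rewrite dxE !enorm_sqr dotpDDl !dotpDDr !dotpZl !dotpZr xiv vxi !mulr0 addr0 add0r.
  by rewrite mulrA -expr2 lerDl mulrA mulr_ge0 ?dotp_ge0 // -expr2 sqr_ge0.
rewrite e2; exact: test_real sp K0 erefl xid T1 T2 T3 Hx.
Qed.

Lemma Aform_segment_continuous (x : E) (u : R) (p0 p1 xi : E) :
  (forall t : R, 0 <= t <= 1 -> dom_U Gam g (x, u, segpt p0 p1 t)) ->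
  {within `[0, 1], continuous (fun t => Aform Gam g x u (segpt p0 p1 t) xi xi)}.
Proof.
move=> seg; apply: continuous_in_subspaceT => t; rewrite inE /= in_itv /= => t01.
have [GP gu gp] := YZP (seg t t01).
have AE (t' : R) : dom_U Gam g (x, u, segpt p0 p1 t') ->
    Aform Gam g x u (segpt p0 p1 t') xi xi =
    d2 g (pt x (YZ Gam g x u (segpt p0 p1 t'))) (inx xi) (inx xi).
  by move=> /YZP[G _ _]; exact: (hxE S).
apply: continuous_eps => e e0.
have f0 : 0 < e / (`|xi| ^+ 2 + 1) by apply: divr_gt0 => //; rewrite ltr_wpDl // sqr_ge0.
have [r1 r10 H1] := d2_near hW oG gC GP f0.
have [r2 r20 H2] := YZ_near S GP r10; rewrite gu gp in H2.
have D0 : 0 < `|p1 - p0| + 1 by rewrite ltr_wpDl.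
have zz (V : normedModType R) (z : V) : `|z - z| < r2 by rewrite subrr normr0.
exists (r2 / (`|p1 - p0| + 1)); first exact: divr_gt0.
move=> t' tt; have pp : `|segpt p0 p1 t' - segpt p0 p1 t| < r2.
  rewrite segptB normrZ; move: tt; rewrite ltr_pdivlMr //; apply: le_lt_trans.
  by apply: ler_wpM2l => //; rewrite lerDl.
have [U' m'] := H2 x u _ (zz _ _) (zz _ _) pp.
rewrite (AE _ U') (AE _ (seg t t01)).
have zx : `|x - x| < r1 by rewrite subrr normr0.
have [_ H] := H1 _ (norm_pt_lt zx m').
rewrite distrC; apply: le_trans (H (inx xi) (inx xi)) _; rewrite !norm_inx.
exact: eps_sqr_le (ltW e0).
Qed.

End Second_order.

Lemma LC_real (R : realFieldType) (d0 r D X h hp hm : R) :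
  h <= (hp + hm) / 2 - 2 * (d0 * (4^-1 * (2 * r * D)) ^+ 2) * X ^+ 2 ->
  h <= (hp + hm) / 2 - d0 / 2 * D ^+ 2 * X ^+ 2 * r ^+ 2.
Proof.
move=> h1; apply: le_trans h1 _; rewrite le_eqVlt; apply/orP; left; apply/eqP.
by congr (_ - _); field.
Qed.

Lemma range_pm (R : realFieldType) (t r : R) : 0 <= t - r -> t + r <= 1 -> 0 < r ->
  [/\ 0 <= t - r <= 1, 0 <= t + r <= 1 & 0 <= t <= 1].
Proof. by move=> h1 h2 h3; split; apply/andP; split; lra. Qed.

Lemma small_range (R : realFieldType) (t r0 : R) : 0 < t -> t < 1 -> 0 < r0 ->
  exists r : R, [/\ 0 < r, r < r0, 0 <= t - r & t + r <= 1].
Proof.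
move=> t0 t1 r00; have t1' : 0 < 1 - t by rewrite subr_gt0.
have r02 : 0 < r0 / 2 by rewrite divr_gt0.
have [r [h1 h2 h3 h4]] := min3 t0 t1' r02.
by exists r; split; lra.
Qed.

Lemma segment_real (R : realFieldType) (k1 t a b : R) :
  k1 * a ^+ 2 * b ^+ 2 / 2 * (t * (1 - t)) = k1 / 2 * t * (1 - t) * a ^+ 2 * b ^+ 2.
Proof. by field. Qed.

Section A3s2.
Context {R : realType} {n : nat}.
Local Notation E := 'rV[R]_n.
Local Notation W := (E * E * R)%type.
Local Notation M := (E * R)%type.
Variables (Gam : set W) (g : W -> R).
Hypothesis S : generating_system Gam g.

(** [midpoint_convex] is applied along the segment with a constant proportional to |p1 - p0|^2
    |xi|^2. This constant has to be positive, so p0 = p1 and xi = 0 are treated apart. Every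
    converse implication to A3s, and the dual statement, pass through this lemma. *)
Lemma codim1_convex_midpoint (U' : set (E * R * E)) (del : R) :
  U' `<=` dom_U Gam g -> 0 < del ->
  (forall (x : E) (u : R) (p0 p1 xi : E) (s r0 : R), vsegment x u p0 p1 `<=` U' ->
     p1 - p0 != 0 -> xi != 0 -> dotp xi (p1 - p0) = 0 -> 0 < s -> s < 1 -> 0 < r0 ->
   exists r : R, [/\ 0 < r, r < r0, 0 <= s - r, s + r <= 1 &
     Aform Gam g x u (segpt p0 p1 s) xi xi <=
       (Aform Gam g x u (segpt p0 p1 (s + r)) xi xi +
        Aform Gam g x u (segpt p0 p1 (s - r)) xi xi) / 2 -
       del * enorm (p1 - p0) ^+ 2 * enorm xi ^+ 2 * r ^+ 2]) ->
  codim1_convex_on U' (fun x u p xi => Aform Gam g x u p xi xi) (del / 2).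
Proof.
move=> sub del0 H x u p0 p1 sU t xi t01 xip.
have seg s : 0 <= s <= 1 -> dom_U Gam g (x, u, segpt p0 p1 s).
  by move=> s01; apply: sub; exact: vsegment_mem sU s01.
have [D0|Dn0] := eqVneq (p1 - p0) 0.
  have p01 : p1 = p0 by apply/eqP; rewrite -subr_eq0 D0.
  have -> : segpt p0 p1 t = p0 by rewrite segptE D0 scaler0 addr0.
  by rewrite D0 enorm0 expr0n /= mulr0 mul0r subr0 p01 -mulrDl subrK mul1r.
have [->|xin0] := eqVneq xi 0.
  have z (p : E) : Aform Gam g x u p 0 0 = 0 by rewrite /Aform dotp0r.
  by rewrite !z enorm0 expr0n !mulr0 addr0 subr0.
have [k kE] := named (del * enorm (p1 - p0) ^+ 2 * enorm xi ^+ 2).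
have k0 : 0 < k.
  by rewrite kE; apply: mulr_gt0; [apply: mulr_gt0 => //|]; apply: exprn_gt0; exact: enorm_gt0.
have := midpoint_convex k0 (Aform_segment_continuous S (xi := xi) seg) _ t01.
rewrite segpt0 segpt1 kE segment_real; apply.
by move=> s r0 s0 s1 r00; exact: (H x u p0 p1 xi s r0 sU Dn0 xin0 xip s0 s1 r00).
Qed.

Definition A3s2_on (U' : set (E * R * E)) (del : R) : Prop :=
  forall (x0 : E) (u0 : R) (p0 p1 : E), vsegment x0 u0 p0 p1 `<=` U' ->
  exists2 N0 : set E, nbhs x0 N0 & forall (x : E) (t : R), N0 x -> 0 <= t <= 1 ->
    let m s := YZ Gam g x0 u0 (segpt p0 p1 s) in
    Gam (pt x (m t)) /\ g (pt x (m t)) <= Num.max (g (pt x (m 0))) (g (pt x (m 1))) -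
      del * (t * (1 - t) * enorm (p1 - p0) * enorm (x - x0)) ^+ 2.

Lemma A3s2P : condA3s2 Gam g <-> forall U' : set (E * R * E),
  compactly_contained U' (dom_U Gam g) -> exists2 del : R, 0 < del & A3s2_on U' del.
Proof. by []. Qed.

Lemma A3s_A3s2 : Aform_A3s Gam g -> condA3s2 Gam g.
Proof.
move=> A; apply/A3s2P => U' cU.
have [kap kap0 H] := max_principle S A cU.
exists kap; first exact: kap0.
move=> x0 u0 p0 p1 sU; have [r r0 Hr] := H x0 u0 p0 p1 sU.
exists [set x : E | `|x - x0| < r].
  by apply/(@near_ball R E); exists r.
move=> x t xr t01 m.
have zz (V : normedModType R) (z : V) : `|z - z| < r by rewrite subrr normr0.
by have [] := Hr x0 u0 p0 p1 x t (zz _ _) (zz _ _) (zz _ _) (zz _ _) xr t01.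
Qed.

(** A3s(2) is used at the middle of the subsegment [s - r, s + r]. Its length 2 r |D| and t (1 - t)
    = 1/4 give the penalty d0 r^2 |D|^2 / 4, which the second order test doubles. *)
Lemma A3s2_A3s : condA3s2 Gam g -> Aform_A3s Gam g.
Proof.
move/A3s2P => H U' cU; have [d0 d00 Hd] := H U' cU.
have d2 : 0 < d0 / 2 by exact: divr_gt0.
exists (d0 / 2 / 2); first exact: divr_gt0.
have sub : U' `<=` dom_U Gam g by move=> w /subset_closure; exact: cU.2.
apply: (codim1_convex_midpoint sub d2) => x u p0 p1 xi s r0 sU.
have [D DE] := named (p1 - p0); rewrite -DE => Dn0 xin0 xip s0 s1 r00.
have seg t : 0 <= t <= 1 -> dom_U Gam g (x, u, segpt p0 p1 t).
  by move=> t01; apply: sub; exact: vsegment_mem sU t01.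
have eD : 0 < enorm D by exact: enorm_gt0.
have [r [rp rr0 r1 r2]] := small_range s0 s1 r00.
exists r; split; [exact: rp|exact: rr0|exact: r1|exact: r2|].
have [tm tp ts] := range_pm r1 r2 rp.
have sUs := vsegment_sub sU tm tp.
have [N0 /(@near_ball R E)[q q0 Hq] HN] := Hd _ _ _ _ sUs.
have [G0 g0 P0] := YZP (seg s ts).
have [Gp gp Pp] := YZP (seg _ tp).
have [Gm gm Pm] := YZP (seg _ tm).
apply: LC_real.
have rD0 : r *: D != 0 by rewrite scaler_eq0 negb_or gt_eqF.
have rDxi : dotp xi (r *: D) = 0 by rewrite dotpZr xip mulr0.
have K0 : 0 <= d0 * (4^-1 * (2 * r * enorm D)) ^+ 2.
  by apply: mulr_ge0; [exact: ltW|exact: sqr_ge0].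
have Pp' : gx g x (YZ Gam g x u (segpt p0 p1 (s + r))) =
    gx g x (YZ Gam g x u (segpt p0 p1 s)) + r *: D.
  by rewrite Pp P0 !segptE -DE scalerDl addrA.
have Pm' : gx g x (YZ Gam g x u (segpt p0 p1 (s - r))) =
    gx g x (YZ Gam g x u (segpt p0 p1 s)) - r *: D.
  by rewrite Pm P0 !segptE -DE scalerDl scaleNr addrA.
apply: (second_order_test S G0 Gp Gm g0 gp gm Pp' Pm' rD0 rDxi K0 q0).
move=> x' xq; have [_] := HN x' 2^-1 (Hq _ xq) (half_in01 R).
rewrite /= segpt0 segpt1 segpt_sub.
have -> : (1 - 2^-1) * (s - r) + 2^-1 * (s + r) = s by field.
rewrite segptB -DE.
have -> : s + r - (s - r) = 2 * r by ring.
rewrite enormZ (gtr0_norm (mulr_gt0 (ltr0Sn R 1) rp)).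
have -> : d0 * (2^-1 * (1 - 2^-1) * (2 * r * enorm D) * enorm (x' - x)) ^+ 2 =
   d0 * (4^-1 * (2 * r * enorm D)) ^+ 2 * enorm (x' - x) ^+ 2 by field.
by [].
Qed.

End A3s2.

(** * The dual generating function *)

Lemma eps_div_le (R : realFieldType) (e h v : R) : 0 < e -> 0 <= h -> 0 <= v ->
  e / (v + 1) * (h * v) <= e * h.
Proof.
move=> e0 h0 v0; have v1 : 0 < v + 1 by rewrite ltr_wpDl.
have -> : e / (v + 1) * (h * v) = e * h * (v / (v + 1)) by ring.
apply: ler_piMr; first by rewrite mulr_ge0 // ltW.
by rewrite ler_pdivrMr // mul1r lerDl.
Qed.

(** * Recognizing C1 functions from pointwise Frechet estimates *)

Section Calculus_C1.
Context {R : realType} {V : normedModType R}.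
Hypothesis hV : finite_coords V.

Lemma derive_frechet (f : V -> R) (P v : V) (l : R) :
  (forall e : R, 0 < e -> exists2 r : R, 0 < r & forall h : R, `|h| < r ->
     `|f (h *: v + P) - f P - h * l| <= e * `|h|) ->
  derivable f P v /\ 'D_v f P = l.
Proof.
move=> H.
have C : (fun h : R => h^-1 *: ((f \o shift P) (h *: v) - f P)) @ 0^' --> l.
  apply/cvgrPdist_le => e e0; have [r r0 Hr] := H e e0.
  rewrite /dnbhs near_withinE; apply/(@near_ball R R); exists r => // h; rewrite subr0 => hr h0.
  have hn : 0 < `|h| by rewrite normr_gt0.
  rewrite -(ler_pM2l hn) -normrM.
  have -> : h * (l - h^-1 *: (f (h *: v + P) - f P)) = - (f (h *: v + P) - f P - h * l).
    by rewrite /GRing.scale /=; field.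
  by rewrite [leRHS]mulrC (normrN (f (h *: v + P) - f P - h * l)); exact: Hr.
by split; [apply/cvg_ex; exists l|apply: cvg_lim C].
Qed.

Lemma near_eq_continuous (D : set V) (f h : V -> R) (P : V) : open D -> D P ->
  (forall Q, D Q -> h Q = f Q) -> {for P, continuous f} -> {for P, continuous h}.
Proof.
move=> oD DP E cf; change (h @ P --> h P); rewrite (E _ DP).
apply: cvg_trans cf; apply: near_eq_cvg.
have nD : \forall Q \near P, D Q by exact: open_nbhs_nbhs.
by near=> Q; apply/esym/E; near: Q.
Unshelve. all: by end_near.
Qed.

(** An estimate at each single point, with a linear candidate depending continuously on the point,
    identifies the directional derivatives; differentiability then comes from [C1linP]. *)
Lemma frechet_C1 (D : set V) (f : V -> R) (L : V -> V -> R) : open D ->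
  (forall P, D P -> forall a u v, L P (a *: u + v) = a * L P u + L P v) ->
  (forall v P, D P -> {for P, continuous (fun Q => L Q v)}) ->
  (forall P, D P -> forall e : R, 0 < e -> exists2 r : R, 0 < r & forall Q : V,
     `|Q - P| < r -> `|f Q - f P - L P (Q - P)| <= e * `|Q - P|) ->
  C1_on D f /\ forall P v, D P -> 'D_v f P = L P v.
Proof.
move=> oD lin cont est.
have key P v : D P -> derivable f P v /\ 'D_v f P = L P v.
  move=> DP; apply: derive_frechet => e e0.
  have LZ (h : R) : L P (h *: v) = h * L P v.
    have L0 : L P 0 = 0.
      by have := lin P DP (-1) 0 0; rewrite scaler0 addr0 mulN1r addNr.
    by have := lin P DP h v 0; rewrite addr0 L0 addr0.
  have N0 : 0 < `|v| + 1 by rewrite ltr_wpDl.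
  have f0 : 0 < e / (`|v| + 1) by exact: divr_gt0.
  have [r r0 Hr] := est P DP _ f0.
  exists (r / (`|v| + 1)); first exact: divr_gt0.
  move=> h; rewrite ltr_pdivlMr // => hr.
  have hv : `|h *: v + P - P| = `|h| * `|v| by rewrite addrK normrZ.
  have hvr : `|h *: v + P - P| < r.
    by rewrite hv; apply: le_lt_trans hr; rewrite ler_wpM2l // lerDl.
  have := Hr _ hvr; rewrite hv addrK LZ => /le_trans; apply.
  by apply: eps_div_le.
split; last by move=> P v DP; case: (key P v DP).
apply: C1linP => //; split.
  move=> P DP; split; first by move=> v; case: (key P v DP).
  by move=> a u v; rewrite !(key _ _ DP).2 lin.
move=> v P DP; apply: (near_eq_continuous oD DP _ (cont v P DP)) => Q DQ.
by case: (key Q v DQ).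
Qed.

Lemma C1_eq (D : set V) (f h : V -> R) : open D -> C1_on D f ->
  (forall Q, D Q -> h Q = f Q) ->
  C1_on D h /\ forall P v, D P -> 'D_v h P = 'D_v f P.
Proof.
move=> oD fC E; apply: frechet_C1 => //.
- by move=> P DP a u v; exact: derivDl fC DP a u v.
- by move=> v P DP; exact: fC.2.
move=> P DP e e0; have [r r0 Hr] := strict_diff hV oD (C1_onW fC) DP e0.
exists r => // Q QP; have PP : `|P - P| < r by rewrite subrr normr0.
have [DQ _] := Hr _ _ QP QP.
by rewrite !E //; case: (Hr _ _ PP QP).
Qed.

Lemma C1_quotient (D : set V) (N Q : V -> R) : open D -> C1_on D N -> C1_on D Q ->
  (forall P, D P -> Q P != 0) -> C1_on D (fun P => N P * (Q P)^-1).
Proof.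
move=> oD NC QC Q0.
have dQ P : D P -> differentiable (fun P => (Q P)^-1) P.
  by move=> DP; apply: differentiableV; [exact: QC.1|exact: Q0].
have cN P : D P -> {for P, continuous N}.
  by move=> DP; apply: differentiable_continuous; exact: NC.1.
have cQ P : D P -> {for P, continuous (fun P => (Q P)^-1)}.
  by move=> DP; apply: differentiable_continuous; exact: dQ.
split; first by move=> P DP; apply: differentiableM; [exact: NC.1|exact: dQ].
move=> v P DP.
apply: (@near_eq_continuous D (fun P => N P * (- ((Q P)^-1 * (Q P)^-1) * 'D_v Q P) +
   (Q P)^-1 * 'D_v N P)) => //.
  move=> P' DP'.
  have -> : (fun P => N P * (Q P)^-1) = N * (fun P => (Q P)^-1) by [].
  rewrite deriveM; [|exact: diff_derivable (NC.1 _ DP')|exact: diff_derivable (dQ _ DP')].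
  rewrite deriveV; [|exact: Q0|exact: diff_derivable (QC.1 _ DP')].
  by rewrite /GRing.scale /= expr2 invfM.
have c1 := cN P DP; have c2 := cQ P DP.
have c3 := QC.2 v P DP; have c4 := NC.2 v P DP.
have c5 : {for P, continuous (fun P => - ((Q P)^-1 * (Q P)^-1))}.
  by apply: continuousN; exact: continuousM.
have c6 : {for P, continuous (fun P => - ((Q P)^-1 * (Q P)^-1) * 'D_v Q P)}.
  exact: continuousM.
have c7 : {for P, continuous (fun P => N P * (- ((Q P)^-1 * (Q P)^-1) * 'D_v Q P))}.
  exact: continuousM.
have c8 : {for P, continuous (fun P => (Q P)^-1 * 'D_v N P)} by exact: continuousM.
exact: (continuousD c7 c8).
Qed.

Lemma C1_cstB (D : set V) (f : V -> R) (c : R) : open D -> C1_on D f ->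
  C1_on D (fun P => c - f P).
Proof.
move=> oD fC.
have [] := @frechet_C1 D (fun P => c - f P) (fun P v => - 'D_v f P) oD.
- by move=> P DP a u v; rewrite (derivDl fC DP) opprD mulrN.
- by move=> v P DP; apply: continuousN; exact: fC.2.
- move=> P DP e e0; have [r r0 Hr] := strict_diff hV oD (C1_onW fC) DP e0.
  exists r => // Q QP; have PP : `|P - P| < r by rewrite subrr normr0.
  have [_] := Hr _ _ PP QP; congr (_ <= _); rewrite -normrN; congr (`|_|); ring.
by [].
Qed.

End Calculus_C1.

Lemma lin_bounded (R : realType) (V : normedModType R) (L : V -> R) : finite_coords V ->
  (forall a u v, L (a *: u + v) = a * L u + L v) ->
  exists2 K : R, 0 < K & forall u, `|L u| <= K * `|u|.
Proof.
move=> [I [e [c cE]]] lin; exists (\sum_i `|L (e i)| + 1).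
  by rewrite ltr_wpDl // sumr_ge0.
have L0 : L 0 = 0.
  by have := lin (-1) 0 0; rewrite scaler0 addr0 mulN1r addNr.
move=> u; have [uE cu] := cE u.
have -> : L u = \sum_i c i u * L (e i).
  rewrite {1}uE; elim/big_ind2 : _ => // [v1 r1 v2 r2|i _].
    by move=> <- <-; have := lin 1 r1 r2; rewrite scale1r mul1r.
  by have := lin (c i u) (e i) 0; rewrite L0 !addr0.
apply: le_trans (ler_norm_sum _ _ _) _; rewrite mulrDl mulr_suml.
apply: (@le_trans _ _ (\sum_i `|L (e i)| * `|u|)).
  by apply: ler_sum => i _; rewrite normrM mulrC; apply: ler_wpM2l.
by rewrite lerDl mul1r.
Qed.

Lemma ivt_up (R : realFieldType) (c s a b u u0 : R) : 0 < c -> 0 < s ->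
  `|a - u0| <= c * s / 4 -> `|u - u0| <= c * s / 4 -> `|b - a + c * s| <= c / 4 * s ->
  b <= u.
Proof.
move=> c0 s0; have cs : 0 < c * s by rewrite mulr_gt0.
rewrite !ler_norml => /andP[? ?] /andP[? ?] /andP[? ?]; lra.
Qed.

Lemma ivt_down (R : realFieldType) (c s a b u u0 : R) : 0 < c -> 0 < s ->
  `|a - u0| <= c * s / 4 -> `|u - u0| <= c * s / 4 -> `|b - a - c * s| <= c / 4 * s ->
  u <= b.
Proof.
move=> c0 s0; have cs : 0 < c * s by rewrite mulr_gt0.
rewrite !ler_norml => /andP[? ?] /andP[? ?] /andP[? ?]; lra.
Qed.

(* |dz - l| <= f (dw + dz) with |l| <= K dw and f small gives |dz - l| = O(f dw). *)
Lemma implicit_real (R : realFieldType) (f K dw dz l e : R) : 0 <= dw -> 0 < K ->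
  f <= 2^-1 -> f * (2 * K + 2) <= e -> 0 <= f ->
  `|l| <= K * dw -> `|dz - l| <= f * (dw + `|dz|) ->
  `|dz - l| <= e * dw /\ `|dz| <= (2 * K + 1) * dw.
Proof.
move=> dw0 K0 f2 fe f0 h1 h2.
have h3 : `|dz| <= `|dz - l| + `|l| by rewrite -{1}(subrK l dz) ler_normD.
have h4 : f * (dw + `|dz|) <= 2^-1 * (dw + `|dz|).
  by apply: ler_wpM2r => //; rewrite addr_ge0.
have h5 : `|dz| <= (2 * K + 1) * dw by lra.
split; last exact: h5.
apply: le_trans h2 _.
have h6 : f * (dw + `|dz|) <= f * ((2 * K + 2) * dw) by apply: ler_wpM2l => //; lra.
apply: le_trans h6 _; rewrite mulrA; exact: ler_wpM2r.
Qed.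

Lemma dgd_real (R : realFieldType) (a u v U V c : R) :
  (a * u + v - (a * U + V)) / c = a * ((u - U) / c) + (v - V) / c.
Proof. by ring. Qed.

Lemma comp_real (R : realFieldType) (a A1 A2 A3 A4 A5 : R) :
  (a * A4 + A5) * A1 + (a * A2 + A3) = a * (A4 * A1 + A2) + (A5 * A1 + A3).
Proof. by ring. Qed.

Lemma comp_est_real (R : realFieldType) (e K B e1 d l D X F1 F0 w : R) : 0 <= w ->
  0 < e -> 0 < K -> 0 < B -> e1 <= e / 2 / B -> e1 <= 1 -> 0 <= e1 -> `|D| <= B ->
  `|F1 - F0 - (d * D + X)| <= e / 2 / (K + 2) * (w + `|d|) ->
  `|d - l| <= e1 * w -> `|l| <= K * w ->
  `|F1 - F0 - (l * D + X)| <= e * w.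
Proof.
move=> w0 e0 K0 B0 h1 h1' e10 h2 h3 h4 h5.
have K2 : 0 < K + 2 by rewrite addr_gt0.
have -> : F1 - F0 - (l * D + X) = F1 - F0 - (d * D + X) + (d - l) * D by ring.
apply: le_trans (ler_normD _ _) _.
have k1 : `|d| <= (K + 1) * w.
  have : `|d| <= `|d - l| + `|l| by rewrite -{1}(subrK l d) ler_normD.
  have : e1 * w <= 1 * w by rewrite ler_wpM2r.
  lra.
have k2 : e / 2 / (K + 2) * (w + `|d|) <= e / 2 / (K + 2) * ((K + 2) * w).
  apply: ler_wpM2l; last lra.
  by rewrite !divr_ge0 // ltW.
have e2 : e / 2 / (K + 2) * ((K + 2) * w) = e / 2 * w by field; rewrite gt_eqF.
have k3 : `|(d - l) * D| <= e / 2 / B * w * B.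
  rewrite normrM; apply: ler_pM => //; apply: le_trans h4 _; exact: ler_wpM2r.
have e3 : e / 2 / B * w * B = e / 2 * w by field; rewrite gt_eqF.
lra.
Qed.

Lemma continuous_comb (R : realType) (V : normedModType R) (P : V) (a b c : V -> R) :
  {for P, continuous a} -> {for P, continuous b} -> {for P, continuous c} ->
  {for P, continuous (fun w => a w * b w + c w)}.
Proof. by move=> ca cb cc; exact: (continuousD (continuousM ca cb) cc). Qed.

Section Dual.
Context {R : realType} {n : nat}.
Local Notation E := 'rV[R]_n.
Local Notation W := (E * E * R)%type.
Local Notation M := (E * R)%type.
Variables (Gam : set W) (g : W -> R).
Hypothesis S : generating_system Gam g.
Let oG := s_open S.
Let gC := s_C2 S.
Let hW : finite_coords W := W_coords.

Lemma d1_cont P u : Gam P -> {for P, continuous (fun Q => d1 g Q u)}.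
Proof. by move=> G; exact: (d1_continuous gC). Qed.

Definition dual_dom : set W :=
  [set w | exists z, Gam (w.1.2, w.1.1, z) /\ g (w.1.2, w.1.1, z) = w.2].
Definition dual_fun (w : W) : R := gstar Gam g w.1.2 w.1.1 w.2.
(** Sends the dual point (y, x, u) to the point (x, y, z) of the original space with g(x, y, z) =
    u. *)
Definition phi (w : W) : W := (w.1.2, w.1.1, dual_fun w).
Definition gz P := d1 g P (inm (0, 1)).
(* The direction (v_x, v_y, 0) of the original space attached to v = (v_y, v_x, v_u). *)
Definition swp (v : W) : W := (v.1.2, v.1.1, 0).

Lemma dualP w : dual_dom w -> Gam (phi w) /\ g (phi w) = w.2.
Proof.
move=> [z zE]; rewrite /phi /dual_fun /gstar.
by apply: (@getPex R (fun z => Gam (w.1.2, w.1.1, z) /\ g (w.1.2, w.1.1, z) = w.2)); exists z.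
Qed.

Lemma dual_fun_unique (w : W) z : Gam (w.1.2, w.1.1, z) -> g (w.1.2, w.1.1, z) = w.2 ->
  dual_dom w /\ dual_fun w = z.
Proof.
move=> G gu; have D : dual_dom w by exists z.
split; first exact: D.
have [G' gu'] := dualP D; apply: (s_zinj S G' G); by rewrite gu.
Qed.

Lemma swp_norm v : `|swp v| <= `|v|.
Proof.
case: v => -[v1 v2] v3; rewrite /swp !prod_normE /= normr0 !ge_max !le_max !lexx !orbT /=.
by rewrite normr_ge0.
Qed.

Local Transparent inm.

Lemma phiB w w' : phi w' - phi w =
  (dual_fun w' - dual_fun w) *: inm (0, 1) + swp (w' - w).
Proof.
rewrite /phi /swp /inm; congr (_, _, _) => /=.
- by rewrite scaler0 add0r.
- by rewrite scaler0 add0r.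
by rewrite addr0; exact/esym/mulr1.
Qed.

Local Opaque inm.

Lemma phi_lt w w' (r : R) : `|w - w'| < r -> `|dual_fun w - dual_fun w'| < r ->
  `|phi w - phi w'| < r.
Proof.
rewrite !prod_normE /= !gt_max => /andP[/andP[h1 h2] _] h3.
by rewrite h1 h2 h3.
Qed.

Lemma swpD (a : R) u v : swp (a *: u + v) = a *: swp u + swp v.
Proof. by rewrite /swp; congr (_, _, _); rewrite /= scaler0 addr0. Qed.

Lemma norm_inm01 : `|inm (0, 1) : W| <= 1.
Proof. by rewrite norm_inm prod_normE /= normr0 normr1 ge_max lexx ler01. Qed.

(** Near the point g decreases in z with slope close to -c, so the intermediate value theorem solves
    g(x, y, z) = u with z within s of z0. Uniqueness in z identifies this solution with
    [dual_fun]. *)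
Lemma dual_near w0 : dual_dom w0 -> forall e : R, 0 < e -> exists2 r : R, 0 < r &
  forall w, `|w - w0| < r -> dual_dom w /\ `|dual_fun w - dual_fun w0| <= e.
Proof.
move=> D0 e e0; have [G0 g0] := dualP D0.
have [z0 z0E] := named (dual_fun w0).
have P0E : phi w0 = pt w0.1.2 (w0.1.1, z0) by rewrite /phi z0E.
rewrite P0E in G0 g0.
have [c cE] := named (- d1 g (pt w0.1.2 (w0.1.1, z0)) (inm (0, 1))).
have c0 : 0 < c by rewrite cE oppr_gt0; exact: s_gz S _ G0.
have c4 : 0 < c / 4 by exact: divr_gt0.
have [r1 r10 H1] := strict1 hW oG gC G0 c4.
have r12 : 0 < r1 / 2 by exact: divr_gt0.
have [s [s0 se sr]] := min2 e0 r12.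
have cs4 : 0 < c * s / 4 by rewrite divr_gt0 // mulr_gt0.
have [r2 r20 H2] := g_near S G0 cs4.
have [r [r0 rr1 rr2 rr3]] := min3 r10 r20 cs4.
exists r; first exact: r0.
move=> w; rewrite !prod_normE /= !gt_max => /andP[/andP[yr xr] ur].
pose P z := pt w.1.2 (w.1.1, z).
have near z : `|z - z0| <= s -> `|P z - pt w0.1.2 (w0.1.1, z0)| < r1.
  move=> h; apply: norm_pt_lt; first exact: lt_le_trans xr rr1.
  rewrite prod_normE /= gt_max; apply/andP; split; first exact: lt_le_trans yr rr1.
  apply: le_lt_trans h _; apply: le_lt_trans sr _; exact: half_ltr.
have z00 : `|z0 - z0| <= s by rewrite subrr normr0 ltW.
have Gz z : `|z - z0| <= s -> Gam (P z).
  by move=> h; case: (H1 _ _ (near z h) (near z h)).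
have est z : `|z - z0| <= s ->
    `|g (P z) - g (P z0) + c * (z - z0)| <= c / 4 * `|z - z0|.
  move=> h; have [_] := H1 _ _ (near z0 z00) (near z h).
  have -> : P z - P z0 = (z - z0) *: inm (0, 1).
    rewrite /P ptBm -inmZ; congr inm; congr (_, _) => /=.
      by rewrite subrr scaler0.
    exact/esym/mulr1.
  rewrite (d1Z gC G0) normrZ => k.
  have kk : c / 4 * (`|z - z0| * `|inm (0, 1) : W|) <= c / 4 * `|z - z0|.
    by rewrite ler_pM2l // ler_piMr // norm_inm01.
  have := le_trans k kk.
  have -> : d1 g (pt w0.1.2 (w0.1.1, z0)) (inm (0, 1)) = - c by rewrite cE opprK.
  by rewrite mulrN opprK mulrC.
have near0 : `|P z0 - pt w0.1.2 (w0.1.1, z0)| < r2.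
  apply: norm_pt_lt; first exact: lt_le_trans xr rr2.
  rewrite prod_normE /= gt_max; apply/andP; split; first exact: lt_le_trans yr rr2.
  by rewrite subrr normr0.
have [_ k0] := H2 _ near0; rewrite g0 in k0.
have ku : `|w.2 - w0.2| <= c * s / 4 by apply: ltW; exact: lt_le_trans ur rr3.
have cont : {within `[z0 - s, z0 + s], continuous (fun z => g (P z))}.
  apply: continuous_in_subspaceT => z; rewrite inE /= in_itv /= -ler_distl => h.
  apply: continuous_eps => e' e'0; have [q q0 Hq] := g_near S (Gz z h) e'0.
  exists q; first exact: q0.
  move=> z' zz; rewrite distrC; apply: ltW; apply: (Hq _ _).2.
  by rewrite /P ptBm norm_inm prod_normE /= subrr normr0 gt_max q0.
have b1 : g (P (z0 + s)) <= w.2.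
  have e1 : z0 + s - z0 = s by ring.
  have h : `|z0 + s - z0| <= s by rewrite e1 gtr0_norm.
  have := est _ h; rewrite e1 (gtr0_norm s0) => k.
  exact: ivt_up c0 s0 (ltW k0) ku k.
have b2 : w.2 <= g (P (z0 - s)).
  have e1 : z0 - s - z0 = - s by ring.
  have h : `|z0 - s - z0| <= s by rewrite e1 normrN gtr0_norm.
  have := est _ h; rewrite e1 normrN (gtr0_norm s0) mulrN => k.
  exact: ivt_down c0 s0 (ltW k0) ku k.
have zs : z0 - s <= z0 + s by rewrite lerD2l ge0_cp ?ltW.
have [|z] := IVT zs cont (_ : Num.min (g (P (z0 - s))) (g (P (z0 + s))) <= w.2 <=
   Num.max (g (P (z0 - s))) (g (P (z0 + s)))).
  by rewrite ge_min b1 orbT le_max b2.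
rewrite in_itv /= -ler_distl => zz gz0.
have [D dz] := dual_fun_unique (Gz z zz) gz0.
by split; [exact: D|rewrite dz -z0E; exact: le_trans zz se].
Qed.

Lemma dual_dom_open : open dual_dom.
Proof.
rewrite openE => w D; apply/(@near_ball R W).
have [r r0 Hr] := dual_near D ltr01.
by exists r => // w' /Hr[].
Qed.

Lemma phi_continuous w : dual_dom w -> {for w, continuous phi}.
Proof.
move=> D; apply: continuous_eps => e e0; have [r r0 Hr] := dual_near D e0.
have [q [q0 qr qe]] := min2 r0 e0.
exists q; first exact: q0.
move=> w' ww; have [_ h] := Hr _ (lt_le_trans ww qr).
have := lt_le_trans ww qe; rewrite distrC prod_normE /= gt_max => /andP[+ _].
rewrite prod_normE /= gt_max => /andP[h1 h2].
rewrite distrC prod_normE /= ge_max h andbT prod_normE /= ge_max.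
by rewrite distrC ltW //= distrC ltW // distrC.
Qed.

Lemma comp_phi_continuous (f : W -> R) w : dual_dom w ->
  {for phi w, continuous f} -> {for w, continuous (fun w => f (phi w))}.
Proof. by move=> D cf; apply: continuous_comp; [exact: phi_continuous|exact: cf]. Qed.

(** The relation g(phi(w)) = w.2, differentiated in the direction v and solved for the
    z-component. *)
Definition dgd (w v : W) : R := (v.2 - d1 g (phi w) (swp v)) / gz (phi w).

Lemma gz_neq0 w : dual_dom w -> gz (phi w) != 0.
Proof. by move=> /dualP[G _]; rewrite lt_eqF //; exact: s_gz S _ G. Qed.

Lemma dgdD w (a : R) (u v : W) : dual_dom w -> dgd w (a *: u + v) = a * dgd w u + dgd w v.
Proof.
move=> D; have [G _] := dualP D; rewrite /dgd swpD (d1Dl gC G) /=.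
exact: dgd_real.
Qed.

(** The expansion of g at [phi w0] controls the remainder by |w - w0| plus the increment of the dual
    function itself; after division by g_z this increment is absorbed by [implicit_real]. *)
Lemma dual_C1 : C1_on dual_dom dual_fun /\
  forall w v, dual_dom w -> 'D_v dual_fun w = dgd w v.
Proof.
apply: (frechet_C1 hW dual_dom_open).
- by move=> w D a u v; exact: dgdD.
- move=> v w D; have [G _] := dualP D.
  have c1 : {for w, continuous (fun w => d1 g (phi w) (swp v))}.
    apply: (comp_phi_continuous (f := fun P => d1 g P (swp v)) D).
    exact: d1_cont.
  have c2 : {for w, continuous (fun w => v.2 - d1 g (phi w) (swp v))}.
    by apply: continuousB; [exact: cvg_cst|exact: c1].
  have c3 : {for w, continuous (fun w => gz (phi w))}.
    apply: (comp_phi_continuous (f := gz) D); exact: d1_cont.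
  have c4 : {for w, continuous (fun w => (gz (phi w))^-1)}.
    by apply: continuousV; [exact: gz_neq0|exact: c3].
  exact: (continuousM c2 c4).
move=> w0 D e e0; have [G0 g0] := dualP D.
have [K K0 HK] := lin_bounded hW (fun a u v => dgdD a u v D).
have [c cE] := named (`|gz (phi w0)|).
have c0 : 0 < c by rewrite cE normr_gt0; exact: gz_neq0.
have h2 : 0 < 2^-1 :> R by rewrite invr_gt0.
have k2 : 0 < e / (2 * K + 2) by rewrite divr_gt0 // addr_gt0 // mulr_gt0.
have [f [f0 f2 fe]] := min2 h2 k2.
have cf : 0 < c * f by exact: mulr_gt0.
have [r1 r10 H1] := strict1 hW oG gC G0 cf.
have r12 : 0 < r1 / 2 by exact: divr_gt0.
have [r2 r20 H2] := dual_near D r12.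
have [r [r0 rr1 rr2]] := min2 r10 r20.
exists r; first exact: r0.
move=> w ww; have [Dw dz] := H2 _ (lt_le_trans ww rr2).
have [Gw gw] := dualP Dw.
have [d dE] := named (dual_fun w - dual_fun w0); rewrite -dE in dz *.
have phn : `|phi w - phi w0| <= `|w - w0| + `|d|.
  rewrite phiB -dE addrC; apply: le_trans (ler_normD _ _) _.
  apply: lerD; first exact: swp_norm.
  by rewrite normrZ ler_piMr // norm_inm01.
have phr : `|phi w - phi w0| < r1.
  apply: phi_lt; first exact: lt_le_trans ww rr1.
  by rewrite -dE; exact: le_lt_trans dz (half_ltr r10).
have zz : `|phi w0 - phi w0| < r1 by rewrite subrr normr0.
have [_] := H1 _ _ zz phr; rewrite gw g0 phiB -dE (d1Dl gC G0) -/(gz _) => k.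
suff h : `|d - dgd w0 (w - w0)| <= f * (`|w - w0| + `|d|).
  have fe' : f * (2 * K + 2) <= e.
    by rewrite -ler_pdivlMr // addr_gt0 // mulr_gt0.
  by case: (implicit_real (normr_ge0 _) K0 f2 fe' (ltW f0) (HK _) h).
rewrite -(ler_pM2l c0) mulrA cE -normrM -cE.
have -> : gz (phi w0) * (d - dgd w0 (w - w0)) =
   - (w.2 - w0.2 - (d * gz (phi w0) + d1 g (phi w0) (swp (w - w0)))).
  rewrite /dgd; have -> : (w - w0).2 = w.2 - w0.2 by [].
  by field; exact: gz_neq0.
rewrite normrN; apply: le_trans k _; rewrite ler_pM2l //.
by move: phn; rewrite phiB -dE.
Qed.

Lemma comp_phi_C1 (f : W -> R) : C1_on Gam f ->
  C1_on dual_dom (fun w => f (phi w)) /\ forall w v, dual_dom w ->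
    'D_v (fun w => f (phi w)) w =
    'D_(dgd w v *: inm (0, 1) + swp v) f (phi w).
Proof.
move=> fC; have [gdC gdE] := dual_C1.
have LE w v : dual_dom w -> 'D_(dgd w v *: inm (0, 1) + swp v) f (phi w) =
   dgd w v * 'D_(inm (0, 1)) f (phi w) + 'D_(swp v) f (phi w).
  by move=> /dualP[G _]; exact: (derivDl fC G).
apply: (frechet_C1 hW dual_dom_open).
- move=> w D a u v; have [G _] := dualP D.
  have sE : 'D_(swp (a *: u + v)) f (phi w) = a * 'D_(swp u) f (phi w) + 'D_(swp v) f (phi w).
    rewrite swpD; exact: (derivDl fC G).
  have dE := dgdD a u v D.
  transitivity (dgd w (a *: u + v) * 'D_(inm (0, 1)) f (phi w) +
     'D_(swp (a *: u + v)) f (phi w)); first exact: LE.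
  rewrite sE dE.
  transitivity (a * (dgd w u * 'D_(inm (0, 1)) f (phi w) + 'D_(swp u) f (phi w)) +
     (dgd w v * 'D_(inm (0, 1)) f (phi w) + 'D_(swp v) f (phi w))).
    exact: comp_real.
  by congr (_ * _ + _); apply/esym; exact: LE.
- move=> v w D; have [G _] := dualP D.
  apply: (@near_eq_continuous _ _ dual_dom (fun w => dgd w v * 'D_(inm (0, 1)) f (phi w) +
    'D_(swp v) f (phi w))); [exact: dual_dom_open|exact: D| |].
    by move=> Q DQ; exact: LE.
  have c1 : {for w, continuous (fun w => dgd w v)}.
    apply: (@near_eq_continuous _ _ dual_dom ('D_v dual_fun)).
    - exact: dual_dom_open.
    - exact: D.
    - by move=> Q DQ; rewrite gdE.
    - exact: gdC.2.
  have c2 : {for w, continuous (fun w => 'D_(inm (0, 1)) f (phi w))}.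
    apply: (comp_phi_continuous (f := 'D_(inm (0, 1)) f) D); exact: fC.2.
  have c3 : {for w, continuous (fun w => 'D_(swp v) f (phi w))}.
    apply: (comp_phi_continuous (f := 'D_(swp v) f) D); exact: fC.2.
  exact: (continuous_comb c1 c2 c3).
move=> w0 D e e0; have [G0 g0] := dualP D.
have [K K0 HK] := lin_bounded hW (fun a u v => dgdD a u v D).
have [B BE] := named (`|'D_(inm (0, 1)) f (phi w0)| + 1).
have B0 : 0 < B by rewrite BE ltr_wpDl.
have f0 : 0 < e / 2 / (K + 2) by rewrite divr_gt0 ?divr_gt0 // addr_gt0.
have h0 : 0 < e / 2 / B by rewrite !divr_gt0.
have [e1 [e10 e1h e11]] := min2 h0 ltr01.
have [r1 r10 H1] := strict_diff hW oG (C1_onW fC) G0 f0.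
have [r2 r20 H2] := strict_diff hW dual_dom_open (C1_onW gdC) D e10.
have r12 : 0 < r1 / 2 by exact: divr_gt0.
have [r3 r30 H3] := dual_near D r12.
have [r [r0 rr1 rr2 rr3]] := min3 r10 r20 r30.
exists r; first exact: r0.
move=> w ww; have [Dw dz] := H3 _ (lt_le_trans ww rr3).
have z2 : `|w0 - w0| < r2 by rewrite subrr normr0.
have z1 : `|phi w0 - phi w0| < r1 by rewrite subrr normr0.
have [_] := H2 _ _ z2 (lt_le_trans ww rr2); rewrite gdE // => k2.
have phr : `|phi w - phi w0| < r1.
  apply: phi_lt; first exact: lt_le_trans ww rr1.
  exact: le_lt_trans dz (half_ltr r10).
have [_] := H1 _ _ z1 phr; rewrite LE // phiB (derivDl fC G0) => k1.
have [d dE] := named (dual_fun w - dual_fun w0); rewrite -dE in k1 k2.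
have phn : `|d *: inm (0, 1) + swp (w - w0)| <= `|w - w0| + `|d|.
  rewrite addrC; apply: le_trans (ler_normD _ _) _.
  apply: lerD; first exact: swp_norm.
  by rewrite normrZ ler_piMr // norm_inm01.
have k1' : `|f (phi w) - f (phi w0) - (d * 'D_(inm (0, 1)) f (phi w0) +
    'D_(swp (w - w0)) f (phi w0))| <= e / 2 / (K + 2) * (`|w - w0| + `|d|).
  by apply: le_trans k1 _; apply: ler_wpM2l => //; exact: ltW.
have Bb : `|'D_(inm (0, 1)) f (phi w0)| <= B by rewrite BE lerDl.
exact: (comp_est_real (normr_ge0 _) e0 K0 B0 e1h e11 (ltW e10) Bb k1' k2 (HK _)).
Qed.

(** By [dual_C1] every directional derivative of the dual function is a quotient of first
    derivatives of g composed with [phi], and g_z does not vanish. *)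
Lemma dual_C2 : C2_on dual_dom dual_fun.
Proof.
have [gdC gdE] := dual_C1; split; first exact: gdC.
move=> v.
have [NC _] := comp_phi_C1 (gC.2 (swp v)); have [QC _] := comp_phi_C1 (gC.2 (inm (0, 1))).
have QN w : dual_dom w -> 'D_(inm (0, 1)) g (phi w) != 0 by exact: gz_neq0.
have NC' := C1_cstB hW v.2 dual_dom_open NC.
have [] := @C1_eq R W hW dual_dom
  (fun w => (v.2 - 'D_(swp v) g (phi w)) * ('D_(inm (0, 1)) g (phi w))^-1) ('D_v dual_fun).
- exact: dual_dom_open.
- exact: (C1_quotient dual_dom_open NC' QC QN).
- by move=> w D; rewrite gdE.
by [].
Qed.

End Dual.

Lemma solve_real (R : ringType) (A B C : R) : A + B + C = 0 -> B = - (A + C).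
Proof. by move=> h; apply/eqP; rewrite -subr_eq0 opprK addrCA addrA h. Qed.

Lemma derive_comb (R : realType) (V : normedModType R) (a b c : V -> R) (P u : V) :
  derivable a P u -> derivable b P u -> derivable c P u ->
  'D_u (fun w => a w * b w + c w) P = a P * 'D_u b P + b P * 'D_u a P + 'D_u c P.
Proof.
move=> da db dc; have -> : (fun w => a w * b w + c w) = a * b + c by [].
transitivity ('D_u (a * b) P + 'D_u c P); first exact: deriveD (derivableM da db) dc.
by rewrite (deriveM da db).
Qed.

(** * The dual function as a generating system *)

Section Dual_system.
Context {R : realType} {n : nat}.
Local Notation E := 'rV[R]_n.
Local Notation W := (E * E * R)%type.
Local Notation M := (E * R)%type.

(** Symmetric in the two systems, so that each result on a pair can be read in both directions. The
    last two fields describe the kernel of D_m g as the graph of the gradient of the other function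
    in its first variable: Q in one case, g_x in the other. *)
Record dual_pair (Gam : set W) (g : W -> R) (Gam' : set W) (g' : W -> R) : Prop := {
  dp_S : generating_system Gam g;
  dp_S' : generating_system Gam' g';
  dp_to : forall x y z, Gam (x, y, z) ->
    Gam' (y, x, g (x, y, z)) /\ g' (y, x, g (x, y, z)) = z;
  dp_of : forall x y u, Gam' (y, x, u) ->
    Gam (x, y, g' (y, x, u)) /\ g (x, y, g' (y, x, u)) = u;
  dp_d1 : forall x y z (k : M), Gam (x, y, z) -> d1 g (x, y, z) (inm k) =
    d1 g (x, y, z) (inm (0, 1)) * (k.2 - d1 g' (y, x, g (x, y, z)) (inx k.1));
  dp_d1' : forall x y u (k : M), Gam' (y, x, u) -> d1 g' (y, x, u) (inm k) =
    d1 g' (y, x, u) (inm (0, 1)) * (k.2 - d1 g (x, y, g' (y, x, u)) (inx k.1)) }.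

Lemma dual_pair_sym Gam g Gam' g' : dual_pair Gam g Gam' g' -> dual_pair Gam' g' Gam g.
Proof.
by case=> S S' to of_ d d'; split=> // *; [exact: of_|exact: to|exact: d'|exact: d].
Qed.

Variables (Gam : set W) (g : W -> R).
Hypothesis S : generating_system Gam g.
Let oG := s_open S.
Let gC := s_C2 S.
Let hW : finite_coords W := W_coords.
Local Notation G' := (dual_dom Gam g).
Local Notation g' := (dual_fun Gam g).
Local Notation phw := (phi Gam g).
Local Notation dgw := (dgd Gam g).

Lemma d1_dual w v : G' w -> d1 g' w v = dgw w v.
Proof. by move=> D; have [_ H] := dual_C1 S; exact: H. Qed.

Lemma inm_split (k : M) : inm k = k.2 *: inm (0, 1) + inm (k.1, 0) :> W.
Proof.
rewrite -inmZ -[in RHS](scale1r (inm (k.1, 0))) -inmZ.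
have h := inmD k.2 ((0, 1) : M) ((k.1, 0) : M).
rewrite -!inmZ in h; rewrite scale1r -h; congr inm.
by case: k {h} => k1 k2; congr (_, _); rewrite /= ?scaler0 ?add0r // addr0; exact/esym/mulr1.
Qed.

Local Transparent inx inm.

Lemma swp_inx v : swp (inx v) = inm (v, 0) :> W.
Proof. by []. Qed.

Lemma swp_inm (k : M) : swp (inm k) = inx k.1 :> W.
Proof. by []. Qed.

Lemma inx2 (v : E) : (inx v : W).2 = 0.
Proof. by []. Qed.

Lemma inm2 (k : M) : (inm k : W).2 = k.2.
Proof. by []. Qed.

Local Opaque inx inm.

Lemma dgd_inx w v : dgw w (inx v) = - d1 g (phw w) (inm (v, 0)) / gz g (phw w).
Proof. by rewrite /dgd swp_inx inx2 sub0r. Qed.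

Lemma dgd_inm w (k : M) : dgw w (inm k) = (k.2 - d1 g (phw w) (inx k.1)) / gz g (phw w).
Proof. by rewrite /dgd swp_inm inm2. Qed.

Lemma d1_inm w (k : M) : G' w ->
  d1 g (phw w) (inm k) = gz g (phw w) * (k.2 - dgw w (inx k.1)).
Proof.
move=> D; have [G _] := dualP D; have n0 := gz_neq0 S D.
rewrite inm_split (d1Dl gC G) -/(gz g (phw w)) dgd_inx.
by move: (d1 g _ _) => A; field.
Qed.

Lemma dgd_inm01 w : G' w -> dgw w (inm (0, 1)) = (gz g (phw w))^-1.
Proof.
move=> D; have [G _] := dualP D.
have h : d1 g (phw w) (inx (0 : E)) = 0 by rewrite inx0; exact: d10.
by rewrite dgd_inm /= h subr0 mul1r.
Qed.

(** The identity g_z D_y g* + g_y = 0 is differentiated along a kernel direction k, in which z does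
    not change. It relates the mixed derivatives of the two systems with their directions exchanged,
    so the matrix E of one is, up to a factor, the transpose of that of the other. *)
Lemma d2_dual w (k : M) (v : E) : G' w -> d1 g' w (inm k) = 0 ->
  gz g (phw w) * d2 g' w (inm k) (inx v) =
  - d2 g (phw w) (inm (v, d1 g' w (inx v))) (inx k.1).
Proof.
move=> D k0; have [G _] := dualP D.
have [g'C g'E] := dual_C1 S; have g'C2 := dual_C2 S.
have oD := dual_dom_open S.
have [AC AE] := comp_phi_C1 S (gC.2 (inm (0, 1))).
have [BC BE] := comp_phi_C1 S (gC.2 (swp (inx v))).
(* F vanishes on the whole dual domain, so its derivative in the direction k can be computed by the
   product and chain rules and set to 0. *)
pose F w := 'D_(inx v) g' w * 'D_(inm (0, 1)) g (phw w) + 'D_(swp (inx v)) g (phw w).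
have FE w' : G' w' -> F w' = cst 0 w'.
  move=> D'; have n0 := gz_neq0 S D'; rewrite /F g'E // dgd_inx /cst swp_inx.
  rewrite -mulrA mulVf ?mulr1; first exact: addNr.
  exact: n0.
have cC : C1_on G' (cst 0 : W -> R).
  split; first by move=> *; exact: differentiable_cst.
  move=> u Q DQ; have -> : 'D_u (cst 0) = cst 0 :> (W -> R).
    by apply/funext => Q'; exact: derive_cst.
  exact: cvg_cst.
have [_ FD] := C1_eq hW oD cC FE.
have := FD w (inm k) D; rewrite derive_cst.
have d0 : derivable ('D_(inx v) g') w (inm k) by exact: diff_derivable ((g'C2.2 _).1 _ D).
have dA : derivable (fun w => 'D_(inm (0, 1)) g (phw w)) w (inm k).
  exact: diff_derivable (AC.1 _ D).
have dB : derivable (fun w => 'D_(swp (inx v)) g (phw w)) w (inm k).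
  exact: diff_derivable (BC.1 _ D).
rewrite (derive_comb d0 dA dB) AE // BE //.
have k0' : dgw w (inm k) = 0 by rewrite -(d1_dual _ D).
rewrite k0' scale0r add0r swp_inm swp_inx => H.
have vE : inm (v, d1 g' w (inx v)) = d1 g' w (inx v) *: inm (0, 1) + inm (v, 0) :> W.
  exact: inm_split.
rewrite (d2C hW oG gC G) vE (d2Dr hW oG gC G).
have {}H : d1 g' w (inx v) * d2 g (phw w) (inx k.1) (inm (0, 1)) +
   gz g (phw w) * d2 g' w (inm k) (inx v) + d2 g (phw w) (inx k.1) (inm (v, 0)) = 0 := H.
exact: solve_real H.
Qed.

Lemma inm_zero w (k : M) : G' w ->
  d1 g (phw w) (inm k) = 0 <-> k.2 = d1 g' w (inx k.1).
Proof.
move=> D; have n0 := gz_neq0 S D; rewrite d1_inm // d1_dual //; split=> [/eqP|->].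
  by rewrite mulf_eq0 (negPf n0) /= subr_eq0 => /eqP.
by rewrite subrr mulr0.
Qed.

Lemma inm_zero' w (k : M) : G' w ->
  d1 g' w (inm k) = 0 <-> k.2 = d1 g (phw w) (inx k.1).
Proof.
move=> D; have n0 := gz_neq0 S D; rewrite d1_dual // dgd_inm; split=> [/eqP|->].
  by rewrite mulf_eq0 invr_eq0 (negPf n0) orbF subr_eq0 => /eqP.
by rewrite subrr mul0r.
Qed.

Lemma dual_A1 y (m m' : M) : G' (pt y m) -> G' (pt y m') ->
  g' (pt y m) = g' (pt y m') ->
  (forall v : E, d1 g' (pt y m) (inx v) = d1 g' (pt y m') (inx v)) -> m = m'.
Proof.
move=> D D' e H; have [G h] := dualP D; have [G1 h'] := dualP D'.
have E1 : phw (pt y m) = pt m.1 (y, g' (pt y m)) by [].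
have E2 : phw (pt y m') = pt m'.1 (y, g' (pt y m)) by rewrite e.
have xx : m.1 = m'.1.
  have := s_A1s S (x := m.1) (x' := m'.1) (m := (y, g' (pt y m))).
  rewrite -E1 -E2; apply; [exact: G|exact: G1|].
  by move=> k /(inm_zero _ D) kE; apply/(inm_zero _ D'); rewrite kE H.
have h1 : g (phw (pt y m)) = m.2 := h.
have h2 : g (phw (pt y m')) = m'.2 := h'.
have E3 : phw (pt y m) = phw (pt y m') by rewrite E1 E2 xx.
by move: xx; rewrite (surjective_pairing m) (surjective_pairing m') /= => ->;
  rewrite -h1 -h2 E3.
Qed.

Lemma dual_A1s y y' (m : M) : G' (pt y m) -> G' (pt y' m) ->
  (forall k : M, d1 g' (pt y m) (inm k) = 0 -> d1 g' (pt y' m) (inm k) = 0) -> y = y'.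
Proof.
move=> D D' H; have [G h] := dualP D; have [G1 h'] := dualP D'.
have E1 : phw (pt y m) = pt m.1 (y, g' (pt y m)) by [].
have E2 : phw (pt y' m) = pt m.1 (y', g' (pt y' m)) by [].
have h1 : g (phw (pt y m)) = m.2 := h.
have h2 : g (phw (pt y' m)) = m.2 := h'.
have := s_A1 S (x := m.1) (m := (y, g' (pt y m))) (m' := (y', g' (pt y' m))).
rewrite -E1 -E2 h1 h2 => K; suff : (y, g' (pt y m)) = (y', g' (pt y' m)) by case.
apply: K; [exact: G|exact: G1|by []|].
move=> v; have k0 : d1 g' (pt y m) (inm (v, d1 g (phw (pt y m)) (inx v))) = 0.
  by apply/(inm_zero' _ D).
by have /(inm_zero' _ D') := H _ k0.
Qed.

Lemma dual_A2 w (k : M) : G' w -> d1 g' w (inm k) = 0 ->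
  (forall v : E, d2 g' w (inm k) (inx v) = 0) -> k = 0.
Proof.
move=> D k0 H; have [G h] := dualP D.
have v0 : k.1 = 0.
  apply: (s_A2s S G) => k' /(inm_zero _ D) kE.
  have := d2_dual k'.1 D k0; rewrite H mulr0 -kE => /eqP.
  by rewrite eq_sym oppr_eq0 => /eqP; case: k' {kE}.
have k2 : k.2 = 0.
  have /(inm_zero' _ D) -> := k0; rewrite v0 inx0; exact: d10.
by rewrite (surjective_pairing k) v0 k2.
Qed.

Lemma dual_A2s w (v : E) : G' w ->
  (forall k : M, d1 g' w (inm k) = 0 -> d2 g' w (inm k) (inx v) = 0) -> v = 0.
Proof.
move=> D H; have [G h] := dualP D.
suff : ((v, d1 g' w (inx v)) : M) = 0 by case.
apply: (s_A2 S G); first exact/(inm_zero _ D).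
move=> z.
have k0 : d1 g' w (inm (z, d1 g (phw w) (inx z))) = 0 by apply/(inm_zero' _ D).
have := d2_dual v D k0; rewrite (H _ k0) mulr0 /= => /eqP.
by rewrite eq_sym oppr_eq0 => /eqP.
Qed.

(** A1 and A1* are exchanged because g_x and Q are the first-variable gradients of g and of the dual
    function; [d2_dual] exchanges the two sides of A2. *)
Lemma dual_system : generating_system G' g'.
Proof.
split.
- exact: dual_dom_open.
- exact: dual_C2.
- move=> w D; have [G _] := dualP D.
  by rewrite d1_dual // dgd_inm01 // invr_lt0; exact: s_gz S _ G.
- move=> y x u u' D D' e; have [_ h] := dualP D; have [_ h'] := dualP D'.
  have E1 : phw (y, x, u) = phw (y, x, u') by rewrite /phi e.
  by rewrite E1 h' in h.
- exact: dual_A1.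
- exact: dual_A1s.
- exact: dual_A2.
- exact: dual_A2s.
Qed.

Lemma dual_pairP : dual_pair Gam g G' g'.
Proof.
split; [exact: S|exact: dual_system| | | |].
- by move=> x y z G; exact: (dual_fun_unique S (w := (y, x, g (x, y, z))) G).
- by move=> x y u /dualP.
- move=> x y z k G.
  have [D e] := dual_fun_unique S (w := (y, x, g (x, y, z))) G erefl.
  have := d1_inm k D; rewrite -(d1_dual _ D) /gz.
  have -> : phw (y, x, g (x, y, z)) = (x, y, z) by rewrite /phi /= e.
  by [].
move=> x y u k D; rewrite !(d1_dual _ D) dgd_inm dgd_inm01 // mulrC.
by [].
Qed.

End Dual_system.

(** * Duality of A3s *)

Lemma bilin_bounded (R : realType) (V : normedModType R) (B : V -> V -> R) :
  finite_coords V ->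
  (forall w a u v, B (a *: u + v) w = a * B u w + B v w) ->
  (forall w a u v, B w (a *: u + v) = a * B w u + B w v) ->
  exists2 K : R, 0 < K & forall u v, `|B u v| <= K * (`|u| * `|v|).
Proof.
move=> hV lin1 lin2; have [I [e [c cE]]] := hV.
have H i : {K : R | 0 < K /\ forall v, `|B (e i) v| <= K * `|v|}.
  apply: cid; have [K K0 HK] := lin_bounded hV (lin2 (e i)); by exists K.
exists (\sum_i sval (H i) + 1).
  by rewrite ltr_wpDl // sumr_ge0 // => i _; apply: ltW; case: (svalP (H i)).
have B0 w : B 0 w = 0.
  by have := lin1 w (-1) 0 0; rewrite scaler0 addr0 mulN1r addNr.
move=> u v; have [uE cu] := cE u.
have -> : B u v = \sum_i c i u * B (e i) v.
  rewrite {1}uE; elim/big_ind2 : _ => // [v1 r1 v2 r2|i _].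
    by move=> <- <-; have := lin1 v 1 r1 r2; rewrite scale1r mul1r.
  by have := lin1 v (c i u) (e i) 0; rewrite B0 !addr0.
apply: le_trans (ler_norm_sum _ _ _) _; rewrite mulrDl mulr_suml.
apply: (@le_trans _ _ (\sum_i sval (H i) * (`|u| * `|v|))).
  apply: ler_sum => i _; rewrite normrM mulrCA; apply: ler_pM => //.
  by case: (svalP (H i)).
by rewrite lerDl mul1r mulr_ge0.
Qed.

(** The inverse of the bound plays the role of the parameter near 0 in the tube lemma, which
    monotonicity in C permits. *)
Lemma compact_bound (R : realType) (Y : normedModType R) (K : set Y)
    (Q : R -> Y -> Prop) : compact K ->
  (forall C C' y, C <= C' -> Q C y -> Q C' y) ->
  (forall y0, K y0 -> exists2 C : R, 0 < C & exists2 r : R, 0 < r &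
     forall y, K y -> `|y - y0| < r -> Q C y) ->
  exists2 C : R, 0 < C & forall y, K y -> Q C y.
Proof.
move=> cK mono H.
have [|r r0 Hr] := @tube R R Y 0 K (fun s y => K y -> 0 < s -> Q s^-1 y) cK.
  move=> y0 Ky; have [C C0 [r r0 Hr]] := H _ Ky.
  have Ci : 0 < C^-1 by rewrite invr_gt0.
  have [q [q0 qr qC]] := min2 r0 Ci; exists q => // s y sq yq Ky' s0.
  apply: (mono C); last exact: Hr Ky' (lt_le_trans yq qr).
  rewrite -[C]invrK lef_pV2 ?posrE //; apply: ltW; apply: lt_le_trans qC.
  by move: sq; rewrite subr0 gtr0_norm.
have r20 : 0 < r / 2 by exact: divr_gt0.
exists (r / 2)^-1; first by rewrite invr_gt0.
move=> y Ky; apply: (Hr (r / 2) y y) => //; last by rewrite subrr normr0.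
by rewrite subr0 gtr0_norm //; exact: half_ltr.
Qed.

Lemma gz_range (R : realFieldType) (C1 C2 c a : R) : 0 < C1 -> 0 < C2 -> 0 < c ->
  `|a - - c| <= c / 2 ->
  1 <= (C1 + C2 + 2 / c + 2 * c) * - a /\ - a <= C1 + C2 + 2 / c + 2 * c.
Proof.
move=> C10 C20 c0; rewrite ler_norml => /andP[h1 h2].
have c2 : 0 < 2 / c by exact: divr_gt0.
split; last lra.
have h3 : c / 2 <= - a by lra.
have h4 : (2 / c) * (c / 2) <= (C1 + C2 + 2 / c + 2 * c) * - a.
  by apply: ler_pM => //; [exact: ltW|rewrite divr_ge0 // ltW|lra].
have e : 2 / c * (c / 2) = 1 by field; rewrite gt_eqF.
by rewrite e in h4.
Qed.

(** * Constants that are uniform on compact sets *)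

Section Local_constants.
Context {R : realType} {n : nat}.
Local Notation E := 'rV[R]_n.
Local Notation W := (E * E * R)%type.
Local Notation M := (E * R)%type.
Variables (Gam : set W) (g : W -> R).
Hypothesis S : generating_system Gam g.
Let oG := s_open S.
Let gC := s_C2 S.
Let hW : finite_coords W := W_coords.

Lemma d1_lipschitz P : Gam P -> exists2 C : R, 0 < C & exists2 r : R, 0 < r &
  forall (A B u : W), `|A - P| < r -> `|B - P| < r ->
  `|d1 g B u - d1 g A u| <= C * `|u| * `|B - A|.
Proof.
move=> GP; have [K K0 HK] := bilin_bounded hW (fun w a u v => d2Dl gC GP a u v w)
  (fun w a u v => d2Dr hW oG gC GP a u v w).
have [r r0 Hr] := strict2 hW oG gC GP ltr01.
exists (K + 1); first exact: addr_gt0.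
exists r; first exact: r0.
move=> A B u Ar Br; have [_ h] := Hr A B u Ar Br.
have k := HK (B - A) u.
rewrite -(subrK (d2 g P (B - A) u) (d1 g B u - d1 g A u)).
apply: le_trans (ler_normD _ _) _.
by move: h k; move: `|_ - d2 _ _ _ _| `|d2 _ _ _ _| `|u| `|B - A| => X1 X2 X3 X4; lra.
Qed.

Lemma strict1' P : Gam P -> exists2 r : R, 0 < r & forall A B : W,
  `|A - P| < r -> `|B - P| < r -> `|g B - g A - d1 g P (B - A)| <= `|B - A|.
Proof.
move=> GP; have [r r0 Hr] := strict1 hW oG gC GP ltr01.
exists r; first exact: r0.
by move=> A B Ar Br; have [_] := Hr A B Ar Br; rewrite mul1r.
Qed.

Lemma g_lipschitz P : Gam P -> exists2 C : R, 0 < C & exists2 r : R, 0 < r &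
  forall A B : W, `|A - P| < r -> `|B - P| < r -> `|g B - g A| <= C * `|B - A|.
Proof.
move=> GP; have [K K0 HK] := lin_bounded hW (fun a u v => d1Dl gC GP a u v).
have [r r0 Hr] := strict1' GP.
exists (K + 1); first exact: addr_gt0.
exists r; first exact: r0.
move=> A B Ar Br; have h := Hr A B Ar Br; have k := HK (B - A).
rewrite -(subrK (d1 g P (B - A)) (g B - g A)).
apply: le_trans (ler_normD _ _) _; rewrite mulrDl addrC mul1r; exact: lerD.
Qed.

Lemma d1mB P (k l : M) : Gam P ->
  d1 g P (inm (k - l)) = d1 g P (inm k) - d1 g P (inm l).
Proof.
move=> GP; have -> : k - l = (-1) *: l + k by rewrite scaleN1r addrC.
by rewrite (d1mD S _ _ _ GP) mulN1r addrC.
Qed.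

Lemma txB P (k l : M) : Gam P -> tx g P (k - l) = tx g P k - tx g P l.
Proof.
move=> GP; have -> : k - l = (-1) *: l + k by rewrite scaleN1r addrC.
by rewrite (txD S _ _ _ GP) scaleN1r addrC.
Qed.

(* Constants at P that can be chosen uniformly on compact sets. *)
Definition local_const (C : R) (P : W) : Prop := exists2 r : R, 0 < r &
  (forall (x : E) (m m' : M), `|pt x m - P| < r -> `|pt x m' - P| < r ->
     `|m' - m| <= C * (`|g (pt x m') - g (pt x m)| + `|gx g x m' - gx g x m|)) /\
  (forall (A B u : W), `|A - P| < r -> `|B - P| < r -> Gam A /\
     `|d1 g B u - d1 g A u| <= C * `|u| * `|B - A| /\
     1 <= C * - d1 g A (inm (0, 1)) /\ - d1 g A (inm (0, 1)) <= C).

Lemma local_const_near P0 : Gam P0 -> exists2 C : R, 0 < C & exists2 r : R, 0 < r &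
  forall P : W, `|P - P0| < r -> local_const C P.
Proof.
move=> G0; have P0E := pt_surj P0.
have G0' : Gam (pt P0.1.1 (P0.1.2, P0.2)) by rewrite -P0E.
have [C1 C10 [r1 r10 H1]] := inverse_lipschitz S G0'.
have [C2 C20 [r2 r20 H2]] := d1_lipschitz G0.
have [c cE] := named (- d1 g P0 (inm (0, 1))).
have c0 : 0 < c by rewrite cE oppr_gt0; exact: s_gz S _ G0.
have c20 : 0 < c / 2 by exact: divr_gt0.
have [r3 r30 H3] := d1_near hW oG gC G0 c20.
have [r [r0 rr1 rr2 rr3]] := min3 r10 r20 r30.
pose C := C1 + C2 + 2 / c + 2 * c.
have C0 : 0 < C by rewrite /C !addr_gt0 ?divr_gt0 // mulr_gt0.
have C2c : 0 < 2 / c by exact: divr_gt0.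
exists C; first exact: C0.
have r_20 : 0 < r / 2 by exact: divr_gt0.
exists (r / 2); first exact: r_20.
move=> P Pr; exists (r / 2); first exact: r_20.
have tri A : `|A - P| < r / 2 -> `|A - P0| < r.
  move=> h; have -> : A - P0 = (A - P) + (P - P0) by rewrite addrA subrK.
  by apply: le_lt_trans (ler_normD _ _) _; rewrite (splitr r); exact: ltrD.
split.
  move=> x m m' /tri h /tri h'; rewrite {1}P0E norm_pt gt_max in h.
  rewrite {1}P0E norm_pt gt_max in h'.
  have [hx hm] := andP h; have [_ hm'] := andP h'.
  apply: le_trans (H1 x m m' (lt_le_trans hx rr1) (lt_le_trans hm rr1) (lt_le_trans hm' rr1)) _.
  apply: ler_wpM2r; first exact: addr_ge0.
  by rewrite /C; lra.
move=> A B u /tri hA /tri hB.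
have [GA HA] := H3 _ (lt_le_trans hA rr3).
split; first exact: GA.
split.
  apply: le_trans (H2 A B u (lt_le_trans hA rr2) (lt_le_trans hB rr2)) _.
  apply: ler_wpM2r; first exact: normr_ge0.
  apply: ler_wpM2r; first exact: normr_ge0.
  by rewrite /C; lra.
have := HA (inm (0, 1)).
have k : c / 2 * `|inm (0, 1) : W| <= c / 2 by apply: ler_piMr; [exact: ltW|exact: norm_inm01].
move=> /le_trans /(_ k).
have -> : d1 g P0 (inm (0, 1)) = - c by rewrite cE opprK.
move: (d1 g A _) => a; exact: (gz_range C10 C20 c0).
Qed.

Lemma local_const_mono (C C' : R) P : C <= C' -> local_const C P -> local_const C' P.
Proof.
move=> CC [r r0 [H1 H2]]; exists r; first exact: r0.
split=> [x m m' h h'|A B u h h'].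
  apply: le_trans (H1 x m m' h h') _; apply: ler_wpM2r => //; exact: addr_ge0.
have [GA [k1 [k2 k3]]] := H2 A B u h h'; split; first exact: GA.
split.
  apply: le_trans k1 _; apply: ler_wpM2r => //; exact: ler_wpM2r.
split; last exact: le_trans k3 CC.
apply: le_trans k2 _; apply: ler_wpM2r => //.
by rewrite oppr_ge0 ltW //; exact: s_gz S _ GA.
Qed.

End Local_constants.

Lemma dist_real (R : realFieldType) (C N d k X a : R) : 0 < C -> 0 <= N -> 0 <= d ->
  0 <= X -> 1 <= C * a -> a * d ^+ 2 <= C * k * X -> k <= (1 + N * C) * d ->
  d <= C * C * (1 + N * C) * X.
Proof.
move=> C0 N0 d0 X0 h1 h2 h3; have [->|dn0] := eqVneq d 0.
  by rewrite !mulr_ge0 ?addr_ge0 ?mulr_ge0 // ltW.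
have dp : 0 < d by rewrite lt_neqAle eq_sym dn0.
have h4 : 1 * d ^+ 2 <= C * a * d ^+ 2 by apply: ler_wpM2r => //; exact: sqr_ge0.
have h5 : C * (a * d ^+ 2) <= C * (C * k * X) by rewrite ler_pM2l.
have h6 : C * (C * k * X) <= C * (C * ((1 + N * C) * d) * X).
  by rewrite ler_pM2l // ler_wpM2r // ler_pM2l.
by rewrite -(ler_pM2r dp); lra.
Qed.

Lemma diff_real (R : realFieldType) (C a d del : R) : 0 < a -> a <= C -> 0 < del ->
  d <= del -> d * a <= C * del.
Proof.
move=> a0 aC del0 dd; have [d0|d0] := leP d 0.
  have h : 0 <= C * del by rewrite mulr_ge0 // ltW // (lt_le_trans a0).
  by apply: le_trans h; rewrite pmulr_lle0.
by rewrite mulrC; apply: ler_pM => //; exact: ltW.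
Qed.

Lemma curve_diff_real (R : realFieldType) (e s z z' z0 q qv f f' Dv val del : R) :
  e = (del - val) / 2 -> val = Dv + 2^-1 * (f' - f) ->
  `|z' - z0 - s * q - s ^+ 2 * (qv + Dv + 2^-1 * f')| <= e * s ^+ 2 ->
  `|z - z0 - s * q - s ^+ 2 * (qv + 2^-1 * f)| <= e * s ^+ 2 ->
  z' - z <= del * s ^+ 2.
Proof. by move=> -> ->; rewrite !ler_norml => /andP[? ?] /andP[? ?]; lra. Qed.

Lemma star_real (R : realFieldType) (C C2 c del s eta D X p : R) : 0 < C -> 0 < C2 ->
  0 < c -> 0 < s -> 0 <= eta -> 0 <= D -> 0 <= X -> 0 <= p ->
  C * del < c * (eta / (2 * C) * (D / C2)) ^+ 2 -> D <= C2 * X ->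
  s * eta / 2 <= C * p -> C * (del * s ^+ 2) < c * (p * X) ^+ 2.
Proof.
move=> C0 C20 c0 s0 e0 D0 X0 p0 h1 h2 h3.
have h4 : s * (eta / (2 * C)) <= p.
  rewrite -(ler_pM2l C0); apply: le_trans h3; rewrite le_eqVlt; apply/orP; left.
  by apply/eqP; field; rewrite gt_eqF.
have h5 : D / C2 <= X by rewrite ler_pdivrMr // mulrC.
have h6 : s * (eta / (2 * C) * (D / C2)) <= p * X.
  rewrite mulrA; apply: ler_pM => //; last by rewrite divr_ge0 // ltW.
  by rewrite mulr_ge0 ?divr_ge0 ?mulr_ge0 // ltW.
have h7 : (s * (eta / (2 * C) * (D / C2))) ^+ 2 <= (p * X) ^+ 2.
  rewrite ler_sqr ?nnegrE //; last exact: mulr_ge0.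
  apply: mulr_ge0; first exact: ltW.
  by rewrite !mulr_ge0 ?invr_ge0 ?mulr_ge0 // ltW.
have h8 : c * (s * (eta / (2 * C) * (D / C2))) ^+ 2 <= c * (p * X) ^+ 2 by rewrite ler_pM2l.
apply: lt_le_trans h8; have s2 : 0 < s ^+ 2 by rewrite exprn_gt0.
move: h1; rewrite -(ltr_pM2r s2); lra.
Qed.

Lemma sign_real (R : realFieldType) (a k q d : R) : a < 0 -> k = q ->
  a * (k - (q + d)) <= 0 -> d <= 0.
Proof.
move=> a0 -> ; have -> : a * (q - (q + d)) = - a * d by ring.
by rewrite pmulr_rle0 // oppr_gt0.
Qed.

Lemma half_gt0 (R : realFieldType) (r : R) : 0 < r -> 0 < r / 2.
Proof. lra. Qed.

Lemma curve_low_real (R : realFieldType) (s eta v : R) : 0 <= s -> 0 <= v ->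
  s < eta / (2 * (v + 1)) -> s * eta / 2 <= s * eta - s ^+ 2 * v.
Proof.
move=> s0 v0; have v1 : 0 < 2 * (v + 1) by rewrite mulr_gt0 // ltr_wpDl.
rewrite ltr_pdivlMr // => h.
have : s * (s * (2 * (v + 1))) <= s * eta by apply: ler_wpM2l => //; exact: ltW.
have := sqr_ge0 s; lra.
Qed.

Lemma small_real (R : realFieldType) (C C2 c D e es N d : R) : 0 < C -> 0 < C2 ->
  0 < c -> 0 < D -> 0 < e -> 0 < N -> e <= N * es ->
  d = c / (4 * C ^+ 3 * C2 ^+ 2 * N ^+ 2) * D ^+ 2 * e ^+ 2 ->
  C * (d / 2) < c * (es / (2 * C) * (D / C2)) ^+ 2.
Proof.
move=> C0 C20 c0 D0 e0 N0 h ->.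
have k : 0 < c * D ^+ 2 / (4 * C ^+ 2 * C2 ^+ 2 * N ^+ 2).
  by rewrite divr_gt0 ?mulr_gt0 ?exprn_gt0.
have -> : c * (es / (2 * C) * (D / C2)) ^+ 2 =
   c * D ^+ 2 / (4 * C ^+ 2 * C2 ^+ 2 * N ^+ 2) * (N * es) ^+ 2.
  by field; rewrite !gt_eqF.
have -> : C * (c / (4 * C ^+ 3 * C2 ^+ 2 * N ^+ 2) * D ^+ 2 * e ^+ 2 / 2) =
   c * D ^+ 2 / (4 * C ^+ 2 * C2 ^+ 2 * N ^+ 2) * (e ^+ 2 / 2).
  by field; rewrite !gt_eqF.
rewrite ltr_pM2l //.
have h2 : e ^+ 2 <= (N * es) ^+ 2.
  by rewrite ler_sqr ?nnegrE ?(ltW e0) // (le_trans (ltW e0)).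
have : 0 < e ^+ 2 by rewrite exprn_gt0.
lra.
Qed.

Lemma val_real (R : realFieldType) (f fp fm d : R) :
  (fp + fm) / 2 - d < f -> (fp + fm - 2 * f) / 4 < d / 2.
Proof. lra. Qed.

Lemma val_eqs (R : realFieldType) (f fp fm d val Dv Dw : R) :
  val = (fp + fm - 2 * f) / 4 -> Dv = (fm - fp) / 4 -> Dw = (d / 2 - val) / 2 ->
  val < d / 2 ->
  [/\ Dv + 2^-1 * (fp - f) < d / 2, Dv + Dw + 2^-1 * (fp - f) < d / 2,
      - Dv + 2^-1 * (fm - f) < d / 2 & - (Dv + Dw) + 2^-1 * (fm - f) < d / 2].
Proof. by move=> -> -> -> h; split; lra. Qed.

Lemma perturb_real (R : realFieldType) (Dw s2 CP N nD nw C3 B l dm : R) : 0 < Dw ->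
  0 < s2 -> 0 < CP -> 0 <= N -> 0 <= nD -> 0 < B ->
  B = N * (nD * (2 * CP * ((1 + C3) * nw))) + 1 ->
  l <= CP * (2 * (Dw / (2 * B) * dm)) -> dm <= (1 + C3) * (s2 * nw) ->
  s2 * Dw <= N * (nD * l) -> False.
Proof.
move=> Dw0 s20 CP0 N0 nD0 B0 BE h1 h2 h3.
have e0 : 0 <= Dw / (2 * B) by rewrite divr_ge0 ?mulr_ge0 // ltW.
have k1 : l <= CP * (2 * (Dw / (2 * B) * ((1 + C3) * (s2 * nw)))).
  apply: le_trans h1 _; rewrite ler_pM2l // ler_pM2l //; exact: ler_wpM2l.
have k2 : N * (nD * l) <= N * (nD * (CP * (2 * (Dw / (2 * B) * ((1 + C3) * (s2 * nw)))))).
  by apply: ler_wpM2l => //; apply: ler_wpM2l.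
have e2 : N * (nD * (CP * (2 * (Dw / (2 * B) * ((1 + C3) * (s2 * nw)))))) =
   s2 * Dw / 2 * ((B - 1) / B).
  by rewrite BE; field; rewrite -BE gt_eqF.
have k3 : s2 * Dw / 2 * ((B - 1) / B) <= s2 * Dw / 2 * 1.
  apply: ler_wpM2l; first by rewrite !mulr_ge0 ?invr_ge0 // ltW.
  by rewrite ler_pdivrMr // mul1r gerBl.
have : 0 < s2 * Dw by rewrite mulr_gt0.
lra.
Qed.

Lemma pert_gt0 (R : realFieldType) (N D CP C3 w : R) : 0 <= N -> 0 <= D -> 0 < CP ->
  0 < C3 -> 0 <= w -> 0 < N * (D * (2 * CP * ((1 + C3) * w))) + 1.
Proof.
move=> N0 D0 P0 C0 w0; rewrite ltr_wpDl //.
by rewrite !mulr_ge0 ?addr_ge0 // ltW.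
Qed.

Lemma coeff_gt0 (R : realFieldType) (c C C2 N D e : R) : 0 < c -> 0 < C -> 0 < C2 ->
  0 < N -> 0 < D -> 0 < e ->
  0 < c / (4 * C ^+ 3 * C2 ^+ 2 * N ^+ 2) * D ^+ 2 * e ^+ 2.
Proof. by move=> *; rewrite !mulr_gt0 ?invr_gt0 ?mulr_gt0 ?exprn_gt0. Qed.

(** * From the infinitesimal maximum principle to a second order inequality for the dual function *)

Section Dual_curve.
Context {R : realType} {n : nat}.
Local Notation E := 'rV[R]_n.
Local Notation W := (E * E * R)%type.
Local Notation M := (E * R)%type.
Variables (Gam : set W) (g : W -> R) (Gam' : set W) (g' : W -> R).
Hypothesis dp : dual_pair Gam g Gam' g'.
Let S := dp_S dp.
Let S' := dp_S' dp.
Let hW : finite_coords W := W_coords.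

Lemma dp_pt x (m : M) : Gam (pt x m) ->
  Gam' (pt m.1 (x, g (pt x m))) /\ g' (pt m.1 (x, g (pt x m))) = m.2.
Proof. by case: m => y z; exact: (dp_to dp). Qed.

Lemma dp_pt' y (m : M) : Gam' (pt y m) ->
  Gam (pt m.1 (y, g' (pt y m))) /\ g (pt m.1 (y, g' (pt y m))) = m.2.
Proof. by case: m => x u; exact: (dp_of dp). Qed.

Lemma dp_q x (m k : M) : Gam (pt x m) -> d1 g (pt x m) (inm k) =
  d1 g (pt x m) (inm (0, 1)) * (k.2 - dotp (gx g' m.1 (x, g (pt x m))) k.1).
Proof.
move=> G; have [G' _] := dp_pt G.
have -> := gxE S' k.1 G'.
by case: m G G' => y z G _; exact: (dp_d1 dp).
Qed.

Variables (x : E) (m0 : M).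
Hypothesis GP : Gam (pt x m0).
Let u := g (pt x m0).
Let q := gx g' m0.1 (x, u).
Variable C : R.
Hypothesis C0 : 0 < C.
Hypothesis lc : local_const Gam g C (pt x m0).
Hypothesis qC : `|q| <= C.
Local Notation N := (n.+1%:R ^+ 2 : R).
Let C2 := C * C * (1 + N * C).

Lemma C2_gt0 : 0 < C2.
Proof. by rewrite /C2 !mulr_gt0 // ltr_wpDr // mulr_ge0 ?sqr_ge0 // ltW. Qed.

(** The vector k = (D, q.D) lies in the kernel of D_m g(x, m0), whereas D_m g(x', m0) k = -g_z
    |D|^2. Lipschitz continuity of D_m g in x compares the two values, and |k| = O(|D|). *)
Lemma dual_dist : exists2 r : R, 0 < r & forall (x' D : E), `|x' - x| < r ->
  gx g' m0.1 (x', g (pt x' m0)) = q + D ->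
  [/\ Gam (pt x' m0) & enorm D <= C2 * `|x' - x|].
Proof.
have [r r0 [_ H]] := lc; exists r; first exact: r0.
move=> x' D xr qD.
have zz : `|pt x m0 - pt x m0| < r by rewrite subrr normr0.
have Pr : `|pt x' m0 - pt x m0| < r by rewrite ptBx norm_inx.
have [G' [_ [k1 _]]] := H _ _ 0 Pr zz; split; first exact: G'.
have [k kE] := named ((D, dotp q D) : M).
have kn : `|k| <= (1 + N * C) * enorm D.
  rewrite kE prod_normE /= ge_max; apply/andP; split.
    apply: le_trans (norm_le_enorm _) _; rewrite ler_peMl ?enorm_ge0 // lerDl.
    by rewrite mulr_ge0 ?sqr_ge0 // ltW.
  apply: le_trans (norm_dotp _ _) _; rewrite mulrDl mul1r -mulrA.
  apply: (@le_trans _ _ (N * (C * enorm D))); last by rewrite lerDr enorm_ge0.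
  apply: ler_wpM2l; first exact: sqr_ge0.
  by apply: ler_pM => //; exact: norm_le_enorm.
have e1 : d1 g (pt x m0) (inm k) = 0.
  by rewrite (dp_q _ GP) -/u -/q kE /= subrr mulr0.
have e2 : d1 g (pt x' m0) (inm k) = - d1 g (pt x' m0) (inm (0, 1)) * enorm D ^+ 2.
  by rewrite (dp_q _ G') qD kE /= dotpDDl enorm_sqr; ring.
have [_ [h _]] := H _ _ (inm k) zz Pr; rewrite e1 subr0 e2 ptBx norm_inx norm_inm in h.
apply: dist_real C0 (sqr_ge0 _) (enorm_ge0 _) (normr_ge0 _) k1 (le_trans (ler_norm _) h) kn.
Qed.

Lemma gz_mvt (r : R) (x' y : E) (z z' : R) :
  (forall A B v : W, `|A - pt x m0| < r -> `|B - pt x m0| < r -> Gam A /\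
     `|d1 g B v - d1 g A v| <= C * `|v| * `|B - A| /\
     1 <= C * - d1 g A (inm (0, 1)) /\ - d1 g A (inm (0, 1)) <= C) ->
  `|pt x' (y, z) - pt x m0| < r -> `|pt x' (y, z') - pt x m0| < r ->
  exists a : R, [/\ 0 < a, a <= C &
    g (pt x' (y, z)) - g (pt x' (y, z')) = (z' - z) * a].
Proof.
move=> H Ar Br; have [A AE] := named (pt x' (y, z')).
have [B BE] := named (pt x' (y, z)); rewrite -AE -BE in Ar Br *.
have AB : B - A = (z - z') *: inm (0, 1).
  rewrite AE BE ptBm -inmZ; congr inm; congr (_, _) => /=.
    by rewrite subrr scaler0.
  exact/esym/mulr1.
have inb t : 0 <= t <= 1 -> `|A + t *: (B - A) - pt x m0| < r by exact: ball_segment.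
have [t t01|c /andP[c0 c1]] := @mvt_line R (fun s => g (A + s *: (B - A)))
  (fun t => 'D_(B - A) g (A + t *: (B - A))).
  apply: is_derive_line; have [G _] := H _ _ 0 (inb t t01) (inb t t01).
  exact: diff_derivable ((s_C2 S).1.1 _ G).
rewrite scale1r scale0r addr0 subrKC => e.
have c01 : 0 <= c <= 1 by rewrite !ltW.
have [G [_ [k1 k2]]] := H _ _ 0 (inb c c01) (inb c c01).
exists (- d1 g (A + c *: (B - A)) (inm (0, 1))); split; last first.
- rewrite e; transitivity (d1 g (A + c *: (B - A)) (B - A)); first by [].
  rewrite {2}AB (d1Z (s_C2 S) G); by ring.
- exact: k2.
- by rewrite oppr_gt0; exact: s_gz S _ G.
Qed.

Definition curve (eta v : E) (s : R) : E := m0.1 + (s *: eta + s ^+ 2 *: v).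
(** The curve in (y, z) whose y-part is [curve], with z chosen to keep g(x, .) at the value u. *)
Definition mcurve (eta v : E) (s : R) : M :=
  (curve eta v s, g' (pt (curve eta v s) (x, u))).

Lemma curve_near (eta v : E) (r : R) : 0 < r -> exists2 s0 : R, 0 < s0 &
  forall s : R, 0 < s -> s < s0 -> `|curve eta v s - m0.1| < r.
Proof.
move=> r0; have [X XE] := named (`|eta| + `|v| + 1).
have X0 : 0 < X by rewrite XE ltr_wpDl // addr_ge0.
have k : 0 < r / X by exact: divr_gt0.
have [s0 [s00 sr s1]] := min2 k ltr01.
exists s0; first exact: s00.
move=> s sp ss; have e1 : curve eta v s - m0.1 = s *: eta + s ^+ 2 *: v.
  by rewrite /curve addrC addKr.
rewrite e1; apply: le_lt_trans (norm_curve _ _ sp) _.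
have s1' : s <= 1 by apply: ltW; exact: lt_le_trans ss s1.
apply: le_lt_trans (dxn_real (ltW sp) s1' (normr_ge0 _) XE) _.
by rewrite -ltr_pdivlMr //; exact: lt_le_trans ss sr.
Qed.

(** Along the curve the dual function is expanded over the two points (x, u) and (x', g(x', m0)).
    Both values start from m0.2 and, D being orthogonal to eta, the first order terms agree; the
    difference z' - z is s^2 val up to o(s^2). An upper bound for it becomes one for the increase of
    g(x', .), because -g_z lies between 0 and C. *)
Lemma dual_diff (x' D eta v : E) (f f' val del : R) (r : R) :
  (forall A B v : W, `|A - pt x m0| < r -> `|B - pt x m0| < r -> Gam A /\
     `|d1 g B v - d1 g A v| <= C * `|v| * `|B - A| /\
     1 <= C * - d1 g A (inm (0, 1)) /\ - d1 g A (inm (0, 1)) <= C) ->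
  0 < r -> `|x' - x| < r -> Gam (pt x' m0) ->
  gx g' m0.1 (x', g (pt x' m0)) = q + D -> dotp D eta = 0 ->
  f = dotp (hx g' (pt m0.1 (x, u)) eta) eta ->
  f' = dotp (hx g' (pt m0.1 (x', g (pt x' m0))) eta) eta ->
  val = dotp D v + 2^-1 * (f' - f) -> val < del -> 0 < del ->
  exists2 s0 : R, 0 < s0 & forall s : R, 0 < s -> s < s0 ->
  [/\ Gam (pt x (mcurve eta v s)), g (pt x (mcurve eta v s)) = u,
      Gam (pt x' (mcurve eta v s)) &
    g (pt x' (mcurve eta v s)) - g (pt x' m0) <= C * (del * s ^+ 2)].
Proof.
move=> H r0 xr Gx' qD Deta fE f'E valE vd del0.
have [Gd gd] := dp_pt GP; have [Gd' gd'] := dp_pt Gx'.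
have [u' u'E] := named (g (pt x' m0)); rewrite -u'E in Gd' gd' f'E qD *.
rewrite -/u in Gd gd.
have e0 : 0 < (del - val) / 2 by rewrite divr_gt0 // subr_gt0.
have [s1 s10 H1] := taylor_curve S' eta v Gd e0.
have [s2 s20 H2] := taylor_curve S' eta v Gd' e0.
have [r1 r10 K1] := g_near S' Gd r0; rewrite gd in K1.
have [r2 r20 K2] := g_near S' Gd' r0; rewrite gd' in K2.
have [r3 [r30 r31 r32 r33]] := min3 r0 r10 r20.
have [s3 s30 H3] := curve_near eta v r30.
have [s0 [s00 ss1 ss2 ss3]] := min3 s10 s20 s30.
exists s0; first exact: s00.
move=> s sp ss.
have [G1 T1] := H1 s sp (lt_le_trans ss ss1).
have [G2 T2] := H2 s sp (lt_le_trans ss ss2).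
have yn := H3 s sp (lt_le_trans ss ss3).
rewrite -/(curve eta v s) in G1 G2 T1 T2.
rewrite /mcurve; have [y yE] := named (curve eta v s); rewrite -yE in G1 G2 T1 T2 yn *.
have [z zE] := named (g' (pt y (x, u))); rewrite -zE in T1 *.
have [z' z'E] := named (g' (pt y (x', u'))); rewrite -z'E in T2.
have [A1 A2] := dp_pt' G1; rewrite /= -zE in A1 A2.
have [B1 B2] := dp_pt' G2; rewrite /= -z'E in B1 B2.
have zz (m : M) (r' : R) : 0 < r' -> `|m - m| < r' by rewrite subrr normr0.
have [_ zn] := K1 _ (norm_pt_lt (lt_le_trans yn r32) (zz (x, u) _ r10)).
have [_ z'n] := K2 _ (norm_pt_lt (lt_le_trans yn r33) (zz (x', u') _ r20)).
rewrite -zE in zn; rewrite -z'E in z'n.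
have near t : `|t - m0.2| < r -> `|pt x' (y, t) - pt x m0| < r.
  move=> h; apply: norm_pt_lt; first exact: xr.
  by rewrite prod_normE /= gt_max h andbT; exact: lt_le_trans yn r31.
have [a [a0 aC aE]] := gz_mvt H (near z zn) (near z' z'n).
have [Gz _] := H _ _ 0 (near z zn) (near z zn).
split; [exact: A1|exact: A2|exact: Gz|].
rewrite -B2 aE; apply: diff_real a0 aC _ _; first by rewrite mulr_gt0 // exprn_gt0.
rewrite gd' qD !dotpDDl Deta addr0 -f'E in T2.
rewrite gd -/q -fE in T1.
exact: curve_diff_real erefl valE T2 T1.
Qed.

Lemma curve_lower (eta v : E) : eta != 0 -> exists2 s0 : R, 0 < s0 &
  forall s : R, 0 < s -> s < s0 -> s * `|eta| / 2 <= `|curve eta v s - m0.1|.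
Proof.
move=> en0; have eta0 : 0 < `|eta| by rewrite normr_gt0.
have k : 0 < `|eta| / (2 * (`|v| + 1)).
  by rewrite divr_gt0 // mulr_gt0 // ltr_wpDl.
exists (`|eta| / (2 * (`|v| + 1))); first exact: k.
move=> s sp ss; have e1 : curve eta v s - m0.1 = s *: eta + s ^+ 2 *: v.
  by rewrite /curve addrC addKr.
rewrite e1; have h := lerB_normD (s *: eta) (s ^+ 2 *: v).
rewrite (normrZ s eta) (normrZ (s ^+ 2) v) (gtr0_norm sp) (ger0_norm (sqr_ge0 s)) in h.
apply: le_trans h; apply: curve_low_real ss => //; exact: ltW.
Qed.

Variable c : R.
Hypothesis c0 : 0 < c.
Hypothesis star : star_at Gam g c x u (gx g x m0) (gx g x m0).

(** By [dual_diff] the increase of g(x', .) along the curve is at most C del s^2, and the threshold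
    in [star_at] is also of order s^2; [small] puts the former below the latter. The conclusion of
    [star_at] concerns the initial velocity k of the g-segment from m0 to the curve; since k is in
    the kernel at x, it reads D.k.1 <= 0. *)
Lemma star_sign : exists2 r : R, 0 < r & forall (x' D eta v : E) (f f' val del : R),
  `|x' - x| < r -> gx g' m0.1 (x', g (pt x' m0)) = q + D -> dotp D eta = 0 -> eta != 0 ->
  f = dotp (hx g' (pt m0.1 (x, u)) eta) eta ->
  f' = dotp (hx g' (pt m0.1 (x', g (pt x' m0))) eta) eta ->
  val = dotp D v + 2^-1 * (f' - f) -> val < del -> 0 < del ->
  C * del < c * (`|eta| / (2 * C) * (enorm D / C2)) ^+ 2 ->
  exists2 s0 : R, 0 < s0 & forall (s : R) (k : M), 0 < s -> s < s0 ->
    d1 g (pt x m0) (inm k) = 0 ->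
    tx g (pt x m0) k = gx g x (mcurve eta v s) - gx g x m0 -> dotp D k.1 <= 0.
Proof.
have [r1 r10 H1] := dual_dist.
have [r2 r20 [H2 H2']] := lc.
have [r3 r30 H3] := star.
have [r [r0 rr1 rr2 rr3]] := min3 r10 r20 r30.
exists r; first exact: r0.
move=> x' D eta v f f' val del xr qD Deta en0 fE f'E valE vd del0 small.
have [Gx' Dn] := H1 x' D (lt_le_trans xr rr1) qD.
have [s1 s10 K1] := dual_diff H2' r20 (lt_le_trans xr rr2) Gx' qD Deta fE f'E valE vd del0.
have [s2 s20 K2] := curve_lower v en0.
have [r4 r40 H4] := gx_near S GP (half_gt0 r30).
have [r5 [r50 r52 r54]] := min2 r20 r40.
have [Gd gd] := dp_pt GP; rewrite -/u in Gd gd.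
have [r6 r60 H6] := g_near S' Gd r50; rewrite gd in H6.
have [r7 [r70 r75 r76]] := min2 r50 r60.
have [s3 s30 K3] := curve_near eta v r70.
have [s0 [s00 ss1 ss2 ss3]] := min3 s10 s20 s30.
exists s0; first exact: s00.
move=> s k sp ss k1 k2.
have [G1 g1 _ gl] := K1 s sp (lt_le_trans ss ss1).
have ylow := K2 s sp (lt_le_trans ss ss2).
have yn := K3 s sp (lt_le_trans ss ss3).
have zz (V : normedModType R) (z : V) (r' : R) : 0 < r' -> `|z - z| < r' by rewrite subrr normr0.
have [m mE] := named (mcurve eta v s).
have m1 : m.1 = curve eta v s by rewrite mE.
have m2 : m.2 = g' (pt (curve eta v s) (x, u)) by rewrite mE.
rewrite -mE in G1 g1 gl k2.
have mn : `|m - m0| < r5.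
  rewrite prod_normE /= gt_max m1; apply/andP; split; first exact: lt_le_trans yn r75.
  by rewrite m2; have [] := H6 _ (norm_pt_lt (lt_le_trans yn r76) (zz _ (x, u) _ r60)).
have mP : `|pt x m - pt x m0| < r2.
  by rewrite ptBm norm_inm; exact: lt_le_trans mn r52.
have m0P : `|pt x m0 - pt x m0| < r2 by exact: zz.
have pn : `|gx g x m - gx g x m0| < r3.
  apply: le_lt_trans (H4 x m (zz _ x _ r40) (lt_le_trans mn r54)) _; exact: half_ltr.
have low : s * `|eta| / 2 <= C * `|gx g x m - gx g x m0|.
  apply: le_trans ylow _; apply: (@le_trans _ _ `|m - m0|).
    by rewrite -m1 prod_normE /= le_max lexx.
  by have := H2 x m0 m m0P mP; rewrite g1 -/u subrr normr0 add0r.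
have x'r3 := lt_le_trans xr rr3.
have YZm0 : YZ Gam g x u (gx g x m0) = m0 by exact: (YZ_pt S GP).
have YZm : YZ Gam g x u (gx g x m) = m by rewrite -g1; exact: (YZ_pt S G1).
have := H3 x u (gx g x m0) (gx g x m) x' (zz _ x _ r30) (zz _ u _ r30) (zz _ _ _ r30) pn x'r3.
rewrite /= YZm0 YZm => st.
have low' : s * `|eta| / 2 <= C * enorm (gx g x m - gx g x m0).
  apply: le_trans low _; rewrite ler_pM2l //; exact: norm_le_enorm.
have Dn' : enorm D <= C2 * enorm (x' - x).
  apply: le_trans Dn _; rewrite ler_pM2l ?C2_gt0 //; exact: norm_le_enorm.
have lt1 : g (pt x' m) - g (pt x' m0) < c * (enorm (gx g x m - gx g x m0) * enorm (x' - x)) ^+ 2.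
  apply: le_lt_trans gl _.
  exact: star_real C0 C2_gt0 c0 sp (normr_ge0 _) (enorm_ge0 _) (enorm_ge0 _) (enorm_ge0 _)
    small Dn' low'.
have := st lt1 k k1 k2; rewrite (dp_q _ Gx') qD dotpDDl.
have k2E : k.2 = dotp q k.1.
  have gzP := s_gz S GP; move: k1; rewrite (dp_q _ GP) -/u -/q => /eqP.
  by rewrite mulf_eq0 lt_eqF //= subr_eq0 => /eqP.
exact: sign_real (s_gz S Gx') k2E.
Qed.

(** k' - k agrees with m' - m up to an arbitrarily small multiple of |m' - m| = O(s^2), and the
    y-part of m' - m is exactly s^2 w. If both velocities were orthogonal to D, then s^2 D.w would
    be smaller than itself. *)
Lemma mcurve_perturb (eta v w D : E) : 0 < dotp D w ->
  exists2 s0 : R, 0 < s0 & forall (s : R) (k k' : M), 0 < s -> s < s0 ->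
    d1 g (pt x m0) (inm k) = 0 -> d1 g (pt x m0) (inm k') = 0 ->
    tx g (pt x m0) k = gx g x (mcurve eta v s) - gx g x m0 ->
    tx g (pt x m0) k' = gx g x (mcurve eta (v + w) s) - gx g x m0 ->
    g (pt x (mcurve eta v s)) = g (pt x (mcurve eta (v + w) s)) ->
    dotp D k.1 = 0 -> dotp D k'.1 = 0 -> False.
Proof.
move=> Dw0; have [Gd gd] := dp_pt GP; rewrite -/u in Gd gd.
have [CP CP0 HCP] := tx_bound S GP.
have [C3 C30 [r1 r10 H1]] := g_lipschitz S' Gd.
have [B BE] := named (N * (`|D| * (2 * CP * ((1 + C3) * `|w|))) + 1).
have B0 : 0 < B.
  rewrite BE; exact: pert_gt0 (sqr_ge0 _) (normr_ge0 _) CP0 C30 (normr_ge0 _).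
have B20 : 0 < 2 * B by exact: mulr_gt0 (ltr0Sn R 1) B0.
have e0 : 0 < dotp D w / (2 * B) by exact: divr_gt0 Dw0 B20.
have [r2 r20 H2] := strictm S GP e0.
have [r6 r60 H6] := g_near S' Gd r20; rewrite gd in H6.
have [r7 [r70 r71 r72 r76]] := min3 r10 r20 r60.
have [s1 s10 K1] := curve_near eta v r70.
have [s2 s20 K2] := curve_near eta (v + w) r70.
have [s0 [s00 ss1 ss2]] := min2 s10 s20.
exists s0; first exact: s00.
move=> s k k' sp ss k1 k1' k2 k2' gg Dk Dk'.
have yn := K1 s sp (lt_le_trans ss ss1); have yn' := K2 s sp (lt_le_trans ss ss2).
have zz (V : normedModType R) (z : V) (r' : R) : 0 < r' -> `|z - z| < r' by rewrite subrr normr0.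
have [y yE] := named (curve eta v s); have [y' y'E] := named (curve eta (v + w) s).
have yy : y' - y = s ^+ 2 *: w.
  by rewrite yE y'E /curve; apply/rowP => i; rewrite !mxE; ring.
have [m mE] := named (mcurve eta v s); have [m' m'E] := named (mcurve eta (v + w) s).
have mm : m = (y, g' (pt y (x, u))) by rewrite mE yE.
have mm' : m' = (y', g' (pt y' (x, u))) by rewrite m'E y'E.
rewrite -mE in k2 gg; rewrite -m'E in k2' gg; rewrite -yE in yn; rewrite -y'E in yn'.
have near y1 : `|y1 - m0.1| < r7 -> `|(y1, g' (pt y1 (x, u))) - m0| < r2.
  move=> h; rewrite prod_normE /= gt_max; apply/andP; split; first exact: lt_le_trans h r72.
  by have [] := H6 _ (norm_pt_lt (lt_le_trans h r76) (zz _ (x, u) _ r60)).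
have mn := near _ yn; have mn' := near _ yn'; rewrite -mm in mn; rewrite -mm' in mn'.
have [_ h1 h2] := H2 x m m' (zz _ x _ r20) mn mn'.
rewrite -gg subrr sub0r normrN in h1.
have dmn : `|m' - m| <= (1 + C3) * (s ^+ 2 * `|w|).
  have w0 : 0 <= s ^+ 2 * `|w| by rewrite mulr_ge0 // sqr_ge0.
  have ny : `|y' - y| = s ^+ 2 * `|w|.
    by rewrite yy (normrZ (s ^+ 2) w) (ger0_norm (sqr_ge0 s)).
  rewrite mm mm' prod_normE /= ge_max; apply/andP; split.
    by rewrite ny ler_peMl // lerDl ltW.
  have := H1 _ _ (norm_pt_lt (lt_le_trans yn r71) (zz _ (x, u) _ r10))
    (norm_pt_lt (lt_le_trans yn' r71) (zz _ (x, u) _ r10)).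
  rewrite ptBx norm_inx ny => /le_trans; apply.
  by apply: ler_wpM2r => //; rewrite lerDr.
have [l lE] := named (k' - k - (m' - m)).
have d1l : d1 g (pt x m0) (inm l) = - d1 g (pt x m0) (inm (m' - m)).
  rewrite lE (d1mB S _ _ GP) (d1mB S _ _ GP) k1 k1' subrr sub0r; by [].
have txl : tx g (pt x m0) l = gx g x m' - gx g x m - tx g (pt x m0) (m' - m).
  transitivity (tx g (pt x m0) (k' - k) - tx g (pt x m0) (m' - m)).
    by rewrite lE (txB S _ _ GP).
  by congr (_ - _); rewrite (txB S k' k GP) k2 k2' opprB addrA subrK.
have ln : `|l| <= CP * (2 * (dotp D w / (2 * B) * `|m' - m|)).
  apply: le_trans (HCP l) _; rewrite ler_pM2l // d1l normrN txl mulr2n mulrDl mul1r.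
  exact: lerD.
have dml : dotp D (m' - m).1 = - dotp D l.1.
  have -> : l.1 = k'.1 - k.1 - (m' - m).1 by rewrite lE.
  by rewrite !dotpBr Dk Dk' subrr sub0r opprK.
have dm1 : dotp D (m' - m).1 = s ^+ 2 * dotp D w.
  have -> : (m' - m).1 = y' - y by rewrite mm mm'.
  by rewrite yy dotpZr.
have l1 : `|dotp D l.1| <= N * (`|D| * `|l|).
  apply: le_trans (norm_dotp _ _) _; apply: ler_wpM2l; first exact: sqr_ge0.
  by apply: ler_wpM2l => //; rewrite prod_normE /= le_max lexx.
have l2 : s ^+ 2 * dotp D w <= N * (`|D| * `|l|).
  by rewrite -dm1 dml; apply: le_trans l1; rewrite -normrN ler_norm.
have sq0 : 0 < s ^+ 2 by rewrite exprn_gt0.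
exact: perturb_real Dw0 sq0 CP0 (sqr_ge0 _) (normr_ge0 _) B0 BE ln dmn l2.
Qed.

(** By contradiction. v balances the two one-sided expansions, so [star_sign] applies with D and
    with -D and gives D.k.1 = 0 exactly. The strict inequality leaves room to replace v by v + w
    with D.w > 0; the same equality for the perturbed curve contradicts [mcurve_perturb]. *)
Lemma dual_second_order : exists2 r : R, 0 < r & forall (xp xm D eta : E),
  `|xp - x| < r -> `|xm - x| < r -> gx g' m0.1 (xp, g (pt xp m0)) = q + D ->
  gx g' m0.1 (xm, g (pt xm m0)) = q - D -> D != 0 -> eta != 0 -> dotp D eta = 0 ->
  dotp (hx g' (pt m0.1 (x, u)) eta) eta <=
    (dotp (hx g' (pt m0.1 (xp, g (pt xp m0))) eta) eta +
     dotp (hx g' (pt m0.1 (xm, g (pt xm m0))) eta) eta) / 2 -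
    c / (4 * C ^+ 3 * C2 ^+ 2 * n.+1%:R ^+ 2) * enorm D ^+ 2 * enorm eta ^+ 2.
Proof.
have [r r0 H] := star_sign; exists r; first exact: r0.
move=> xp xm D eta xpr xmr qp qm Dn0 en0 Deta.
have [f fE] := named (dotp (hx g' (pt m0.1 (x, u)) eta) eta).
have [fp fpE] := named (dotp (hx g' (pt m0.1 (xp, g (pt xp m0))) eta) eta).
have [fm fmE] := named (dotp (hx g' (pt m0.1 (xm, g (pt xm m0))) eta) eta).
rewrite -[X in X <= _]fE -[X in _ <= (X + _) / 2 - _]fpE -[X in _ <= (_ + X) / 2 - _]fmE.
have [d dE] := named (c / (4 * C ^+ 3 * C2 ^+ 2 * n.+1%:R ^+ 2) * enorm D ^+ 2 * enorm eta ^+ 2).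
rewrite -dE leNgt; apply/negP => neg.
have eD : 0 < enorm D by exact: enorm_gt0.
have ee : 0 < enorm eta by exact: enorm_gt0.
have [DD DDE] := named (dotp D D).
have DD0 : 0 < DD by rewrite DDE -enorm_sqr exprn_gt0.
have d0 : 0 < d.
  have C2p : 0 < C2 := C2_gt0; rewrite dE.
  exact: coeff_gt0 c0 C0 C2p (ltr0Sn R n) eD ee.
have d20 : 0 < d / 2 by exact: half_gt0.
have small : C * (d / 2) < c * (`|eta| / (2 * C) * (enorm D / C2)) ^+ 2.
  apply: (small_real C0 C2_gt0 c0 eD ee (ltr0Sn R n) _ dE).
  exact: enorm_le_norm.
have [val valE] := named ((fp + fm - 2 * f) / 4).
have vd : val < d / 2 by rewrite valE; exact: val_real neg.
have [v vE] := named (((fm - fp) / 4 / DD) *: D).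
(* D.w is half of the gap d/2 - val, so both val + D.w and val - D.w stay below d/2. *)
have [w wE] := named (((d / 2 - val) / 2 / DD) *: D).
have Dv : dotp D v = (fm - fp) / 4 by rewrite vE dotpZr -DDE divfK // gt_eqF.
have Dw : dotp D w = (d / 2 - val) / 2 by rewrite wE dotpZr -DDE divfK // gt_eqF.
have Dw0 : 0 < dotp D w by rewrite Dw; apply: half_gt0; rewrite subr_gt0.
have Dm : dotp (- D) eta = 0 by rewrite dotpNl Deta oppr0.
have smallm : C * (d / 2) < c * (`|eta| / (2 * C) * (enorm (- D) / C2)) ^+ 2.
  by rewrite enormN.
have [e1 e2 e3 e4] := val_eqs valE Dv Dw vd.
rewrite -dotpDDr in e2; rewrite -dotpNl in e3; rewrite -dotpDDr -dotpNl in e4.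
have [s1 s10 K1] := H xp D eta v f fp _ (d / 2) xpr qp Deta en0 fE fpE erefl e1 d20 small.
have [s2 s20 K2] := H xp D eta (v + w) f fp _ (d / 2) xpr qp Deta en0 fE fpE erefl e2 d20 small.
have [s3 s30 K3] := H xm (- D) eta v f fm _ (d / 2) xmr qm Dm en0 fE fmE erefl e3 d20 smallm.
have [s4 s40 K4] := H xm (- D) eta (v + w) f fm _ (d / 2) xmr qm Dm en0 fE fmE erefl e4 d20 smallm.
have [s5 s50 K5] := mcurve_perturb eta v Dw0.
have [r2 r20 [_ lc2]] := lc.
have zP : `|x - x| < r2 by rewrite subrr normr0.
have q0 : gx g' m0.1 (x, g (pt x m0)) = q + 0 by rewrite addr0.
have z0 : dotp (0 : E) eta = 0 by rewrite dotp0l.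
have v0 (v' : E) : dotp 0 v' + 2^-1 * (f - f) < 1 by rewrite dotp0l subrr mulr0 addr0 ltr01.
(* With x' = x and D = 0 the comparison only serves to place the curve at the level u of g(x, .). *)
have [s6 s60 K6] := dual_diff lc2 r20 zP GP q0 z0 fE fE erefl (v0 v) ltr01.
have [s7 s70 K7] := dual_diff lc2 r20 zP GP q0 z0 fE fE erefl (v0 (v + w)) ltr01.
have [t1 [t10 t11 t12 t13 t14]] := min4 s10 s20 s30 s40.
have [t2 [t20 t21 t25 t26 t27]] := min4 t10 s50 s60 s70.
have sp : 0 < t2 / 2 by exact: half_gt0.
have ss : t2 / 2 < t2 by exact: half_ltr.
move: sp ss; move: (t2 / 2) => s sp ss.
have [_ g6 _ _] := K6 s sp (lt_le_trans ss t26).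
have [_ g7 _ _] := K7 s sp (lt_le_trans ss t27).
have ss1 := lt_le_trans ss t21.
have [k [k1 k2]] := tx_surj S GP 0 (gx g x (mcurve eta v s) - gx g x m0).
have [k' [k1' k2']] := tx_surj S GP 0 (gx g x (mcurve eta (v + w) s) - gx g x m0).
have l1 := K1 s k sp (lt_le_trans ss1 t11) k1 k2.
have l2 := K2 s k' sp (lt_le_trans ss1 t12) k1' k2'.
have l3 := K3 s k sp (lt_le_trans ss1 t13) k1 k2.
have l4 := K4 s k' sp (lt_le_trans ss1 t14) k1' k2'.
rewrite dotpNl oppr_le0 in l3; rewrite dotpNl oppr_le0 in l4.
apply: (K5 s k k' sp (lt_le_trans ss t25) k1 k1' k2 k2').
- by rewrite g6 g7.
- by apply/eqP; rewrite eq_le l1 l3.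
- by apply/eqP; rewrite eq_le l2 l4.
Qed.

End Dual_curve.

Section Star_uniform.
Context {R : realType} {n : nat}.
Local Notation E := 'rV[R]_n.
Local Notation W := (E * E * R)%type.
Variables (Gam : set W) (g : W -> R).
Hypothesis S : generating_system Gam g.

Lemma AformE x u p xi eta :
  Aform Gam g x u p xi eta = dotp (hx g (pt x (YZ Gam g x u p)) xi) eta.
Proof. by []. Qed.

Lemma segptxx (p : E) t : segpt p p t = p.
Proof. by rewrite segptE subrr scaler0 addr0. Qed.

Lemma star_uniform (U' : set (E * R * E)) : Aform_A3s Gam g ->
  compactly_contained U' (dom_U Gam g) -> exists2 c : R, 0 < c &
  forall xs us P0 P1, vsegment xs us P0 P1 `<=` U' -> star_at Gam g c xs us P0 P1.
Proof.
move=> A cU; have [kap kap0 H] := max_principle S A cU.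
exists (kap / 16); first exact: divr_gt0.
move=> xs us P0 P1 sU; apply: (max_principle_star S kap0); first exact: H.
apply: H; rewrite -{1}(segpt0 P0 P1).
exact: vsegment_sub sU (zero_in01 R) (half_in01 R).
Qed.

End Star_uniform.

(** * Transfer of A3s across a dual pair *)

Section Dual_A3s.
Context {R : realType} {n : nat}.
Local Notation E := 'rV[R]_n.
Local Notation W := (E * E * R)%type.
Local Notation M := (E * R)%type.
Variables (Gam : set W) (g : W -> R) (Gam' : set W) (g' : W -> R).
Hypothesis dp : dual_pair Gam g Gam' g'.
Let S := dp_S dp.
Let S' := dp_S' dp.

(* (y, z, q) in V  |->  (x, u, g_x(x, y, z)) in U *)
Definition dual_point (w : E * R * E) : E * R * E :=
  let xu := YZ Gam' g' w.1.1 w.1.2 w.2 in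
  (xu.1, xu.2, gx g xu.1 (w.1.1, w.1.2)).

Lemma dual_baseP y z q : dom_U Gam' g' (y, z, q) -> let xu := YZ Gam' g' y z q in
  [/\ Gam (pt xu.1 (y, z)), g (pt xu.1 (y, z)) = xu.2, Gam' (pt y xu),
      g' (pt y xu) = z & gx g' y xu = q].
Proof.
move=> /YZP; move: (YZ Gam' g' y z q) => xu [G gu gq] /=.
by have [h1 h2] := dp_pt' dp G; rewrite gu in h1 h2.
Qed.

Lemma dual_point_dom w : dom_U Gam' g' w -> dom_U Gam g (dual_point w).
Proof.
case: w => [[y z] q] /dual_baseP[G gu _ _ _]; apply/dom_UP.
by exists (y, z); split.
Qed.

Lemma dual_point_near w0 : dom_U Gam' g' w0 -> forall e : R, 0 < e ->
  exists2 r : R, 0 < r & forall w, `|w - w0| < r ->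
  dom_U Gam' g' w /\ `|dual_point w - dual_point w0| <= e.
Proof.
case: w0 => [[y0 z0] q0] D e e0.
have [G0 gu0 G0' gz0 gq0] := dual_baseP D.
rewrite /dual_point /=; move: (YZ Gam' g' y0 z0 q0) G0 gu0 G0' gz0 gq0 => [x0 u0] /= G0 gu0 G0' gz0 gq0.
have [r1 r10 H1] := gx_near S G0 e0.
have [r2 [r20 r21 r2e]] := min2 r10 e0.
have [r3 r30 H3] := YZ_near S' G0' r20; rewrite gz0 gq0 in H3.
have [r [r0 rr1 rr3]] := min2 r10 r30.
exists r; first exact: r0.
move=> [[y z] q]; rewrite !prod_normE /= !gt_max => /andP[/andP[yr zr] qr].
have [D' h] := H3 y z q (lt_le_trans yr rr3) (lt_le_trans zr rr3) (lt_le_trans qr rr3).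
split; first exact: D'.
move: (YZ Gam' g' y z q) h => [x u] /=; rewrite prod_normE /= gt_max => /andP[xr ur].
rewrite !ge_max; apply/andP; split.
  apply/andP; split; apply: ltW; [exact: lt_le_trans xr r2e|exact: lt_le_trans ur r2e].
apply: H1; first exact: lt_le_trans xr r21.
by rewrite prod_normE /= gt_max; apply/andP; split; [exact: lt_le_trans yr rr1|exact: lt_le_trans zr rr1].
Qed.

Lemma dual_point_compact (V' : set (E * R * E)) :
  compactly_contained V' (dom_U Gam' g') ->
  compactly_contained (dual_point @` closure V') (dom_U Gam g).
Proof.
move=> [cV sV].
have cK : compact (dual_point @` closure V').
  apply: continuous_compact cV; apply: continuous_in_subspaceT => w.
  rewrite inE => /sV D; apply: (@continuous_eps R (E * R * E)%type (E * R * E)%type) => e e0.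
  have [r r0 H] := dual_point_near D e0; exists r; first exact: r0.
  by move=> w' /H[_]; rewrite distrC.
have clK : closure (dual_point @` closure V') = dual_point @` closure V'.
  by apply/esym/closure_id; apply: compact_closed => //; exact: norm_hausdorff.
rewrite /compactly_contained clK; split; first exact: cK.
by move=> _ [w /sV D <-]; exact: dual_point_dom.
Qed.

Lemma dual_const (V' : set (E * R * E)) : compactly_contained V' (dom_U Gam' g') ->
  exists2 C : R, 0 < C & forall y z q, closure V' (y, z, q) ->
  local_const Gam g C (pt (YZ Gam' g' y z q).1 (y, z)) /\ `|q| <= C.
Proof.
move=> [cV sV].
have [|w0 /sV D|C C0 HC] := @compact_bound R (E * R * E)%type (closure V')
  (fun C w => local_const Gam g C (pt (dual_point w).1.1 w.1) /\ `|w.2| <= C) cV.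
- move=> C C' w CC [h1 h2]; split; last exact: le_trans h2 CC.
  exact: local_const_mono CC h1.
- have G0 : Gam (pt (dual_point w0).1.1 w0.1).
    by case: w0 D => [[y z] q] D; have [] := dual_baseP D.
  have [C1 C10 [r1 r10 H1]] := local_const_near S G0.
  have r12 : 0 < r1 / 2 by exact: divr_gt0.
  have [r2 r20 H2] := dual_point_near D r12.
  have [r [r0 rr1 rr2 rr3]] := min3 r10 r20 ltr01.
  have q1 : 0 < C1 + (`|w0.2| + 1) by rewrite addr_gt0 // ltr_wpDl.
  exists (C1 + (`|w0.2| + 1)); first exact: q1.
  exists r; first exact: r0.
  move=> w _ wr; have [_ h] := H2 w (lt_le_trans wr rr2).
  have wr' := wr; rewrite prod_normE /= gt_max in wr'.
  have [wr1 wr2] := andP wr'.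
  split.
    apply: (@local_const_mono _ _ _ _ S C1); first by rewrite lerDl addr_ge0.
    apply: H1; apply: norm_pt_lt; last exact: lt_le_trans wr1 rr1.
    apply: le_lt_trans (half_ltr r10); apply: le_trans h.
    by rewrite [leRHS]prod_normE /= le_max [X in _ <= X]prod_normE /= le_max lexx.
  have -> : w.2 = (w.2 - w0.2) + w0.2 by rewrite subrK.
  apply: le_trans (ler_normD _ _) _; rewrite addrC; apply: ler_wpDl; first exact: ltW.
  rewrite lerD2l; apply: ltW; exact: lt_le_trans wr2 rr3.
- exists C; first exact: C0.
  by move=> y z q K; exact: (HC (y, z, q) K).
Qed.

(** Since midpoint convexity at small scales is enough, [star_at] is used only for degenerate
    segments P0 = P1, at the point of U that corresponds to the middle point of the dual segment.
    All constants come from a compact image of V'. *)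
Lemma dual_A3s : Aform_A3s Gam g -> Aform_A3s Gam' g'.
Proof.
move=> A V' cV; have cU := dual_point_compact cV.
have [c c0 Hc] := star_uniform S A cU.
have [C C0 HC] := dual_const cV.
have [C2 C2E] := named (C * C * (1 + n.+1%:R ^+ 2 * C)).
have [k1 k1E] := named (c / (4 * C ^+ 3 * C2 ^+ 2 * n.+1%:R ^+ 2)).
have C20 : 0 < C2 by rewrite C2E !mulr_gt0 // ltr_wpDr // mulr_ge0 ?sqr_ge0 // ltW.
have k10 : 0 < k1.
  have := coeff_gt0 c0 C0 C20 (ltr0Sn R n) ltr01 ltr01.
  by rewrite -k1E expr1n !mulr1.
exists (k1 / 2); first exact: divr_gt0.
have cl w : V' w -> closure V' w by exact: subset_closure.
have sub : V' `<=` dom_U Gam' g' by move=> w /cl; exact: cV.2.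
apply: (codim1_convex_midpoint S' sub k10) => y z q0 q1 eta s r0 sV.
have [D DE] := named (q1 - q0); rewrite -DE => Dn0 en0 etap s0 s1 r00.
have seg t : 0 <= t <= 1 -> dom_U Gam' g' (y, z, segpt q0 q1 t).
  by move=> t01; apply: sub; exact: vsegment_mem sV t01.
have s01 : 0 <= s <= 1 by rewrite !ltW.
have Vs := vsegment_mem sV s01.
have [lc qC] := HC _ _ _ (cl _ Vs).
have [G0 gu0 G0' gz0 gq0] := dual_baseP (seg s s01).
have st : star_at Gam g c (YZ Gam' g' y z (segpt q0 q1 s)).1 (YZ Gam' g' y z (segpt q0 q1 s)).2
   (gx g (YZ Gam' g' y z (segpt q0 q1 s)).1 (y, z)) (gx g (YZ Gam' g' y z (segpt q0 q1 s)).1 (y, z)).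
  apply: Hc => _ [r _ <-]; exists (y, z, segpt q0 q1 s); first exact: cl.
  by rewrite segptxx.
rewrite (AformE _ _ _ _ (segpt q0 q1 s)); move: (YZ Gam' g' y z (segpt q0 q1 s)) lc G0 gu0 G0' gz0 gq0 st => [x u] /= lc G0 gu0 G0' gz0 gq0 st.
rewrite -gu0 in st; rewrite -gq0 -gu0 in qC.
have [r1 r10 H1] := dual_second_order dp G0 C0 lc qC c0 st.
have [r2 r20 H2] := YZ_near S' G0' r10; rewrite gz0 gq0 in H2.
have nD : 0 < `|D| by rewrite normr_gt0.
have r2D : 0 < r2 / `|D| by exact: divr_gt0.
have [r3 [r30 r31 r32]] := min2 r00 r2D.
have [r [rp rr rm rM]] := small_range s0 s1 r30.
exists r.
have [tm tp _] := range_pm rm rM rp.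
have near (s' : R) : `|s' - s| = r ->
    `|(YZ Gam' g' y z (segpt q0 q1 s')).1 - x| < r1.
  move=> s'r; have zz (V : normedModType R) (v : V) : `|v - v| < r2 by rewrite subrr normr0.
  have sn : `|segpt q0 q1 s' - segpt q0 q1 s| < r2.
    rewrite segptB -DE normrZ s'r -ltr_pdivlMr //; exact: lt_le_trans rr r32.
  have [_] := H2 y z _ (zz _ _) (zz _ _) sn.
  by rewrite prod_normE /= gt_max => /andP[].
have np : `|s + r - s| = r by rewrite addrC addKr gtr0_norm.
have nm : `|s - r - s| = r by rewrite addrC addKr normrN gtr0_norm.
have xp := near _ np; have xm := near _ nm.
have [Gp gup _ _ gqp] := dual_baseP (seg _ tp).
have [Gm gum _ _ gqm] := dual_baseP (seg _ tm).
split; [exact: rp|exact: lt_le_trans rr r31|exact: rm|exact: rM|].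
rewrite (AformE _ _ _ _ (segpt q0 q1 (s + r))) (AformE _ _ _ _ (segpt q0 q1 (s - r))).
have qp : gx g' y (YZ Gam' g' y z (segpt q0 q1 (s + r))) = gx g' y (x, u) + r *: D.
  by rewrite gqp gq0 !segptE -DE scalerDl addrA.
have qm : gx g' y (YZ Gam' g' y z (segpt q0 q1 (s - r))) = gx g' y (x, u) - r *: D.
  by rewrite gqm gq0 !segptE -DE scalerDl scaleNr addrA.
move: (YZ Gam' g' y z (segpt q0 q1 (s + r))) xp Gp gup qp {gqp} => [xp up] /= xpr Gp gup qp.
move: (YZ Gam' g' y z (segpt q0 q1 (s - r))) xm Gm gum qm {gqm} => [xm um] /= xmr Gm gum qm.
rewrite -gup -gu0 in qp *; rewrite -gum -gu0 in qm *.
have rD0 : r *: D != 0 by rewrite scaler_eq0 negb_or gt_eqF.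
have rDe : dotp (r *: D) eta = 0 by rewrite dotpZl dotpC etap mulr0.
apply: le_trans (H1 xp xm (r *: D) eta xpr xmr qp qm rD0 en0 rDe) _.
rewrite -C2E -k1E enormZ (gtr0_norm rp) exprMn lerD2l lerN2.
by rewrite le_eqVlt; apply/orP; left; apply/eqP; ring.
Qed.

End Dual_A3s.

(** * Equivalence with A3s(1) *)

Lemma normal_real (R : realFieldType) (c l2 L X0 a dd dx eps vd h G1b G1m G10 u Gm pbd pmd l' : R) :
  0 < c -> L = c / 4 * l2 -> pbd = pmd - L * a + eps * vd -> Gm = u + L / 2 * X0 ->
  h = G1m - G10 - L / 2 * (X0 + 2 * a + dd) -> eps * vd < - h ->
  `|(G1b - u - pbd) - (G1m - Gm - pmd)| <= 2 * (c * l2 / 16) * dx ->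
  0 <= l2 -> dx <= dd -> l2 <= 4 * l' -> 0 <= dd ->
  G1b - G10 < c * (l' * dd).
Proof.
move=> c0 LE -> -> hE ev; rewrite ler_norml => /andP[_ h1] l20 h2 h3 dd0.
have k1 : c * l2 * dx <= c * l2 * dd by apply: ler_wpM2l => //; rewrite mulr_ge0 // ltW.
have k2 : c * l2 * dd <= c * (4 * l') * dd by apply: ler_wpM2r => //; rewrite ler_pM2l.
have k3 : L * dd = c * l2 * dd / 4 by rewrite LE; field.
move: h1 hE ev; rewrite -mulrA mulrDr mulrDr (mulrCA _ 2 a); lra.
Qed.

Lemma half_sq (R : realFieldType) (l l' e : R) : 0 <= l -> 0 <= l' ->
  `|l' - l| <= e -> e <= l / 2 -> l ^+ 2 <= 4 * l' ^+ 2.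
Proof.
move=> l0 l'0; rewrite ler_norml => /andP[h1 _] h2.
have h3 : l <= 2 * l' by lra.
have -> : 4 * l' ^+ 2 = (2 * l') ^+ 2 by ring.
by rewrite ler_sqr // nnegrE mulr_ge0.
Qed.

Lemma le3_real (R : realFieldType) (q a b c : R) : 0 < q -> a <= q / 4 -> b <= q / 4 ->
  c <= q / 4 -> a + b + c < q.
Proof. by move=> *; lra. Qed.

Lemma lt_div1 (R : realFieldType) (L x q : R) : 0 <= L -> 0 <= x -> x < q / (L + 1) ->
  L * x <= q.
Proof.
move=> L0 x0; rewrite ltr_pdivlMr ?ltr_wpDl // => h.
by have : 0 <= x by []; nra.
Qed.

Lemma sub_swap (V : zmodType) (a b c d : V) : a - b - (c - d) = (a - c) - (b - d).
Proof. by rewrite !opprB addrACA [RHS]addrACA (addrC (- b)). Qed.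

Lemma quarter_real (R : realFieldType) (q l N : R) : 0 < N -> q <= l / (4 * N) ->
  N * (2 * q) <= l / 2.
Proof. by move=> N0; rewrite ler_pdivlMr ?mulr_gt0 // => h; lra. Qed.

(** * Supporting half-spaces at boundary points of the sublevel set *)

Section Boundary.
Context {R : realType} {n : nat}.
Local Notation E := 'rV[R]_n.
Local Notation W := (E * E * R)%type.
Local Notation M := (E * R)%type.
Variables (Gam : set W) (g : W -> R).
Hypothesis S : generating_system Gam g.
Let oG := s_open S.
Let gC := s_C2 S.
Let hW : finite_coords W := W_coords.
Variables (xs : E) (m0 m1 : M) (c : R).
Hypotheses (G0 : Gam (pt xs m0)) (G1 : Gam (pt xs m1)) (c0 : 0 < c).
Hypothesis g01 : g (pt xs m1) = g (pt xs m0).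
Hypothesis star : star_at Gam g c xs (g (pt xs m0)) (gx g xs m0) (gx g xs m1).
Variables (l L : R).
Hypotheses (lE : l = enorm (gx g xs m1 - gx g xs m0)) (l0 : 0 < l).
Hypothesis LE : L = c / 4 * l ^+ 2.

Lemma L_gt0 : 0 < L.
Proof. by rewrite LE mulr_gt0 ?divr_gt0 ?exprn_gt0. Qed.

Definition hdel (x : E) : R :=
  g (pt x m1) - g (pt x m0) - L / 2 * enorm (x - xs) ^+ 2.

Lemma near_target (q : R) : 0 < q -> exists2 r : R, 0 < r & forall (x v : E),
  `|x - xs| < r -> exists2 e0 : R, 0 < e0 & forall e : R, 0 < e -> e < e0 ->
  `|gx g x m1 - L *: (x - xs) + e *: v - gx g xs m1| < q.
Proof.
move=> q0; have q4 : 0 < q / 4 by exact: divr_gt0.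
have [r1 r10 H1] := gx_near S G1 q4.
have k : 0 < q / 4 / (L + 1) by rewrite divr_gt0 // ltr_wpDl // ltW // L_gt0.
have [r [r0 rr1 rk]] := min2 r10 k.
exists r; first exact: r0.
move=> x v xr; have v1 : 0 < `|v| + 1 by rewrite ltr_wpDl.
have e00 : 0 < q / 4 / (`|v| + 1) by exact: divr_gt0.
exists (q / 4 / (`|v| + 1)); first exact: e00.
move=> e ep ee.
have -> : gx g x m1 - L *: (x - xs) + e *: v - gx g xs m1 =
  (gx g x m1 - gx g xs m1) - L *: (x - xs) + e *: v.
  by move: (gx g x m1) (gx g xs m1) (L *: _) (e *: v) => A B C D; rewrite [LHS]addrAC [X in X + D]addrAC.
apply: le_lt_trans (ler_normD _ _) _.
apply: (@le_lt_trans _ _ (`|gx g x m1 - gx g xs m1| + `|L *: (x - xs)| + `|e *: v|)).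
  by apply: lerD => //; apply: le_trans (ler_normD _ _) _; rewrite normrN.
apply: le3_real q0 _ _ _.
- apply: H1; first exact: lt_le_trans xr rr1.
  by rewrite subrr normr0.
- rewrite normrZ (gtr0_norm L_gt0); apply: lt_div1 (ltW L_gt0) (normr_ge0 _) _.
  exact: lt_le_trans xr rk.
- rewrite normrZ (gtr0_norm ep) mulrC; apply: lt_div1 => //; exact: ltW.
Qed.

(** The prescribed value of [tx] is the gradient of [hdel] at x perturbed by e v, where v is free.
    [star_at], based at x, is applied to the member b with the corresponding slope, and g(x1, b) is
    compared with g(x1, m1) by Taylor expansions from x. What remains is [hdel] at x1, negative with
    room for e v, and quadratic terms. L = c l^2 / 4 makes these admissible, because the slope
    length seen from x is at least l/2. *)
Lemma boundary_normal : exists2 r : R, 0 < r & forall (x x1 v : E),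
  `|x - xs| < r -> `|x1 - xs| < r -> hdel x = 0 -> hdel x1 < 0 ->
  exists2 e0 : R, 0 < e0 & forall (e : R) (k : M), 0 < e -> e < e0 ->
  d1 g (pt x m0) (inm k) = 0 ->
  tx g (pt x m0) k = gx g x m1 - gx g x m0 - L *: (x - xs) + e *: v ->
  d1 g (pt x1 m0) (inm k) <= 0.
Proof.
have [r1 r10 H1] := star.
have l2 : 0 < l ^+ 2 by rewrite exprn_gt0.
have tay0 : 0 < c * l ^+ 2 / 16 by rewrite divr_gt0 // mulr_gt0.
have [r2 r20 H2] := taylor hW oG gC G1 tay0.
have [r3 r30 H3] := YZ_near S G1 r20; rewrite g01 in H3.
have N0 : 0 < n.+1%:R :> R by [].
have k0 : 0 < l / (4 * n.+1%:R) by rewrite divr_gt0 // mulr_gt0.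
have [q [q0 q1 q3 qk]] := min3 r10 r30 k0.
have [r4 r40 H4] := near_target q0.
have q2 : 0 < q / 2 by exact: divr_gt0.
have [r5 r50 H5] := gx_near S G0 q2.
have [r6 r60 H6] := g_near S G0 q0.
have [r7 [r70 r71 r72 r73 r74]] := min4 r10 r20 r30 r40.
have [r [r0 rr7 rr5 rr6]] := min3 r70 r50 r60.
have zz (V : normedModType R) (z : V) (e : R) : 0 < e -> `|z - z| < e by rewrite subrr normr0.
exists r; first exact: r0.
move=> x x1 v xr x1r hx0 hx1.
have xr7 := lt_le_trans xr rr7; have x1r7 := lt_le_trans x1r rr7.
have [e1 e10 K1] := H4 x v (lt_le_trans xr7 r74).
have [vd vdE] := named (dotp v (x1 - x)).
have hh : 0 < - hdel x1 / (`|vd| + 1) by rewrite divr_gt0 ?oppr_gt0 // ltr_wpDl.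
have [e0 [e00 e01 eh]] := min2 e10 hh.
exists e0; first exact: e00.
move=> e k ep ee k1 k2.
have [p1 p1E] := named (gx g x m1 - L *: (x - xs) + e *: v).
have pE : p1 - gx g x m0 = gx g x m1 - gx g x m0 - L *: (x - xs) + e *: v.
  by rewrite p1E -[RHS]addrA [RHS]addrAC addrA.
rewrite -pE in k2.
have p1q := K1 e ep (lt_le_trans ee e01); rewrite -p1E in p1q.
have [Gx0 u0n] := H6 _ (norm_pt_lt (lt_le_trans xr rr6) (zz _ m0 _ r60)).
have p0n := H5 x m0 (lt_le_trans xr rr5) (zz _ m0 _ r50).
have [u uE] := named (g (pt x m0)); rewrite -uE in u0n.
have [D b_near] := H3 x u p1 (lt_le_trans xr7 r73) (lt_le_trans u0n q3) (lt_le_trans p1q q3).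
have [Gb gb pb] := YZP D.
have [b bE] := named (YZ Gam g x u p1); rewrite -bE in Gb gb pb b_near.
have Y0 : YZ Gam g x u (gx g x m0) = m0 by rewrite uE; exact: YZ_pt.
have := H1 x u (gx g x m0) p1 x1 (lt_le_trans xr7 r71) (lt_le_trans u0n q1)
  (lt_le_trans (le_lt_trans p0n (half_ltr q0)) q1) (lt_le_trans p1q q1) (lt_le_trans x1r7 r71).
rewrite /= Y0 -bE; apply; last 2 first.
- exact: k1.
- exact: k2.
have x2 := lt_le_trans xr7 r72; have x12 := lt_le_trans x1r7 r72.
have [Gm1 T1] := H2 _ _ (norm_pt_lt x2 (zz _ m1 _ r20)) (norm_pt_lt x12 (zz _ m1 _ r20)).
have [_ T2] := H2 _ _ (norm_pt_lt x2 b_near) (norm_pt_lt x12 b_near).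
rewrite !ptBx norm_inx -(gxE S _ Gm1) in T1.
rewrite !ptBx norm_inx -(gxE S _ Gb) gb pb in T2.
rewrite exprMn.
(* Both expansions are frozen at (xs, m1) and have the same displacement, so this quadratic term
   cancels. *)
have [Q QE] := named (2^-1 * d2 g (pt xs m1) (inx (x1 - x)) (inx (x1 - x))).
rewrite -QE in T1 T2.
apply: (@normal_real R c (l ^+ 2) L (enorm (x - xs) ^+ 2) (dotp (x - xs) (x1 - x))
  (enorm (x1 - x) ^+ 2) (`|x1 - x| ^+ 2) e vd (hdel x1) (g (pt x1 b)) (g (pt x1 m1))
  (g (pt x1 m0)) u (g (pt x m1)) (dotp p1 (x1 - x)) (dotp (gx g x m1) (x1 - x)) _ c0 LE).
- by rewrite p1E vdE dotpDDl dotpDDl dotpNl !dotpZl.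
- move: hx0; rewrite /hdel -uE => /eqP; rewrite subr_eq0 subr_eq => /eqP ->; exact: addrC.
- rewrite /hdel; congr (_ - _ * _).
  have -> : x1 - xs = (x - xs) + (x1 - x) by rewrite [RHS]addrC addrA subrK.
  move: (x - xs) (x1 - x) => w w'; rewrite !enorm_sqr dotpDDl !dotpDDr (dotpC w' w); ring.
- have v1 : 0 < `|vd| + 1 by rewrite ltr_wpDl.
  have ee' := lt_le_trans ee eh; rewrite ltr_pdivlMr // in ee'.
  apply: le_lt_trans ee'; rewrite ler_pM2l //.
  by apply: le_trans (ler_norm _) _; rewrite lerDl.
- rewrite distrC in T1.
  have -> : g (pt x1 b) - u - dotp p1 (x1 - x) - (g (pt x1 m1) - g (pt x m1) - dotp (gx g x m1) (x1 - x)) =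
     (g (pt x1 b) - u - dotp p1 (x1 - x) - Q) + (Q - (g (pt x1 m1) - g (pt x m1) - dotp (gx g x m1) (x1 - x))).
    by rewrite addrA subrK.
  apply: le_trans (ler_normD _ _) _; rewrite -mulrA mulr2n mulrDl mul1r; exact: lerD T2 T1.
- exact: sqr_ge0.
- by rewrite ler_sqr ?nnegrE ?enorm_ge0 //; exact: norm_le_enorm.
- apply: half_sq (ltW l0) (enorm_ge0 _) _ _; first by rewrite lE; exact: enorm_dist.
  rewrite sub_swap.
  apply: (@le_trans _ _ (n.+1%:R * (2 * q))).
    rewrite ler_pM2l //; apply: le_trans (ler_normB _ _) _; rewrite mulr2n mulrDl mul1r.
    apply: lerD; first exact: ltW.
    apply: le_trans p0n _; apply: ltW; exact: half_ltr.
  exact: quarter_real N0 qk.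
- exact: sqr_ge0.
Qed.

End Boundary.

Lemma convex_setP (R : realType) (V : lmodType R) (A : set V) : convex_set A <->
  forall (a b : V) (t : R), A a -> A b -> 0 <= t <= 1 -> A ((1 - t) *: a + t *: b).
Proof.
split=> [cA a b t Aa Ab /andP[t0 t1]|H a b l]; last first.
  rewrite !inE => Aa Ab.
  have l01 : 0 <= 1 - l%:num <= 1 by rewrite subr_ge0 gerBl; apply/andP; split.
  by have := H a b _ Aa Ab l01; rewrite subKr.
have s0 : 0 <= 1 - t by rewrite subr_ge0.
have s1 : 1 - t <= 1 by rewrite gerBl.
have := cA a b (Itv01 s0 s1); rewrite !inE => /(_ Aa Ab).
by rewrite -[X in _ -> A (_ + X *: _)](subKr 1 t).
Qed.

Lemma conv_ball (R : realType) (V : normedModType R) (a b q : V) (t r : R) :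
  0 <= t <= 1 -> `|a - q| < r -> `|b - q| < r -> `|(1 - t) *: a + t *: b - q| < r.
Proof.
move=> /andP[t0 t1] ar br.
have -> : (1 - t) *: a + t *: b - q = (1 - t) *: (a - q) + t *: (b - q).
  rewrite !scalerBr addrACA -opprD -scalerDl subrK scale1r; by [].
apply: le_lt_trans (ler_normD _ _) _; rewrite !normrZ (ger0_norm t0).
have s0 : 0 <= 1 - t by rewrite subr_ge0.
rewrite (ger0_norm s0).
have [->|tn] := eqVneq t 0; first by rewrite subr0 mul1r mul0r addr0.
have tp : 0 < t by rewrite lt_neqAle eq_sym tn.
have k1 : t * `|b - q| < t * r by rewrite ltr_pM2l.
have k2 : (1 - t) * `|a - q| <= (1 - t) * r by apply: ler_wpM2l => //; exact: ltW.
move: k1 k2; move: (t * `|_|) ((1 - t) * `|_|) => u v; lra.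
Qed.

Lemma convex_zero_real (R : realFieldType) (a0 a1 k t q0 q1 : R) : a0 < 0 -> a1 < 0 ->
  0 < t -> t < 1 -> k = (1 - t) * q0 + t * q1 -> a0 * (k - q0) <= 0 ->
  a1 * (k - q1) <= 0 -> a0 * (k - q0) = 0.
Proof.
move=> h0 h1 t0 t1 kE; rewrite !nmulr_rle0 // => k0 k1.
have s0 : 0 < 1 - t by rewrite subr_gt0.
have k2 : 0 <= t * (k - q1) by exact: mulr_ge0 (ltW t0) k1.
have k3 : (1 - t) * (k - q0) <= 0 by lra.
rewrite pmulr_rle0 // in k3.
by have -> : k - q0 = 0; rewrite ?mulr0 //; apply/eqP; rewrite eq_le k3.
Qed.

Lemma lin_zero_real (R : realFieldType) (a b e : R) : 0 < e -> a + e * b = 0 ->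
  a + e / 2 * b = 0 -> b = 0.
Proof.
move=> e0 h1 h2; have : e * b = 0 by lra.
by move/eqP; rewrite mulf_eq0 gt_eqF //= => /eqP.
Qed.

(** * The map Q as a gradient of the dual function *)

Section Quotient.
Context {R : realType} {n : nat}.
Local Notation E := 'rV[R]_n.
Local Notation W := (E * E * R)%type.
Local Notation M := (E * R)%type.
Variables (Gam : set W) (g : W -> R) (Gam' : set W) (g' : W -> R).
Hypothesis dp : dual_pair Gam g Gam' g'.
Let S := dp_S dp.
Let S' := dp_S' dp.
Let hW : finite_coords W := W_coords.

(** The vector Q written as the y-gradient of the dual function, so that the inverse function
    results for the dual system apply to it. *)
Definition quo (x : E) (m : M) : E := gx g' m.1 (x, g (pt x m)).

Lemma quoE (x : E) (m k : M) : Gam (pt x m) -> d1 g (pt x m) (inm k) =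
  d1 g (pt x m) (inm (0, 1)) * (k.2 - dotp (quo x m) k.1).
Proof. by move=> G; exact: (dp_q dp k). Qed.

Lemma Qfun_quo (x : E) (m : M) : Gam (pt x m) -> Qfun g x m.1 m.2 = quo x m.
Proof.
move=> G; have n0 : d1 g (pt x m) (inm (0, 1)) != 0 by rewrite lt_eqF // (s_gz S G).
apply/rowP => i; rewrite mxE mxE.
have -> : g_z g x m.1 m.2 = d1 g (pt x m) (inm (0, 1)) by exact: derive_z.
have -> : g_y g x m.1 m.2 0 i = d1 g (pt x m) (inm (delta_mx 0 i, 0)).
  by rewrite mxE; exact: derive_y.
by rewrite (quoE (delta_mx 0 i, 0) G) /= sub0r dotp_delta !mulrN mulKf ?opprK.
Qed.

Lemma quo_inv (x : E) (m : M) : Gam (pt x m) ->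
  YZ Gam' g' m.1 m.2 (quo x m) = (x, g (pt x m)).
Proof.
move=> G; have [G' gE] := dp_pt dp G.
by rewrite -{1}gE; exact: (YZ_pt S' G').
Qed.

Lemma quo_local (x0 : E) (m : M) : Gam (pt x0 m) -> forall e : R, 0 < e ->
  exists2 r : R, 0 < r & forall q : E, `|q - quo x0 m| < r ->
  let x := (YZ Gam' g' m.1 m.2 q).1 in
  [/\ Gam (pt x m), quo x m = q & `|x - x0| < e].
Proof.
move=> G e e0; have [G' gE] := dp_pt dp G.
have [r r0 H] := YZ_near S' G' e0; rewrite gE in H.
exists r; first exact: r0.
have zz (V : normedModType R) (z : V) : `|z - z| < r by rewrite subrr normr0.
move=> q qr; have [D h] := H m.1 m.2 q (zz _ _) (zz _ _) qr.
have [Gx gu _ _ qE] := dual_baseP dp D.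
move: (YZ Gam' g' m.1 m.2 q) h Gx gu qE => [x u] /=; rewrite prod_normE /= gt_max => /andP[h _].
by case: m G G' gE H D {qr} => y z G G' gE H D Gx gu qE; rewrite /quo gu.
Qed.

Lemma quo_near (x0 : E) (m : M) : Gam (pt x0 m) -> forall e : R, 0 < e ->
  exists2 r : R, 0 < r & forall x : E, `|x - x0| < r -> `|quo x m - quo x0 m| < e.
Proof.
move=> G e e0; have [G' gE] := dp_pt dp G.
have e20 : 0 < e / 2 by exact: divr_gt0.
have [r1 r10 H1] := gx_near S' G' e20.
have [r2 r20 H2] := g_near S G r10.
have [r [r0 rr1 rr2]] := min2 r10 r20.
exists r; first exact: r0.
move=> x xr; apply: le_lt_trans (half_ltr e0); apply: H1; first by rewrite subrr normr0.
have [_ h] : Gam (pt x m) /\ `|g (pt x m) - g (pt x0 m)| < r1.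
  by apply: H2; rewrite ptBx norm_inx; exact: lt_le_trans xr rr2.
by rewrite prod_normE /= gt_max h andbT; exact: lt_le_trans xr rr1.
Qed.

(** Each of the forms is g_z < 0 times k.2 - Q.k.1. Nonpositivity at x0 and x1 makes these factors
    nonnegative there; a convex combination of them with positive weights is the factor at x, which
    vanishes, so they vanish. *)
Lemma convex_zero (x x0 x1 : E) (m k : M) (t : R) : Gam (pt x m) ->
  Gam (pt x0 m) -> Gam (pt x1 m) -> 0 < t -> t < 1 ->
  quo x m = (1 - t) *: quo x0 m + t *: quo x1 m -> d1 g (pt x m) (inm k) = 0 ->
  d1 g (pt x0 m) (inm k) <= 0 -> d1 g (pt x1 m) (inm k) <= 0 ->
  d1 g (pt x0 m) (inm k) = 0.
Proof.
move=> G G0 G1 t0 t1 qE.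
have gz y : Gam (pt y m) -> d1 g (pt y m) (inm (0, 1)) < 0 by exact: s_gz.
rewrite (quoE _ G) (quoE k G0) (quoE k G1) => /eqP.
rewrite mulf_eq0 lt_eqF ?gz //= subr_eq0 => /eqP kE.
apply: convex_zero_real (gz _ G0) (gz _ G1) t0 t1 _.
by rewrite kE qE dotpDDl !dotpZl.
Qed.

Lemma hdel_continuous (xs x : E) (m0 m1 : M) (L : R) : Gam (pt x m0) -> Gam (pt x m1) ->
  {for x, continuous (hdel g xs m0 m1 L)}.
Proof.
move=> G0 G1; have gc m : Gam (pt x m) -> {for x, continuous (fun y => g (pt y m))}.
  move=> G; apply: (@continuous_eps R E R) => e e0; have [r r0 H] := g_near S G e0.
  exists r; first exact: r0.
  move=> y yr; rewrite distrC; apply: ltW.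
  have [] : Gam (pt y m) /\ `|g (pt y m) - g (pt x m)| < e.
    by apply: H; rewrite ptBx norm_inx.
  by [].
have ec : {for x, continuous (fun y : E => enorm (y - xs))}.
  apply: (@continuous_eps R E R) => e e0.
  exists (e / n.+1%:R); first exact: divr_gt0.
  move=> y yr; rewrite distrC; apply: le_trans (enorm_dist _ _) _.
  rewrite opprB addrA subrK mulrC -ler_pdivlMr //; exact: ltW.
have e2 : {for x, continuous (fun y : E => L / 2 * enorm (y - xs) ^+ 2)}.
  apply: (@continuousM R E (fun=> L / 2) (fun y : E => enorm (y - xs) ^+ 2)).
    exact: cst_continuous.
  exact: (continuousM ec ec).
exact: (continuousB (continuousB (gc _ G1) (gc _ G0)) e2).
Qed.

End Quotient.

Section A3s1.
Context {R : realType} {n : nat}.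
Local Notation E := 'rV[R]_n.
Local Notation W := (E * E * R)%type.
Local Notation M := (E * R)%type.
Variables (Gam : set W) (g : W -> R) (Gam' : set W) (g' : W -> R).
Hypothesis dp : dual_pair Gam g Gam' g'.
Let S := dp_S dp.
Let S' := dp_S' dp.
Local Notation Q := (quo g g').

Definition sublevel (xs : E) (us : R) (P0 P1 : E) (del : R) : set E :=
  let m0 := YZ Gam g xs us P0 in let m1 := YZ Gam g xs us P1 in
  [set x : E | [/\ vsegment x us P0 P1 `<=` dom_U Gam g, Gam (pt x m1), Gam (pt x m0) &
     hdel g xs m0 m1 (del * enorm (P1 - P0) ^+ 2) x < 0]].

Lemma S_setE (xs : E) (us : R) (P0 P1 : E) (del : R) :
  S_set Gam g xs us P0 P1 1 del = sublevel xs us P0 P1 del.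
Proof.
apply/seteqP; split => x; rewrite /S_set /sublevel /hdel /h_delta /h_fun /y_at /z_at
  /Yfun /Zfun /= !segpt0 !segpt1 (mulrAC del) => -[h1 h2 h3 h4]; split; exact: h1 || exact: h2 || exact: h3 || exact: h4.
Qed.

Lemma g_convexP (Om : set E) (m : M) : (forall x, Om x -> Gam (pt x m)) ->
  g_convex Gam g Om m.1 m.2 <-> forall a b (t : R), Om a -> Om b -> 0 <= t <= 1 ->
  exists2 x, Om x & Q x m = (1 - t) *: Q a m + t *: Q b m.
Proof.
move=> OmG; have QE x : Om x -> Qfun g x m.1 m.2 = Q x m.
  by move=> /OmG; exact: (Qfun_quo dp).
split=> [[_ /convex_setP H] a b t Oa Ob t01|H].
  have im x : Om x -> [set Qfun g x m.1 m.2 | x in Om] (Qfun g x m.1 m.2).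
    by move=> Ox; exists x.
  have [x Ox] := H _ _ t (im _ Oa) (im _ Ob) t01.
  by rewrite !QE // => e; exists x.
split; first exact: OmG.
apply/convex_setP => _ _ t [a Oa <-] [b Ob <-] t01.
have [x Ox e] := H a b t Oa Ob t01.
by exists x => //; rewrite !QE.
Qed.

Lemma Omega_near (xs : E) (us : R) (P0 P1 : E) :
  vsegment xs us P0 P1 `<=` dom_U Gam g -> exists2 r : R, 0 < r &
  forall x : E, `|x - xs| < r -> vsegment x us P0 P1 `<=` dom_U Gam g.
Proof.
move=> sU; have [|r r0 H] := @tube_segment R E xs (fun x t => dom_U Gam g (x, us, segpt P0 P1 t)).
  move=> t0 t01; have D := vsegment_mem sU t01.
  have [r r0 Hr] := D_near (dom_U_open S) D.
  have X0 : 0 < `|P1 - P0| + 1 by rewrite ltr_wpDl.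
  have k : 0 < r / (`|P1 - P0| + 1) by exact: divr_gt0.
  have [q [q0 qr qk]] := min2 r0 k.
  exists q; first exact: q0.
  move=> x t xq tq; apply: Hr; rewrite !prod_normE /= subrr normr0 !gt_max r0 andbT.
  apply/andP; split; first exact: lt_le_trans xq qr.
  rewrite segptB normrZ; have := lt_le_trans tq qk; rewrite ltr_pdivlMr //.
  by apply: le_lt_trans; apply: ler_wpM2l => //; rewrite lerDl.
exists r; first exact: r0.
by move=> x xr _ [t /= t01 <-]; apply: H.
Qed.

(** Let k be in the kernel at x. As v is free, the half-space condition holds along l + e k, and
    [convex_zero] makes the form at c0 vanish there for two values of e, hence at k. The kernel at x
    is thus contained in the kernel at c0, and A1* gives x = c0. *)
Lemma boundary_contradiction (xs : E) (m0 m1 : M) (L : R) (x c0 c1 : E) (t : R) :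
  Gam (pt x m0) -> Gam (pt c0 m0) -> Gam (pt c1 m0) -> 0 < t -> t < 1 ->
  Q x m0 = (1 - t) *: Q c0 m0 + t *: Q c1 m0 ->
  (forall v y : E, y = c0 \/ y = c1 -> exists2 e0 : R, 0 < e0 &
    forall (e : R) (k : M), 0 < e -> e < e0 -> d1 g (pt x m0) (inm k) = 0 ->
    tx g (pt x m0) k = gx g x m1 - gx g x m0 - L *: (x - xs) + e *: v ->
    d1 g (pt y m0) (inm k) <= 0) -> x = c0.
Proof.
move=> G G0 G1 t0 t1 qE H; apply: (s_A1s S G G0) => k k0.
have [e1 e10 H1] := H (tx g (pt x m0) k) c0 (or_introl erefl).
have [e2 e20 H2] := H (tx g (pt x m0) k) c1 (or_intror erefl).
have [l [l1 l2]] := tx_surj S G 0 (gx g x m1 - gx g x m0 - L *: (x - xs)).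
have [e0 [e00 e01 e02]] := min2 e10 e20.
have zero (e : R) : 0 < e -> e < e0 ->
    d1 g (pt c0 m0) (inm l) + e * d1 g (pt c0 m0) (inm k) = 0.
  move=> ep ee.
  have h1 : d1 g (pt x m0) (inm (e *: k + l)) = 0.
    by rewrite (d1mD S _ _ _ G) k0 l1 mulr0 addr0.
  have h2 : tx g (pt x m0) (e *: k + l) = gx g x m1 - gx g x m0 - L *: (x - xs) +
      e *: tx g (pt x m0) k.
    by rewrite (txD S _ _ _ G) l2 addrC.
  have k1 := H1 e _ ep (lt_le_trans ee e01) h1 h2.
  have k2 := H2 e _ ep (lt_le_trans ee e02) h1 h2.
  have := convex_zero dp G G0 G1 t0 t1 qE h1 k1 k2.
  by rewrite (d1mD S _ _ _ G0) addrC.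
have e2p : 0 < e0 / 2 by exact: half_gt0.
have e2l : e0 / 2 < e0 by exact: half_ltr.
have e2h := lt_trans (half_ltr e2p) e2l.
exact: lin_zero_real e2p (zero _ e2p e2l) (zero _ (half_gt0 e2p) e2h).
Qed.

(** If a Q-segment between two points of the sublevel set left it, [hdel] would vanish at an
    intermediate point. The half-spaces at this boundary point force it to coincide with an end,
    where [hdel] is negative. *)
Lemma star_locally_convex (xs : E) (us : R) (P0 P1 : E) (c : R) : 0 < c ->
  vsegment xs us P0 P1 `<=` dom_U Gam g -> star_at Gam g c xs us P0 P1 ->
  locally_g_convex Gam g (sublevel xs us P0 P1 (c / 4)) xs
    (YZ Gam g xs us P0).1 (YZ Gam g xs us P0).2.
Proof.
move=> c0 sU star.
have [G0 g0 p0] := YZP (vsegment_mem sU (zero_in01 R)).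
have [G1 g1 p1] := YZP (vsegment_mem sU (one_in01 R)).
rewrite segpt0 in G0 g0 p0; rewrite segpt1 in G1 g1 p1.
have [m0 m0E] := named (YZ Gam g xs us P0); have [m1 m1E] := named (YZ Gam g xs us P1).
rewrite /sublevel -m0E -m1E in G0 g0 p0 G1 g1 p1 *.
have [l lE] := named (enorm (P1 - P0)); rewrite -lE.
have [L LE] := named (c / 4 * l ^+ 2); rewrite -LE.
have SG (N : set E) x : ([set x : E | [/\ vsegment x us P0 P1 `<=` dom_U Gam g,
    Gam (pt x m1), Gam (pt x m0) & hdel g xs m0 m1 L x < 0]] `&` N) x -> Gam (pt x m0).
  by case=> -[].
(* For p0 = p1 the function h vanishes identically, so the sublevel set is empty. *)
have [D0|Dn0] := eqVneq (P1 - P0) 0.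
  have mm : m0 = m1.
    by apply: (gx_inj S G0 G1); rewrite ?g0 ?g1 ?p0 ?p1 //; apply/esym/eqP; rewrite -subr_eq0 D0.
  have L0 : L = 0 by rewrite LE lE D0 enorm0 expr0n mulr0.
  exists setT; first exact: filterT.
  apply/(g_convexP (@SG setT)) => a b t [[_ _ _]].
  by rewrite /hdel mm L0 subrr !mul0r subr0 ltxx.
have l0 : 0 < l by rewrite lE; exact: enorm_gt0.
have g01 : g (pt xs m1) = g (pt xs m0) by rewrite g0 g1.
have lE' : l = enorm (gx g xs m1 - gx g xs m0) by rewrite p0 p1.
rewrite -g0 -p0 -p1 in star.
have [r1 r10 H1] := boundary_normal S G0 G1 c0 g01 star lE' l0 LE.
have [r2 r20 H2] := Omega_near sU.
have [r3 r30 H3] := g_near S G1 ltr01.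
have [rho [rho0 rh1 rh2 rh3]] := min3 r10 r20 r30.
have [r' r'0 H4] := quo_local dp G0 rho0.
have [r5 r50 H5] := quo_near dp G0 r'0.
have [r6 [r60 r65 r6r]] := min2 r50 rho0.
(* The neighbourhood is cut out by a ball in the Q variable, so that Q-segments stay in it; [rho]
   selects the branch of the inverse of Q near xs. *)
exists [set x : E | `|x - xs| < rho /\ `|Q x m0 - Q xs m0| < r'].
  apply/(@near_ball R E); exists r6; first exact: r60.
  by move=> x xr; split; [exact: lt_le_trans xr r6r|exact/H5/(lt_le_trans xr r65)].
apply/(g_convexP (@SG _)) => a b t [[oa Ga1 Ga0 ha] [ar aq]] [[ob Gb1 Gb0 hb] [br bq]] t01.
have [X XE] := named (fun s : R => (YZ Gam' g' m0.1 m0.2 ((1 - s) *: Q a m0 + s *: Q b m0)).1).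
have XP (s : R) : 0 <= s <= 1 -> [/\ Gam (pt (X s) m0),
    Q (X s) m0 = (1 - s) *: Q a m0 + s *: Q b m0 & `|X s - xs| < rho].
  by move=> s01; rewrite XE; apply: H4; exact: conv_ball.
have G1n y : `|y - xs| < rho -> Gam (pt y m1).
  move=> yr; have [] : Gam (pt y m1) /\ `|g (pt y m1) - g (pt xs m1)| < 1 => //.
  by apply: H3; rewrite ptBx norm_inx; exact: lt_le_trans yr rh3.
have X0 : X 0 = a by rewrite XE subr0 scale1r scale0r addr0 (quo_inv dp Ga0).
have X1 : X 1 = b by rewrite XE subrr scale1r scale0r add0r (quo_inv dp Gb0).
have [GX QX Xr] := XP t t01.
exists (X t); last exact: QX.
split; last first.
  by split; [exact: Xr|rewrite QX; exact: conv_ball].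
split; [exact/H2/(lt_le_trans Xr rh2)|exact: G1n|exact: GX|].
rewrite ltNge; apply/negP => hX.
have Xc (s : R) : 0 <= s <= 1 -> {for s, continuous X}.
  move=> s01; have [Gs Qs _] := XP s s01.
  apply: (@continuous_eps R R E) => e e0; have [r r0 H] := quo_local dp Gs e0.
  have Z0 : 0 < `|Q b m0 - Q a m0| + 1 by rewrite ltr_wpDl.
  have k : 0 < r / (`|Q b m0 - Q a m0| + 1) by exact: divr_gt0.
  exists (r / (`|Q b m0 - Q a m0| + 1)); first exact: k.
  move=> s' ss; rewrite distrC {1}XE; apply: ltW.
  have qs : `|(1 - s') *: Q a m0 + s' *: Q b m0 - Q (X s) m0| < r.
    rewrite Qs -/(segpt _ _ s') -/(segpt _ _ s) segptB normrZ.
    move: ss; rewrite ltr_pdivlMr //.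
    by apply: le_lt_trans; apply: ler_wpM2l => //; rewrite lerDl.
  by have [] := H _ qs.
have [t0 t1] := andP t01.
have hc : {within `[0, t], continuous (fun s : R => hdel g xs m0 m1 L (X s))}.
  apply: continuous_in_subspaceT => s; rewrite inE /= in_itv /= => /andP[s0 st].
  have s01 : 0 <= s <= 1 by rewrite s0; exact: le_trans st t1.
  have [Gs _ sr] := XP s s01.
  exact: (@continuous_comp R E R X _ s (Xc s s01) (hdel_continuous dp (xs := xs) (L := L) Gs (G1n _ sr))).
have [|s] := IVT t0 hc (_ : _ <= 0 <= _).
  by rewrite X0 ge_min (ltW ha) le_max hX orbT.
rewrite in_itv /= => /andP[s0 st] hs.
have s1 : s <= 1 by exact: le_trans st t1.
have s01 : 0 <= s <= 1 by rewrite s0.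
have [Gs Qs sr] := XP s s01.
have sn0 : s != 0.
  apply/eqP => e; have e' : X s = a by rewrite e.
  by move: ha; rewrite -e' hs ltxx.
have sn1 : s != 1.
  apply/eqP => e; have e' : X s = b by rewrite e.
  by move: hb; rewrite -e' hs ltxx.
have sp : 0 < s by rewrite lt_neqAle eq_sym sn0.
have sl : s < 1 by rewrite lt_neqAle sn1.
have xa : X s = a.
  apply: (@boundary_contradiction xs m0 m1 L (X s) a b s Gs Ga0 Gb0 sp sl Qs).
  move=> v y yE; have [yr hy] : `|y - xs| < rho /\ hdel g xs m0 m1 L y < 0 by case: yE => ->.
  exact: H1 (lt_le_trans sr rh1) (lt_le_trans yr rh1) hs hy.
by move: ha; rewrite -xa hs ltxx.
Qed.

Lemma A3s_A3s1 : Aform_A3s Gam g -> condA3s1 Gam g.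
Proof.
move=> A U' cU; have [c c0 Hc] := star_uniform S A cU.
exists (c / 4); first exact: divr_gt0.
move=> xs us P0 P1 sU.
have sub : U' `<=` dom_U Gam g by move=> w /subset_closure; exact: cU.2.
rewrite S_setE /y_at /z_at /Yfun /Zfun segpt0.
apply: star_locally_convex c0 _ (Hc _ _ _ _ sU).
exact: subset_trans sU sub.
Qed.

End A3s1.

Lemma sublevel_real (R : realFieldType) (L u s pxi pv c h0 h1 ha hb gam x g0 g1 d : R) :
  0 < s -> 0 < L -> c = (hb - h1) / 4 -> ha = (h1 + hb) / 4 -> s ^+ 2 * x <= d ->
  gam = 2^-1 * h0 + L / 2 * x - ha -> 0 < gam ->
  `|g0 - u - s * pxi - s ^+ 2 * (pv + 2^-1 * h0)| <= gam / 4 * s ^+ 2 ->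
  `|g1 - u - s * pxi - s ^+ 2 * (pv + c + 2^-1 * h1)| <= gam / 4 * s ^+ 2 ->
  g1 - g0 - L / 2 * d < 0.
Proof.
move=> s0 L0 -> -> xd gE g0' ; rewrite !ler_norml => /andP[h2 _] /andP[_ h3].
have h4 : L / 2 * (s ^+ 2 * x) <= L / 2 * d by rewrite ler_pM2l // divr_gt0.
have h5 : 0 < s ^+ 2 * gam by rewrite mulr_gt0 // exprn_gt0.
have h6 : s ^+ 2 * gam = s ^+ 2 * (2^-1 * h0 + L / 2 * x - (h1 + hb) / 4) by rewrite gE.
lra.
Qed.

Lemma reflect_real (R : realFieldType) (h P0d G1 Gm0 L d dd e ad k C s w beta a g1 : R) :
  0 < s -> h = G1 - Gm0 - L / 2 * d -> 0 <= L -> 0 <= d -> 0 < e ->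
  `|G1 - g1 - (P0d + dd)| <= e * ad -> `|Gm0 - g1 - P0d| <= e * ad ->
  `|- (a * (s * beta)) - 0 - dd| <= e * k * ad -> ad <= C * (s * w) ->
  0 <= k -> e * ((k + 2) * C * w) < a * beta -> h < 0.
Proof.
move=> s0 -> L0 d0 e0; rewrite !ler_norml => /andP[_ h1] /andP[h2 _] /andP[h3 _] h4 k0 h5.
have h6 : 0 <= L / 2 * d by rewrite mulr_ge0 // divr_ge0.
have h7 : e * ((k + 2) * ad) <= e * ((k + 2) * (C * (s * w))).
  by rewrite ler_pM2l // ler_pM2l // ltr_wpDl.
have h8 : s * (e * ((k + 2) * C * w)) < s * (a * beta) by rewrite ltr_pM2l.
lra.
Qed.

Lemma neg_range (R : realFieldType) (a b : R) : 0 < a -> `|b - - a| <= a / 2 -> a / 2 <= - b.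
Proof. by move=> a0; rewrite ler_norml => /andP[h1 h2]; lra. Qed.

Lemma reflect_comb (R : realFieldType) (V : lmodType R) (q w : V) (s : R) : 0 < s ->
  (1 - s / (1 + s)) *: (q - s *: w) + (s / (1 + s)) *: (q + w) = q.
Proof.
move=> s0; rewrite scalerBr scalerDr addrACA -scalerDl subrK scale1r scalerA -scaleNr -scalerDl.
have -> : - ((1 - s / (1 + s)) * s) + s / (1 + s) = 0.
  by field; rewrite gt_eqF // ltr_wpDl.
by rewrite scale0r addr0.
Qed.

Lemma frac_range (R : realFieldType) (s : R) : 0 < s -> 0 <= s / (1 + s) <= 1.
Proof.
move=> s0; have s1 : 0 < 1 + s by rewrite ltr_wpDl.
by apply/andP; split; [rewrite divr_ge0 // ltW|rewrite ler_pdivrMr // mul1r lerDr].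
Qed.

Lemma small_half (R : realFieldType) (a X : R) : 0 < a -> 0 <= X -> a / 2 / (X + 1) * X < a.
Proof.
move=> a0 X0; have X1 : 0 < X + 1 by rewrite ltr_wpDl.
rewrite mulrAC ltr_pdivrMr //.
have : 0 <= a * X by rewrite mulr_ge0 // ltW.
lra.
Qed.

Lemma gap_real (R : realFieldType) (hp hm h0 L X : R) : (hp + hm) / 2 - L * X < h0 ->
  0 < 2^-1 * h0 + L / 2 * X - (hp + hm) / 4.
Proof. by move=> h; lra. Qed.

(** * From local g-convexity back to A3s *)

Section A3s1_converse.
Context {R : realType} {n : nat}.
Local Notation E := 'rV[R]_n.
Local Notation W := (E * E * R)%type.
Local Notation M := (E * R)%type.
Variables (Gam : set W) (g : W -> R) (Gam' : set W) (g' : W -> R).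
Hypothesis dp : dual_pair Gam g Gam' g'.
Let S := dp_S dp.
Let S' := dp_S' dp.
Let oG := s_open S.
Let gC := s_C2 S.
Let hW : finite_coords W := W_coords.
Local Notation Q := (quo g g').

Lemma quo_lip (x0 : E) (m : M) : Gam (pt x0 m) -> exists2 C : R, 0 < C &
  exists2 r : R, 0 < r & forall x : E, `|x - x0| < r ->
  `|x - x0| <= C * `|Q x m - Q x0 m|.
Proof.
move=> G; have [G' gE] := dp_pt dp G.
have [C C0 [r r0 H]] := inverse_lipschitz S' G'.
exists C; first exact: C0.
have [r1 r10 H1] := g_near S G r0.
have [r2 [r20 rr1 rr2]] := min2 r0 r10.
exists r2; first exact: r20.
move=> x xr; have zz (V : normedModType R) (z : V) : `|z - z| < r by rewrite subrr normr0.
have [Gx gx'] : Gam (pt x m) /\ `|g (pt x m) - g (pt x0 m)| < r.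
  by apply: H1; rewrite ptBx norm_inx; exact: lt_le_trans xr rr2.
have [_ gE'] := dp_pt dp Gx.
have mr : `|(x, g (pt x m)) - (x0, g (pt x0 m))| < r.
  by rewrite prod_normE /= gt_max gx' andbT; exact: lt_le_trans xr rr1.
have := H m.1 (x0, g (pt x0 m)) (x, g (pt x m)) (zz _ _) (zz _ _) mr.
rewrite gE gE' subrr normr0 add0r; apply: le_trans.
by rewrite prod_normE /= le_max lexx.
Qed.

(* If the direction k pointed out of the sublevel set at x, then g-convexity along
   the Q-segment through x and the reflection of x in xs would put xs, where
   h = 0, into the sublevel set. *)
Lemma sublevel_halfspace (xs : E) (us : R) (P0 P1 : E) (del : R) (k : M) : 0 <= del ->
  vsegment xs us P0 P1 `<=` dom_U Gam g ->
  let m0 := YZ Gam g xs us P0 in let m1 := YZ Gam g xs us P1 in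
  locally_g_convex Gam g (sublevel Gam g xs us P0 P1 del) xs m0.1 m0.2 ->
  d1 g (pt xs m0) (inm k) = 0 -> tx g (pt xs m0) k = P1 - P0 ->
  exists2 r : R, 0 < r & forall x : E, `|x - xs| < r ->
    hdel g xs m0 m1 (del * enorm (P1 - P0) ^+ 2) x < 0 -> d1 g (pt x m0) (inm k) <= 0.
Proof.
move=> del0 sU /=.
have [G0 g0 p0] := YZP (vsegment_mem sU (zero_in01 R)).
have [G1 g1 p1] := YZP (vsegment_mem sU (one_in01 R)).
rewrite segpt0 in G0 g0 p0; rewrite segpt1 in G1 g1 p1.
have [m0 m0E] := named (YZ Gam g xs us P0); have [m1 m1E] := named (YZ Gam g xs us P1).
rewrite /sublevel -m0E -m1E in G0 g0 p0 G1 g1 p1 *.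
have [L LE] := named (del * enorm (P1 - P0) ^+ 2); rewrite -LE.
have L0 : 0 <= L by rewrite LE mulr_ge0 // sqr_ge0.
case=> N0 /(@near_ball R E)[r1 r10 H1] conv k0 k1.
have {}conv := (g_convexP dp (m := m0) (fun x (h : (_ `&` N0) x) => let: conj h1 _ := h in
  let: And4 _ _ h3 _ := h1 in h3)).1 conv.
have [r2 r20 H2] := Omega_near dp sU.
have [r3 r30 H3] := D_near oG G0.
have [r4 r40 H4] := D_near oG G1.
have [r [r0 rr1 rr2 rr3 rr4]] := min4 r10 r20 r30 r40.
exists r; first exact: r0.
move=> x xr hx; rewrite leNgt; apply/negP => pos.
have inS y : `|y - xs| < r -> hdel g xs m0 m1 L y < 0 -> 
    ([set x : E | [/\ vsegment x us P0 P1 `<=` dom_U Gam g, Gam (pt x m1), Gam (pt x m0) &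
      hdel g xs m0 m1 L x < 0]] `&` N0) y.
  move=> yr hy; split; last exact/H1/(lt_le_trans yr rr1).
  split; [exact/H2/(lt_le_trans yr rr2)| | |exact: hy].
    by apply: H4; rewrite ptBx norm_inx; exact: lt_le_trans yr rr4.
  by apply: H3; rewrite ptBx norm_inx; exact: lt_le_trans yr rr3.
have [[_ _ Gx _] _] := inS x xr hx.
have gz y : Gam (pt y m0) -> d1 g (pt y m0) (inm (0, 1)) < 0 by exact: s_gz.
have [w wE] := named (Q x m0 - Q xs m0).
have [beta bE] := named (dotp w k.1).
have kE : k.2 = dotp (Q xs m0) k.1.
  move/eqP: k0; rewrite (quoE dp k G0) mulf_eq0 lt_eqF ?gz //= subr_eq0.
  by move/eqP.
have b0 : 0 < beta.
  move: pos; rewrite (quoE dp k Gx) nmulr_rgt0 ?gz // kE -dotpBl -opprB -wE dotpNl -bE.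
  by rewrite oppr_lt0.
have [a aE] := named (- d1 g (pt xs m0) (inm (0, 1))).
have a0 : 0 < a by rewrite aE oppr_gt0 gz.
have a20 : 0 < a / 2 by exact: half_gt0.
have [C C0 [r5 r50 H5]] := quo_lip G0.
have ab : 0 < a / 2 * beta by exact: mulr_gt0.
have [X XE] := named ((`|k| + 2) * C * `|w|).
have X0 : 0 <= X by rewrite XE !mulr_ge0 ?addr_ge0 // ltW.
have [e eE] := named (a / 2 * beta / 2 / (X + 1)).
have e0 : 0 < e by rewrite eE divr_gt0 ?half_gt0 // ltr_wpDl.
have [r6 r60 H6] := strict2 hW oG gC G0 e0.
have [r7 r70 H7] := strict1 hW oG gC G0 e0.
have [r8 r80 H8] := strict1 hW oG gC G1 e0.
have [r9 r90 H9] := d1_near hW oG gC G0 a20.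
have [t1 [t10 t11 t12 t13]] := min3 r0 r50 r60.
have [t2 [t20 t21 t22 t23 t24]] := min4 t10 r70 r80 r90.
have [q q0 Hq] := quo_local dp G0 t20.
have w1 : 0 < `|w| + 1 by rewrite ltr_wpDl.
have [s sE] := named (q / 2 / (`|w| + 1)).
have s0 : 0 < s by rewrite sE divr_gt0 ?half_gt0.
have sw : `|Q xs m0 - s *: w - Q xs m0| < q.
  rewrite addrC addKr normrN normrZ gtr0_norm // sE; exact: small_half.
have [Gc Qc cr] := Hq _ sw.
move: (YZ Gam' g' m0.1 m0.2 (Q xs m0 - s *: w)).1 Gc Qc cr => c Gc Qc cr.
have cr1 := lt_le_trans cr t21.
have cn : `|pt c m0 - pt xs m0| = `|c - xs| by rewrite ptBx norm_inx.
have cn1 : `|pt c m1 - pt xs m1| = `|c - xs| by rewrite ptBx norm_inx.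
have zz (r' : R) (P : W) : 0 < r' -> `|P - P| < r' by rewrite subrr normr0.
have [_ T6] := H6 (pt xs m0) (pt c m0) (inm k) (zz _ _ r60)
  ltac:(rewrite cn; exact: lt_le_trans cr1 t13).
have [_ T7] := H7 (pt xs m0) (pt c m0) (zz _ _ r70)
  ltac:(rewrite cn; exact: lt_le_trans cr t22).
have [_ T8] := H8 (pt xs m1) (pt c m1) (zz _ _ r80)
  ltac:(rewrite cn1; exact: lt_le_trans cr t23).
have [_ T9] := H9 (pt c m0) ltac:(rewrite cn; exact: lt_le_trans cr t24).
have ac : a / 2 <= - d1 g (pt c m0) (inm (0, 1)).
  apply: neg_range a0 _; rewrite aE opprK; apply: le_trans (T9 (inm (0, 1))) _.
  rewrite -aE; apply: ler_piMr; [exact: ltW|exact: norm_inm01].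
rewrite cn norm_inm k0 !ptBx (d2C hW oG gC G0) -(txE S _ _ G0) k1 (quoE dp k Gc) Qc kE in T6.
rewrite cn ptBx -(gxE S _ G0) g0 p0 in T7.
rewrite cn1 ptBx -(gxE S _ G1) g1 p1 in T8.
have hc : hdel g xs m0 m1 L c < 0.
  apply: (@reflect_real R _ (dotp P0 (c - xs)) (g (pt c m1)) (g (pt c m0)) L
    (enorm (c - xs) ^+ 2) (dotp (P1 - P0) (c - xs)) e `|c - xs| `|k| C s `|w| beta
    (- d1 g (pt c m0) (inm (0, 1))) us s0 erefl L0 (sqr_ge0 _) e0).
  - by rewrite -dotpDDl (addrC P0) subrK.
  - exact: T7.
  - move: T6; congr (`|_ - _ - _| <= _).
    by rewrite dotpBl dotpZl -bE opprB addrC subrK mulNr opprK.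
  - have := H5 c (lt_le_trans cr1 t12).
    by rewrite Qc [_ - _ - Q xs m0]addrC addKr normrN normrZ (gtr0_norm s0).
  - exact: normr_ge0.
  - rewrite -XE; apply: (@lt_le_trans _ _ (a / 2 * beta)); first by rewrite eE; exact: small_half.
    by rewrite ler_pM2r.
have [y [[_ _ Gy hy] _]] := conv _ _ _ (inS c (lt_le_trans cr1 t11) hc) (inS x xr hx) (frac_range s0).
rewrite Qc (_ : Q x m0 = Q xs m0 + w); last by rewrite wE addrC subrK.
rewrite (reflect_comb _ _ s0) => Qy.
have := quo_inv dp Gy; rewrite Qy (quo_inv dp G0) => -[xy _].
by move: hy; rewrite -xy /hdel g0 g1 !subrr enorm0 expr0n mulr0 subr0 ltxx.
Qed.

(** The slopes of mp and mm lie on opposite sides of that of m0. As in [second_order_test], v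
    balances the two expansions; the failure of midpoint convexity then bounds both second order
    coefficients by -gam < 0. *)
Lemma sublevel_common_point (x0 : E) (u0 : R) (m0 mp mm : M) (D xi : E) (L : R) :
  Gam (pt x0 m0) -> Gam (pt x0 mp) -> Gam (pt x0 mm) ->
  g (pt x0 m0) = u0 -> g (pt x0 mp) = u0 -> g (pt x0 mm) = u0 ->
  gx g x0 mp = gx g x0 m0 + D -> gx g x0 mm = gx g x0 m0 - D -> D != 0 ->
  dotp xi D = 0 -> 0 < L ->
  (dotp (hx g (pt x0 mp) xi) xi + dotp (hx g (pt x0 mm) xi) xi) / 2 - L * enorm xi ^+ 2 <
    dotp (hx g (pt x0 m0) xi) xi ->
  forall r : R, 0 < r -> exists x : E, [/\ `|x - x0| < r,
    hdel g x0 m0 mp L x < 0 & hdel g x0 m0 mm L x < 0].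
Proof.
move=> G0 Gp Gm g0 gp gm pp pm Dn0 xiD L0 H r0 r00.
have [h0 h0E] := named (dotp (hx g (pt x0 m0) xi) xi).
have [hp hpE] := named (dotp (hx g (pt x0 mp) xi) xi).
have [hm hmE] := named (dotp (hx g (pt x0 mm) xi) xi).
rewrite -[X in _ < X]h0E -[X in (X + _) / 2 - _ < _]hpE -[X in (_ + X) / 2 - _ < _]hmE in H.
have DD : dotp D D != 0 by rewrite -enorm_sqr expf_eq0 /= gt_eqF // enorm_gt0.
have [c cE] := named ((hm - hp) / 4 / dotp D D).
have [v vE] := named (c *: D).
have Dv : dotp D v = (hm - hp) / 4 by rewrite vE dotpZr cE divfK.
have Dxi : dotp D xi = 0 by rewrite dotpC.
have [gam gamE] := named (2^-1 * h0 + L / 2 * enorm xi ^+ 2 - (hp + hm) / 4).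
have gam0 : 0 < gam by rewrite gamE; exact: gap_real H.
have e0 : 0 < gam / 4 by exact: divr_gt0.
have [s1 s10 H1] := taylor_curve S xi v G0 e0.
have [s2 s20 H2] := taylor_curve S xi v Gp e0.
have [s3 s30 H3] := taylor_curve S xi v Gm e0.
have [X XE] := named (`|xi| + `|v| + 1).
have X0 : 0 < X by rewrite XE ltr_wpDl // addr_ge0.
have k1 : 0 < r0 / X by exact: divr_gt0.
have [s4 [s40 s41 s42 s43 s44]] := min4 s10 s20 s30 k1.
have [s5 [s50 s54 s51]] := min2 s40 ltr01.
have sq : 0 < s5 / 2 by exact: divr_gt0.
have ss : s5 / 2 < s4 by apply: lt_le_trans (half_ltr s50) s54.
have s1' : s5 / 2 <= 1 by apply: ltW; exact: lt_le_trans (half_ltr s50) s51.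
move: sq ss s1'; move: (s5 / 2) => s sp ss s1'.
have [_ T1] := H1 s sp (lt_le_trans ss s41).
have [_ T2] := H2 s sp (lt_le_trans ss s42).
have [_ T3] := H3 s sp (lt_le_trans ss s43).
have [dx dxE] := named (s *: xi + s ^+ 2 *: v); rewrite -dxE in T1 T2 T3.
have dxn : `|dx| <= s * X.
  rewrite dxE; apply: le_trans (norm_curve _ _ sp) _.
  exact: dxn_real (ltW sp) s1' (normr_ge0 _) XE.
exists (x0 + dx); rewrite /hdel [x0 + dx - x0]addrC addKr.
rewrite -h0E g0 in T1; rewrite -hpE gp pp !dotpDDl Dv Dxi addr0 in T2.
rewrite -hmE gm pm !dotpBl Dv Dxi subr0 in T3.
have xid : s ^+ 2 * enorm xi ^+ 2 <= enorm dx ^+ 2.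
  have xiv : dotp xi v = 0 by rewrite vE dotpZr xiD mulr0.
  have vxi : dotp v xi = 0 by rewrite dotpC.
  rewrite dxE !enorm_sqr dotpDDl !dotpDDr !dotpZl !dotpZr xiv vxi !mulr0 addr0 add0r.
  by rewrite mulrA -expr2 lerDl mulrA mulr_ge0 ?dotp_ge0 // -expr2 sqr_ge0.
split.
- apply: le_lt_trans dxn _.
  by rewrite -ltr_pdivlMr //; exact: lt_le_trans ss s44.
- exact: sublevel_real sp L0 erefl erefl xid gamE gam0 T1 T2.
- have cm : - ((hm - hp) / 4) = (hp - hm) / 4 by rewrite -mulNr opprB.
  have gamE' : gam = 2^-1 * h0 + L / 2 * enorm xi ^+ 2 - (hm + hp) / 4.
    by rewrite gamE [hp + hm]addrC.
  exact: sublevel_real sp L0 cm erefl xid gamE' gam0 T1 T3.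
Qed.

(** Differentiating D_m g(., m0) k = 0 in x at x1 puts k in the kernel of the mixed derivative as
    well, and A2 makes this common kernel trivial. *)
Lemma constant_direction (x0 x1 : E) (m0 : M) (k : M) (r : R) : Gam (pt x0 m0) ->
  Gam (pt x1 m0) -> 0 < r -> d1 g (pt x1 m0) (inm k) = 0 ->
  (forall x, `|x - x1| < r -> d1 g (pt x m0) (inm k) = 0) -> k = 0.
Proof.
move=> G0 G1 r0 k0 H; apply: (s_A2 S G1 k0) => v.
rewrite (d2C hW oG gC G1); apply/eqP; rewrite -normr_le0; apply: small_slope_le => e e0.
have v1 : 0 < `|v| + 1 by rewrite ltr_wpDl.
have kv : 0 < `|k| * `|v| + 1 by rewrite ltr_wpDl // mulr_ge0.
have f0 : 0 < e / (`|k| * `|v| + 1) by exact: divr_gt0.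
have [r1 r10 H1] := strict2 hW oG gC G1 f0.
have [r2 [r20 rr rr1]] := min2 r0 r10.
have [s sE] := named (r2 / 2 / (`|v| + 1)).
have s0 : 0 < s by rewrite sE divr_gt0 ?half_gt0.
exists s; first exact: s0.
have sv : `|s *: v| < r2 by rewrite normrZ gtr0_norm // sE; exact: small_half.
have xv : x1 + s *: v - x1 = s *: v by rewrite addrC addKr.
have zP : `|pt x1 m0 - pt x1 m0| < r1 by rewrite subrr normr0.
have nP : `|pt (x1 + s *: v) m0 - pt x1 m0| < r1.
  by rewrite ptBx xv norm_inx; exact: lt_le_trans sv rr1.
have [_] := H1 _ _ (inm k) zP nP.
rewrite k0 (H (x1 + s *: v)); last by rewrite xv; exact: lt_le_trans sv rr.
rewrite ptBx xv norm_inm norm_inx normrZ subrr sub0r normrN inxZ (d2Zl gC G1).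
rewrite normrM (gtr0_norm s0) => /le_trans; apply.
rewrite mulrCA [leRHS]mulrC ler_pM2l // -mulrA mulrAC ler_pdivrMr //.
by rewrite ler_pM2l // lerDl.
Qed.

(** The two halves of [s - r, s + r], both started at the middle, have opposite velocities l and -l,
    so their sublevel sets lie where D_m g(., m0) l is nonpositive, respectively nonnegative. A
    failure of midpoint convexity gives a common point, hence by continuity a common ball on which
    the form vanishes; then l = 0, although [tx] sends l to r D. *)
Lemma A3s1_A3s : condA3s1 Gam g -> Aform_A3s Gam g.
Proof.
move=> H U' cU; have [d0 d00 Hd] := H U' cU.
exists (d0 / 2); first exact: divr_gt0.
have sub : U' `<=` dom_U Gam g by move=> w /subset_closure; exact: cU.2.
apply: (codim1_convex_midpoint S sub d00) => x u p0 p1 xi s r0 sU.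
have [D DE] := named (p1 - p0); rewrite -DE => Dn0 xin0 xip s0 s1 r00.
have seg t : 0 <= t <= 1 -> dom_U Gam g (x, u, segpt p0 p1 t).
  by move=> t01; apply: sub; exact: vsegment_mem sU t01.
have [r [rp rr0 r1 r2]] := small_range s0 s1 r00.
exists r; split; [exact: rp|exact: rr0|exact: r1|exact: r2|].
have [tm tp ts] := range_pm r1 r2 rp.
have sp := vsegment_sub sU ts tp; have sm := vsegment_sub sU ts tm.
have cp := Hd _ _ _ _ sp; have cm := Hd _ _ _ _ sm.
rewrite S_setE /y_at /z_at /Yfun /Zfun segpt0 in cp.
rewrite S_setE /y_at /z_at /Yfun /Zfun segpt0 in cm.
have [G0 g0 P0] := YZP (seg s ts).
have [Gp gp Pp] := YZP (seg _ tp).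
have [Gm gm Pm] := YZP (seg _ tm).
have Dp : segpt p0 p1 (s + r) - segpt p0 p1 s = r *: D.
  by rewrite segptB -DE addrC addKr.
have Dm : segpt p0 p1 (s - r) - segpt p0 p1 s = - (r *: D).
  by rewrite segptB -DE addrC addKr scaleNr.
have Pp' : gx g x (YZ Gam g x u (segpt p0 p1 (s + r))) =
    gx g x (YZ Gam g x u (segpt p0 p1 s)) + r *: D.
  by rewrite Pp P0 !segptE -DE scalerDl addrA.
have Pm' : gx g x (YZ Gam g x u (segpt p0 p1 (s - r))) =
    gx g x (YZ Gam g x u (segpt p0 p1 s)) - r *: D.
  by rewrite Pm P0 !segptE -DE scalerDl scaleNr addrA.
have rD0 : r *: D != 0 by rewrite scaler_eq0 negb_or gt_eqF.
have rDxi : dotp xi (r *: D) = 0 by rewrite dotpZr xip mulr0.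
have [l [l0 l1]] := tx_surj S G0 0 (r *: D).
have [L LE] := named (d0 * enorm (r *: D) ^+ 2).
have L0 : 0 < L by rewrite LE; apply: mulr_gt0 => //; rewrite exprn_gt0 // enorm_gt0.
have l1p : tx g (pt x (YZ Gam g x u (segpt p0 p1 s))) l =
  segpt p0 p1 (s + r) - segpt p0 p1 s by rewrite Dp.
have l1m : tx g (pt x (YZ Gam g x u (segpt p0 p1 s))) (- l) =
  segpt p0 p1 (s - r) - segpt p0 p1 s.
  by rewrite Dm -sub0r (txB S _ _ G0) l1 -[X in tx g _ X](subrr l) (txB S _ _ G0) subrr sub0r.
have l0m : d1 g (pt x (YZ Gam g x u (segpt p0 p1 s))) (inm (- l)) = 0.
  by rewrite inmN (d1N gC G0) l0 oppr0.
have [r3 r30 H3] := sublevel_halfspace (ltW d00) (subset_trans sp sub) cp l0 l1p.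
have [r4 r40 H4] := sublevel_halfspace (ltW d00) (subset_trans sm sub) cm l0m l1m.
rewrite Dp -LE in H3; rewrite Dm enormN -LE in H4.
rewrite !AformE; move: (YZ Gam g x u (segpt p0 p1 s)) G0 g0 P0 Pp' Pm' l0 l1 H3 H4 {cp cm l1p l1m l0m}.
move=> m0 G0 g0 P0 Pp' Pm' l0 l1 H3 H4.
move: (YZ Gam g x u (segpt p0 p1 (s + r))) Gp gp Pp' H3 {Pp} => mp Gp gp Pp' H3.
move: (YZ Gam g x u (segpt p0 p1 (s - r))) Gm gm Pm' H4 {Pm} => mm Gm gm Pm' H4.
rewrite leNgt; apply/negP => neg.
have neg' : (dotp (hx g (pt x mp) xi) xi + dotp (hx g (pt x mm) xi) xi) / 2 - L * enorm xi ^+ 2 <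
    dotp (hx g (pt x m0) xi) xi.
  apply: le_lt_trans neg; rewrite lerD2l lerN2 LE enormZ (gtr0_norm rp).
  by rewrite le_eqVlt; apply/orP; left; apply/eqP; ring.
have [r5 r50 H5] := D_near oG G0.
have [r6 r60 H6] := D_near oG Gp.
have [r7 r70 H7] := D_near oG Gm.
have [q1 [q10 q13 q14]] := min2 r30 r40.
have [q [q0 qq1 q5 q6 q7]] := min4 q10 r50 r60 r70.
have q2 : 0 < q / 2 by exact: half_gt0.
have [y [yr yp ym]] := sublevel_common_point G0 Gp Gm g0 gp gm Pp' Pm' rD0 rDxi L0 neg' q2.
have yq := lt_trans yr (half_ltr q0).
have Gy m (rm : R) : (forall A : W, `|A - pt x m| < rm -> Gam A) -> q <= rm -> Gam (pt y m).
  by move=> HA qr; apply: HA; rewrite ptBx norm_inx; exact: lt_le_trans yq qr.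
have Gy0 := Gy _ _ H5 q5; have Gyp := Gy _ _ H6 q6; have Gym := Gy _ _ H7 q7.
have cont m : Gam (pt y m) -> hdel g x m0 m L y < 0 -> exists2 e : R, 0 < e &
    forall z : E, `|z - y| < e -> hdel g x m0 m L z < 0.
  move=> Gm' hy; apply/(@near_ball R E).
  have := hdel_continuous dp (xs := x) (L := L) Gy0 Gm'.
  by move/cvgr_lt => /(_ 0 hy).
have [e1 e10 K1] := cont _ Gyp yp; have [e2 e20 K2] := cont _ Gym ym.
have [e [e0 ee1 ee2 eq]] := min3 e10 e20 q2.
have zero z : `|z - y| < e -> d1 g (pt z m0) (inm l) = 0.
  move=> zy; have zx : `|z - x| < q.
    have -> : z - x = (z - y) + (y - x) by rewrite addrA subrK.
    apply: le_lt_trans (ler_normD _ _) _; rewrite (splitr q); apply: ltrD yr.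
    exact: lt_le_trans zy eq.
  have Gz : Gam (pt z m0) by apply: H5; rewrite ptBx norm_inx; exact: lt_le_trans zx q5.
  have h1 := H3 z (lt_le_trans (lt_le_trans zx qq1) q13) (K1 z (lt_le_trans zy ee1)).
  have := H4 z (lt_le_trans (lt_le_trans zx qq1) q14) (K2 z (lt_le_trans zy ee2)).
  rewrite inmN (d1N gC Gz) oppr_le0 => h2.
  by apply/eqP; rewrite eq_le h1.
have zy : `|y - y| < e by rewrite subrr normr0.
have lz := constant_direction G0 Gy0 e0 (zero y zy) zero.
move: rD0; rewrite -l1 lz -(subrr 0) (txB S _ _ G0) subrr eqxx; by [].
Qed.

End A3s1_converse.

(** * From the hypotheses on g *)

Lemma dotp_mulmx (R : realType) n (A : 'M[R]_n) (u v : 'rV[R]_n) :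
  dotp (u *m A) v = dotp (v *m A^T) u.
Proof.
rewrite !dotpE; under eq_bigr do rewrite mxE mulr_suml.
rewrite exchange_big /=; apply: eq_bigr => i _; rewrite mxE mulr_suml.
by apply: eq_bigr => j _; rewrite mxE [LHS]mulrC mulrA [RHS]mulrAC.
Qed.

Lemma lift_real (R : comRingType) (a c p q : R) :
  - (c * (a * p + q)) = a * - (c * p) + - (c * q).
Proof. by ring. Qed.

Section Generating.
Context {R : realType} {n : nat}.
Local Notation E := 'rV[R]_n.
Local Notation W := (E * E * R)%type.
Local Notation M := (E * R)%type.
Variables (Gam : set W) (g : W -> R).
Hypotheses (hg : generating_function Gam g) (A1 : condA1 Gam g).
Hypotheses (A2 : condA2 Gam g) (A1s : condA1star Gam g).

Lemma gam_open : open Gam. Proof. by case: hg. Qed.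
Lemma gam_C2 : C2_on Gam g. Proof. by case: hg => _ _ _ _ []. Qed.

Lemma g_zE x y z : g_z g x y z = d1 g (pt x (y, z)) (inm (0, 1)).
Proof. exact: derive_z. Qed.

Lemma g_yE x y z i : g_y g x y z 0 i = d1 g (pt x (y, z)) (inm (delta_mx 0 i, 0)).
Proof. by rewrite mxE; exact: derive_y. Qed.

Lemma gam_gz P : Gam P -> d1 g P (inm (0, 1)) < 0.
Proof.
case: P => [[x y] z] G; have [_ _ _ _ [_ H]] := hg.
by have := H x y z G; rewrite g_zE.
Qed.

Lemma pt_inm (x : E) (y : E) (z z' t : R) :
  pt x (y, z) + inm (t *: ((y, z') - (y, z))) = pt x (y, z + t * (z' - z)).
Proof.
have := ptBm x (y, z) (y, z + t * (z' - z)).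
move/eqP; rewrite subr_eq => /eqP ->; rewrite [LHS]addrC; congr (inm _ + _); congr (_, _) => /=.
  by rewrite subrr scaler0.
by rewrite [RHS]addrC addKr.
Qed.

(** The section I(x, y) is an interval, so the segment from z to z' stays in the domain and the mean
    value theorem applies with g_z < 0. *)
Lemma gam_zlt x y z z' : Gam (x, y, z) -> Gam (x, y, z') -> z < z' ->
  g (x, y, z') < g (x, y, z).
Proof.
move=> G G' zz'; have [_ _ _ I _] := hg; have [_ Ixy] := I x y.
have BA : pt x (y, z') - pt x (y, z) = (z' - z) *: inm (0, 1).
  rewrite ptBm -inmZ; congr inm; congr (_, _) => /=.
    by rewrite subrr scaler0.
  exact/esym/mulr1.
have GP (t : R) : 0 <= t <= 1 -> Gam (pt x (y, z) + t *: (pt x (y, z') - pt x (y, z))).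
  move=> /andP[t0 t1].
  rewrite ptBm -inmZ pt_inm -(ptE x y).
  apply: (Ixy z z') => //; apply/andP; split.
    by rewrite lerDl mulr_ge0 // subr_ge0 ltW.
  rewrite -lerBrDl; apply: ler_piMl => //; by rewrite subr_ge0 ltW.
have [t t01|c /andP[c0 c1]] := @mvt_line R
  (fun s => g (pt x (y, z) + s *: (pt x (y, z') - pt x (y, z))))
  (fun t => 'D_(pt x (y, z') - pt x (y, z)) g (pt x (y, z) + t *: (pt x (y, z') - pt x (y, z)))).
  apply: is_derive_line; apply: diff_derivable; exact: gam_C2.1.1 (GP t t01).
rewrite scale1r scale0r addr0 subrKC => e.
have c01 : 0 <= c <= 1 by rewrite !ltW.
rewrite -subr_lt0 (ptE x y z') (ptE x y z) e.
have h := GP c c01; move: (pt x (y, z) + c *: _) h => Pc h.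
apply: (@le_lt_trans _ _ (d1 g Pc (pt x (y, z') - pt x (y, z)))); first exact: lexx.
by rewrite BA (d1Z gam_C2 h) pmulr_rlt0 ?subr_gt0 //; exact: gam_gz h.
Qed.

(** The solution of g_y.eta + g_z zeta = 0 with prescribed y-part. The columns of E are the mixed
    derivatives of g along the lifts of the basis vectors. *)
Definition ker_lift (P : W) (eta : E) : M :=
  (eta, - ((d1 g P (inm (0, 1)))^-1 * d1 g P (inm (eta, 0)))).

Lemma ker_lift_inm (P : W) (eta : E) : inm (ker_lift P eta) =
  - ((d1 g P (inm (0, 1)))^-1 * d1 g P (inm (eta, 0))) *: inm (0, 1) + inm (eta, 0).
Proof.
rewrite -inmD; congr inm; rewrite /ker_lift; congr (_, _) => /=.
  by rewrite scaler0 add0r.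
by rewrite addr0; exact/esym/mulr1.
Qed.

Lemma ker_lift0 (P : W) (eta : E) : Gam P -> d1 g P (inm (ker_lift P eta)) = 0.
Proof.
move=> G; have n0 : d1 g P (inm (0, 1)) != 0 by rewrite lt_eqF // gam_gz.
rewrite ker_lift_inm (d1Dl gam_C2 G); move: n0.
move: (d1 g P (inm (0, 1))) (d1 g P _) => a b n0.
by rewrite mulNr mulrAC mulVf // mul1r addNr.
Qed.

Lemma ker_liftP (P : W) (k : M) : Gam P ->
  d1 g P (inm k) = 0 <-> k = ker_lift P k.1.
Proof.
move=> G; have n0 : d1 g P (inm (0, 1)) != 0 by rewrite lt_eqF // gam_gz.
have kE : inm k = k.2 *: inm (0, 1) + inm (k.1, 0) :> W.
  rewrite -inmD; congr inm; case: k => k1 k2; congr (_, _); rewrite /= ?scaler0 ?add0r //.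
  by rewrite addr0; exact/esym/mulr1.
split=> [|e].
  rewrite kE (d1Dl gam_C2 G) => /eqP; rewrite addr_eq0 => /eqP e.
  rewrite /ker_lift; case: k kE e => k1 k2 /= _ e; congr (_, _).
  by apply: (mulIf n0); rewrite e mulNr -mulrA mulrCA mulVf // mulr1.
rewrite e; exact: ker_lift0.
Qed.

Lemma inm0D (a : R) (u v : E) : inm (a *: u + v, 0) = a *: inm (u, 0) + inm (v, 0) :> W.
Proof.
by rewrite -inmD; congr inm; congr (_, _); rewrite addr0; exact/esym/mulr0.
Qed.

Lemma ker_liftD (P : W) (a : R) (u v : E) : Gam P ->
  inm (ker_lift P (a *: u + v)) = a *: inm (ker_lift P u) + inm (ker_lift P v) :> W.
Proof.
move=> G.
have e : d1 g P (inm (a *: u + v, 0)) = a * d1 g P (inm (u, 0)) + d1 g P (inm (v, 0)).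
  by rewrite inm0D; exact: (d1Dl gam_C2 G).
rewrite -inmD; congr inm; rewrite /ker_lift e; congr (_, _); exact: lift_real.
Qed.

Lemma d2_lift (P v : W) (a : R) (u w : E) : Gam P ->
  d2 g P (inm (ker_lift P (a *: u + w))) v =
  a * d2 g P (inm (ker_lift P u)) v + d2 g P (inm (ker_lift P w)) v.
Proof.
move=> G; transitivity (d2 g P (a *: inm (ker_lift P u) + inm (ker_lift P w)) v).
  by congr (d2 g P _ v); exact: ker_liftD.
exact: (d2Dl gam_C2 G a (inm (ker_lift P u)) (inm (ker_lift P w)) v).
Qed.

Lemma EmxE x y z i j : Gam (x, y, z) -> Emx g x y z i j =
  d2 g (x, y, z) (inm (ker_lift (x, y, z) (delta_mx 0 j))) (inx (delta_mx 0 i)).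
Proof.
move=> G; rewrite ker_lift_inm (d2Dl gam_C2 G) addrC.
have e1 : g_xy g x y z i j = d2 g (x, y, z) (inm (delta_mx 0 j, 0)) (inx (delta_mx 0 i)).
  rewrite mxE (_ : (fun y' => g_x g x y' z 0 i) =
      fun y' => ('D_(inx (delta_mx 0 i)) g) (x, y', z)); first exact: derive_y.
  by apply/funext => y'; rewrite mxE; exact: derive_x.
have e2 : g_xz g x y z 0 i = d2 g (x, y, z) (inm (0, 1)) (inx (delta_mx 0 i)).
  rewrite mxE (_ : (fun z' => g_x g x y z' 0 i) =
      fun z' => ('D_(inx (delta_mx 0 i)) g) (x, y, z')); first exact: derive_z.
  by apply/funext => z'; rewrite mxE; exact: derive_x.
have e3 : ((g_xz g x y z)^T *m g_y g x y z) i j = g_xz g x y z 0 i * g_y g x y z 0 j.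
  by rewrite mxE big_ord1 mxE.
have -> : Emx g x y z i j = g_xy g x y z i j -
    (g_z g x y z)^-1 * ((g_xz g x y z)^T *m g_y g x y z) i j.
  by rewrite /Emx mxE; congr (_ + _); rewrite mxE mxE.
rewrite e3 e1 e2 g_yE g_zE -!ptE; congr (_ + _).
by rewrite mulNr mulrA mulrAC.
Qed.

Lemma Emx_form x y z (eta v : E) : Gam (x, y, z) ->
  d2 g (x, y, z) (inm (ker_lift (x, y, z) eta)) (inx v) =
  dotp (eta *m (Emx g x y z)^T) v.
Proof.
move=> G.
have := lin_row (f := fun v => d2 g (x, y, z) (inm (ker_lift (x, y, z) eta)) (inx v)).
move=> <-; last first.
  by move=> a u w; rewrite inxD (d2Dr W_coords gam_open gam_C2 G).
congr dotp; apply/rowP => i; rewrite !mxE.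
have := lin_row (f := fun eta => d2 g (x, y, z) (inm (ker_lift (x, y, z) eta)) (inx (delta_mx 0 i))).
move=> <-; last first.
  by move=> a u w; exact: d2_lift.
rewrite dotpE; apply: eq_bigr => j _; rewrite [in RHS]mxE EmxE // mxE mulrC; by [].
Qed.

Lemma Emx_unit x y z : Gam (x, y, z) -> Emx g x y z \in unitmx.
Proof. by move=> G; rewrite unitmxE unitfE; exact: A2. Qed.

(** The kernel of D_m g consists of the lifts of vectors eta, so both forms of A2 reduce to the
    invertibility of E, acting on rows directly or transposed; and inclusion of kernels at x and x'
    amounts to equality of Q. *)
Lemma generating_systemP : generating_system Gam g.
Proof.
split; [exact: gam_open|exact: gam_C2|exact: gam_gz| | | | |].
- move=> x y z z' G G' e; have [zz|zz|//] := ltgtP z z'.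
    by have := gam_zlt G G' zz; rewrite e ltxx.
  by have := gam_zlt G' G zz; rewrite e ltxx.
- move=> x m m' G G' e1 e2.
  have D : dom_U Gam g (x, g (pt x m), g_x g x m.1 m.2) by exists x, m.1, m.2.
  have [m2 [_ uniq]] := A1 D; transitivity m2; first by apply/esym/uniq; split.
  apply: uniq; split; [exact: G'|exact/esym/e1|].
  by rewrite !g_xE; apply/rowP => i; rewrite !mxE e2.
- move=> x x' [y z] G G' H; apply: (A1s (y := y) (z := z)); rewrite ?inE //.
  apply/rowP => i; rewrite /Qfun mxE [RHS]mxE; congr (- _); rewrite mxE [RHS]mxE !g_zE !g_yE.
  have h : d1 g (pt x (y, z)) (inm (ker_lift (pt x (y, z)) (delta_mx 0 i))) = 0.
    exact/(ker_liftP _ G).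
  by have /(ker_liftP _ G')/(congr1 snd) /= /oppr_inj := H _ h.
- move=> [[x y] z] k G /(ker_liftP _ G) kE H.
  have k1 : k.1 = 0.
    have : k.1 *m (Emx g x y z)^T = 0.
      apply: dotp_eq => v; rewrite -Emx_form // -kE dotp0l; exact: H.
    move/(congr1 (mulmx^~ (invmx (Emx g x y z)^T))).
    by rewrite mul0mx mulmxK // unitmx_tr Emx_unit.
  by rewrite kE k1 /ker_lift -/(inm 0) inm0 d10 mulr0 oppr0.
- move=> [[x y] z] v G H.
  have : v *m Emx g x y z = 0.
    apply: dotp_eq => eta; rewrite dotp0l.
    rewrite dotp_mulmx.
    rewrite -Emx_form //; apply: H; exact/(ker_liftP _ G).
  move/(congr1 (mulmx^~ (invmx (Emx g x y z)))).
  by rewrite mul0mx mulmxK // Emx_unit.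
Qed.

Let dpP : dual_pair Gam g (dual_dom Gam g) (dual_fun Gam g) := dual_pairP generating_systemP.

(** Q is the y-gradient of the dual function, so V is the set U of the dual system and A3s* becomes
    A3s for that system. *)
Lemma dom_V_dual : dom_V Gam g = dom_U (dual_dom Gam g) (dual_fun Gam g).
Proof.
apply/seteqP; split => -[[y z] q].
  move=> [x [y' [z' [G [-> -> ->]]]]]; apply/dom_UP.
  exists (x, g (x, y', z')); have [G' gE] := dp_to dpP G.
  by split; [exact: G'|exact: gE|exact/esym/(Qfun_quo dpP (m := (y', z')))].
move=> /dom_UP[[x u] [G gE qE]].
have [G' gE'] := dp_of dpP G; exists x, y, z.
have Gz : Gam (x, y, z) by rewrite -gE.
split; first exact: Gz.
rewrite (Qfun_quo dpP (m := (y, z)) Gz) /quo -qE; congr (_, _, gx _ _ (_, _)).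
by rewrite -gE; exact/esym/gE'.
Qed.

Lemma Xfun_dual y z q : dom_V Gam g (y, z, q) ->
  YZ (dual_dom Gam g) (dual_fun Gam g) y z q = (Xfun Gam g y z q, g (Xfun Gam g y z q, y, z)).
Proof.
move=> [x [y' [z' [G [-> -> ->]]]]].
have [GX QX] : Gam (Xfun Gam g y' z' (Qfun g x y' z'), y', z') /\
    Qfun g (Xfun Gam g y' z' (Qfun g x y' z')) y' z' = Qfun g x y' z'.
  have := @getPex _ [set x' : E | Gam (x', y', z') /\ Qfun g x' y' z' = Qfun g x y' z'].
  by apply; exists x.
by rewrite -{1}QX (Qfun_quo dpP (m := (y', z')) GX) (quo_inv dpP (m := (y', z')) GX).
Qed.

Lemma A3s_starP : condA3s_star Gam g <-> Aform_A3s (dual_dom Gam g) (dual_fun Gam g).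
Proof.
rewrite /Aform_A3s -dom_V_dual; apply: codim1_convexP => y z q xi V.
have D := V; rewrite dom_V_dual in D.
rewrite -(quadf_Aform (dp_S' dpP) xi D) /Amx /Yfun /Zfun (Xfun_dual V).
by [].
Qed.

(** The dual pair is symmetric: the reverse implication is the direct one for the exchanged pair. *)
Lemma A3s_duality : condA3s Gam g <-> condA3s_star Gam g.
Proof.
have S := generating_systemP; split.
  by move/(A3sP S)/(dual_A3s dpP)/A3s_starP.
by move/A3s_starP/(dual_A3s (dual_pair_sym dpP))/(A3sP S).
Qed.

Lemma A3s_A3s1_iff : condA3s Gam g <-> condA3s1 Gam g.
Proof.
have S := generating_systemP; split; first by move/(A3sP S)/(A3s_A3s1 dpP).
by move/(A3s1_A3s dpP)/(A3sP S).
Qed.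

Lemma A3s_A3s2_iff : condA3s Gam g <-> condA3s2 Gam g.
Proof.
have S := generating_systemP; split; first by move/(A3sP S)/(A3s_A3s2 S).
by move/(A3s2_A3s S)/(A3sP S).
Qed.

End Generating.

Theorem theorem2p2 (R : realType) (n : nat)
    (Gam : set ('rV[R]_n * 'rV[R]_n * R)) (g : 'rV[R]_n * 'rV[R]_n * R -> R)
    (hg : generating_function Gam g)
    (hA1 : condA1 Gam g) (hA2 : condA2 Gam g) (hA1s : condA1star Gam g) :
  (condA3s Gam g <-> condA3s_star Gam g) /\
  (condA3s Gam g <-> condA3s1 Gam g) /\
  (condA3s Gam g <-> condA3s2 Gam g).
Proof.
split; first exact: A3s_duality.
by split; [exact: A3s_A3s1_iff|exact: A3s_A3s2_iff].
Qed.
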